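(* Let $n\ge1$, $s\in(0,1)$ and $\varepsilon,\delta>0$. Let $u\in C^{s+\varepsilon}_{loc}(\mathbb{R}^n)\cap L^1_{s/2}(\mathbb{R}^n)$ be such that $|\nabla^s u|^2\in C^{2s+\delta}_{loc}(\mathbb{R}^n)\cap L^1_s(\mathbb{R}^n)$ and $(-\Delta)^s|\nabla^s u|^2\le0$ in a neighborhood of the origin. Then there exists $R_0>0$ such that the map $$R\mapsto \mathfrak{J}^s_{ACF}(u,R):=\frac{1}{R^{1+s}}\int_0^R r^s\int_{\mathbb{R}^n\setminus B_r}K^s_r(0,y)\,|\nabla^s u(y)|^2\,dy\,dr$$ is monotone nondecreasing on $(0,R_0)$.
   Context: $B_r$ is the open ball of radius $r$ centered at $0$. $C_{n,s}:=\left(\int_{\mathbb{R}^n}\frac{1-\cos(\zeta_1)}{|\zeta|^{n+2s}}d\zeta\right)^{-1}$. For $1\le p<\infty$ and $t\in(0,1)$, $L^p_t(\mathbb{R}^n):=\{u\in L^1_{loc}(\mathbb{R}^n):\int_{\mathbb{R}^n}\frac{|u(x)|^p}{1+|x|^{n+2t}}dx<\infty\}$. For $\gamma>0$ not an integer, $C^{\gamma}_{loc}$ denotes $C^{k,\gamma-k}_{loc}$ with $k=\lfloor\gamma\rfloor$. $(-\Delta)^s u(x):=C_{n,s}\lim_{\epsilon\to0}\int_{\mathbb{R}^n\setminus B_\epsilon(x)}\frac{u(x)-u(y)}{|x-y|^{n+2s}}dy$. With $\mu_{n,s}:=2^s\pi^{-n/2}\frac{\Gamma((n+s+1)/2)}{\Gamma((1-s)/2)}$,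 the fractional partial derivatives are $\partial^s_i u(x):=\mu_{n,s}\int_{\mathbb{R}^n}\frac{(y_i-x_i)(u(y)-u(x))}{|y-x|^{n+s+1}}dy$, $\nabla^s u:=(\partial^s_1u,\dots,\partial^s_nu)$, and $|\nabla^s u|$ is its Euclidean norm. With $a_{n,s}:=\Gamma(n/2)\pi^{-n/2-1}\sin(\pi s)$, $K^s_r(0,y):=a_{n,s}\left(\frac{r^2}{|y|^2-r^2}\right)^s\frac{1}{|y|^n}$ for $|y|>r$. *)

(* Defs.v *)
From HB Require Import structures.
From mathcomp Require Import all_boot all_order all_algebra.
From mathcomp Require Import all_classical all_reals all_analysis.
Set Implicit Arguments. Unset Strict Implicit. Unset Printing Implicit Defensive.
Import Order.TTheory GRing.Theory Num.Theory.
Import numFieldNormedType.Exports.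
Local Open Scope classical_set_scope.
Local Open Scope ring_scope.

(** n-dimensional Lebesgue measure, built as the iterated product of the
    Lebesgue measure on R, transported to row vectors 'rV[R]_n. *)
Record Rspace (R : realType) (n : nat) := {
  rs_disp : measure_display;
  rs_car : measurableType rs_disp;
  rs_vol : {measure set rs_car -> \bar R};
  rs_vec : rs_car -> 'rV[R]_n }.

Fixpoint rspace (R : realType) (m : nat) : Rspace R m.+1 :=
  match m with
  | 0 => @Build_Rspace R 1 _ (measurableTypeR R) lebesgue_measure
           (fun x => \row_(i < 1) x)
  | m'.+1 =>
    let S := rspace R m' in
    @Build_Rspace R m'.+2 _ (rs_car S * measurableTypeR R)%type
      (rs_vol S \x lebesgue_measure)%E
      (fun p => \row_(i < m'.+2)
         (if unlift ord_max i is Some j then @rs_vec _ _ S p.1 0 j else p.2))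
  end.

Section Rn.
Variable R : realType.
Local Open Scope ereal_scope.

(** Lebesgue integral over a subset A of R^n (as 'rV[R]_n), extended-real
    valued.  For n = 0, R^0 is a point carrying the unit mass. *)
Definition Rn_int (n : nat) : set 'rV[R]_n -> ('rV[R]_n -> \bar R) -> \bar R :=
  match n return set 'rV[R]_n -> ('rV[R]_n -> \bar R) -> \bar R with
  | 0 => fun A f => if `[< A 0%R >] then f 0%R else 0
  | m.+1 => fun A f =>
      \int[@rs_vol _ _ (rspace R m)]_(p in @rs_vec _ _ (rspace R m) @^-1` A)
        f (@rs_vec _ _ (rspace R m) p)
  end.

Definition Rn_integrable (n : nat) : set 'rV[R]_n -> ('rV[R]_n -> R) -> Prop :=
  match n return set 'rV[R]_n -> ('rV[R]_n -> R) -> Prop with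
  | 0 => fun A f => True
  | m.+1 => fun A f =>
      (@rs_vol _ _ (rspace R m)).-integrable (@rs_vec _ _ (rspace R m) @^-1` A)
        (fun p => (f (@rs_vec _ _ (rspace R m) p))%:E)
  end.

(** Real-valued Lebesgue integral (meaningful for integrable functions). *)
Definition Rn_Rint (n : nat) (A : set 'rV[R]_n) (f : 'rV[R]_n -> R) : R :=
  fine (Rn_int A (fun x => (f x)%:E)).
End Rn.

Section Frac.
Variable R : realType.
Variable n : nat.
Local Open Scope ring_scope.
Implicit Types (u v : 'rV[R]_n -> R) (x y : 'rV[R]_n).

(** Euclidean norm on R^n (mathcomp's matrix norm is the sup norm). *)
Definition enorm x : R := Num.sqrt (\sum_(i < n) x 0 i ^+ 2).

Definition eball (r : R) : set 'rV[R]_n := [set y | enorm y < r].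

Definition coord1 x : R := \sum_(i < n | nat_of_ord i == 0%N) x 0 i.

Definition Gamma (z : R) : R :=
  fine (\int[@lebesgue_measure R]_(t in `]0%R, +oo[%classic)
          (t `^ (z - 1) * expR (- t))%:E)%E.

Definition C_ns (s : R) : R :=
  (fine (Rn_int setT (fun z : 'rV[R]_n =>
     ((1 - cos (coord1 z)) / enorm z `^ (n%:R + 2 * s))%:E)))^-1.

Definition Lpt (p t : R) u : Prop :=
  (forall r : R, 0 < r -> Rn_integrable (eball r) u) /\
  (Rn_int setT (fun x => (`|u x| `^ p / (1 + enorm x `^ (n%:R + 2 * t)))%:E)
     < +oo)%E.

Definition frac_lap_trunc (s : R) u x (eps : R) : R :=
  Rn_Rint [set y | eps <= enorm (y - x)]
    (fun y => (u x - u y) / enorm (x - y) `^ (n%:R + 2 * s)).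

Definition frac_lap (s : R) u x : R :=
  C_ns s * lim (frac_lap_trunc s u x eps @[eps --> 0^'+]).

Definition mu_ns (s : R) : R :=
  2 `^ s * pi `^ (- (n%:R / 2)) * Gamma ((n%:R + s + 1) / 2)
    / Gamma ((1 - s) / 2).

Definition frac_partial (s : R) u (i : 'I_n) x : R :=
  mu_ns s * Rn_Rint setT
    (fun y => (y 0 i - x 0 i) * (u y - u x) / enorm (y - x) `^ (n%:R + s + 1)).

Definition frac_grad_norm2 (s : R) u x : R :=
  \sum_(i < n) frac_partial s u i x ^+ 2.

Definition a_ns (s : R) : R :=
  Gamma (n%:R / 2) * pi `^ (- (n%:R / 2) - 1) * sin (pi * s).

(** K^s_r(0,y), for |y| > r *)
Definition poisson_K (s r : R) y : R :=
  a_ns s * (r ^+ 2 / (enorm y ^+ 2 - r ^+ 2)) `^ s / enorm y ^+ n.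

Definition J_ACF (s : R) u (Rad : R) : \bar R :=
  ((Rad `^ (1 + s))^-1)%:E *
  \int[@lebesgue_measure R]_(r in `]0%R, Rad[%classic)
     ((r `^ s)%:E *
      Rn_int [set y : 'rV[R]_n | (r <= enorm y)%R]
        (fun y => (poisson_K s r y * frac_grad_norm2 s u y)%:E))%E.

Definition pderiv (i : 'I_n) (f : 'rV[R]_n -> R) : 'rV[R]_n -> R :=
  'D_(delta_mx 0 i) f.

Fixpoint Ck (k : nat) (f : 'rV[R]_n -> R) : Prop :=
  match k with
  | 0 => continuous f
  | k'.+1 => continuous f /\
      (forall i x, derivable f x (delta_mx 0 i)) /\
      (forall i, Ck k' (pderiv i f))
  end.

Definition dpartial (b : seq 'I_n) (f : 'rV[R]_n -> R) := foldr pderiv f b.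

Definition Holder_loc (k : nat) (alpha : R) (f : 'rV[R]_n -> R) : Prop :=
  Ck k f /\
  forall b : seq 'I_n, size b = k ->
  forall r : R, 0 < r -> exists C : R, forall x y,
    enorm x < r -> enorm y < r ->
    `|dpartial b f x - dpartial b f y| <= C * enorm (x - y) `^ alpha.

(** C^gamma_loc, gamma > 0: C^{k, gamma - k}_loc with k = ceil(gamma) - 1
    (= floor gamma when gamma is not an integer). *)
Definition C_loc (g : R) (f : 'rV[R]_n -> R) : Prop :=
  let k := `|(Num.ceil g - 1)%R|%N in Holder_loc k (g - k%:R) f.

End Frac.

(* Main.v *)
(** Only [g = |nabla^s u|^2 >= 0] matters. Write [k z = |z|^-(n+2s)], [nu = n/2] and
    [M S = \int_(|y|^2 > S) (S / (|y|^2 - S))^s |y|^-n g y dy].  Scaling [r = R t] gives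
    [J R = a_ns \int_0^1 t^s M (R^2 t^2) dt], so it suffices that [M] is nondecreasing near 0.

    Test the inequality [(-Delta)^s g <= 0] against [b_S x = (S - |x|^2)_+^s].
    - Inside its ball, the fractional Laplacian of [b_S] is a constant [A] independent of [S] and of
      the point: on each line through [y], comparing [b_S] with the [s]-th power of its affine part
      [(S - |y|^2 - 2 y.z)_+] leaves an integral which the substitution [v = 1/t] makes explicit,
      and the half-space power itself contributes nothing.
    - Outside, it is minus the potential [\int b_S (y + z) k z dz], an integral in [S] of the
      potentials of [(S - |x|^2)_+^(s-1)]; the latter are computed in gnomonic coordinates, in which
      each ray meets the ball along a parabola.
    As the truncated kernels are symmetric and [b_S] increases with [S], the quantity
    [A \int_(|y|^2 < S) g - \int_(|y|^2 > S) g pot_S] is nonincreasing in [S].  By the formula for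
    [pot_S] it equals [kappa \int_(|y|^2 < S) g + K (nu \int_0^S t^(nu-1) M t dt - S^nu M S)] with
    constants [kappa] and [K > 0].  For [g = 1] it vanishes by symmetry and [M] is constant by
    scaling, so [kappa = 0].  Hence [S^nu M S - nu \int_0^S t^(nu-1) M t dt] is nondecreasing, which
    (formally, its derivative is [S^nu M' S]) forces [M] to be nondecreasing; comparing with
    the infimum of [M] on an interval proves this without any regularity of [M]. *)
Require Import Defs.
From HB Require Import structures.
From mathcomp Require Import all_boot all_order all_algebra.
From mathcomp Require Import finmap.
From mathcomp Require Import all_classical all_reals all_analysis.
From mathcomp Require Import measurable_realfun simple_functions.
From mathcomp Require Import measurable_fun_approximation.
From mathcomp Require Import ring lra.
Import Order.TTheory GRing.Theory Num.Theory.
Import numFieldNormedType.Exports.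
Set Implicit Arguments. Unset Strict Implicit. Unset Printing Implicit Defensive.
Local Open Scope classical_set_scope.
Local Open Scope ring_scope.

(** * Integration on the line *)

(** The inequality on [g] holds pointwise, as a limit of truncated singular integrals. The operator
    is moved onto the barrier only at positive truncation [e], where everything is nonnegative and
    Tonelli suffices. There the tested quantities contain [k e^(-2s)] times the integral of the
    barrier against [g], which diverges as [e] tends to 0. So the energies for two values of [S] are
    compared first; their divergent parts cancel exactly, and only then does [e] tend to 0. That
    limit needs control up to the sphere. Inside the ball the truncated Laplacian of the barrier is
    bounded, uniformly in [e], by a constant plus a multiple of [(S - |y|^2)^(-s)], which is
    integrable because [s < 1]; outside, monotone convergence suffices. The difference of two
    barriers is the actual test function: it is nonnegative and lives in the larger ball, where the
    inequality holds. No constant is evaluated: the area of the sphere, the Beta integrals, [A] and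
    [K] only need a sign and finiteness. Identities between possibly infinite quantities are stated
    additively, with nonnegative terms on both sides. *)

Section nonneg_induction.
Local Open Scope ereal_scope.
Context d (T : measurableType d) (R : realType).
Import HBNNSimple.

Lemma ge0_measurable_fun_ind (P : (T -> \bar R) -> Prop) :
  (forall A, measurable A -> P (fun x => (\1_A x)%:E)) ->
  (forall f g : T -> \bar R, measurable_fun setT f -> measurable_fun setT g ->
     (forall x, 0 <= f x) -> (forall x, 0 <= g x) ->
     P f -> P g -> P (fun x => f x + g x)) ->
  (forall (k : R) (f : T -> \bar R), (0 <= k)%R -> measurable_fun setT f ->
     (forall x, 0 <= f x) -> P f -> P (fun x => k%:E * f x)) ->
  (forall f_ : (T -> \bar R)^nat, (forall n, measurable_fun setT (f_ n)) ->
     (forall n x, 0 <= f_ n x) ->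
     (forall x, {homo (f_ ^~ x) : m n / (m <= n)%N >-> m <= n}) ->
     (forall n, P (f_ n)) -> P (fun x => limn (f_ ^~ x))) ->
  forall f : T -> \bar R, measurable_fun setT f -> (forall x, 0 <= f x) -> P f.
Proof.
move=> Pind Padd Pscale Plim f mf f0.
pose f_ := nnsfun_approx measurableT mf.
rewrite (_ : f = fun x => limn (fun n => (f_ n x)%:E)); last first.
  apply/funext => x; apply/esym/cvg_lim => //.
  exact: (@cvg_nnsfun_approx _ _ _ _ measurableT _ mf (fun x _ => f0 x)).
apply: (Plim (fun n x => (f_ n x)%:E)).
- by move=> n; exact/measurable_EFinP/measurable_funP.
- by move=> n x; rewrite lee_fin.
- by move=> x m n mn; rewrite lee_fin; exact/lefP/nd_nnsfun_approx.
move=> n; move: (f_ n) => {f_}h.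
have mh r : measurable (h @^-1` [set r]) by exact: measurable_funPTI.
rewrite (_ : (fun x => _) = fun x => \sum_(r <- finmap.enum_fset (fset_set (range h)))
    (r * \1_(h @^-1` [set r]) x)%:E); last first.
  by apply/funext => x; rewrite fimfunE fsbig_finite//= sumEFin.
have h0 r : r \in finmap.enum_fset (fset_set (range h)) -> (0 <= r)%R.
  by move=> rh; have : r \in fset_set (range h) by []; rewrite in_fset_set// => /set_mem[x _ <-]; exact: fun_ge0.
elim: (finmap.enum_fset _) (h0) => [_|r s ih hr].
  under eq_fun do rewrite big_nil.
  by have := Pind set0 measurable0; under eq_fun do rewrite indic0.
under eq_fun do rewrite big_cons.
have r0 : (0 <= r)%R by apply: hr; rewrite mem_head.
have hs x : x \in s -> (0 <= x)%R by move=> xs; apply: hr; rewrite inE xs orbT.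
apply: Padd.
- apply/measurable_EFinP; apply: measurable_funM => //.
- by apply: emeasurable_sum => i; apply/measurable_EFinP; exact: measurable_funM.
- by move=> x; rewrite lee_fin mulr_ge0.
- by move=> x; rewrite big_seq sume_ge0// => i /hs i0; rewrite lee_fin mulr_ge0.
- under eq_fun do rewrite EFinM.
  apply: Pscale => //; first exact/measurable_EFinP.
  exact: Pind.
- exact: ih.
Qed.

End nonneg_induction.

Section density.
Local Open Scope ereal_scope.
Context d (T : measurableType d) (R : realType).
Variables (mu : {measure set T -> \bar R}) (h : T -> \bar R).
Hypotheses (mh : measurable_fun setT h) (h0 : forall x, 0 <= h x).

Let nu (A : set T) := \int[mu]_(x in A) h x.
Let nu0 : nu set0 = 0. Proof. exact: integral_set0. Qed.
Let nu_ge0 A : 0 <= nu A. Proof. exact: integral_ge0. Qed.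
Let nu_sigma : semi_sigma_additive nu.
Proof.
move=> F mF tF mUF; rewrite /nu ge0_integral_bigcup//.
- by apply: is_cvg_nneseries => n _ _; exact: integral_ge0.
- exact: measurable_funTS.
Qed.

(** Existential, so that a measure with a given density can be introduced in the middle of a proof,
    where no canonical instance can be declared. *)
Lemma density_measure : exists m : {measure set T -> \bar R},
  forall A, m A = \int[mu]_(x in A) h x.
Proof.
pose mm := isMeasure.Build _ _ _ nu nu0 nu_ge0 nu_sigma.
by exists (HB.pack_for {measure set T -> \bar R} nu mm).
Qed.

End density.

Section image_measure.
Local Open Scope ereal_scope.
Context d d' (T : measurableType d) (T' : measurableType d') (R : realType).
Variables (mu : {measure set T -> \bar R}) (f : T -> T').
Hypothesis mf : measurable_fun setT f.

Lemma image_measure : exists m : {measure set T' -> \bar R},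
  forall A, m A = mu (f @^-1` A).
Proof.
by exists (measure_function_pushforward__canonical__measure_function_Measure mu mf).
Qed.

End image_measure.

Lemma measurable_fun_powR d (T : measurableType d) (R : realType) (D : set T) (f : T -> R) p :
  measurable_fun D f -> measurable_fun D (fun x => f x `^ p).
Proof.
move=> mf; rewrite (_ : (fun x => _) = (@powR R ^~ p) \o f)//.
by apply: measurableT_comp => //; exact: measurable_powR.
Qed.

Lemma measurable_funV d (T : measurableType d) (R : realType) (D : set T) (f : T -> R) :
  measurable_fun D f -> measurable_fun D (fun x => (f x)^-1).
Proof.
move=> mf.
(* The exponent -1 of [powR] is the inverse only on nonnegative reals, hence the detour through the
   square; at 0 both sides are 0. *)
rewrite (_ : (fun _ => _) = fun x => f x * (f x ^+ 2) `^ (-1)); last first.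
  apply/funext => x; rewrite powR_inv1 ?sqr_ge0//.
  have [->|fx0] := eqVneq (f x) 0; first by rewrite invr0 mul0r.
  by field.
apply: measurable_funM => //.
by apply: measurable_fun_powR; exact: measurable_funX.
Qed.

Lemma is_derive_cvg (R : realType) (F : R -> R) (x d : R) :
  is_derive x 1 F d -> F y @[y --> x] --> F x.
Proof.
by move=> [dF _]; apply: differentiable_continuous; exact/derivable1_diffP.
Qed.

Lemma is_derive_Ninv (R : realType) (x : R) : x != 0 ->
  is_derive x 1 (fun v : R => - v^-1) (x ^- 2).
Proof.
move=> x0; have dV : derivable (fun v : R => v^-1) x 1.
  by apply: derivableV => //; exact: derivable_id.
apply: DeriveDef; first exact: derivableN.
by rewrite deriveN// deriveV// derive_id scaleNr opprK scaler1.
Qed.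

Lemma continuous_inv_sqr (R : realType) (x : R) : x != 0 ->
  {for x, continuous (fun v : R => v ^- 2)}.
Proof.
move=> x0; apply: continuousV; last exact: exprn_continuous.
by rewrite expf_neq0.
Qed.

Section one_dimensional.
Context {R : realType}.
Local Notation leb := (@lebesgue_measure R).
Implicit Types (f : R -> \bar R) (a b c p : R).
Local Open Scope ereal_scope.


Lemma integral_setI_bool d (T : measurableType d) (mu : {measure set T -> \bar R})
    (D : set T) (P : T -> bool) (f : T -> \bar R) :
  \int[mu]_(x in D `&` [set x | P x]) f x =
  \int[mu]_(x in D) ((P x)%:R%:E * f x).
Proof.
rewrite integral_mkcondr; apply: eq_integral => x _; rewrite patchE.
by case: ifPn => [/set_mem/= ->|/negP xP]; rewrite ?mul1e//;
  case: (boolP (P x)) => [Px|]; rewrite ?mul0e//; exfalso; apply/xP/mem_set.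
Qed.

Lemma integral_bool d (T : measurableType d) (mu : {measure set T -> \bar R})
    (P : T -> bool) (f : T -> \bar R) :
  \int[mu]_(x in [set x | P x]) f x = \int[mu]_x ((P x)%:R%:E * f x).
Proof. by rewrite -integral_setI_bool setTI. Qed.

(* Change of variables for arbitrary nonnegative measurable functions reduces, by
   uniqueness of the Lebesgue measure, to its validity on half-open intervals. *)
Lemma ge0_change_of_variables (D E : set R) (phi : R -> R) (phi' : R -> R) f :
  measurable D -> measurable E -> measurable_fun setT phi ->
  measurable_fun setT phi' -> (forall v, D v -> (0 <= phi' v)%R) ->
  (forall v, D v -> E (phi v)) ->
  (forall a b, (a < b)%R ->
    \int[leb]_(v in D `&` phi @^-1` `]a, b]) (phi' v)%:E = leb (E `&` `]a, b])) ->
  measurable_fun setT f -> (forall x, 0 <= f x) ->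
  \int[leb]_(v in D) (f (phi v) * (phi' v)%:E) = \int[leb]_(x in E) f x.
Proof.
move=> mD mE mphi mphi' phi'0 DE key.
have mphiP A : measurable A -> measurable (phi @^-1` A).
  by move=> mA; rewrite -[_ @^-1` _]setTI; exact: mphi.
pose h v := ((v \in D)%:R * phi' v)%:E.
have mh : measurable_fun setT h.
  apply/measurable_EFinP; apply: measurable_funM => //.
  exact: measurable_indic.
have h0 v : 0 <= h v.
  rewrite /h lee_fin; case: (boolP (v \in D)) => vD; rewrite ?mul0r// mul1r.
  by apply: phi'0; exact: set_mem.
have [nu nuE] := density_measure leb mh h0.
have hE A : measurable A ->
    \int[leb]_(v in D `&` phi @^-1` A) (phi' v)%:E = pushforward nu phi A.
  move=> mA; rewrite /pushforward nuE setIC.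
  rewrite (_ : D = [set x | x \in D]) ?integral_setI_bool; last first.
    by apply/seteqP; split => x /=; rewrite inE.
  by apply: eq_integral => v _; rewrite /h EFinM.
have [pf pfE] : exists m : {measure set (measurableTypeR R) -> \bar R},
    forall A, m A = nu (phi @^-1` A).
  exact: (@image_measure _ _ (measurableTypeR R) (measurableTypeR R) R nu phi mphi).
have mEC : measurable (~` E) by exact: measurableC.
(* The image measure only charges [E]. Adding Lebesgue measure on the complement of [E] gives a
   measure [tot] that agrees with Lebesgue measure on every half-open interval, as uniqueness
   requires. *)
have [rest restE] : exists m : {measure set (measurableTypeR R) -> \bar R},
    forall A, measurable A -> m A = leb (A `&` ~` E).
  have [||m mE'] := @density_measure _ _ _ leb (fun x => (\1_(~` E) x)%:E).
  - by apply/measurable_EFinP; exact: measurable_indic.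
  - by move=> x; rewrite lee_fin.
  - by exists m => A mA; rewrite mE' integral_indic// setIC.
pose tot : {measure set (measurableTypeR R) -> \bar R} := measure_add pf rest.
have totE A : measurable A -> tot A = pushforward nu phi A + leb (A `&` ~` E).
  by move=> mA; rewrite -restE// -[pushforward _ _ _]pfE; exact: measure_addE.
have E1 A : measurable A -> pushforward nu phi A = leb (E `&` A).
  move=> mA.
  have -> : pushforward nu phi A = pushforward nu phi (E `&` A).
    rewrite -!hE//; last exact: measurableI.
    congr integral; apply/seteqP; split => x /= [Dx Ax]; split => //.
      by split => //; exact: DE.
    by case: Ax.
  have : leb (E `&` A) = tot (E `&` A).
    apply: lebesgue_measure_unique; last exact: measurableI.
    move=> _ [[a b] /= ab <-]; rewrite totE//.
    have [ab'|ba] := ltP a b; last first.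
      have -> : `]a, b]%classic = set0 :> set R by apply: set_itv_ge; rewrite bnd_simp -leNgt.
      by rewrite set0I /pushforward preimage_set0 !measure0 adde0.
    rewrite -hE// key// -measureU//.
    - by rewrite setIC -setIUr setUv setIT.
    - exact: measurableI.
    - by apply: measurableI => //; exact: measurableC.
    - by apply/seteqP; split => x //= [[Ex _] [_ /(_ Ex)]].
  move=> ->; rewrite totE; last exact: measurableI.
  rewrite (_ : _ `&` ~` E = set0) ?measure0 ?adde0//.
  by rewrite setIAC setICr set0I.
have mff' (g : R -> \bar R) : measurable_fun setT g ->
    measurable_fun D (fun v => g (phi v) * (phi' v)%:E).
  move=> mg; apply: measurable_funTS; apply: emeasurable_funM => //.
    exact: (measurableT_comp mg).
  exact/measurable_EFinP.
apply: (@ge0_measurable_fun_ind _ _ R (fun f => \int[leb]_(v in D)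
  (f (phi v) * (phi' v)%:E) = \int[leb]_(x in E) f x)).
- move=> A mA; transitivity (leb (E `&` A)); last by rewrite integral_indic// setIC.
  apply: etrans (E1 A mA); rewrite -hE//.
  rewrite (_ : phi @^-1` A = [set x | phi x \in A]) ?integral_setI_bool; last first.
    by apply/seteqP; split => x /=; rewrite inE.
  by apply: eq_integral => v _; rewrite indicE.
- move=> f1 f2 mf1 mf2 f10 f20 h1 h2.
  rewrite ge0_integralD//; try exact: measurable_funTS.
  rewrite -h1 -h2 -ge0_integralD//; try exact: mff'.
  + by apply: eq_integral => v /set_mem Dv; rewrite ge0_muleDl.
  + by move=> v Dv; rewrite mule_ge0// lee_fin phi'0.
  + by move=> v Dv; rewrite mule_ge0// lee_fin phi'0.
- move=> k f1 k0 mf1 f10 h1.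
  rewrite ge0_integralZl//; last exact: measurable_funTS.
  rewrite -h1 -ge0_integralZl//; try exact: mff'.
  + by apply: eq_integral => v _; rewrite muleA.
  + by move=> v Dv; rewrite mule_ge0// lee_fin phi'0.
- move=> f_ mf_ f_0 ndf_ h_.
  rewrite [RHS]monotone_convergence//; last by move=> n; exact: measurable_funTS (mf_ n).
  transitivity (limn (fun n => \int[leb]_(v in D) (f_ n (phi v) * (phi' v)%:E))); last first.
    by congr (limn _); apply/funext => n; exact: h_.
  rewrite -monotone_convergence//.
  + apply: eq_integral => v /set_mem Dv.
    rewrite muleC -limeMl//; last by apply: ereal_nondecreasing_is_cvgn; exact: ndf_.
    by under eq_fun do rewrite muleC.
  + by move=> n; exact: mff'.
  + by move=> n x Dx; rewrite mule_ge0// lee_fin phi'0.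
  + by move=> x Dx m n mn; rewrite lee_wpmul2r// ?lee_fin ?phi'0//; exact: ndf_.
Qed.

Let integral_cstr (A : set R) c : measurable A ->
  \int[leb]_(v in A) (cst c v)%:E = c%:E * leb A.
Proof. by move=> mA; rewrite -integral_cst. Qed.

Lemma ge0_integral_translation f c : measurable_fun setT f -> (forall x, 0 <= f x) ->
  \int[leb]_x f (x + c)%R = \int[leb]_x f x.
Proof.
move=> mf f0.
rewrite -[RHS](@ge0_change_of_variables setT setT (fun x => x + c)%R (cst 1%R))//.
- by apply: eq_integral => x _; rewrite mule1.
- exact: measurable_funD.
- move=> a b ab; rewrite integral_cstr; last first.
    by rewrite setTI -[X in measurable X]setTI; exact: measurable_funD.
  rewrite !setTI mul1e (_ : _ @^-1` _ = `](a - c)%R, (b - c)%R]%classic); last first.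
    by apply/seteqP; split => x /=; rewrite !in_itv/= ltrBlDr lerBrDr.
  by rewrite !lebesgue_measure_itv/= !lte_fin ltrD2r -!EFinB opprB addrA subrK.
Qed.

Lemma ge0_integral_scaling f c : (0 < c)%R ->
  measurable_fun setT f -> (forall x, 0 <= f x) ->
  c%:E * \int[leb]_x f (c * x)%R = \int[leb]_x f x.
Proof.
move=> c0 mf f0.
rewrite -[RHS](@ge0_change_of_variables setT setT (fun x => c * x)%R (cst c))//.
- rewrite muleC -ge0_integralZr//.
  + by apply: measurableT_comp => //; exact: measurable_funM.
  + by rewrite lee_fin ltW.
- exact: measurable_funM.
- by move=> v _; exact: ltW.
- move=> a b ab; rewrite integral_cstr; last first.
    by rewrite setTI -[X in measurable X]setTI; exact: measurable_funM.
  rewrite !setTI (_ : _ @^-1` _ = `](a / c)%R, (b / c)%R]%classic); last first.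
    by apply/seteqP; split => x /=; rewrite !in_itv/= ltr_pdivrMr// ler_pdivlMr// mulrC.
  rewrite !lebesgue_measure_itv/= !lte_fin ltr_pM2r ?invr_gt0// ab -!EFinB -EFinM.
  by rewrite mulrBr mulrCA divff ?gt_eqF// mulr1 mulrCA divff ?gt_eqF// mulr1.
Qed.

Lemma ge0_integral_opp f : measurable_fun setT f -> (forall x, 0 <= f x) ->
  \int[leb]_x f (- x)%R = \int[leb]_x f x.
Proof.
move=> mf f0.
rewrite -[RHS](@ge0_change_of_variables setT setT (fun x => - x)%R (cst 1%R))//.
- by apply: eq_integral => x _; rewrite mule1.
- exact: oppr_measurable.
- move=> a b ab; rewrite integral_cstr; last first.
    by rewrite setTI -[X in measurable X]setTI; exact: oppr_measurable.
  rewrite !setTI mul1e (_ : _ @^-1` _ = `[(- b)%R, (- a)%R[%classic); last first.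
    by apply/seteqP; split => x /=; rewrite !in_itv/= lerNl ltrNr andbC.
  by rewrite !lebesgue_measure_itv/= !lte_fin ltrN2 -!EFinB opprK addrC.
Qed.

(** The integrands below may blow up at the ends of the interval. As [f] is nonnegative, the usual
    theorem on compact subintervals passes to the limit by monotone convergence. *)
Lemma ge0_FTC2_oo (f F : R -> R) a b : (a < b)%R ->
  (forall x, a < x < b -> is_derive x 1 F (f x))%R ->
  {in `]a, b[, continuous f} -> (forall x, a < x < b -> 0 <= f x)%R ->
  F x @[x --> a^'+] --> F a -> F x @[x --> b^'-] --> F b ->
  \int[leb]_(x in `]a, b[) (f x)%:E = (F b - F a)%:E.
Proof.
move=> ab dF cf f0 Fa Fb.
(* The shift by 3 keeps [2 e n] below two thirds of [b - a], so that every interval [S n] is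
   nondegenerate. *)
pose e n : R := ((b - a) / n.+3%:R)%R.
have e0 n : (0 < e n)%R by rewrite divr_gt0// subr_gt0.
have ba0 : (0 <= b - a)%R by rewrite subr_ge0 ltW.
have e_cvg : e n @[n --> \oo] --> 0%R.
  rewrite -[X in _ --> X](mulr0 (b - a)%R); apply: cvgM; first exact: cvg_cst.
  have /= h := @cvg_harmonic R.
  by rewrite -(cvg_shiftn 2%N) in h; apply: cvg_trans h; apply: near_eq_cvg;
    near=> n; rewrite /= addn2.
have nde m n : (m <= n)%N -> (e n <= e m)%R.
  by move=> mn; rewrite /e ler_wpM2l// lef_pV2 ?posrE// ler_nat !ltnS.
have e2 n : (a + e n < b - e n)%R.
  rewrite ltrBrDr -addrA -ltrBrDl.
  have : (e n + e n <= (b - a) * (2 / 3))%R.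
    rewrite /e -mulrDr ler_wpM2l// -mulr2n -[X in (X <= _)%R]mulr_natl.
    by rewrite ler_wpM2l// lef_pV2 ?posrE// ler_nat.
  by move/le_lt_trans; apply; rewrite gtr_pMr ?subr_gt0//; lra.
pose S n : set R := `[(a + e n)%R, (b - e n)%R]%classic.
have SE : \bigcup_n S n = `]a, b[%classic.
  apply/seteqP; split => x.
    move=> [n _]; rewrite /S /= !in_itv/= => /andP[]; rewrite ?bnd_simp => h1 h2; apply/andP; split.
      by apply: lt_le_trans h1; rewrite ltrDl.
    by apply: le_lt_trans h2 _; rewrite ltrBlDr ltrDl.
  rewrite /= in_itv/= => /andP[ax xb].
  have : \forall n \near \oo, (e n <= Num.min (x - a) (b - x))%R.
    move/cvgr_le : e_cvg; apply.
    by rewrite lt_min !subr_gt0 ax.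
  move=> [N _ /(_ N (leqnn N))]; rewrite le_min => /andP[h1 h2].
  exists N => //=; apply/andP; rewrite !bnd_simp; split; first by rewrite addrC -lerBrDr.
  by rewrite lerBrDl -lerBrDr.
have Fn n : \int[leb]_(x in S n) (f x)%:E = (F (b - e n) - F (a + e n))%:E.
  have sub (x : R) : (a + e n <= x <= b - e n)%R -> (a < x < b)%R.
    move=> /andP[h1 h2]; apply/andP; split.
      by apply: lt_le_trans h1; rewrite ltrDl.
    by apply: le_lt_trans h2 _; rewrite ltrBlDr ltrDl.
  rewrite EFinB; apply: continuous_FTC2 => //.
  - apply: continuous_in_subspaceT => x; rewrite inE/= in_itv/= => /sub xab.
    by apply: cf; rewrite in_itv.
  - split => [x||].
    + by rewrite in_itv/= => /andP[/ltW h1 /ltW h2]; have [] := dF x (sub x _); rewrite ?h1.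
    + by apply: cvg_at_right_filter; apply: is_derive_cvg (dF _ (sub _ _)); rewrite lexx ltW.
    + by apply: cvg_at_left_filter; apply: is_derive_cvg (dF _ (sub _ _)); rewrite lexx ltW.
  - move=> x; rewrite in_itv/= => /andP[/ltW h1 /ltW h2]; rewrite derive1E.
    by apply: derive_val; apply: dF; apply: sub; rewrite h1.
have h : \int[leb]_(x in S n) (f x)%:E @[n --> \oo] --> \int[leb]_(x in `]a, b[) (f x)%:E.
  rewrite -SE; apply: ge0_nondecreasing_set_cvg_integral => //.
  - move=> m n mn; apply/subsetPset => x; rewrite /S /= !in_itv/= => /andP[h1 h2].
    apply/andP; split; first by apply: le_trans h1; rewrite lerD2l nde.
    by apply: le_trans h2 _; rewrite lerD2l lerN2 nde.
  - by move=> n; exact: measurable_itv.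
  - move=> n; apply/measurable_EFinP; apply: (@measurable_funS _ _ _ _ `]a, b[%classic) => //.
      by rewrite -SE; exact: bigcup_sup.
    by apply: open_continuous_measurable_fun => // x; rewrite inE => /cf.
  - move=> n x Sx; have : (\bigcup_n S n) x by exists n.
    by rewrite SE /= in_itv lee_fin; exact: f0.
suff h2 : (F (b - e n) - F (a + e n))%:E @[n --> \oo] --> (F b - F a)%:E.
  apply: (cvg_unique _ h) => //; apply: cvg_trans h2.
  by apply: near_eq_cvg; near=> n; exact/esym/Fn.
apply: cvg_EFin; first exact: nearW.
apply: cvgB.
  move/cvg_at_leftP : Fb; apply; split => [n|]; first by rewrite ltrBlDr ltrDl.
  by rewrite -[X in _ --> X](subr0 b); apply: cvgB => //; exact: cvg_cst.
move/cvg_at_rightP : Fa; apply; split => [n|]; first by rewrite ltrDl.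
by rewrite -[X in _ --> X](addr0 a); apply: cvgD => //; exact: cvg_cst.
Unshelve. all: by end_near. Qed.

Lemma ge0_integral_invr f : measurable_fun setT f -> (forall x, 0 <= f x) ->
  \int[leb]_(v in `]0%R, +oo[) (f (v^-1)%R * (v ^- 2)%:E) = \int[leb]_(x in `]0%R, +oo[) f x.
Proof.
move=> mf f0.
apply: (@ge0_change_of_variables _ _ (fun v => v^-1)%R (fun v => v ^- 2)%R) => //.
- exact: measurable_funV.
- by apply: measurable_funV; exact: exprn_measurable.
- by move=> v /=; rewrite in_itv/= andbT => v0; rewrite invr_ge0 exprn_ge0// ltW.
- by move=> v /=; rewrite !in_itv/= !andbT invr_gt0.
have dF (x : R) : (0 < x)%R -> is_derive x 1%R (fun v : R => - v^-1)%R (x ^- 2).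
  by move=> x0; apply: is_derive_Ninv; rewrite gt_eqF.
have cf (x : R) : (0 < x)%R -> {for x, continuous (fun v : R => v ^- 2)%R}.
  move=> x0; apply: continuousV; last exact: exprn_continuous.
  by rewrite expf_neq0// gt_eqF.
move=> a b ab.
have [b0|b0] := leP b 0%R.
  rewrite (_ : _ `&` _ = set0); last first.
    apply/seteqP; split => x //= []; rewrite !in_itv/= andbT => x0 /andP[_].
    by rewrite leNgt (le_lt_trans b0)// invr_gt0.
  rewrite integral_set0 (_ : _ `&` _ = set0) ?measure0//.
  apply/seteqP; split => x //= []; rewrite !in_itv/= andbT => x0 /andP[_].
  by rewrite leNgt (le_lt_trans b0).
(* When [a <= 0 < b] the preimage of the interval is unbounded, and the primitive [- v^-1] has to be
   followed up to infinity. *)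
have [a0|a0] := leP a 0%R.
  rewrite (_ : _ `&` _ = `[(b^-1)%R, +oo[%classic); last first.
    apply/seteqP; split => x; rewrite /= !in_itv/= !andbT.
      by move=> [x0 /andP[_ xb]]; rewrite -[x]invrK lef_pV2 ?posrE// invr_gt0.
    move=> bx; have x0 : (0 < x)%R by apply: lt_le_trans bx; rewrite invr_gt0.
    split=> //; rewrite (le_lt_trans a0) ?invr_gt0//=.
    by rewrite -[b]invrK lef_pV2 ?posrE// invr_gt0.
  rewrite (_ : _ `&` _ = `]0%R, b]%classic); last first.
    apply/seteqP; split => x; rewrite /= !in_itv/= ?andbT.
      by move=> [-> /andP[_ ->]].
    by move=> /andP[x0 ->]; rewrite x0 (le_lt_trans a0).
  rewrite (@ge0_continuous_FTC2y _ _ (fun v => - v^-1)%R _ 0%R).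
  - by rewrite lebesgue_measure_itv/= lte_fin b0 invrK -!EFinB opprK add0r subr0.
  - by move=> x bx; rewrite invr_ge0 exprn_ge0// ltW// (lt_le_trans _ bx)// invr_gt0.
  - apply: continuous_in_subspaceT => x; rewrite inE/= in_itv/= andbT => bx.
    by apply: cf; rewrite (lt_le_trans _ bx)// invr_gt0.
  - rewrite -[X in _ --> X]oppr0; apply: cvgN.
    apply/cvgrPdist_le => /= e e0; near=> x.
    rewrite sub0r normrN gtr0_norm ?invr_gt0//.
    by rewrite -[e]invrK lef_pV2 ?posrE ?invr_gt0.
  - by move=> x bx; have [] := dF x (lt_trans _ bx); rewrite ?invr_gt0.
  - by apply: cvg_at_right_filter; apply: is_derive_cvg (dF _ _); rewrite invr_gt0.
  - move=> x; rewrite in_itv/= andbT => bx; rewrite derive1E.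
    by apply: derive_val; apply: dF; rewrite (lt_trans _ bx)// invr_gt0.
rewrite (_ : _ `&` _ = `[(b^-1)%R, (a^-1)%R[%classic); last first.
  apply/seteqP; split => x; rewrite /= !in_itv/= !andbT.
    move=> [x0 /andP[ax xb]]; rewrite -[x]invrK lef_pV2 ?posrE ?invr_gt0// xb/=.
    by rewrite ltf_pV2 ?posrE ?invr_gt0.
  move=> /andP[bx xa].
  have x0 : (0 < x)%R by apply: lt_le_trans bx; rewrite invr_gt0.
  by rewrite x0 -[a]invrK ltf_pV2 ?posrE ?invr_gt0// xa -[b]invrK lef_pV2 ?posrE ?invr_gt0.
rewrite (_ : _ `&` _ = `]a, b]%classic); last first.
  apply/seteqP; split => x; rewrite /= !in_itv/= ?andbT.
    by move=> [x0 /andP[-> ->]].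
  by move=> /andP[ax ->]; rewrite ax (lt_trans a0).
rewrite integral_itv_bndo_bndc/=; last first.
  by apply/measurable_EFinP; apply: measurable_funTS; apply: measurable_funV; exact: exprn_measurable.
have pos (x : R) : (b^-1 <= x -> 0 < x)%R by apply: lt_le_trans; rewrite invr_gt0.
rewrite (@continuous_FTC2 _ _ (fun v => - v^-1)%R)//.
- by rewrite lebesgue_measure_itv/= lte_fin ab !invrK -!EFinB opprK addrC.
- by rewrite ltf_pV2 ?posrE.
- apply: continuous_in_subspaceT => x; rewrite inE/= in_itv/= => /andP[bx _].
  by apply: cf; exact: pos.
- split => [x||].
  + by rewrite in_itv/= => /andP[/ltW bx _]; have [] := dF x (pos _ bx).
  + by apply: cvg_at_right_filter; apply: is_derive_cvg (dF _ _); rewrite invr_gt0.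
  + by apply: cvg_at_left_filter; apply: is_derive_cvg (dF _ _); rewrite invr_gt0.
- move=> x; rewrite in_itv/= => /andP[/ltW bx _]; rewrite derive1E.
  by apply: derive_val; apply: dF; exact: pos.
Unshelve. all: by end_near. Qed.

(** For [p > 0] and [b >= 0] the polynomial increases from 0 to infinity on the half-line; [psi] is
    its inverse. With general [b] this serves the parabolas of the barrier, with [p = 1] and [b = 0]
    it is the passage to squares in [gnomonic_radial]. *)
Lemma ge0_integral_quadratic f p b : (0 < p)%R -> (0 <= b)%R ->
  measurable_fun setT f -> (forall x, 0 <= f x) ->
  \int[leb]_(v in `]0%R, +oo[) (f (p * v ^+ 2 + 2 * b * v)%R * (2 * p * v + 2 * b)%:E) =
  \int[leb]_(x in `]0%R, +oo[) f x.
Proof.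
move=> p0 b0 mf f0.
have mono (v w : R) : (0 <= v -> v < w -> p * v ^+ 2 + 2 * b * v < p * w ^+ 2 + 2 * b * w)%R.
  move=> v0 vw; have : (0 < p * ((w - v) * (w + v)))%R.
    by rewrite !mulr_gt0// ?subr_gt0//; lra.
  have : (0 <= b * (w - v))%R by rewrite mulr_ge0// subr_ge0 ltW.
  by nra.
pose psi (x : R) := ((Num.sqrt (b ^+ 2 + p * x) - b) / p)%R.
have psi0 (x : R) : (0 <= x -> 0 <= psi x)%R.
  move=> x0; rewrite /psi divr_ge0// ?(ltW p0)// subr_ge0 -[leLHS]ger0_norm// -sqrtr_sqr ler_sqrt; nra.
have psiK (x : R) : (0 <= x -> p * (psi x) ^+ 2 + 2 * b * psi x = x)%R.
  move=> x0; have : (Num.sqrt (b ^+ 2 + p * x) ^+ 2 = b ^+ 2 + p * x)%R.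
    by rewrite sqr_sqrtr//; nra.
  rewrite /psi; move: (Num.sqrt _) => q q2; rewrite -[RHS](mulKf (lt0r_neq0 p0)).
  have -> : (p * x = q ^+ 2 - b ^+ 2)%R by rewrite q2; ring.
  by field; rewrite gt_eqF.
have le_psi (x v : R) : (0 <= x -> 0 <= v -> (p * v ^+ 2 + 2 * b * v <= x) = (v <= psi x))%R.
  move=> x0 v0; apply/idP/idP.
    by apply: contraTT; rewrite -!ltNge => /(mono _ _ (psi0 _ x0)); rewrite psiK.
  rewrite le_eqVlt => /orP[/eqP->|]; first by rewrite psiK.
  by move/(mono _ _ v0); rewrite psiK// => /ltW.
have cphi' : continuous (fun v : R => 2 * p * v + 2 * b)%R.
  by move=> x; apply: cvgD; [apply: cvgM; [exact: cvg_cst|exact: cvg_id]|exact: cvg_cst].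
have dF (x : R) : is_derive x 1%R (fun v : R => p * v ^+ 2 + 2 * b * v)%R (2 * p * x + 2 * b)%R.
  by apply: is_derive_eq; rewrite /GRing.scale/=; ring.
have cphi : continuous (fun v : R => p * v ^+ 2 + 2 * b * v)%R.
  by move=> x; exact: is_derive_cvg (dF x).
apply: (@ge0_change_of_variables _ _ (fun v => p * v ^+ 2 + 2 * b * v)%R (fun v => 2 * p * v + 2 * b)%R) => //.
- exact: continuous_measurable_fun.
- exact: continuous_measurable_fun.
- by move=> v /=; rewrite in_itv/= andbT => v0; nra.
- by move=> v /=; rewrite !in_itv/= !andbT => v0; have := mono 0%R v (lexx _) v0; nra.
move=> a c ac.
have [c0|c0] := leP c 0%R.
  rewrite (_ : _ `&` _ = set0); last first.
    apply/seteqP; split => x //= []; rewrite !in_itv/= andbT => x0 /andP[_].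
    by have := mono 0%R x (lexx _) x0; nra.
  rewrite integral_set0 (_ : _ `&` _ = set0) ?measure0//.
  apply/seteqP; split => x //= []; rewrite !in_itv/= andbT => x0 /andP[_].
  by rewrite leNgt (le_lt_trans c0).
(* The image contains positive values only, so a negative left end is replaced by 0 before applying
   the inverse. *)
pose d := Num.max a 0%R.
have d0 : (0 <= d)%R by rewrite /d le_max lexx orbT.
have dc : (d < c)%R by rewrite /d gt_max ac.
have psidc : (psi d < psi c)%R.
  by rewrite ltNge -le_psi ?psi0 ?(ltW c0)// psiK ?(ltW c0)// -ltNge.
rewrite (_ : _ `&` _ = `](psi d), (psi c)]%classic); last first.
  apply/seteqP; split => x; rewrite /= !in_itv/= !andbT.
    move=> [x0 /andP[ax xc]].
    rewrite -(le_psi c x (ltW c0) (ltW x0)) xc andbT ltNge -(le_psi d x d0 (ltW x0)).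
    rewrite -ltNge /d gt_max ax/=.
    by have := mono 0%R x (lexx _) x0; nra.
  move=> /andP[dx xc].
  have x0 : (0 < x)%R by apply: le_lt_trans dx; exact: psi0.
  rewrite x0 (le_psi c x (ltW c0) (ltW x0)) xc; split=> //; rewrite andbT.
  move: dx; rewrite ltNge -(le_psi d x d0 (ltW x0)) -ltNge; apply: le_lt_trans.
  by rewrite /d le_max lexx.
rewrite (_ : _ `&` _ = `]d, c]%classic); last first.
  apply/seteqP; split => x; rewrite /= !in_itv/= ?andbT.
    by move=> [x0 /andP[h1 ->]]; rewrite /d gt_max h1 x0.
  by rewrite /d gt_max => /andP[/andP[-> ->] ->].
rewrite integral_itv_obnd_cbnd; last first.
  by apply/measurable_EFinP; apply: measurable_funTS; exact: continuous_measurable_fun.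
rewrite (@continuous_FTC2 _ _ (fun v => p * v ^+ 2 + 2 * b * v)%R)//.
- by rewrite !psiK// ?(ltW c0)// lebesgue_measure_itv/= lte_fin dc.
- exact: continuous_subspaceT.
- split => [x _||]; first by have [] := dF x.
    by apply: cvg_at_right_filter; exact: cphi.
  by apply: cvg_at_left_filter; exact: cphi.
- by move=> x _; rewrite derive1E; exact: derive_val.
Qed.

End one_dimensional.

(** * Lebesgue measure on row vectors *)

Section Rn_measurable.
Context {R : realType}.
Local Notation leb := (@lebesgue_measure R).

Definition rs_of_vec : forall m, 'rV[R]_m.+1 -> rs_car (rspace R m) :=
  fix loop m := match m return 'rV[R]_m.+1 -> rs_car (rspace R m) with
  | 0 => fun x => x 0 0
  | m'.+1 => fun x => (loop m' (\row_j x 0 (lift ord_max j)), x 0 ord_max)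
  end.

Definition snoc m (x : 'rV[R]_m.+1) (t : R) : 'rV[R]_m.+2 :=
  \row_(i < m.+2) (if unlift ord_max i is Some j then x 0 j else t).

Lemma snoc_lift m (x : 'rV[R]_m.+1) t j : snoc x t 0 (lift ord_max j) = x 0 j.
Proof. by rewrite mxE liftK. Qed.

Lemma snoc_max m (x : 'rV[R]_m.+1) t : snoc x t 0 ord_max = t.
Proof. by rewrite mxE unlift_none. Qed.

Lemma snoc_eta m (x : 'rV[R]_m.+2) :
  x = snoc (\row_j x 0 (lift ord_max j)) (x 0 ord_max).
Proof.
apply/rowP => i; rewrite mxE; case: unliftP => [j ->|->] //; by rewrite mxE.
Qed.

Lemma sum_snoc m (F : 'I_m.+2 -> R) :
  \sum_i F i = \sum_(j < m.+1) F (lift ord_max j) + F ord_max.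
Proof.
rewrite big_ord_recr/=; congr (_ + _); apply: eq_bigr => j _; congr F.
by apply/val_inj; rewrite /= /bump leqNgt ltn_ord.
Qed.

Lemma rs_vecK m : cancel (@rs_vec _ _ (rspace R m)) (@rs_of_vec m).
Proof.
elim: m => [x|m ih [p t]] /=; first by rewrite mxE.
rewrite -/(snoc _ _) snoc_max; congr pair; rewrite -[RHS]ih; congr rs_of_vec.
by apply/rowP => j; rewrite mxE snoc_lift.
Qed.

Lemma rs_of_vecK m : cancel (@rs_of_vec m) (@rs_vec _ _ (rspace R m)).
Proof.
elim: m => [x|m ih x] /=; first by apply/rowP => i; rewrite mxE ord1.
by rewrite -/(snoc _ _) ih -snoc_eta.
Qed.

Section measurable_structure.
Variable m : nat.
Let V := 'rV[R]_m.+1.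
(** Row vectors receive the sigma-algebra transported along the bijection [rs_vec]. With the image
    measure [vol], [Rn_int] then becomes an ordinary integral over row vectors. *)
Let meas (A : set V) := measurable (@rs_vec _ _ (rspace R m) @^-1` A).
Let meas0 : meas set0. Proof. by rewrite /meas preimage_set0. Qed.
Let measC A : meas A -> meas (~` A).
Proof. by rewrite /meas preimage_setC; exact: measurableC. Qed.
Let meas_bigcup (F : (set V)^nat) : (forall i, meas (F i)) -> meas (\bigcup_i F i).
Proof. by rewrite /meas preimage_bigcup => mF; exact: bigcupT_measurable. Qed.

HB.instance Definition _ := isMeasurable.Build (rs_disp (rspace R m)) 'rV[R]_m.+1
  meas0 measC meas_bigcup.
End measurable_structure.

Lemma measurable_rs_vec m : measurable_fun setT (@rs_vec _ _ (rspace R m) : _ -> 'rV[R]_m.+1).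
Proof. by move=> _ A mA; rewrite setTI. Qed.

Lemma measurable_rs_of_vec m : measurable_fun setT (@rs_of_vec m : 'rV[R]_m.+1 -> _).
Proof.
move=> _ A mA; rewrite setTI.
change (measurable (@rs_vec _ _ (rspace R m) @^-1` (@rs_of_vec m @^-1` A))).
rewrite (_ : _ @^-1` _ = A)//; apply/seteqP; split => x /=; by rewrite rs_vecK.
Qed.

Lemma measurable_coord m (i : 'I_m.+1) : measurable_fun setT (fun x : 'rV[R]_m.+1 => x 0 i).
Proof.
suff h : measurable_fun setT (fun p => @rs_vec _ _ (rspace R m) p 0 i).
  rewrite (_ : (fun _ => _) = (fun p => @rs_vec _ _ (rspace R m) p 0 i) \o @rs_of_vec m).
    exact: measurableT_comp h (@measurable_rs_of_vec m).
  by apply/funext => x /=; rewrite rs_of_vecK.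
elim: m i => [i|m ih i] /=; first by under eq_fun do rewrite mxE; exact: measurable_id.
under eq_fun do rewrite mxE.
case: unliftP => [j _|_]; last exact: measurable_snd.
exact: measurableT_comp (ih j) measurable_fst.
Qed.

Section into_Rn.
Context d (T : measurableType d).

Lemma measurable_coord_comp m (f : T -> 'rV[R]_m.+1) i :
  measurable_fun setT f -> measurable_fun setT (fun p => f p 0 i).
Proof. by move=> mf; exact: (measurableT_comp (measurable_coord i) mf). Qed.

Lemma measurable_rV m (f : T -> 'rV[R]_m.+1) :
  (forall i, measurable_fun setT (fun p => f p 0 i)) -> measurable_fun setT f.
Proof.
move=> mf; rewrite (_ : f = @rs_vec _ _ (rspace R m) \o (@rs_of_vec m \o f)); last first.
  by apply/funext => x /=; rewrite rs_of_vecK.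
apply: measurableT_comp; first exact: measurable_rs_vec.
elim: m f mf => [f|m ih f] mf /=; first exact: mf.
apply: measurable_fun_pair; last exact: mf.
apply: (ih (fun x => \row_j f x 0 (lift ord_max j))) => i.
by under eq_fun do rewrite mxE; exact: mf.
Qed.

Lemma measurable_rVD m (f g : T -> 'rV[R]_m.+1) :
  measurable_fun setT f -> measurable_fun setT g -> measurable_fun setT (fun p => f p + g p).
Proof.
move=> mf mg; apply: measurable_rV => i; under eq_fun do rewrite mxE.
by apply: measurable_funD; exact: measurable_coord_comp.
Qed.

Lemma measurable_rVN m (f : T -> 'rV[R]_m.+1) :
  measurable_fun setT f -> measurable_fun setT (fun p => - f p).
Proof.
move=> mf; apply: measurable_rV => i; under eq_fun do rewrite mxE.
by apply: measurable_funN; exact: measurable_coord_comp.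
Qed.

Lemma measurable_rVZ m (c : T -> R) (f : T -> 'rV[R]_m.+1) :
  measurable_fun setT c -> measurable_fun setT f ->
  measurable_fun setT (fun p => c p *: f p).
Proof.
move=> mc mf; apply: measurable_rV => i; under eq_fun do rewrite mxE.
by apply: measurable_funM => //; exact: measurable_coord_comp.
Qed.

Lemma measurable_snoc m (f : T -> 'rV[R]_m.+1) (g : T -> R) :
  measurable_fun setT f -> measurable_fun setT g ->
  measurable_fun setT (fun p => snoc (f p) (g p)).
Proof.
move=> mf mg; apply: measurable_rV => i; under eq_fun do rewrite mxE.
by case: unliftP => [j _|_] //; exact: measurable_coord_comp.
Qed.

Lemma measurable_sumr (D : set T) n (F : 'I_n -> T -> R) :
  (forall i, measurable_fun D (F i)) -> measurable_fun D (fun p => \sum_(i < n) F i p).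
Proof. by move=> mF; exact: measurable_sum. Qed.

Lemma measurable_enorm m (f : T -> 'rV[R]_m.+1) :
  measurable_fun setT f -> measurable_fun setT (fun p => enorm (f p)).
Proof.
move=> mf; rewrite (_ : (fun p => _) = fun p => (\sum_(i < m.+1) f p 0 i ^+ 2) `^ 2^-1); last first.
  by apply/funext => p; rewrite powR12_sqrt// sumr_ge0// => i _; exact: sqr_ge0.
apply: measurable_fun_powR; apply: measurable_sumr => i.
by apply: measurable_funX; exact: measurable_coord_comp.
Qed.

Lemma measurable_boolr (D : set T) (b : T -> bool) :
  measurable_fun D b -> measurable_fun D (fun p => (b p)%:R : R).
Proof.
move=> mb mD A mA.
exact: (mb mD ((fun c : bool => c%:R : R) @^-1` A)).
Qed.

End into_Rn.

Definition vol m : set 'rV[R]_m.+1 -> \bar R :=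
  pushforward (rs_vol (rspace R m)) (@rs_vec _ _ (rspace R m)).

HB.instance Definition _ m := Measure.copy (@vol m)
  (measure_function_pushforward__canonical__measure_function_Measure
     (rs_vol (rspace R m)) (@measurable_rs_vec m)).

Definition box m (a b : R) : set 'rV[R]_m.+1 :=
  [set x | [forall i, a <= x 0 i <= b]].

Lemma measurable_box m a b : measurable (@box m a b).
Proof.
rewrite (_ : box _ _ = \bigcap_(i in [set: 'I_m.+1]) [set x : 'rV[R]_m.+1 | a <= x 0 i <= b]).
  apply: fin_bigcap_measurable => // i _.
  rewrite -[X in measurable X]setTI.
  have := @measurable_coord m i measurableT `[a, b]%classic (measurable_itv _).
  by congr (measurable (_ `&` _)); apply/seteqP; split => x /=; rewrite in_itv.
apply/seteqP; split => x /=.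
  by move=> /forallP h i _; exact: h.
by move=> h; apply/forallP => i; exact: h.
Qed.

Lemma vol_box m a b : a <= b -> vol (@box m a b) = ((b - a) ^+ m.+1)%:E.
Proof.
move=> ab; have lebE : leb `[a, b] = (b - a)%:E.
  rewrite lebesgue_measure_itv/= lte_fin.
  by case: ltP => [//|ba]; rewrite (le_anti _ : b = a) ?subrr// ab ba.
rewrite /vol /pushforward; elim: m => [|m ih] /=.
  rewrite (_ : _ @^-1` _ = `[a, b]%classic); last first.
    apply/seteqP; split => x /=; rewrite in_itv/=.
      by move=> /forallP/(_ 0); rewrite mxE.
    by move=> h; apply/forallP => i; rewrite mxE.
  by rewrite expr1; exact: lebE.
rewrite (_ : _ @^-1` _ = (@rs_vec _ _ (rspace R m) @^-1` @box m a b) `*` `[a, b]%classic); last first.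
  apply/seteqP; split => -[p t] /=; rewrite in_itv/=.
    move=> /forallP h; split; last by have := h ord_max; rewrite mxE unlift_none.
    by apply/forallP => j; have := h (lift ord_max j); rewrite mxE liftK.
  move=> [/forallP h1 h2]; apply/forallP => i; rewrite mxE.
  by case: unliftP => [j _|_] //; exact: h1.
rewrite product_measure1E//; last by have := @measurable_box m a b.
by rewrite exprSr EFinM; exact: (congr2 (fun x y => x * y)%E ih lebE).
Qed.

Lemma vol_sigma_finite m : sigma_finite setT (@vol m).
Proof.
exists (fun k : nat => @box m (- k%:R) k%:R); last first.
  move=> k; split; first exact: measurable_box.
  by rewrite vol_box ?ltry//; apply: (@le_trans _ _ 0); rewrite ?oppr_le0.
apply/seteqP; split => // x _.
pose k := \sum_(i < m.+1) `|x 0 i|.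
exists `|Num.ceil k|%N => //=; apply/forallP => i.
rewrite -ler_norml.
have h : `|x 0 i| <= k.
  by rewrite /k (bigD1 i)//= lerDl sumr_ge0.
apply: le_trans h _; apply: le_trans (ceil_ge k) _.
by rewrite natr_absz ler_int ler_norm.
Qed.

HB.instance Definition _ m := Measure_isSigmaFinite.Build _ _ _ (@vol m) (@vol_sigma_finite m).

End Rn_measurable.

(** Measurability by recursion on the shape of the function; the second [match] eta-expands
    operations that unification has left partially applied, so that the first one applies again. *)
Ltac mfun := repeat first
  [ assumption
  | exact: measurable_cst | exact: measurable_id | exact: measurable_fst | exact: measurable_snd
  | apply: measurable_coord
  | match goal with
    | |- measurable_fun _ (fun p => _ + _)%R =>
        first [apply: measurable_funD | apply: measurable_rVD | apply: emeasurable_funD]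
    | |- measurable_fun _ (fun p => - _)%R =>
        first [apply: measurable_funN | apply: measurable_rVN]
    | |- measurable_fun _ (fun p => _ * _)%R => apply: measurable_funM
    | |- measurable_fun _ (fun p => _ *: _)%R => apply: measurable_rVZ
    | |- measurable_fun _ (fun p => _ ^+ _)%R => apply: measurable_funX
    | |- measurable_fun _ (fun p => _ ^-1)%R => apply: measurable_funV
    | |- measurable_fun _ (fun p => _ `^ _)%R => apply: measurable_fun_powR
    | |- measurable_fun _ (fun p => Order.max _ _)%R => apply: measurable_maxr
    | |- measurable_fun _ (fun p => `| _ |)%R => apply: measurableT_comp
    | |- measurable_fun _ (fun p => (nat_of_bool _)%:R)%R => apply: measurable_boolr
    | |- measurable_fun _ (fun p => _ <= _)%R => apply: measurable_fun_ler
    | |- measurable_fun _ (fun p => _ < _)%R => apply: measurable_fun_ltr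
    | |- measurable_fun _ (fun p => _ && _) => apply: measurable_and
    | |- measurable_fun _ (fun p => enorm _) => apply: measurable_enorm
    | |- measurable_fun _ (fun p => snoc _ _) => apply: measurable_snoc
    | |- measurable_fun _ (fun p => (_ * _)%E) => apply: emeasurable_funM
    | |- measurable_fun _ (fun p => (_ + _)%E) => apply: emeasurable_funD
    | |- measurable_fun _ (fun p => (_)%:E) => apply/measurable_EFinP
    | |- measurable_fun _ (fun p => EFin _) => apply/measurable_EFinP
    | |- measurable_fun _ (fun p => \sum_(i < _) _)%R => apply: measurable_sumr => ?
    end
  | match goal with
    | |- measurable_fun ?D (@enorm ?a ?b) =>
        change (measurable_fun D (fun p => @enorm a b p))
    | |- measurable_fun ?D (@Order.lt ?a ?b ?c) =>
        change (measurable_fun D (fun p => @Order.lt a b c p))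
    | |- measurable_fun ?D (@Order.le ?a ?b ?c) =>
        change (measurable_fun D (fun p => @Order.le a b c p))
    | |- measurable_fun ?D (@snoc ?a ?b ?c) =>
        change (measurable_fun D (fun p => @snoc a b c p))
    | |- measurable_fun ?D (@GRing.scale ?a ?b ?c) =>
        change (measurable_fun D (fun p => @GRing.scale a b c p))
    | |- measurable_fun ?D (@GRing.opp ?a) =>
        change (measurable_fun D (fun p => @GRing.opp a p))
    | |- measurable_fun ?D (@GRing.inv ?a) =>
        change (measurable_fun D (fun p => @GRing.inv a p))
    | |- measurable_fun ?D (@GRing.add ?a ?b) =>
        change (measurable_fun D (fun p => @GRing.add a b p))
    | |- measurable_fun ?D (@GRing.mul ?a ?b) =>
        change (measurable_fun D (fun p => @GRing.mul a b p))
    end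
  | apply: measurable_coord_comp ].

Section sigma_finite_wrap.
Context d (T : measurableType d) (R : realType).
Variable mu : {measure set T -> \bar R}.

(** An alias of [mu] that carries a proof of sigma-finiteness; Tonelli asks for this structure, and
    for [rs_vol] it is obtained from [vol_sigma_finite] inside a proof. *)
Definition sf_wrap (sf : sigma_finite setT mu) : set T -> \bar R := mu.

HB.instance Definition _ sf := Measure.copy (sf_wrap sf) mu.
HB.instance Definition _ sf := Measure_isSigmaFinite.Build _ _ _ (sf_wrap sf) sf.

End sigma_finite_wrap.

Section nonneg_integral.
Local Open Scope ereal_scope.
Context d (T : measurableType d) (R : realType) (mu : {measure set T -> \bar R}).
Implicit Types f g : T -> \bar R.

Lemma ge0_intD f g : measurable_fun setT f -> measurable_fun setT g ->
  (forall x, 0 <= f x) -> (forall x, 0 <= g x) ->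
  \int[mu]_x (f x + g x) = \int[mu]_x f x + \int[mu]_x g x.
Proof. by move=> mf mg f0 g0; rewrite ge0_integralD. Qed.

Lemma ge0_intZl (k : R) f : (0 <= k)%R -> measurable_fun setT f ->
  (forall x, 0 <= f x) -> \int[mu]_x (k%:E * f x) = k%:E * \int[mu]_x f x.
Proof. by move=> k0 mf f0; rewrite ge0_integralZl. Qed.

Lemma ge0_intZr (k : \bar R) f : 0 <= k -> measurable_fun setT f ->
  (forall x, 0 <= f x) -> \int[mu]_x (f x * k) = (\int[mu]_x f x) * k.
Proof. by move=> k0 mf f0; rewrite ge0_integralZr. Qed.

Lemma ge0_int_le f g : measurable_fun setT f -> measurable_fun setT g ->
  (forall x, 0 <= f x) -> (forall x, f x <= g x) ->
  \int[mu]_x f x <= \int[mu]_x g x.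
Proof. by move=> mf mg f0 fg; apply: ge0_le_integral. Qed.

End nonneg_integral.

Lemma integral_posE {R : realType} (f : R -> \bar R) :
  (\int[@lebesgue_measure R]_(t in `]0%R, +oo[) f t =
   \int[@lebesgue_measure R]_t ((0 < t)%R%:R%:E * f t))%E.
Proof.
rewrite (_ : `]0, +oo[%classic = [set t : R | 0 < t]) ?integral_bool//.
by apply/seteqP; split => t /=; rewrite in_itv/= andbT.
Qed.

Section Rn_integral.
Context {R : realType}.
Local Notation leb := (@lebesgue_measure R).
Local Open Scope ereal_scope.

Lemma integral_vol m (A : set 'rV[R]_m.+1) (f : 'rV[R]_m.+1 -> \bar R) :
  measurable A -> measurable_fun setT f -> (forall x, 0 <= f x) ->
  Rn_int A f = \int[@vol R m]_(x in A) f x.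
Proof.
move=> mA mf f0; apply/esym; apply: ge0_integral_pushforward => //.
- exact: measurable_rs_vec.
- exact: measurable_funTS.
Qed.

Lemma ge0_integral_vol0 (f : 'rV[R]_1 -> \bar R) :
  measurable_fun setT f -> (forall x, 0 <= f x) ->
  \int[@vol R 0]_x f x = \int[leb]_t f (\row_(i < 1) t)%R.
Proof.
move=> mf f0; rewrite /vol ge0_integral_pushforward//.
exact: (@measurable_rs_vec R 0).
Qed.

(** Tonelli in the last coordinate. Invariance under translations and under negation, and the
    scaling rule, are deduced from it by induction on the dimension. *)
Lemma ge0_integral_slice m (f : 'rV[R]_m.+2 -> \bar R) :
  measurable_fun setT f -> (forall x, 0 <= f x) ->
  \int[@vol R m.+1]_x f x = \int[leb]_t \int[@vol R m]_x f (snoc x t).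
Proof.
move=> mf f0; rewrite /vol ge0_integral_pushforward//; last exact: (@measurable_rs_vec R m.+1).
have sf : sigma_finite setT (rs_vol (rspace R m)).
  have [F FT Fm] := @vol_sigma_finite R m.
  exists (fun i => @rs_vec _ _ (rspace R m) @^-1` F i).
    by rewrite -preimage_bigcup -FT preimage_setT.
  by move=> i; have [] := Fm i.
rewrite preimage_setT.
have mff : measurable_fun setT (f \o @rs_vec _ _ (rspace R m.+1)).
  by apply: (measurableT_comp mf); exact: (@measurable_rs_vec R m.+1).
have := @fubini_tonelli2 _ _ _ _ R (sf_wrap sf) leb _ mff (fun x => f0 _).
rewrite /fubini_G => h; apply: etrans h _; apply: eq_integral => t _.
apply/esym; apply: ge0_integral_pushforward => //.
- exact: measurable_rs_vec.
- by apply: (measurableT_comp mf); mfun.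
Qed.

Lemma snocD m (x y : 'rV[R]_m.+1) (s t : R) : (snoc x s + snoc y t = snoc (x + y) (s + t))%R.
Proof. by apply/rowP => i; rewrite !mxE; case: unliftP => [j _|_] //; rewrite mxE. Qed.

Lemma snocZ m (x : 'rV[R]_m.+1) (c t : R) : (c *: snoc x t = snoc (c *: x) (c * t))%R.
Proof. by apply/rowP => i; rewrite !mxE; case: unliftP => [j _|_] //; rewrite mxE. Qed.

Lemma measurable_integral_vol m d (T : measurableType d) (f : T -> 'rV[R]_m.+1 -> \bar R) :
  measurable_fun setT (fun p : T * 'rV[R]_m.+1 => f p.1 p.2) -> (forall t x, 0 <= f t x) ->
  measurable_fun setT (fun t => \int[@vol R m]_x f t x).
Proof.
move=> mf f0.
by have := @measurable_fun_fubini_tonelli_F _ _ _ _ _ (@vol R m) (fun p => f p.1 p.2) mf (fun p => f0 p.1 p.2).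
Qed.

Lemma measurable_integral_leb d (T : measurableType d) (f : T -> R -> \bar R) :
  measurable_fun setT (fun p : T * R => f p.1 p.2) -> (forall t x, 0 <= f t x) ->
  measurable_fun setT (fun t => \int[leb]_x f t x).
Proof.
move=> mf f0.
by have := @measurable_fun_fubini_tonelli_F _ _ _ _ _ leb (fun p => f p.1 p.2) mf (fun p => f0 p.1 p.2).
Qed.

Lemma vol_tonelli m m' (f : 'rV[R]_m.+1 -> 'rV[R]_m'.+1 -> \bar R) :
  measurable_fun setT (fun p : 'rV[R]_m.+1 * 'rV[R]_m'.+1 => f p.1 p.2) ->
  (forall x y, 0 <= f x y) ->
  \int[@vol R m]_x \int[@vol R m']_y f x y = \int[@vol R m']_y \int[@vol R m]_x f x y.
Proof.
move=> mf f0.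
exact: (@fubini_tonelli _ _ _ _ R (@vol R m) (@vol R m') (fun p => f p.1 p.2) mf (fun p => f0 _ _)).
Qed.

Lemma vol_leb_tonelli m (f : 'rV[R]_m.+1 -> R -> \bar R) :
  measurable_fun setT (fun p : 'rV[R]_m.+1 * R => f p.1 p.2) ->
  (forall x y, 0 <= f x y) ->
  \int[@vol R m]_x \int[leb]_y f x y = \int[leb]_y \int[@vol R m]_x f x y.
Proof.
move=> mf f0.
exact: (@fubini_tonelli _ _ _ _ R (@vol R m) leb (fun p => f p.1 p.2) mf (fun p => f0 _ _)).
Qed.

Lemma measurable_slice m (f : 'rV[R]_m.+2 -> \bar R) :
  measurable_fun setT f -> (forall x, 0 <= f x) ->
  measurable_fun setT (fun t => \int[@vol R m]_x f (snoc x t)).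
Proof.
by move=> mf f0; apply: measurable_integral_vol => //; apply: (measurableT_comp mf); mfun.
Qed.

Lemma ge0_vol_translation m (f : 'rV[R]_m.+1 -> \bar R) a :
  measurable_fun setT f -> (forall x, 0 <= f x) ->
  \int[@vol R m]_x f (x + a)%R = \int[@vol R m]_x f x.
Proof.
elim: m f a => [|m ih] f a mf f0.
  rewrite !ge0_integral_vol0//; last by apply: (measurableT_comp mf); mfun.
  rewrite -[RHS](ge0_integral_translation (a 0 0)%R)//.
  apply: eq_integral => t _; congr f; apply/rowP => i.
  by rewrite !mxE ord1.
have mfa : measurable_fun setT (fun x : 'rV[R]_m.+2 => f (x + a)%R).
  by apply: (measurableT_comp mf); mfun.
rewrite (ge0_integral_slice mfa (fun x => f0 _)) (ge0_integral_slice mf f0).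
move: {mfa} (snoc_eta a); move: (\row_j _)%R (a 0 ord_max)%R => b t ->.
have F0 t' : 0 <= \int[@vol R m]_x f (snoc x t') by exact: integral_ge0.
rewrite -[RHS](ge0_integral_translation t (measurable_slice mf f0) F0).
apply: eq_integral => s _; under eq_integral do rewrite snocD.
by rewrite (ih (fun x => f (snoc x (s + t))))//; apply: (measurableT_comp mf); mfun.
Qed.

Lemma ge0_vol_scaling m (f : 'rV[R]_m.+1 -> \bar R) (c : R) : (0 < c)%R ->
  measurable_fun setT f -> (forall x, 0 <= f x) ->
  (c ^+ m.+1)%:E * \int[@vol R m]_x f (c *: x)%R = \int[@vol R m]_x f x.
Proof.
move=> c0; elim: m f => [|m ih] f mf f0.
  rewrite !ge0_integral_vol0//; last by apply: (measurableT_comp mf); mfun.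
  rewrite -[RHS](ge0_integral_scaling c0)//.
  rewrite expr1; congr (_ * _); apply: eq_integral => t _; congr f; apply/rowP => i.
  by rewrite !mxE.
have mfc : measurable_fun setT (fun x : 'rV[R]_m.+2 => f (c *: x)%R).
  by apply: (measurableT_comp mf); mfun.
rewrite (ge0_integral_slice mfc (fun x => f0 _)) (ge0_integral_slice mf f0).
have mF : measurable_fun setT (fun t => \int[@vol R m]_x f (snoc x t)).
  exact: measurable_slice mf f0.
have F0 t : 0 <= \int[@vol R m]_x f (snoc x t) by exact: integral_ge0.
rewrite -[RHS](ge0_integral_scaling c0 mF F0) exprS EFinM -muleA; congr (_ * _).
have c0' : 0 <= (c ^+ m.+1)%:E by rewrite lee_fin exprn_ge0// ltW.
have Fc0 (t : R) : [set: R] t -> 0 <= \int[@vol R m]_x f (c *: snoc x t)%R.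
  by move=> _; exact: integral_ge0.
rewrite -(ge0_integralZl leb measurableT (measurable_slice mfc (fun x => f0 _)) Fc0 c0').
apply: eq_integral => s _; under eq_integral do rewrite snocZ.
by rewrite (ih (fun x => f (snoc x (c * s))))//; apply: (measurableT_comp mf); mfun.
Qed.

Lemma ge0_vol_opp m (f : 'rV[R]_m.+1 -> \bar R) :
  measurable_fun setT f -> (forall x, 0 <= f x) ->
  \int[@vol R m]_x f (- x)%R = \int[@vol R m]_x f x.
Proof.
have snocN k (x : 'rV[R]_k.+1) (t : R) : (- snoc x t = snoc (- x) (- t))%R.
  by apply/rowP => i; rewrite !mxE; case: unliftP => [j _|_] //; rewrite mxE.
elim: m f => [|m ih] f mf f0.
  rewrite !ge0_integral_vol0//; last by apply: (measurableT_comp mf); mfun.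
  rewrite -[RHS]ge0_integral_opp//.
  apply: eq_integral => t _; congr f; apply/rowP => i.
  by rewrite !mxE.
have mfc : measurable_fun setT (fun x : 'rV[R]_m.+2 => f (- x)%R).
  by apply: (measurableT_comp mf); mfun.
rewrite (ge0_integral_slice mfc (fun x => f0 _)) (ge0_integral_slice mf f0).
have F0 t : 0 <= \int[@vol R m]_x f (snoc x t) by exact: integral_ge0.
rewrite -[RHS](ge0_integral_opp (measurable_slice mf f0) F0).
apply: eq_integral => s _; under eq_integral do rewrite snocN.
by rewrite (ih (fun x => f (snoc x (- s))))//; apply: (measurableT_comp mf); mfun.
Qed.

End Rn_integral.

(** * Isometries and polar coordinates *)

Section enorm_theory.
Context {R : realType} {n : nat}.
Implicit Types x y z : 'rV[R]_n.

Definition dot x y : R := \sum_(i < n) x 0 i * y 0 i.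

Lemma enorm_sqr x : enorm x ^+ 2 = dot x x.
Proof.
rewrite /enorm sqr_sqrtr; last by apply: sumr_ge0 => i _; exact: sqr_ge0.
by apply: eq_bigr => i _; rewrite expr2.
Qed.

Lemma enorm_ge0 x : 0 <= enorm x. Proof. exact: sqrtr_ge0. Qed.

Lemma dotC x y : dot x y = dot y x.
Proof. by apply: eq_bigr => i _; rewrite mulrC. Qed.

Lemma dotDl x y z : dot (x + y) z = dot x z + dot y z.
Proof. by rewrite -big_split; apply: eq_bigr => i _; rewrite mxE mulrDl. Qed.

Lemma dotZl c x y : dot (c *: x) y = c * dot x y.
Proof. by rewrite mulr_sumr; apply: eq_bigr => i _; rewrite mxE mulrA. Qed.

Lemma dotNl x y : dot (- x) y = - dot x y.
Proof. by rewrite -scaleN1r dotZl mulN1r. Qed.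

Lemma dotDr x y z : dot z (x + y) = dot z x + dot z y.
Proof. by rewrite dotC dotDl !(dotC z). Qed.

Lemma dotZr c x y : dot x (c *: y) = c * dot x y.
Proof. by rewrite dotC dotZl dotC. Qed.

Lemma dotNr x y : dot x (- y) = - dot x y.
Proof. by rewrite dotC dotNl dotC. Qed.

Lemma enormZ c x : enorm (c *: x) = `|c| * enorm x.
Proof.
apply/eqP; rewrite -(@eqrXn2 _ 2) ?mulr_ge0 ?enorm_ge0//.
by rewrite exprMn !enorm_sqr dotZl dotZr mulrA -expr2 real_normK// num_real.
Qed.

Lemma enormN x : enorm (- x) = enorm x.
Proof. by rewrite -scaleN1r enormZ normrN1 mul1r. Qed.

Lemma enormBC x y : enorm (x - y) = enorm (y - x).
Proof. by rewrite -enormN opprB. Qed.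

Lemma enorm0 : enorm (0 : 'rV[R]_n) = 0.
Proof. by rewrite -(scale0r 0) enormZ normr0 mul0r. Qed.

Lemma coord_le_enorm x i : `|x 0 i| <= enorm x.
Proof.
rewrite -(@ler_pXn2r _ 2) ?nnegrE ?enorm_ge0// enorm_sqr real_normK ?num_real//.
rewrite /dot (bigD1 i)//= -expr2 lerDl sumr_ge0// => j _.
by rewrite -expr2 sqr_ge0.
Qed.

Lemma enorm_eq0 x : enorm x = 0 -> x = 0.
Proof.
move=> x0; apply/rowP => i; rewrite mxE; apply/eqP; rewrite -normr_le0 -x0.
exact: coord_le_enorm.
Qed.

Lemma enorm_sqrD x y : enorm (x + y) ^+ 2 = enorm x ^+ 2 + 2 * dot x y + enorm y ^+ 2.
Proof. rewrite !enorm_sqr !(dotDl, dotDr) (dotC y x); ring. Qed.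

Lemma dot_le x y : `|dot x y| <= enorm x * enorm y.
Proof.
wlog xy0 : x / 0 <= dot x y => [h|].
  have [/h//|/ltW] := leP 0 (dot x y).
  by rewrite -oppr_ge0 -dotNl => /h; rewrite dotNl normrN enormN.
rewrite ger0_norm//.
have [x0|x0] := eqVneq (enorm x) 0.
  rewrite x0 mul0r (enorm_eq0 x0) -(scale0r 0) dotZl mul0r//.
have [y0|y0] := eqVneq (enorm y) 0.
  rewrite y0 mulr0 (enorm_eq0 y0) -(scale0r 0) dotZr mul0r//.
(* The expansion of this square is twice [|x| |y|] times [|x| |y| - dot x y], and [|x| |y|] is
   positive here. *)
have := sqr_ge0 (enorm (enorm y *: x + (- enorm x) *: y)).
rewrite enorm_sqrD !enormZ dotZl dotZr !exprMn !real_normK ?num_real//.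
have xp : 0 < enorm x * enorm y by rewrite mulr_gt0// lt_def ?x0 ?y0 enorm_ge0.
move: (enorm x) (enorm y) (dot x y) xp => a b c ab h.
have : 0 <= a * b * (a * b - c) by nra.
by rewrite pmulr_rge0// subr_ge0.
Qed.

Lemma enorm_triangle x y : enorm (x + y) <= enorm x + enorm y.
Proof.
rewrite -(@ler_pXn2r _ 2) ?nnegrE ?addr_ge0 ?enorm_ge0// enorm_sqrD.
have := dot_le x y; rewrite ler_norml => /andP[_ h].
by rewrite sqrrD lerD2r lerD2l -[X in _ <= X]mulr_natl ler_wpM2l.
Qed.

Lemma enorm_le_add x y : enorm x <= enorm y + enorm (x - y).
Proof. by rewrite -{1}(subrK y x) addrC; apply: le_trans (enorm_triangle _ _) _. Qed.

End enorm_theory.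

Section invariance_and_polar.
Context {R : realType}.
Local Notation leb := (@lebesgue_measure R).
Variable m : nat.
Local Notation V := 'rV[R]_m.+1.
Local Notation vol := (@vol R m).
Implicit Types f h : V -> \bar R.
Local Open Scope ereal_scope.

Lemma measurable_enorm_lt r : measurable [set x : V | (enorm x < r)%R].
Proof.
have h : measurable_fun setT (fun x : V => enorm x < r)%R by mfun.
by have := h measurableT [set true] I; rewrite setTI.
Qed.

Lemma enorm_lt_vol_lty r : vol [set x : V | (enorm x < r)%R] < +oo.
Proof.
have [r0|r0] := leP r 0%R.
  rewrite (_ : [set _ | _] = set0) ?measure0//; apply/seteqP; split => x //=.
  by rewrite ltNge (le_trans r0)// enorm_ge0.
apply: (@le_lt_trans _ _ (vol (@box R m (- r) r))).
  apply: le_measure; rewrite ?inE; [exact: measurable_enorm_lt|exact: measurable_box|].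
  move=> x /= xr; apply/forallP => i; rewrite -ler_norml.
  by apply: le_trans (coord_le_enorm _ _) (ltW xr).
by rewrite vol_box ?ltry//; lra.
Qed.

Lemma enorm_lt_vol_gt0 r : (0 < r)%R -> 0 < vol [set x : V | (enorm x < r)%R].
Proof.
(* A cube of side [c] at the origin has squared norms at most [(m+1) c^2], which is below [r^2]
   since [m + 1 < (m + 2)^2]. *)
move=> r0; pose c := (r / m.+2%:R)%R.
have c0 : (0 < c)%R by rewrite divr_gt0.
apply: (@lt_le_trans _ _ (vol (@box R m 0%R c))).
  by rewrite vol_box ?ltW// lte_fin exprn_gt0// subr0.
apply: le_measure; rewrite ?inE; [exact: measurable_box|exact: measurable_enorm_lt|].
move=> x /= /forallP h.
rewrite -(@ltr_pXn2r _ 2) ?nnegrE ?enorm_ge0 ?ltW// enorm_sqr.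
apply: (@le_lt_trans _ _ (\sum_(i < m.+1) c ^+ 2)%R).
  apply: ler_sum => i _; have /andP[h1 h2] := h i.
  by rewrite -expr2 lerXn2r ?nnegrE// ltW.
rewrite sumr_const card_ord -mulr_natl /c expr_div_n mulrCA gtr_pMr ?exprn_gt0//.
rewrite ltr_pdivrMr ?exprn_gt0// mul1r -natrX ltr_nat.
by rewrite expnS expn1 (leq_trans (ltnSn _))// leq_pmulr.
Qed.

Lemma origin_box : [set (0%R : V)] = @box R m 0%R 0%R.
Proof.
apply/seteqP; split => x /=.
  by move=> ->; apply/forallP => i; rewrite mxE lexx.
move=> /forallP h; apply/rowP => i; rewrite mxE.
by apply/eqP; rewrite eq_le andbC; exact: h.
Qed.

Lemma vol_origin : vol [set 0%R] = 0.
Proof. by rewrite origin_box vol_box// subrr expr0n. Qed.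

(* Uniqueness of translation-invariant measures, in the form of the classical
   Tonelli argument: with I the integral and N f = I (f o L), both translation
   invariant, I f * N h = I h * N (f o -). *)
Lemma ge0_vol_isometry (L : V -> V) f :
  (forall x y, L (x + y) = L x + L y)%R -> (forall x, L (L x) = x) ->
  (forall x, enorm (L x) = enorm x) -> measurable_fun setT L ->
  measurable_fun setT f -> (forall x, 0 <= f x) ->
  \int[vol]_x f (L x) = \int[vol]_x f x.
Proof.
move=> LD LK Ln mL.
have mfL (g : V -> \bar R) : measurable_fun setT g -> measurable_fun setT (g \o L).
  by move=> mg; exact: measurableT_comp.
have NT g a : measurable_fun setT g -> (forall x, 0 <= g x) ->
    \int[vol]_x g (L x + a)%R = \int[vol]_x g (L x).
  move=> mg g0; rewrite -(ge0_vol_translation (L a) (mfL _ mg) (fun x => g0 _)).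
  by apply: eq_integral => x _ /=; rewrite LD LK.
have main g h : measurable_fun setT g -> (forall x, 0 <= g x) ->
    measurable_fun setT h -> (forall x, 0 <= h x) ->
    (\int[vol]_x g x) * (\int[vol]_x h (L x)) =
    (\int[vol]_x h x) * (\int[vol]_x g (- (L x))%R).
  move=> mg g0 mh h0.
  have mprod (k1 k2 : V -> \bar R) (u : V * V -> V) :
      measurable_fun setT k1 -> measurable_fun setT k2 -> measurable_fun setT u ->
      measurable_fun setT (fun p : V * V => k1 p.1 * k2 (u p)).
    move=> mk1 mk2 mu; apply: emeasurable_funM; first exact: measurableT_comp mk1 measurable_fst.
    exact: measurableT_comp mk2 mu.
  transitivity (\int[vol]_x \int[vol]_y (g x * h (L y + x)%R)).
    rewrite -ge0_integralZr//; last by apply: integral_ge0.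
    apply: eq_integral => x _; rewrite -(NT h x)// ge0_integralZl//.
    by apply: (measurableT_comp mh); mfun.
  rewrite vol_tonelli; last 2 first.
  - apply: (mprod g h (fun p => L p.2 + p.1)%R) => //.
    by apply: measurable_rVD; [exact: measurableT_comp mL measurable_snd|mfun].
  - by move=> x y; rewrite mule_ge0.
  transitivity (\int[vol]_y \int[vol]_x (h x * g (x - L y)%R)).
    apply: eq_integral => y _.
    rewrite -(ge0_vol_translation (- (L y))%R) => [||x]; last by rewrite mule_ge0.
      by apply: eq_integral => x _; rewrite [(L y + _)%R]addrC subrK muleC.
    by apply: emeasurable_funM => //; apply: (measurableT_comp mh); mfun.
  rewrite vol_tonelli; last 2 first.
  - apply: (measurableT_comp (f := fun p : V * V => h p.1 * g (p.1 - L p.2)%R)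
      (g := fun p : V * V => (p.2, p.1))).
      apply: (mprod h g (fun p => p.1 - L p.2)%R) => //.
      by apply: measurable_rVD; [mfun|apply: measurable_rVN; exact: measurableT_comp mL measurable_snd].
    by apply: measurable_fun_pair; mfun.
  - by move=> x y; rewrite mule_ge0.
  rewrite -ge0_integralZr//; last by apply: integral_ge0.
  apply: eq_integral => x _; rewrite ge0_integralZl//; last first.
    apply: (measurableT_comp mg); apply: measurable_rVD; mfun.
  congr (_ * _).
  have := @NT (fun y => g (- y)%R) (- x)%R; rewrite /= => <- //.
    by apply: eq_integral => y _; rewrite opprD opprK addrC.
  by apply: (measurableT_comp mg); mfun.
move=> mf f0.
(* The unit ball is invariant under [L] and has finite nonzero volume, so its mass cancels from
   [main]. What remains compares [g] with [g] composed with [- L]; the sign is removed at the end by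
   [ge0_vol_opp]. *)
pose b : V -> \bar R := fun x => ((enorm x < 1)%R)%:R%:E.
have mb : measurable_fun setT b by rewrite /b; mfun.
have b0 x : 0 <= b x by rewrite lee_fin.
have Ib : \int[vol]_x b x = vol [set x : V | (enorm x < 1)%R].
  rewrite -[RHS]mul1e -integral_cst//; last exact: measurable_enorm_lt.
  by rewrite integral_bool; apply: eq_integral => x _; rewrite mule1.
have Ib_fin : \int[vol]_x b x \is a fin_num.
  by rewrite ge0_fin_numE ?Ib ?enorm_lt_vol_lty.
have Ib_neq0 : \int[vol]_x b x != 0.
  by rewrite Ib gt_eqF// enorm_lt_vol_gt0.
have cancelb (u v : \bar R) : u * \int[vol]_x b x = v * \int[vol]_x b x -> u = v.
  move=> uv; have := congr1 (fun z => z * (fine (\int[vol]_x b x))^-1%:E) uv.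
  rewrite -!muleA -{1 3}(fineK Ib_fin) -EFinM divff ?mule1//.
  by rewrite fine_eq0.
have E1 g : measurable_fun setT g -> (forall x, 0 <= g x) ->
    \int[vol]_x g x = \int[vol]_x g (- L x)%R.
  move=> mg g0; apply: cancelb; have := main g b mg g0 mb b0.
  rewrite [X in _ * X = _](_ : _ = \int[vol]_x b x) => [->|]; first by rewrite muleC.
  by apply: eq_integral => x _; rewrite /b Ln.
have mfN : measurable_fun setT (fun x : V => f (- x)%R).
  by apply: (measurableT_comp mf); mfun.
rewrite -[RHS](ge0_vol_opp mf f0) (E1 _ mfN (fun x => f0 _)).
by apply: eq_integral => x _; rewrite opprK.
Qed.

Definition annulus (z : V) : bool := (1 < enorm z < 2)%R.

(* Polar coordinates without a surface measure: every direction is represented by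
   the points z of an annulus, with weight |z|. *)
Lemma ge0_polar f : measurable_fun setT f -> (forall x, 0 <= f x) ->
  \int[vol]_x f x = \int[vol]_z (((annulus z)%:R * enorm z)%:E *
     \int[leb]_(t in `]0%R, +oo[) ((t ^+ m)%:E * f (t *: z)%R)).
Proof.
move=> mf f0.
pose c (z : V) (t : R) : R := ((annulus z)%:R * enorm z * ((0 < t)%R%:R * t ^+ m))%R.
have c0 z t : (0 <= c z t)%R.
  rewrite /c; case: (ltP 0%R t) => t0; last by rewrite mul0r mulr0.
  by rewrite !mulr_ge0 ?enorm_ge0// exprn_ge0// ltW.
have mc : measurable_fun setT (fun p : V * R => c p.1 p.2) by rewrite /c /annulus; mfun.
have mG : measurable_fun setT (fun p : V * R => (c p.1 p.2)%:E * f (p.2 *: p.1)%R).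
  by apply: emeasurable_funM; [exact/measurable_EFinP|apply: (measurableT_comp mf); mfun].
have mf1 z : measurable_fun setT (fun t : R => f (t *: z)%R).
  by apply: (measurableT_comp mf); mfun.
transitivity (\int[vol]_z \int[leb]_t ((c z t)%:E * f (t *: z)%R)); last first.
  apply: eq_integral => z _.
  rewrite (_ : `]0%R, +oo[%classic = [set t : R | (0 < t)%R]); last first.
    by apply/seteqP; split => t /=; rewrite in_itv/= andbT.
  rewrite integral_bool -ge0_integralZl//; last 3 first.
  - apply: emeasurable_funM; first by mfun.
    by apply: emeasurable_funM; [mfun|exact: mf1].
  - move=> t _; case: ltP => t0; last by rewrite mul0e.
    by rewrite mul1e mule_ge0// lee_fin exprn_ge0// ltW.
  - by rewrite lee_fin mulr_ge0// enorm_ge0.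
  by apply: eq_integral => t _; rewrite /c !EFinM !muleA.
rewrite vol_leb_tonelli//; last by move=> z t; rewrite mule_ge0// lee_fin.
pose k (t : R) (w : V) : R :=
  ((0 < t)%R%:R * ((t < enorm w < 2 * t)%R%:R * enorm w * t ^- 2))%R.
have k0 t w : (0 <= k t w)%R.
  by rewrite /k !mulr_ge0 ?enorm_ge0// invr_ge0 sqr_ge0.
have mk : measurable_fun setT (fun p : R * V => k p.1 p.2) by rewrite /k; mfun.
transitivity (\int[leb]_t \int[vol]_w ((k t w)%:E * f w)); last first.
  apply: eq_integral => t _.
  have [t0|t0] := ltP 0%R t; last first.
    rewrite !integral0_eq// => z _; rewrite /k /c ltNge t0/= ?mul0r ?mulr0 mul0e//.
  have mkt : measurable_fun setT (fun w : V => k t w) by rewrite /k; mfun.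
  rewrite -(@ge0_vol_scaling R m (fun w => (k t w)%:E * f w) t)//; last 2 first.
  - by apply: emeasurable_funM => //; exact/measurable_EFinP.
  - by move=> w; rewrite mule_ge0// lee_fin.
  rewrite -ge0_integralZl//; last 3 first.
  - apply: emeasurable_funM; last by apply: (measurableT_comp mf); mfun.
    by apply/measurable_EFinP; apply: (measurableT_comp mkt); mfun.
  - by move=> w _; rewrite mule_ge0// lee_fin.
  - by rewrite lee_fin exprn_ge0// ltW.
  apply: eq_integral => w _; rewrite muleA -EFinM; congr (_%:E * _).
  rewrite /k /c /annulus enormZ gtr0_norm// t0 !mul1r exprS.
  rewrite -[X in (X < _ * _)%R]mulr1 ltr_pM2l// [in (2 * t)%R]mulrC ltr_pM2l//.
  by field; rewrite gt_eqF.
rewrite -vol_leb_tonelli; last 2 first.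
- apply: (measurableT_comp (f := fun p : R * V => (k p.1 p.2)%:E * f p.2)
    (g := fun p : V * R => (p.2, p.1))).
    apply: emeasurable_funM; first exact/measurable_EFinP.
    exact: measurableT_comp mf measurable_snd.
  by apply: measurable_fun_pair; mfun.
- by move=> w t; rewrite mule_ge0// lee_fin.
(* A point [w] lies on the dilate of the annulus by [t] exactly for [|w|/2 < t < |w|], and
   [|w| (2/|w| - 1/|w|) = 1]; the weight [|z|] is chosen for this. *)
have key w : \int[leb]_t ((k t w)%:E * f w) = (0 < enorm w)%R%:R%:E * f w.
  rewrite ge0_integralZr//; last 2 first.
  - by apply/measurable_EFinP; rewrite /k; mfun.
  - by move=> t _; rewrite lee_fin.
  congr (_ * _).
  have [w0|w0] := eqVneq (enorm w) 0%R.
    by rewrite w0 ltxx integral0_eq// => t _; rewrite /k w0 mulr0 mul0r mulr0.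
  have {}w0 : (0 < enorm w)%R by rewrite lt_def w0 enorm_ge0.
  rewrite w0.
  rewrite /k; move: (enorm w) w0 => a a0.
  have a2 : (a / 2 < a)%R by lra.
  have a20 : (0 < a / 2)%R by lra.
  transitivity (\int[leb]_(t in `](a / 2)%R, a[) (a * t ^- 2)%:E).
    rewrite (_ : `](a / 2)%R, a[%classic = [set t : R | (a / 2 < t < a)%R]); last first.
      by apply/seteqP; split => t /=; rewrite in_itv.
    rewrite integral_bool; apply: eq_integral => t _; rewrite -EFinM; congr EFin.
    have -> : (t < a < 2 * t)%R = (a / 2 < t < a)%R.
      by rewrite andbC; congr (_ && _); rewrite ltr_pdivrMr// mulrC.
    case: (boolP (a / 2 < t < a)%R) => [/andP[h _]|_]; last by rewrite !mul0r mulr0.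
    by rewrite (lt_trans a20 h) !mul1r.
  rewrite (_ : (fun t => _) = fun t => a%:E * (t ^- 2)%:E); last by apply/funext => t; rewrite EFinM.
  rewrite ge0_integralZl ?lee_fin ?(ltW a0)//; last 2 first.
  - by apply: measurable_funTS; mfun.
  - by move=> t _; rewrite lee_fin invr_ge0 sqr_ge0.
  have pos (x : R) : (a / 2 < x < a -> x != 0)%R by move=> /andP[x1 _]; rewrite gt_eqF// (lt_trans a20).
  have h : \int[leb]_(t in `](a / 2)%R, a[) (t ^- 2)%:E = (- a^-1 - - (a / 2)^-1)%:E.
    apply: (@ge0_FTC2_oo R (fun t : R => t ^- 2)%R (fun v : R => - v^-1)%R) => //.
    - by move=> x /pos; exact: is_derive_Ninv.
    - by move=> x; rewrite in_itv/= => /pos; exact: continuous_inv_sqr.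
    - by move=> x _; rewrite invr_ge0 sqr_ge0.
    - by apply: cvg_at_right_filter; apply: is_derive_cvg (is_derive_Ninv _); rewrite gt_eqF.
    - by apply: cvg_at_left_filter; apply: is_derive_cvg (is_derive_Ninv _); rewrite gt_eqF.
  by rewrite h -EFinM /= mulr1n; congr EFin; field; rewrite gt_eqF.
under [RHS]eq_integral do rewrite key.
apply: ge0_ae_eq_integral => //.
- by apply: emeasurable_funM => //; mfun.
- by move=> w _; rewrite mule_ge0// lee_fin.
exists [set 0%R]; split; [|exact: vol_origin|].
  by rewrite origin_box; exact: measurable_box.
move=> w /=; apply: contra_notP => w0 _.
suff -> : (0 < enorm w)%R by rewrite mul1e.
by rewrite lt_def enorm_ge0 andbT; apply/eqP => /enorm_eq0.
Qed.

(** The constant is the area of the unit sphere, left implicit as the integral of [|z|^(-m)] over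
    the annulus. Its finiteness and positivity are read off from the formula applied to the unit
    ball, whose volume is finite and positive. *)
Lemma radial : exists2 k : R, (0 < k)%R & forall h : R -> \bar R,
  measurable_fun setT h -> (forall t, 0 <= h t) ->
  \int[vol]_x h (enorm x) = k%:E * \int[leb]_(t in `]0%R, +oo[) ((t ^+ m)%:E * h t).
Proof.
pose c z : R := ((annulus z)%:R * enorm z * enorm z ^- m.+1)%R.
have c0 z : (0 <= c z)%R by rewrite /c !mulr_ge0 ?enorm_ge0// invr_ge0 exprn_ge0 ?enorm_ge0.
have polar (h : R -> \bar R) : measurable_fun setT h -> (forall t, 0 <= h t) ->
    \int[vol]_x h (enorm x) =
    \int[vol]_z (c z)%:E * \int[leb]_(t in `]0%R, +oo[) ((t ^+ m)%:E * h t).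
  move=> mh h0.
  have mh' : measurable_fun setT (fun t : R => (0 < t)%R%:R%:E * ((t ^+ m)%:E * h t)) by mfun.
  have h0' (t : R) : 0 <= (0 < t)%R%:R%:E * ((t ^+ m)%:E * h t).
    by case: ltP => t0; rewrite ?mul0e// mul1e mule_ge0// lee_fin exprn_ge0// ltW.
  rewrite ge0_polar//; last by apply: (measurableT_comp mh); mfun.
  have mc : measurable_fun setT (fun z : V => (c z)%:E) by rewrite /c /annulus; mfun.
  have c0' z : 0 <= (c z)%:E by rewrite lee_fin.
  have I0 : 0 <= \int[leb]_(t in `]0%R, +oo[) ((t ^+ m)%:E * h t).
    by rewrite integral_posE; exact: integral_ge0.
  rewrite -(ge0_intZr vol I0 mc c0').
  apply: eq_integral => z _; rewrite !integral_posE.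
  have [z0|] := boolP (annulus z); last by move=> /negbTE h1; rewrite /c h1 !mul0r !mul0e.
  have z1 : (0 < enorm z)%R by move: z0 => /andP[/(lt_trans _)-> //].
  rewrite -(ge0_integral_scaling z1 mh' h0') muleA -EFinM /c z0 mul1r.
  have -> : (enorm z * enorm z ^- m.+1 * enorm z = enorm z * (enorm z ^- m))%R.
    by rewrite exprS; field; rewrite expf_neq0 gt_eqF.
  rewrite EFinM -muleA; congr (_ * _).
  have mh2 : measurable_fun setT (fun t : R => (0 < enorm z * t)%R%:R%:E *
      (((enorm z * t) ^+ m)%:E * h (enorm z * t)%R)).
    by apply: (measurableT_comp mh'); mfun.
  have zm0 : (0 <= enorm z ^- m)%R by rewrite invr_ge0 exprn_ge0// ltW.
  rewrite -(ge0_intZl leb zm0 mh2 (fun t => h0' _)).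
  apply: eq_integral => t _; rewrite pmulr_rgt0//.
  case: ltP => t0; last by rewrite !mul0e mule0.
  rewrite !mul1e enormZ gtr0_norm// muleA -EFinM [(t * _)%R]mulrC exprMn mulrA mulVf ?mul1r//.
  by rewrite expf_neq0// gt_eqF.
pose b : R -> \bar R := fun t => (t < 1)%R%:R%:E.
have mb : measurable_fun setT b by rewrite /b; mfun.
have b0 t : 0 <= b t by rewrite lee_fin.
have Ib : \int[vol]_x b (enorm x) = vol [set x : V | (enorm x < 1)%R].
  rewrite -[RHS]mul1e -integral_cst//; last exact: measurable_enorm_lt.
  by rewrite integral_bool; apply: eq_integral => x _; rewrite mule1.
have I1 : 0 < \int[leb]_(t in `]0%R, +oo[) ((t ^+ m)%:E * b t).
  pose q : R := (2^-1 ^+ m)%R.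
  have q0 : (0 < q)%R by rewrite exprn_gt0// invr_gt0.
  have mb' : measurable_fun setT (fun t : R => (0 < t)%R%:R%:E * ((t ^+ m)%:E * b t)) by mfun.
  apply: (@lt_le_trans _ _ (\int[leb]_t ((2^-1 < t < 1)%R%:R%:E * q%:E))).
    rewrite -integral_bool (_ : [set t : R | _] = `](2^-1)%R, 1%R[%classic); last first.
      by apply/seteqP; split => t /=; rewrite in_itv.
    apply: (@lt_le_trans _ _ (q%:E * leb `](2^-1)%R, 1%R[)); last by rewrite integral_cst.
    by rewrite lebesgue_measure_itv/= lte_fin ifT ?mule_gt0 ?lte_fin ?subr_gt0//; lra.
  rewrite integral_posE; apply: ge0_int_le => //.
  - by mfun.
  - by move=> t; rewrite mule_ge0// lee_fin ltW.
  move=> t; rewrite /b -!EFinM lee_fin.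
  case: (boolP (2^-1 < t < 1)%R) => [/andP[t1 ->]|_]; last first.
    rewrite mul0r; case: ltP => t0; rewrite ?mul0r// mul1r mulr_ge0//.
    by rewrite exprn_ge0// ltW.
  have t0 : (0 < t)%R by apply: lt_trans t1; rewrite invr_gt0.
  by rewrite t0 !mul1r mulr1 lerXn2r ?nnegrE ?invr_ge0// ltW.
have Ic0 : 0 <= \int[vol]_z (c z)%:E by apply: integral_ge0 => z _; rewrite lee_fin.
have := polar b mb b0; rewrite Ib => Iv.
have Icfin : \int[vol]_z (c z)%:E \is a fin_num.
  rewrite ge0_fin_numE// ltey; apply/eqP => h.
  by have := enorm_lt_vol_lty 1%R; rewrite Iv h gt0_mulye// ltxx.
exists (fine (\int[vol]_z (c z)%:E)); last by rewrite fineK.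
rewrite fine_gt0// -ge0_fin_numE// Icfin andbT lt_def Ic0 andbT.
apply/eqP => h; have := @enorm_lt_vol_gt0 1%R ltr01.
by rewrite Iv h mul0e ltxx.
Qed.

End invariance_and_polar.

(** * The kernel *)

Section power_integrals.
Context {R : realType}.
Local Notation leb := (@lebesgue_measure R).
Local Open Scope ereal_scope.

Lemma integral_powR_near0 (a b : R) : (0 < a)%R -> (0 < b)%R ->
  \int[leb]_(t in `]0%R, b[) (t `^ (a - 1))%:E = (b `^ a / a)%:E.
Proof.
move=> a0 b0; pose F (t : R) : R := (a^-1 * t `^ a)%R.
have dF (x : R) : (0 < x)%R -> is_derive x 1%R F (x `^ (a - 1))%R.
  move=> x0; have h := is_deriveZ a^-1 (is_derive1_powR a x0).
  by apply: (is_derive_eq h); rewrite /GRing.scale/= mulKf// gt_eqF.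
have Fcvg0 : F x @[x --> 0%R^'+] --> F 0%R.
  rewrite /F powR0 ?gt_eqF// ; apply: cvgM; first exact: cvg_cst.
  exact: powR_cvg0.
have -> : (b `^ a / a = F b - F 0)%R.
  by rewrite /F powR0 ?gt_eqF// mulr0 subr0 mulrC.
apply: (@ge0_FTC2_oo R (fun t => t `^ (a - 1))%R F) => //.
- by move=> x /andP[x0 _]; exact: dF.
- move=> x; rewrite in_itv/= => /andP[x0 _].
  exact: is_derive_cvg (is_derive1_powR _ x0).
- by move=> x _; exact: powR_ge0.
- by apply: cvg_at_left_filter; exact: is_derive_cvg (dF _ b0).
Qed.

Lemma integral_powR_near0E (a b : R) : (0 < a)%R -> (0 < b)%R ->
  \int[leb]_(t in `]0%R, +oo[) ((t < b)%R%:R * t `^ (a - 1))%:E = (b `^ a / a)%:E.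
Proof.
move=> a0 b0; rewrite -integral_powR_near0// integral_posE.
rewrite (_ : `]0%R, b[%classic = [set t : R | (0 < t < b)%R]) ?integral_bool; last first.
  by apply/seteqP; split => t /=; rewrite in_itv.
apply: eq_integral => t _; rewrite -!EFinM; congr EFin.
by case: (0 < t)%R; case: (t < b)%R; rewrite /= ?(mul1r, mul0r).
Qed.

Lemma integral_powR_infty (a b : R) : (0 < a)%R -> (0 < b)%R ->
  \int[leb]_(t in `]0%R, +oo[) ((b < t)%R%:R * t `^ (- a - 1))%:E = (b `^ (- a) / a)%:E.
Proof.
move=> a0 b0.
rewrite -(ge0_integral_invr (f := fun t => ((b < t)%R%:R * t `^ (- a - 1))%:E)); last 2 first.
- by mfun.
- by move=> t; rewrite lee_fin mulr_ge0// powR_ge0.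
have b'0 : (0 < b^-1)%R by rewrite invr_gt0.
have -> : (b `^ (- a) / a = b^-1 `^ a / a)%R.
  by rewrite -(powR_inv1 (ltW b0)) -powRrM mulN1r.
rewrite -(integral_powR_near0E a0 b'0).
apply: eq_integral => t /set_mem; rewrite /= in_itv/= andbT => t0.
rewrite -EFinM; congr EFin.
have -> : (b < t^-1)%R = (t < b^-1)%R by rewrite -[in RHS](invrK t) ltf_pV2 ?posrE// invr_gt0.
rewrite -mulrA; congr (_ * _)%R.
rewrite -(powR_inv1 (ltW t0)) -powRrM -(powR_invn 2 (ltW t0)) -powRD ?(gt_eqF t0) ?implybT//.
by congr (_ `^ _)%R; ring.
Qed.

End power_integrals.

Section kernel.
Context {R : realType} {m : nat}.
Local Notation leb := (@lebesgue_measure R).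
Local Notation V := 'rV[R]_m.+1.
Local Notation vol := (@vol R m).
Variable s : R.
Hypotheses (s0 : 0 < s) (s1 : s < 1).
Local Open Scope ereal_scope.

Definition kern (z : V) : R := ((enorm z `^ (m.+1%:R + 2 * s))^-1)%R.

Lemma kern_ge0 z : (0 <= kern z)%R. Proof. by rewrite invr_ge0 powR_ge0. Qed.

Lemma kernN z : kern (- z)%R = kern z. Proof. by rewrite /kern enormN. Qed.

Lemma measurable_kern d (T : measurableType d) (f : T -> V) :
  measurable_fun setT f -> measurable_fun setT (fun x => kern (f x)).
Proof. by move=> mf; rewrite /kern; mfun. Qed.

Lemma exponent_gt0 : (0 < m.+1%:R + 2 * s :> R)%R.
Proof. by rewrite addr_gt0// mulr_gt0. Qed.

Lemma exprm_kern (t : R) : (0 < t)%R ->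
  (t ^+ m * (t `^ (m.+1%:R + 2 * s))^-1 = t `^ (- (2 * s) - 1))%R.
Proof.
move=> t0; rewrite -powR_mulrn ?ltW// -powRN -powRD ?(gt_eqF t0) ?implybT//.
by congr (_ `^ _)%R; rewrite -natr1; ring.
Qed.

Lemma kern_tail : exists2 k : R, (0 < k)%R & forall e : R, (0 < e)%R ->
  \int[vol]_z ((e <= enorm z)%R%:R * kern z)%:E = (k * e `^ (- (2 * s)))%:E.
Proof.
have [k k0 hk] := radial m (R := R).
have s20 : (0 < 2 * s)%R by rewrite mulr_gt0.
exists (k / (2 * s))%R; first by rewrite divr_gt0.
move=> e e0.
rewrite (hk (fun t => ((e <= t)%R%:R * (t `^ (m.+1%:R + 2 * s))^-1)%:E)); last 2 first.
- by mfun.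
- by move=> t; rewrite lee_fin mulr_ge0// invr_ge0 powR_ge0.
have -> : (k / (2 * s) * e `^ (- (2 * s)) = k * (e `^ (- (2 * s)) / (2 * s)))%R by ring.
rewrite EFinM; congr (_ * _).
rewrite -integral_powR_infty// [RHS]integral_posE integral_posE.
have mS : measurable ([set: R] `\ e) by exact: measurableD.
rewrite -[LHS](integral_setD1 mS); last by apply: measurable_funTS; mfun.
have h (t : R) : t != e -> (0 < t)%R%:R%:E * ((t ^+ m)%:E * ((e <= t)%R%:R * (t `^ (m.+1%:R + 2 * s))^-1)%:E) =
   (0 < t)%R%:R%:E * ((e < t)%R%:R * t `^ (- (2 * s) - 1))%:E.
  move=> te; rewrite le_eqVlt [e == t]eq_sym (negbTE te)/=.
  case: ltP => t0; last by rewrite !mul0e.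
  by rewrite !mul1e -EFinM mulrCA exprm_kern.
rewrite -[RHS](integral_setD1 mS); last by apply: measurable_funTS; mfun.
by apply: eq_integral => t /set_mem[_ /= /eqP te]; exact: h.
Qed.

Lemma kern_near0 (q : R) : (2 * s < q)%R ->
  exists2 k : R, (0 <= k)%R & forall e : R, (0 < e)%R ->
  \int[vol]_z ((enorm z < e)%R%:R * (enorm z `^ q * kern z))%:E = (k * e `^ (q - 2 * s))%:E.
Proof.
move=> sq; have [k k0 hk] := radial m (R := R).
have qs0 : (0 < q - 2 * s)%R by rewrite subr_gt0.
exists (k / (q - 2 * s))%R; first by rewrite divr_ge0// ltW.
move=> e e0.
rewrite (hk (fun t => ((t < e)%R%:R * (t `^ q * (t `^ (m.+1%:R + 2 * s))^-1))%:E)); last 2 first.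
- by mfun.
- by move=> t; rewrite lee_fin !mulr_ge0// ?invr_ge0 powR_ge0.
have -> : (k / (q - 2 * s) * e `^ (q - 2 * s) = k * (e `^ (q - 2 * s) / (q - 2 * s)))%R by ring.
rewrite EFinM; congr (_ * _).
rewrite -integral_powR_near0E// [RHS]integral_posE integral_posE.
apply: eq_integral => t _; case: ltP => t0; last by rewrite !mul0e.
rewrite !mul1e -EFinM mulrCA; congr ((_ * _)%R%:E).
rewrite mulrCA exprm_kern// -powRD ?(gt_eqF t0) ?implybT//; congr (_ `^ _)%R; ring.
Qed.

Lemma one_minus_cos_le (x : R) : (0 <= 1 - cos x <= x ^+ 2)%R.
Proof.
apply/andP; split; first by rewrite subr_ge0 cos_le1.
wlog x0 : x / (0 <= x)%R => [h|].
  have [/h//|/ltW x0] := leP 0%R x.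
  by rewrite -cosN -sqrrN; apply: h; rewrite oppr_ge0.
have sin_le (y : R) : (0 <= y -> sin y <= y)%R.
  move=> y0; have [c _] := @MVT_segment R sin cos 0%R y y0
    (fun x _ => is_derive_sin x) (continuous_subspaceT (@continuous_sin R)).
  rewrite sin0 !subr0 => ->; rewrite -[leRHS]mul1r ler_wpM2r//; exact: cos_le1.
have [c /[!in_itv]/= /andP[c0 cx]] := @MVT_segment R (fun x => - cos x)%R sin 0%R x x0
    (fun x _ => is_derive_eq (is_deriveN (is_derive_cos x)) (opprK _))
    (continuous_subspaceT (fun x => continuousN (@continuous_cos R x))).
rewrite cos0 opprK addrC subr0 => ->; rewrite expr2 ler_wpM2r//.
exact: le_trans (sin_le _ c0) cx.
Qed.

Lemma coord1E (z : V) : coord1 z = z 0%R 0%R.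
Proof.
rewrite /coord1 (big_pred1 (0%R : 'I_m.+1))//.
Qed.

(** Were the defining integral infinite, [fine] would make it 0 and [C_ns] would vanish, so that the
    sign of [frac_lap] would carry no information. The integral is finite because
    [1 - cos z_1 <= |z|^2] near 0 and the kernel is integrable at infinity. *)
Lemma C_ns_gt0 : (0 < C_ns m.+1 s)%R.
Proof.
rewrite /C_ns invr_gt0.
pose u (z : V) : R := ((1 - cos (coord1 z)) / enorm z `^ (m.+1%:R + 2 * s))%R.
have mu : measurable_fun setT (fun z => (u z)%:E).
  apply/measurable_EFinP; apply: measurable_funM; last by mfun.
  under eq_fun do rewrite coord1E.
  apply: measurable_funB => //.
  apply: (measurableT_comp (continuous_measurable_fun (@continuous_cos R))).
  exact: measurable_coord.
have u0 z : 0 <= (u z)%:E.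
  by rewrite lee_fin mulr_ge0 ?kern_ge0//; have /andP[] := one_minus_cos_le (coord1 z).
rewrite (_ : Rn_int _ _ = \int[vol]_z (u z)%:E); last by rewrite integral_vol.
have [k k0 hk] := kern_tail.
have s22 : (2 * s < 2)%R by rewrite -[ltRHS]mulr1 ltr_pM2l.
have [k2 k20 hk2] := kern_near0 s22.
apply/fine_gt0/andP; split; last first.
  apply: (@le_lt_trans _ _ (\int[vol]_z (((enorm z < 1)%R%:R * (enorm z `^ 2 * kern z))%:E +
     2%:E * ((1 <= enorm z)%R%:R * kern z)%:E))).
    apply: ge0_int_le => //.
      by apply: emeasurable_funD; [|apply: measurable_funeM]; rewrite /kern; mfun.
    move=> z; rewrite -EFinM -EFinD lee_fin /u coord1E.
    case: ltP => z1; rewrite ?mul1r ?mul0r ?mulr0 ?addr0 ?add0r.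
      rewrite ler_wpM2r ?kern_ge0//; have /andP[_ h] := one_minus_cos_le (z 0%R 0%R).
      apply: le_trans h _; rewrite powR_mulrn ?enorm_ge0// -real_normK ?num_real//.
      by rewrite lerXn2r ?nnegrE ?enorm_ge0// coord_le_enorm.
    by rewrite ler_wpM2r ?kern_ge0//; have := cos_geN1 (z 0%R 0%R); lra.
  rewrite ge0_intD.
  - rewrite hk2// ge0_intZl ?hk ?ltry//.
    + by rewrite /kern; mfun.
    + by move=> z; rewrite lee_fin mulr_ge0// kern_ge0.
  - by rewrite /kern; mfun.
  - by apply: measurable_funeM; rewrite /kern; mfun.
  - by move=> z; rewrite lee_fin !mulr_ge0// ?powR_ge0 ?kern_ge0.
  - by move=> z; rewrite -EFinM lee_fin !mulr_ge0// kern_ge0.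
(* A vanishing integral would make the integrand null off a negligible set, which would then contain
   the cube with coordinates in [[1/2, 1]]; there [0 < z_1 < pi], hence [cos z_1 < 1]. *)
rewrite lt_def integral_ge0// andbT; apply/eqP => I0.
have /(ae_eq_integral_abs vol measurableT mu) : \int[vol]_z `|(u z)%:E| = 0.
  by under eq_integral do rewrite gee0_abs//.
move=> [N [mN N0 sub]].
have : vol (@box R m 2^-1%R 1%R) <= vol N.
  apply: le_measure; rewrite ?inE//; first exact: measurable_box.
  move=> z /= /forallP hz; apply: sub => /= /(_ I); apply/eqP.
  rewrite /cst/= eqe /u mulf_neq0//.
    rewrite coord1E subr_eq0 eq_sym.
    have /andP[z1 z2] := hz 0%R; have z0 : (0 < z 0%R 0%R)%R by apply: lt_le_trans z1; rewrite invr_gt0.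
    have zpi : (z 0%R 0%R <= pi)%R by apply: le_trans z2 _; have := pi_ge2 R; lra.
    have := @ltr_cos R 0%R (z 0%R 0%R); rewrite !in_itv/= zpi (ltW z0) lexx pi_ge0 => /(_ isT isT).
    by rewrite [in X in _ = X]z0 cos0 => h; rewrite lt_eqF.
  rewrite invr_neq0// gt_eqF// powR_gt0//.
  apply: lt_le_trans (coord_le_enorm z 0%R).
  by have /andP[z1 _] := hz 0%R; rewrite gtr0_norm (lt_le_trans _ z1)// invr_gt0.
rewrite N0 vol_box; last by lra.
by rewrite lee_fin leNgt exprn_gt0//; lra.
Qed.

End kernel.

(** * Second differences of Hölder functions *)

Section Holder_regularity.
Context {R : realType} {n : nat}.
Local Notation V := 'rV[R]_n.
Implicit Types (f g : V -> R) (x y z h : V).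

Lemma le_enorm x y : (forall i, `|x 0 i| <= `|y 0 i|) -> enorm x <= enorm y.
Proof.
move=> xy; rewrite /enorm ler_sqrt; last by apply: sumr_ge0 => i _; exact: sqr_ge0.
apply: ler_sum => i _; rewrite -[leLHS]real_normK ?num_real// -[leRHS]real_normK ?num_real//.
by rewrite lerXn2r ?nnegrE.
Qed.

Lemma is_derive_line f (a v : V) (t : R) : derivable f (a + t *: v) v ->
  is_derive t 1 (fun u : R => f (a + u *: v)) ('D_v f (a + t *: v)).
Proof.
have E : (fun h : R => h^-1 *: (f (a + (h *: (1 : R^o) + t) *: v) - f (a + t *: v))) =
         (fun h : R => h^-1 *: (f (h *: v + (a + t *: v)) - f (a + t *: v))).
  apply/funext => h; congr (_ *: (f _ - _)).
  by rewrite scalerDl [h *: (1 : R^o)]mulr1 addrCA addrA.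
move=> df; apply: DeriveDef; first by rewrite /derivable /= E.
by rewrite /derive /= E.
Qed.

Lemma coordinate_mvt f (a : V) (i : 'I_n) (c : R) :
  (forall x, derivable f x (delta_mx 0 i)) ->
  exists2 t : R, `|t| <= `|c| &
    f (a + c *: delta_mx 0 i) - f a = c * pderiv i f (a + t *: delta_mx 0 i).
Proof.
move=> df; set v := delta_mx 0 i.
pose phi (u : R) := f (a + u *: v).
have dphi (t : R) : is_derive t 1 phi (pderiv i f (a + t *: v)) by exact: is_derive_line.
have cphi (A : set R) : {within A, continuous phi}.
  by apply: continuous_subspaceT => t; exact: is_derive_cvg (dphi t).
have phi0 : phi 0 = f a by rewrite /phi scale0r addr0.
have [c0|/ltW c0] := leP 0 c.
  have [t + E] := MVT_segment c0 (fun t _ => dphi t) (cphi _).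
  rewrite in_itv/= => /andP[t0 tc]; exists t; first by rewrite !ger0_norm.
  by rewrite -phi0 E subr0 mulrC.
have [t + E] := MVT_segment c0 (fun t _ => dphi t) (cphi _).
rewrite in_itv/= => /andP[t0 tc]; exists t; first by rewrite !ler0_norm// lerN2.
by rewrite -phi0 -opprB E sub0r mulrN opprK mulrC.
Qed.

(** Only partial derivatives are available, so the increment is travelled one coordinate at a time,
    [P k] keeping the first [k] coordinates of [h]. Each coordinate has its own intermediate point,
    whose offset from [x] is dominated coordinatewise by [h]. *)
Lemma mean_value f x h : (forall i x, derivable f x (delta_mx 0 i)) ->
  exists2 xi : 'I_n -> V, (forall i, enorm (xi i - x) <= enorm h) &
    f (x + h) - f x = \sum_i h 0 i * pderiv i f (xi i).
Proof.
move=> df.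
pose P (k : nat) : V := \row_j (if (j < k)%N then h 0 j else 0).
have P0 : P 0%N = 0 by apply/rowP => j; rewrite !mxE.
have Pn : P n = h by apply/rowP => j; rewrite !mxE ltn_ord.
have PS (i : 'I_n) : P i.+1 = P i + h 0 i *: delta_mx 0 i.
  apply/rowP => j; rewrite !mxE eqxx/= ltnS leq_eqVlt val_eqE.
  have [->|ji] := eqVneq j i; first by rewrite ltnn add0r mulr1.
  by rewrite mulr0 addr0.
pose t (i : 'I_n) := s2val (cid2 (coordinate_mvt (x + P i) (h 0 i) (df i))).
pose xi (i : 'I_n) := x + P i + t i *: delta_mx 0 i.
exists xi.
  move=> i; rewrite /xi /t; case: cid2 => u /= uh _.
  have -> : x + P i + u *: delta_mx 0 i - x = P i + u *: delta_mx 0 i :> V.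
    by rewrite [X in X - x]addrC -[x + P i]addrC addrA addrK addrC.
  apply: le_enorm => j.
  rewrite !mxE eqxx/=; have [->|ji] := eqVneq j i; first by rewrite ltnn add0r mulr1.
  by rewrite mulr0 addr0; case: ifP; rewrite ?normr0.
rewrite -{1}Pn -[X in _ - f X](addr0 x) -P0.
rewrite -(telescope_sumr (fun k => f (x + P k)) (leq0n n)) big_mkord.
apply: eq_bigr => i _; rewrite /xi /t; case: cid2 => u /= _ <-.
by rewrite PS addrA.
Qed.

Lemma CkW k f : Ck k.+1 f -> Ck k f.
Proof.
elim: k f => [|k ih] f; first by case.
by move=> [cf [df h]]; split=> //; split=> // i; apply: ih; exact: h.
Qed.

Lemma Ck_dpartial (b : seq 'I_n) k f : Ck (size b + k) f -> Ck k (dpartial b f).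
Proof.
elim: b k => [//|i b ih] k; rewrite [size _]/= addSnnS => /ih [_ [_ h]]; exact: h.
Qed.

Lemma Holder_bounded (F : V -> R) (r C a : R) : 0 < r -> 0 <= a ->
  (forall x y, enorm x < r -> enorm y < r -> `|F x - F y| <= C * enorm (x - y) `^ a) ->
  exists2 B : R, 0 <= B & forall x, enorm x < r -> `|F x| <= B.
Proof.
move=> r0 a0 hF; exists (`|F 0| + `|C| * r `^ a).
  by rewrite addr_ge0// mulr_ge0// powR_ge0.
move=> x xr; have := hF x 0 xr; rewrite enorm0 => /(_ r0); rewrite subr0 => h.
rewrite -[F x](subrK (F 0)) addrC; apply: le_trans (ler_normD _ _) _.
rewrite lerD2l; apply: le_trans h _; apply: (@le_trans _ _ (`|C| * enorm x `^ a)).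
  by rewrite ler_wpM2r ?powR_ge0// ler_norm.
by rewrite ler_wpM2l// ge0_ler_powR// ?nnegrE ?enorm_ge0// ltW.
Qed.

Lemma Holder_locW k a f : 0 <= a -> Holder_loc k.+1 a f -> Holder_loc k 1 f.
Proof.
move=> a0 [cf hf]; split; first exact: CkW.
move=> b bk r r0.
have [cF [dF _]] : Ck 1 (dpartial b f) by apply: Ck_dpartial; rewrite bk addn1.
(* The intermediate points stay within [|x - y| < 2 r] of [y], hence in the ball of radius [3 r]. *)
have r30 : 0 < 3 * r by rewrite mulr_gt0.
have bnd i : exists2 B : R, 0 <= B &
    forall x, enorm x < 3 * r -> `|pderiv i (dpartial b f) x| <= B.
  have [|C hC] := hf (i :: b) _ _ r30; first by rewrite /= bk.
  exact: (@Holder_bounded _ (3 * r) C a).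
pose B i := s2val (cid2 (bnd i)).
have B0 i : 0 <= B i by rewrite /B; case: cid2.
have Bh i x : enorm x < 3 * r -> `|pderiv i (dpartial b f) x| <= B i.
  by rewrite /B; case: cid2 => ? ? h; exact: h.
exists (\sum_i B i) => x y xr yr.
have [xi hxi] := mean_value y (x - y) dF.
rewrite [y + (x - y)]addrC subrK => ->; rewrite powRr1 ?enorm_ge0//.
apply: le_trans (ler_norm_sum _ _ _) _; rewrite mulr_suml; apply: ler_sum => i _.
rewrite normrM mulrC ler_pM//; last exact: coord_le_enorm.
apply: Bh; apply: le_lt_trans (enorm_le_add _ y) _.
apply: le_lt_trans (lerD (lexx _) (hxi i)) _.
have := enorm_triangle x (- y); rewrite enormN; lra.
Qed.

(** The symmetrised form of the regularity: with [q > 2 s] it makes the truncations of the singular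
    integral converge at a rate uniform on balls. *)
Definition second_difference_bound f (q : R) := forall r : R, 0 < r ->
  exists2 C : R, 0 <= C & forall x z, enorm x < r -> enorm z < 1 ->
    `|2 * f x - f (x + z) - f (x - z)| <= C * enorm z `^ q.

Lemma Holder_loc0_second_difference a f : Holder_loc 0 a f -> second_difference_bound f a.
Proof.
move=> [_ hf] r r0; have r10 : 0 < r + 1 by lra.
have [C hC] := hf [::] erefl _ r10.
exists (2 * `|C|); first by rewrite mulr_ge0.
move=> x z xr z1.
have h (w : V) : enorm w = enorm z -> `|f x - f (x + w)| <= `|C| * enorm z `^ a.
  move=> wz; have -> : enorm z = enorm (x - (x + w)) by rewrite opprD addrA subrr sub0r enormN.
  apply: le_trans (hC _ _ _ _) _; [lra| |].
    by apply: le_lt_trans (enorm_triangle _ _) _; rewrite wz; lra.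
  by rewrite ler_wpM2r ?powR_ge0// ler_norm.
have -> : 2 * f x - f (x + z) - f (x - z) = (f x - f (x + z)) + (f x - f (x - z)) by ring.
apply: le_trans (ler_normD _ _) _.
have := h z erefl; have := h (- z) (enormN z); lra.
Qed.

Lemma Holder_loc1_second_difference a f : 0 < a -> Holder_loc 1 a f ->
  second_difference_bound f (1 + a).
Proof.
move=> a0 [[_ [df _]] hf] r r0; have r10 : 0 < r + 1 by lra.
have hi i : exists2 C : R, 0 <= C & forall x y, enorm x < r + 1 -> enorm y < r + 1 ->
    `|pderiv i f x - pderiv i f y| <= C * enorm (x - y) `^ a.
  have [C hC] := hf [:: i] erefl _ r10; exists `|C| => // x y xr yr.
  by apply: le_trans (hC _ _ xr yr) _; rewrite ler_wpM2r ?powR_ge0// ler_norm.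
pose C i := s2val (cid2 (hi i)).
have C0 i : 0 <= C i by rewrite /C; case: cid2.
have Ch i x y : enorm x < r + 1 -> enorm y < r + 1 ->
    `|pderiv i f x - pderiv i f y| <= C i * enorm (x - y) `^ a.
  by rewrite /C; case: cid2 => ? ? h; exact: h.
exists (\sum_i C i * 2 `^ a).
  by apply: sumr_ge0 => i _; rewrite mulr_ge0 ?powR_ge0.
move=> x z xr z1.
have [xi hxi Exi] := mean_value x z df.
have [et het Eet] := mean_value x (- z) df.
have -> : 2 * f x - f (x + z) - f (x - z) = - ((f (x + z) - f x) + (f (x - z) - f x)) by ring.
rewrite normrN Exi Eet -big_split/= mulr_suml.
apply: le_trans (ler_norm_sum _ _ _) _; apply: ler_sum => i _.
rewrite mxE mulNr -mulrBr normrM.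
have ball w : enorm (w - x) <= enorm z -> enorm w < r + 1.
  by move=> h; apply: le_lt_trans (enorm_le_add w x) _; lra.
have het' := het i; rewrite enormN in het'.
have dist : enorm (xi i - et i) <= 2 * enorm z.
  apply: le_trans (enorm_le_add _ (xi i - x)) _; have := hxi i.
  have -> : xi i - et i - (xi i - x) = x - et i by rewrite opprB addrC addrA subrK.
  by rewrite (enormBC x); lra.
have h1 := Ch i _ _ (ball _ (hxi i)) (ball _ het').
have h2 : enorm (xi i - et i) `^ a <= 2 `^ a * enorm z `^ a.
  rewrite -powRM ?enorm_ge0//; apply: ge0_ler_powR; rewrite ?(ltW a0) ?nnegrE ?enorm_ge0//.
  by rewrite mulr_ge0 ?enorm_ge0.
rewrite powRD; last by rewrite gt_eqF// addr_gt0.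
rewrite powRr1 ?enorm_ge0// [leLHS]mulrC mulrCA [leRHS]mulrC; apply: ler_pM.
- exact: normr_ge0.
- exact: normr_ge0.
- by apply: le_trans h1 _; rewrite -mulrA ler_wpM2l.
- exact: coord_le_enorm.
Qed.

(** Second differences have order [g] when at most one derivative is available, the evenness in [z]
    gaining one order over the gradient. With two or more derivatives the gradient is locally
    Lipschitz and the order is 2, which exceeds [2 s] because [s < 1]. *)
Lemma C_loc_regularity (s g : R) f : 0 < s -> s < 1 -> 2 * s < g -> C_loc g f ->
  (exists2 q : R, 2 * s < q & second_difference_bound f q) /\
  (forall r : R, 0 < r -> exists2 B : R, 0 <= B & forall x, enorm x < r -> `|f x| <= B).
Proof.
move=> s0 s1 sg; rewrite /C_loc; set k := `|_|%N.
have g0 : 0 < g by lra.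
have ceil1 : (0 <= Num.ceil g - 1)%R.
  by rewrite subr_ge0 -gtz0_ge1 ceil_gt0.
have kE : k%:R = (Num.ceil g - 1)%:~R :> R by rewrite /k natr_absz ger0_norm.
have a0 : 0 < g - k%:R.
  by rewrite kE subr_gt0 ceilB1_lt.
move: k kE a0 => k _ a0 hf.
have bnd j a : 0 < a -> Holder_loc j a f ->
    forall r : R, 0 < r -> exists2 B : R, 0 <= B & forall x, enorm x < r -> `|f x| <= B.
  elim: j a => [|j ih] a a1 hfj; last by apply: (ih 1) => //; apply: Holder_locW hfj; exact: ltW.
  move=> r r0; have [C hC] := hfj.2 [::] erefl _ r0.
  exact: (@Holder_bounded f r C a r0 (ltW a1)).
split; last exact: bnd hf.
have two j a : 0 < a -> Holder_loc j.+2 a f -> Holder_loc 1 1 f.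
  elim: j a => [|j ih] a a1 hfj; first by apply: Holder_locW hfj; exact: ltW.
  by apply: (ih 1) => //; apply: Holder_locW hfj; exact: ltW.
case: k a0 hf => [|[|k]] a0 hf.
- by exists g => //; rewrite -[g]subr0; exact: Holder_loc0_second_difference.
- by exists (1 + (g - 1)); [lra|exact: Holder_loc1_second_difference].
- by exists (1 + 1); [lra|apply: Holder_loc1_second_difference => //; exact: two hf].
Qed.

End Holder_regularity.

(** * Integrals along a line *)

Section positive_powers.
Context {R : realType}.
Local Notation leb := (@lebesgue_measure R).
Implicit Types (a c s x y : R).

Lemma powR_expR x a : 0 < x -> x `^ a = expR (a * ln x).
Proof. by move=> x0; rewrite /powR gt_eqF. Qed.

Lemma powRB1 x a : 0 < x -> x `^ (a - 1) = x `^ a / x.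
Proof. by move=> x0; rewrite powRB ?(gt_eqF x0) ?implybT// powRr1 ?ltW. Qed.

Lemma powR_le1 x a : 0 <= a -> 0 <= x <= 1 -> x `^ a <= 1.
Proof.
move=> a0 /andP[x0 x1]; rewrite (_ : 1 = 1 `^ a); last by rewrite powR1.
by apply: ge0_ler_powR; rewrite ?nnegrE.
Qed.

Lemma powR_ge1 x a : 0 <= a -> 1 <= x -> 1 <= x `^ a.
Proof.
move=> a0 x1; rewrite [leLHS](_ : 1 = 1 `^ a); last by rewrite powR1.
by apply: ge0_ler_powR; rewrite ?nnegrE// (le_trans ler01).
Qed.

(** The power of the positive part. The indicator is essential because [powR] is an exponential,
    hence nonzero, at negative bases. *)
Definition ppow a x : R := (0 < x)%R%:R * x `^ a.

Lemma ppow_ge0 a x : 0 <= ppow a x. Proof. by rewrite mulr_ge0 ?powR_ge0. Qed.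

Lemma ppow_gt0E a x : 0 < x -> ppow a x = x `^ a.
Proof. by rewrite /ppow => ->; rewrite mul1r. Qed.

Lemma ppow_le0E a x : x <= 0 -> ppow a x = 0.
Proof. by move=> x0; rewrite /ppow ltNge x0 mul0r. Qed.

Lemma ppowZ a c x : 0 < c -> ppow a (c * x) = c `^ a * ppow a x.
Proof.
move=> c0; have [x0|x0] := ltP 0 x; last by rewrite !ppow_le0E ?mulr0// pmulr_rle0.
by rewrite !ppow_gt0E ?mulr_gt0// powRM// ltW.
Qed.

Lemma ppow_le a x y : 0 <= a -> x <= y -> ppow a x <= ppow a y.
Proof.
move=> a0 xy; have [x0|x0] := ltP 0 x; last by rewrite ppow_le0E// ppow_ge0.
have y0 := lt_le_trans x0 xy.
by rewrite !ppow_gt0E// ge0_ler_powR// nnegrE ltW.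
Qed.

Lemma measurable_ppow d (T : measurableType d) (D : set T) (f : T -> R) (a : R) :
  measurable_fun D f -> measurable_fun D (fun t => ppow a (f t)).
Proof. by move=> mf; rewrite /ppow; mfun. Qed.

(** Young's inequality for the product of [(1 + x)^s] and 1 with exponents [1/s] and [1/(1 - s)]. *)
Lemma bernoulli_le s x : 0 < s < 1 -> 0 <= x -> (1 + x) `^ s <= 1 + s * x.
Proof.
move=> /andP[s0 s1] x0; have x10 : 0 <= 1 + x by rewrite addr_ge0.
have := @conjugate_powR R ((1 + x) `^ s) 1 s^-1 (1 - s)^-1.
rewrite powR_ge0 ler01 !invr_gt0 s0 subr_gt0 s1 !invrK subrKC.
move=> /(_ isT isT isT isT erefl).
rewrite -powRrM mulfV ?gt_eqF// powRr1// powR1 mulr1; lra.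
Qed.

(** From [exp t >= 1 + t] and [ln (1 + x) >= x / (1 + x) >= x - x^2]. The loss is quadratic, the
    precision needed in [two_sided_tail_bound]. *)
Lemma bernoulli_ge s x : 0 < s -> 0 <= x -> 1 + s * (x - x ^+ 2) <= (1 + x) `^ s.
Proof.
move=> s0 x0; have x10 : 0 < 1 + x by rewrite ltr_pwDl.
rewrite powR_expR//; apply: le_trans (expR_ge1Dx _); rewrite lerD2l ler_pM2l//.
have := @le_ln1Dx R (- (x / (1 + x))).
have -> : 1 - x / (1 + x) = (1 + x)^-1 by field; rewrite gt_eqF.
rewrite lnV ?posrE// ltrN2 ltr_pdivrMr// mul1r ltrDr ltr01 lerN2 => /(_ isT).
apply: le_trans; rewrite ler_pdivlMr//.
have -> : (x - x ^+ 2) * (1 + x) = x - x ^+ 3 by ring.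
by rewrite lerBlDr lerDl exprn_ge0.
Qed.

End positive_powers.

Section real_integrands.
Context {R : realType}.
Local Notation leb := (@lebesgue_measure R).
Implicit Types (f F : R -> R) (a b c p : R).
Local Open Scope ereal_scope.

Lemma ge0_integral_invrR f : measurable_fun setT f -> (forall x, 0 <= f x)%R ->
  \int[leb]_v ((0 < v)%R%:R * (f v^-1 * v ^- 2))%:E = \int[leb]_t ((0 < t)%R%:R * f t)%:E.
Proof.
move=> mf f0; have := @ge0_integral_invr R (EFin \o f).
by rewrite !integral_posE => <-//; exact/measurable_EFinP.
Qed.

Lemma ge0_integral_quadraticR f p b : (0 < p)%R -> (0 <= b)%R ->
  measurable_fun setT f -> (forall x, 0 <= f x)%R ->
  \int[leb]_v ((0 < v)%R%:R * (f (p * v ^+ 2 + 2 * b * v) * (2 * p * v + 2 * b)))%:E =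
  \int[leb]_x ((0 < x)%R%:R * f x)%:E.
Proof.
move=> p0 b0 mf f0; have := @ge0_integral_quadratic R (EFin \o f) p b p0 b0.
by rewrite !integral_posE => <-//; exact/measurable_EFinP.
Qed.

Lemma ge0_integral_le_lt f c : measurable_fun setT f -> (forall x, 0 <= f x)%R ->
  \int[leb]_x ((x <= c)%R%:R * f x)%:E = \int[leb]_x ((x < c)%R%:R * f x)%:E.
Proof.
move=> mf f0.
under eq_integral do rewrite EFinM; under [RHS]eq_integral do rewrite EFinM.
rewrite -!integral_bool.
have -> : [set x : R | (x <= c)%R] = `]-oo, c]%classic by apply/seteqP; split => x /=; rewrite in_itv.
have -> : [set x : R | (x < c)%R] = `]-oo, c[%classic by apply/seteqP; split => x /=; rewrite in_itv.
by rewrite integral_itv_bndo_bndc//; apply/measurable_EFinP; exact: measurable_funTS.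
Qed.

Lemma integral_lt_lt (a b : R) f :
  \int[leb]_x ((a < x < b)%R%:R * f x)%:E = \int[leb]_(x in `]a, b[) (f x)%:E.
Proof.
by rewrite (_ : `]a, b[%classic = [set x : R | (a < x < b)%R]) ?integral_bool.
Qed.

End real_integrands.

(** * Powers of affine and quadratic functions along a line *)

Section half_line.
Context {R : realType}.
Variable s : R.
Hypotheses (s0 : 0 < s) (s1 : s < 1).
Local Notation leb := (@lebesgue_measure R).
Local Open Scope ereal_scope.

Let s_ge0 : (0 <= s)%R. Proof. exact: ltW. Qed.

Lemma half_line_primitive (V : R) : (0 < V)%R ->
  \int[leb]_v ((0 < v < V)%R%:R * ((v + 1) `^ s * v `^ (s - 1) + v `^ s * (v + 1) `^ (s - 1)))%:E =
  ((V * (V + 1)) `^ s / s)%:E.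
Proof.
move=> V0.
pose F (v : R) : R := (s^-1 * (v * (v + 1)) `^ s)%R.
pose f (v : R) : R := ((v + 1) `^ s * v `^ (s - 1) + v `^ s * (v + 1) `^ (s - 1))%R.
have pos (v : R) : (0 < v)%R -> (0 < v + 1)%R by move=> v0; rewrite addr_gt0.
have dF (v : R) : (0 < v)%R -> is_derive v 1%R F (f v).
  move=> v0; have v10 := pos _ v0.
  have dq : is_derive v 1%R (fun v : R => v * (v + 1))%R (2 * v + 1)%R.
    by apply: is_derive_eq; rewrite /GRing.scale/=; ring.
  have vv : (0 < v * (v + 1))%R by rewrite mulr_gt0.
  have dp : is_derive v 1%R (fun v : R => (v * (v + 1)) `^ s)%R
      ((s * (v * (v + 1)) `^ (s - 1)) * (2 * v + 1))%R.
    have d2 := is_derive1_powR s vv.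
    exact: (@is_derive1_comp R (fun w => w `^ s)%R (fun v : R => v * (v + 1))%R _ _ _ d2 dq).
  have h := is_deriveZ s^-1 dp.
  apply: (is_derive_eq h); rewrite /GRing.scale/= /f.
  rewrite !powRB1// powRM ?(ltW v0) ?(ltW v10)//.
  by field; rewrite !gt_eqF.
rewrite integral_lt_lt.
have -> : ((V * (V + 1)) `^ s / s = F V - F 0)%R.
  by rewrite /F mul0r powR0 ?gt_eqF// mulr0 subr0 mulrC.
apply: (@ge0_FTC2_oo R f F) => //.
- by move=> v /andP[v0 _]; exact: dF.
- move=> v; rewrite in_itv/= => /andP[v0 _].
  have c1 (a : R) : (fun v1 : R => v1 `^ a)%R @ v --> (v `^ a)%R.
    exact: is_derive_cvg (is_derive1_powR _ v0).
  have c2 (a : R) : (fun v1 : R => (v1 + 1) `^ a)%R @ v --> ((v + 1) `^ a)%R.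
    have d1 : is_derive v 1%R (fun v : R => v + 1)%R 1%R.
      by apply: is_derive_eq; rewrite addr0.
    have d2 := is_derive1_powR a (pos _ v0).
    exact: is_derive_cvg (@is_derive1_comp R (fun w => w `^ a)%R (fun v : R => v + 1)%R _ _ _ d2 d1).
  by apply: cvgD; apply: cvgM.
- by move=> v _; rewrite addr_ge0// mulr_ge0// powR_ge0.
- rewrite /F mul0r powR0 ?gt_eqF// mulr0.
  rewrite -[X in _ --> X](mulr0 s^-1%R); apply: cvgM; first exact: cvg_cst.
  have sub : (fun v : R => (v * (v + 1)) `^ s)%R @ 0%R^'+ --> 0%R.
    have h : (fun v : R => v `^ s * (v + 1) `^ s)%R @ 0%R^'+ --> (0 * (0 + 1) `^ s)%R.
      apply: cvgM; first exact: powR_cvg0.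
      have d1 : is_derive (0 : R)%R 1%R (fun v : R => v + 1)%R 1%R.
        by apply: is_derive_eq; rewrite addr0.
      apply: cvg_at_right_filter.
      have d2 : is_derive (0 + 1 : R)%R 1%R (fun w : R => w `^ s)%R (s * (0 + 1) `^ (s - 1))%R.
        by apply: is_derive1_powR; rewrite add0r.
      exact: is_derive_cvg (@is_derive1_comp R (fun w => w `^ s)%R (fun v : R => v + 1)%R _ _ _ d2 d1).
    rewrite mul0r in h; apply: cvg_trans h; apply: near_eq_cvg.
    near=> v; have v0 : (0 < v)%R by near: v; exact: nbhs_right_gt.
    by rewrite powRM// ltW// pos.
  exact: sub.
- by apply: cvg_at_left_filter; exact: is_derive_cvg (dF _ V0).
Unshelve. all: by end_near. Qed.

(** The restriction of a half-space power to a line is proportional to [(1 + c t)_+^s]; this is its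
    potential at [t = 0] with [|t| < tau] cut out, both rays together. *)
Definition two_sided_tail (c tau : R) : \bar R :=
  \int[leb]_t ((0 < t)%R%:R * ((tau <= t)%R%:R * ((ppow s (1 - c * t) + ppow s (1 + c * t)) *
     t `^ (- (2 * s) - 1))))%:E.

Lemma two_sided_tail_invr (tau : R) : (0 < tau)%R -> two_sided_tail 1 tau =
  \int[leb]_v ((0 < v < tau^-1)%R%:R *
    (((v + 1) `^ s * v `^ (s - 1)) + ppow s (v - 1) * v `^ (s - 1)))%:E.
Proof.
move=> tau0; rewrite /two_sided_tail.
rewrite -ge0_integral_invrR; last 2 first.
- by rewrite /ppow; mfun.
- by move=> t; rewrite !mulr_ge0 ?powR_ge0 ?addr_ge0 ?ppow_ge0.
transitivity (\int[leb]_v ((v <= tau^-1)%R%:R * ((0 < v)%R%:R *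
    (((v + 1) `^ s * v `^ (s - 1)) + ppow s (v - 1) * v `^ (s - 1))))%:E).
  apply: eq_integral => v _; congr EFin.
  have [v0|] := ltP 0%R v; last by rewrite !(mul0r, mulr0).
  have -> : (tau <= v^-1)%R = (v <= tau^-1)%R by rewrite -[in LHS](invrK tau) lef_pV2 ?posrE ?invr_gt0.
  rewrite !mul1r -mulrA; congr (_ * _)%R.
  have v'0 : (0 < v^-1)%R by rewrite invr_gt0.
  have -> : (1 - v^-1 = v^-1 * (v - 1))%R by field; rewrite gt_eqF.
  have -> : (1 + v^-1 = v^-1 * (v + 1))%R by field; rewrite gt_eqF.
  have v10 : (0 < v + 1)%R by rewrite addr_gt0.
  rewrite !ppowZ// (ppow_gt0E _ v10) -mulrDr [X in (_ * X * _ * _)%R]addrC -mulrDl.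
  rewrite -mulrA mulrAC [RHS]mulrC; congr (_ * _)%R.
  rewrite -(powR_invn 2 (ltW v0)) -!(powR_inv1 (ltW v0)) -!powRrM.
  rewrite -!powRD ?(gt_eqF v0) ?implybT//.
  by congr (_ `^ _)%R; ring.
rewrite ge0_integral_le_lt.
- apply: eq_integral => v _; congr EFin.
  by case: (0 < v)%R; case: (v < tau^-1)%R; rewrite /= ?(mul1r, mul0r).
- by rewrite /ppow; mfun.
- by move=> v; rewrite mulr_ge0// addr_ge0// mulr_ge0 ?powR_ge0 ?ppow_ge0.
Qed.

Lemma two_sided_tail_le1 (V : R) : (0 < V <= 1)%R ->
  0 <= two_sided_tail 1 V^-1 <= (2 * (V `^ s / s))%:E.
Proof.
move=> /andP[V0 V1]; rewrite two_sided_tail_invr ?invr_gt0// invrK; apply/andP; split.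
  apply: integral_ge0 => v _; rewrite lee_fin mulr_ge0// addr_ge0// mulr_ge0 ?powR_ge0 ?ppow_ge0//.
rewrite EFinM -integral_powR_near0E// integral_posE -ge0_intZl//; last 2 first.
- by mfun.
- by move=> v; rewrite lee_fin !mulr_ge0// powR_ge0.
apply: ge0_int_le.
- by rewrite /ppow; mfun.
- by mfun.
- by move=> v; rewrite lee_fin mulr_ge0// addr_ge0// mulr_ge0 ?powR_ge0 ?ppow_ge0.
move=> v; rewrite -!EFinM lee_fin; have [v0|] := ltP 0%R v; last by rewrite !(mul0r, mulr0).
rewrite /= mul1r; have [vV|] := ltP v V; last by rewrite !(mul0r, mulr0).
have v1 : (v - 1 <= 0)%R by lra.
rewrite !mul1r ppow_le0E// mul0r addr0 ler_wpM2r ?powR_ge0//.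
apply: le_trans (_ : 2 `^ s <= _)%R.
  by apply: ge0_ler_powR; rewrite ?nnegrE//; lra.
by rewrite -[leRHS]powRr1//; apply: ler_powR; [lra|exact: ltW].
Qed.

(** After [v = 1/t] the two rays give [(v + 1)^s v^(s-1)] and [(v - 1)_+^s v^(s-1)] on []0, V[].
    Translating the second by 1 yields [v^s (v + 1)^(s-1)] on []0, V - 1[], and the sum of the two
    integrands is the exact derivative of [half_line_primitive]. The missing piece on [[V - 1, V[],
    of length 1, is [p], enclosed by monotonicity of the factors. *)
Lemma two_sided_tail_ge1 (V : R) : (1 < V)%R -> exists2 p : R,
  two_sided_tail 1 V^-1 = ((V * (V + 1)) `^ s / s - p)%:E &
  ((V - 1) `^ s * (V + 1) `^ (s - 1) <= p <= V `^ s * V `^ (s - 1))%R.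
Proof.
move=> V1; have V0 : (0 < V)%R by apply: lt_trans V1.
have V10 : (0 < V - 1)%R by rewrite subr_gt0.
pose chi (v : R) := (v `^ s * (v + 1) `^ (s - 1))%R.
pose phi (v : R) := ((v + 1) `^ s * v `^ (s - 1))%R.
have chi0 v : (0 <= chi v)%R by rewrite mulr_ge0// powR_ge0.
have phi0 v : (0 <= phi v)%R by rewrite mulr_ge0// powR_ge0.
have mchi : measurable_fun setT chi by rewrite /chi; mfun.
have mphi : measurable_fun setT phi by rewrite /phi; mfun.
pose c1 := ((V - 1) `^ s * (V + 1) `^ (s - 1))%R.
pose c2 := (V `^ s * V `^ (s - 1))%R.
pose P3 := \int[leb]_v ((V - 1 <= v < V)%R%:R * chi v)%:E.
have I1 c : (0 <= c)%R -> \int[leb]_v ((V - 1 <= v < V)%R%:R * c)%:E = c%:E.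
  move=> c0; under eq_integral do rewrite EFinM.
  rewrite -integral_bool (_ : [set v | _] = `[(V - 1)%R, V[%classic); last first.
    by apply/seteqP; split => v /=; rewrite in_itv.
  rewrite integral_cst//= lebesgue_measure_itv/= lte_fin.
  rewrite ltrBlDr ltrDl ltr01 -EFinD.
  by rewrite -EFinM; congr EFin; ring.
have cc (v : R) : (V - 1 <= v < V)%R -> (c1 <= chi v <= c2)%R.
  move=> /andP[v1 v2]; have v0 : (0 < v)%R by apply: lt_le_trans v1.
  have le1 (x y : R) : (0 < x)%R -> (x <= y)%R -> (y `^ (s - 1) <= x `^ (s - 1))%R.
    move=> x0 xy; have y0 := lt_le_trans x0 xy.
    rewrite -[(s - 1)%R]opprB !powRN lef_pV2 ?posrE ?powR_gt0//.
    by apply: ge0_ler_powR; rewrite ?nnegrE ?subr_ge0 ?(ltW s1) ?(ltW x0) ?(ltW y0).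
  rewrite /c1 /chi /c2; apply/andP; split; apply: ler_pM; rewrite ?powR_ge0//.
  - by apply: ge0_ler_powR; rewrite ?nnegrE//; apply: ltW.
  - by apply: le1; lra.
  - by apply: ge0_ler_powR; rewrite ?nnegrE//; apply: ltW.
  - by apply: le1; lra.
have P3b : c1%:E <= P3 <= c2%:E.
  rewrite -(I1 c1) ?mulr_ge0 ?powR_ge0// -(I1 c2) ?mulr_ge0 ?powR_ge0//.
  apply/andP; split; apply: ge0_int_le => //; try (by rewrite /c1 /c2; mfun).
  - by move=> v; rewrite lee_fin !mulr_ge0// powR_ge0.
  - move=> v; rewrite lee_fin; case: (boolP (V - 1 <= v < V)%R) => h; last by rewrite !mul0r.
    by rewrite !mul1r; have /andP[] := cc _ h.
  - by move=> v; rewrite lee_fin !mulr_ge0// powR_ge0.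
  - move=> v; rewrite lee_fin; case: (boolP (V - 1 <= v < V)%R) => h; last by rewrite !mul0r.
    by rewrite !mul1r; have /andP[] := cc _ h.
have [p pE] : exists p : R, P3 = p%:E.
  exists (fine P3); rewrite fineK//; apply/fin_numPlt/andP; split.
    by have /andP[h _] := P3b; apply: lt_le_trans h; rewrite ltNyr.
  by have /andP[_ h] := P3b; apply: le_lt_trans h _; rewrite ltry.
exists p; last by move: P3b; rewrite pE !lee_fin.
rewrite two_sided_tail_invr ?invr_gt0// invrK.
set A := (X in X = _); suff h : A + P3 = ((V * (V + 1)) `^ s / s)%:E.
  by rewrite EFinB -h pE addeK.
rewrite /A -half_line_primitive//; apply/esym.
transitivity (\int[leb]_v ((0 < v < V)%R%:R * phi v)%:E + \int[leb]_v ((0 < v < V)%R%:R * chi v)%:E).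
  rewrite -ge0_intD.
  - by apply: eq_integral => v _; rewrite -EFinD -mulrDr.
  - by mfun.
  - by mfun.
  - by move=> v; rewrite lee_fin mulr_ge0.
  - by move=> v; rewrite lee_fin mulr_ge0.
transitivity (\int[leb]_v ((0 < v < V)%R%:R * phi v)%:E +
   \int[leb]_v ((0 < v < V)%R%:R * (ppow s (v - 1) * v `^ (s - 1)))%:E + P3); last first.
  rewrite -ge0_intD.
  - by congr (_ + _); apply: eq_integral => v _; rewrite -EFinD -mulrDr.
  - by mfun.
  - by rewrite /ppow; mfun.
  - by move=> v; rewrite lee_fin mulr_ge0.
  - by move=> v; rewrite lee_fin !mulr_ge0 ?powR_ge0 ?ppow_ge0.
rewrite -addeA; congr (_ + _).
rewrite -(ge0_integral_translation
  (f := fun v => ((0 < v < V)%R%:R * (ppow s (v - 1) * v `^ (s - 1)))%:E) 1%R).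
- rewrite /P3 -ge0_intD.
  + apply: eq_integral => v _; rewrite -EFinD addrK; congr EFin.
    have [v0|v0] := ltP 0%R v; last first.
      by rewrite ppow_le0E// [(V - 1 <= v)%R]leNgt (le_lt_trans v0 V10) /= !mul0r mulr0 addr0.
    rewrite ppow_gt0E// addr_gt0// /= -[(v + 1 < V)%R]ltrBrDr.
    have [v1|v1] := ltP v (V - 1)%R; last by rewrite mul0r add0r.
    by rewrite mul0r addr0; have -> : (v < V)%R by apply: lt_trans v1 _; lra.
  + by rewrite /ppow; mfun.
  + by mfun.
  + by move=> v; rewrite lee_fin !mulr_ge0 ?powR_ge0 ?ppow_ge0.
  + by move=> v; rewrite lee_fin mulr_ge0.
- by rewrite /ppow; mfun.
- by move=> v; rewrite lee_fin !mulr_ge0 ?powR_ge0 ?ppow_ge0.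
Qed.

(** The subtracted term is the tail of the constant 1 on both rays; that the difference tends to 0
    with [tau] says that [x_+^s] is [s]-harmonic on the half-line. The bound without [tau] is used
    for domination, the one with [tau^(2 - 2s)] for the limit. *)
Lemma two_sided_tail_bound (tau : R) : (0 < tau)%R -> exists2 r : R,
  two_sided_tail 1 tau = r%:E &
  (`|r - tau `^ (- (2 * s)) / s| <= 2 / s)%R /\
  (`|r - tau `^ (- (2 * s)) / s| <= 2 / s * tau `^ (2 - 2 * s))%R.
Proof.
move=> tau0; pose V : R := (tau^-1)%R.
have V0 : (0 < V)%R by rewrite invr_gt0.
have tauE : tau = (V^-1)%R by rewrite invrK.
have W : (tau `^ (- (2 * s)) = V `^ s * V `^ s)%R.
  rewrite tauE -(powR_inv1 (ltW V0)) -powRrM -powRD ?(gt_eqF V0) ?implybT//.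
  by congr (_ `^ _)%R; ring.
have si : (0 <= s^-1)%R by rewrite invr_ge0 ltW.
have [tau1|tau1] := leP 1%R tau.
  have V1 : (0 < V <= 1)%R by rewrite V0 invf_le1.
  have /andP[t0 t1] := two_sided_tail_le1 V1; rewrite -tauE in t0 t1.
  have [r rE] : exists r : R, two_sided_tail 1 tau = r%:E.
    exists (fine (two_sided_tail 1 tau)); rewrite fineK// ge0_fin_numE//.
    by apply: le_lt_trans t1 _; rewrite ltry.
  exists r => //; rewrite rE !lee_fin in t0 t1.
  have Vs1 : (V `^ s <= 1)%R.
    by apply: powR_le1 => //; rewrite (ltW V0); have /andP[] := V1.
  have h : (`|r - tau `^ (- (2 * s)) / s| <= 2 / s)%R.
    rewrite W ler_norml; apply/andP; split.
      rewrite lerBrDl lerBlDr; apply: (@le_trans _ _ (1 * 1 / s)%R).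
        by rewrite ler_wpM2r// ler_pM// powR_ge0.
      by rewrite mul1r; lra.
    rewrite lerBlDr; apply: le_trans t1 _.
    have : (V `^ s / s <= 1 / s)%R by rewrite ler_wpM2r.
    have : (0 <= V `^ s * V `^ s / s)%R by rewrite !mulr_ge0// powR_ge0.
    lra.
  split=> //; apply: le_trans h _; rewrite ler_peMr ?mulr_ge0//.
  by apply: powR_ge1 => //; rewrite subr_ge0 ler_piMr// ltW.
have V1 : (1 < V)%R by rewrite invf_gt1.
have [p tE /andP[p1 p2]] := two_sided_tail_ge1 V1; rewrite -tauE in tE.
exists ((V * (V + 1)) `^ s / s - p)%R => //.
set w := (V `^ s * V `^ s)%R.
have w0 : (0 < w)%R by rewrite mulr_gt0// powR_gt0.
have tV : (tau * V = 1)%R by rewrite mulfV// gt_eqF.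
have E1 : ((V * (V + 1)) `^ s = w * (1 + tau) `^ s)%R.
  have -> : (V + 1 = V * (1 + tau))%R by rewrite mulrDr mulr1 [(V * tau)%R]mulrC tV.
  have t10 : (0 <= 1 + tau)%R by rewrite addr_ge0// ltW.
  by rewrite !powRM ?(ltW V0)// ?mulrA// mulr_ge0// ltW.
have E2 : (V `^ s * V `^ (s - 1) = w * tau)%R.
  by rewrite powRB1// mulrA invrK.
have u1 := bernoulli_le (x := tau) (introT andP (conj s0 s1)) (ltW tau0).
have u2 := bernoulli_ge s0 (ltW tau0).
have E3 : (w * tau * (1 - 2 * tau) <= p)%R.
  apply: le_trans p1.
  have -> : (V - 1 = V * (1 - tau))%R by rewrite mulrBr mulr1 mulrC tV.
  have -> : (V + 1 = V * (1 + tau))%R by rewrite mulrDr mulr1 [(V * tau)%R]mulrC tV.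
  rewrite !powRM ?(ltW V0)//; [|by lra|by lra].
  rewrite mulrACA E2 ler_pM2l ?mulr_gt0 ?powR_gt0//.
  apply: (@le_trans _ _ ((1 - tau) * (1 - tau))%R); first by nra.
  apply: ler_pM; rewrite ?subr_ge0 ?(ltW tau1)//.
    by apply: ger1_powR; [lra|exact: ltW].
  apply: (@le_trans _ _ ((1 + tau) `^ (-1))%R).
    rewrite powR_inv1; last by lra.
    by rewrite -[leRHS]mul1r ler_pdivlMr; nra.
  by apply: ler_powR; move: s0; lra.
(* Both [((1 + tau)^s - 1) / s] and [p / w] equal [tau] up to second order, so the terms [w tau]
   cancel. *)
have h : (`|(V * (V + 1)) `^ s / s - p - tau `^ (- (2 * s)) / s| <= 2 * (w * tau ^+ 2))%R.
  rewrite W -/w E1 [X in (X / s - p - _)%R](_ : _ = w * ((1 + tau) `^ s - 1) + w)%R; last by ring.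
  have -> : ((w * ((1 + tau) `^ s - 1) + w) / s - p - w / s = w * (((1 + tau) `^ s - 1) / s) - p)%R.
    by field; rewrite gt_eqF.
  set u := (((1 + tau) `^ s - 1) / s)%R.
  have uu1 : (u <= tau)%R by rewrite /u ler_pdivrMr//; lra.
  have uu2 : (tau - tau ^+ 2 <= u)%R by rewrite /u ler_pdivlMr//; lra.
  have wu1 : (w * u <= w * tau)%R by rewrite ler_pM2l.
  have wu2 : (w * (tau - tau ^+ 2) <= w * u)%R by rewrite ler_pM2l.
  have w2 : (0 <= w * tau ^+ 2)%R by rewrite mulr_ge0 ?sqr_ge0// ltW.
  by rewrite E2 in p2; rewrite ler_norml; apply/andP; split; lra.
have wE : (w * tau ^+ 2 = tau `^ (2 - 2 * s))%R.
  rewrite /w -W -(powR_mulrn 2 (ltW tau0)) -powRD ?(gt_eqF tau0) ?implybT//.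
  by congr (_ `^ _)%R; ring.
have k2 : (2 <= 2 / s)%R by rewrite ler_pdivlMr// ler_piMr// ltW.
rewrite wE in h; split; apply: le_trans h _.
  rewrite -[leRHS]mulr1; apply: ler_pM; rewrite ?powR_ge0//.
  by apply: powR_le1; rewrite ?subr_ge0 ?ler_piMr ?(ltW tau0) ?(ltW tau1) ?(ltW s1).
by rewrite ler_wpM2r// powR_ge0.
Qed.

Definition ppow_gap (c x : R) : R := (ppow s x - ppow s (x - c))%R.
Local Notation h := ppow_gap.

Let h_ge0 c x : (0 <= c)%R -> (0 <= h c x)%R.
Proof. by move=> c0; rewrite subr_ge0 ppow_le// gerBl. Qed.

Let h_eq0 c x : (0 <= c)%R -> (x <= 0)%R -> h c x = 0%R.
Proof. by move=> c0 x0; rewrite /ppow_gap !ppow_le0E ?subrr//; lra. Qed.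

Let mh c (f : R -> R) : measurable_fun setT f -> measurable_fun setT (fun x => h c (f x)).
Proof. by move=> mf; rewrite /ppow_gap /ppow; mfun. Qed.

Let h_invr (p b c v : R) : (0 < v)%R ->
  ((ppow s (p + b * v^-1) - ppow s (p + b * v^-1 - c * v^-1 ^+ 2)) * v^-1 `^ (- (2 * s) - 1) * v ^- 2 =
  h c (p * v ^+ 2 + b * v) / v)%R.
Proof.
move=> v0; have v'0 : (0 < v^-1 ^+ 2)%R by rewrite exprn_gt0// invr_gt0.
have -> : (p + b * v^-1 = v^-1 ^+ 2 * (p * v ^+ 2 + b * v))%R by field; rewrite gt_eqF.
rewrite [(c * _)%R]mulrC -mulrBr !ppowZ//.
transitivity (h c (p * v ^+ 2 + b * v) * ((v^-1 ^+ 2) `^ s * v^-1 `^ (- (2 * s) - 1) * v ^- 2))%R.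
  by rewrite /ppow_gap; ring.
congr (_ * _)%R.
have vi : (0 <= v^-1)%R by rewrite invr_ge0 ltW.
rewrite -(powR_invn 2 (ltW v0)) -(powR_mulrn 2 vi) -!(powR_inv1 (ltW v0)) -!powRrM.
by rewrite -!powRD ?(gt_eqF v0) ?implybT//; congr (_ `^ _)%R; ring.
Qed.

(** Along a ray from [y] the barrier is [(p + b t - c t^2)_+^s]; the gap is measured from the power
    of its affine part. *)
Definition parabola_gap (p b c : R) : \bar R :=
  \int[leb]_t ((0 < t)%R%:R * ((ppow s (p + b * t) - ppow s (p + b * t - c * t ^+ 2)) *
     t `^ (- (2 * s) - 1)))%:E.

Let parabola_gap_invr (p b c : R) : (0 <= c)%R -> parabola_gap p b c =
  \int[leb]_v ((0 < v)%R%:R * (h c (p * v ^+ 2 + b * v) / v))%:E.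
Proof.
move=> c0; rewrite /parabola_gap -ge0_integral_invrR; last 2 first.
- by rewrite /ppow; mfun.
- move=> t; rewrite mulr_ge0 ?powR_ge0// subr_ge0 ppow_le//.
  by rewrite gerBl mulr_ge0// sqr_ge0.
apply: eq_integral => v _; congr EFin.
by have [v0|] := ltP 0%R v; [rewrite h_invr|rewrite !mul0r].
Qed.

(** [h 1 x] is at most [x^s] everywhere and at most [x^(s-1)] for large [x], so [h 1 x / x] is
    integrable at both ends. *)
Let gap1_lty : \int[leb]_x ((0 < x)%R%:R * (h 1 x / x))%:E < +oo.
Proof.
have m1 : (0 < 1 - s)%R by rewrite subr_gt0.
have e1 := integral_powR_near0E s0 (ltr0n R 2).
have e2 := integral_powR_infty m1 (@ltr01 R).
rewrite !integral_posE in e1 e2.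
apply: (@le_lt_trans _ _ (\int[leb]_x ((0 < x)%R%:R%:E * ((x < 2)%R%:R * x `^ (s - 1))%:E +
    (0 < x)%R%:R%:E * ((1 < x)%R%:R * x `^ (- (1 - s) - 1))%:E))); last first.
  rewrite ge0_intD.
  - by rewrite e1 e2 -EFinD ltry.
  - by mfun.
  - by mfun.
  - by move=> x; rewrite -EFinM lee_fin !mulr_ge0// powR_ge0.
  - by move=> x; rewrite -EFinM lee_fin !mulr_ge0// powR_ge0.
apply: ge0_int_le.
- have mhx : measurable_fun setT (fun x : R => h 1 x) by apply: mh; exact: measurable_id.
  by mfun.
- by apply: emeasurable_funD; mfun.
- move=> x; rewrite lee_fin; have [x0|] := ltP 0%R x; last by rewrite mul0r.
  by rewrite mul1r divr_ge0 ?h_ge0// ltW.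
move=> x; rewrite -!EFinM -EFinD lee_fin.
have [x0|] := ltP 0%R x; last by rewrite !mul0r addr0.
rewrite !mul1r; have [x2|x2] := ltP x 2%R.
  apply: (@le_trans _ _ (x `^ (s - 1))%R); last first.
    by rewrite mul1r lerDl mulr_ge0// powR_ge0.
  by rewrite powRB1// ler_pM2r ?invr_gt0// /ppow_gap ppow_gt0E// gerBl ppow_ge0.
have x1 : (1 < x)%R by apply: lt_le_trans x2; rewrite ltr1n.
rewrite mul0r add0r x1 mul1r /ppow_gap !ppow_gt0E ?subr_gt0//.
have -> : (- (1 - s) - 1 = s - 1 - 1)%R by ring.
rewrite powRB1// ler_pM2r ?invr_gt0// powRB1//.
have -> : (x - 1 = x * (1 - x^-1))%R by field; rewrite gt_eqF.
have xi : (0 < x^-1 < 1)%R by rewrite invr_gt0 x0 invf_lt1.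
have xi2 : (0 <= 1 - x^-1)%R by have /andP[] := xi; lra.
rewrite powRM ?(ltW x0)// -{1}[(x `^ s)%R]mulr1 -mulrBr ler_wpM2l ?powR_ge0//.
rewrite lerBlDr -lerBlDl; apply: ger1_powR; last exact: ltW.
by have /andP[] := xi; lra.
Qed.

(** The value is free of [p] and [b], which is why the Laplacian of the barrier is constant. With
    slopes written [2 b] and [- 2 b], the substitution [v = 1/t] gives [h c (p v^2 + 2 b v) / v] on
    the increasing ray. On the other one the integrand vanishes up to [beta = 2 b / p], and
    translation by [beta] produces the same [q v = p v^2 + 2 b v], divided by [v + beta]. Since
    [q v = p v (v + beta)], the sum of [1/v] and [1/(v + beta)] is the logarithmic derivative of
    [q], and [x = q v] leaves the integral of [h c x / x]. *)
Lemma parabola_gapD : exists2 A : R, (0 <= A)%R & forall p b c : R, (0 < p)%R -> (0 < c)%R ->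
  parabola_gap p b c + parabola_gap p (- b) c = (c `^ s * A)%:E.
Proof.
pose I1 := \int[leb]_x ((0 < x)%R%:R * (h 1 x / x))%:E.
have I10 : 0 <= I1.
  apply: integral_ge0 => x _; rewrite lee_fin; have [x0|] := ltP 0%R x; last by rewrite mul0r.
  by rewrite mul1r divr_ge0 ?h_ge0// ltW.
exists (fine I1); first exact: fine_ge0.
have mhx c (f : R -> R) : measurable_fun setT f -> measurable_fun setT (fun x => h c (f x)).
  exact: mh.
suff main (p b b2 c : R) : (0 < p)%R -> (0 <= b)%R -> (0 < c)%R -> b2 = (2 * b)%R ->
    parabola_gap p (- b2) c + parabola_gap p b2 c = (c `^ s * fine I1)%:E.
  move=> p b c p0 c0; have [b0|b0] := leP 0%R b.
    have b20 : (0 <= b / 2)%R by rewrite divr_ge0.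
    by rewrite addeC; apply: main b20 _ _ => //; field.
  have b20 : (0 <= - b / 2)%R by rewrite divr_ge0// oppr_ge0 ltW.
  by rewrite -{1}[b]opprK; apply: main b20 _ _ => //; field.
move=> p0 b0 c0 ->; have c0' := ltW c0.
pose beta := (2 * b / p)%R.
have beta0 : (0 <= beta)%R by rewrite divr_ge0 ?mulr_ge0// ltW.
pose q (v : R) := (p * v ^+ 2 + 2 * b * v)%R.
have mq : measurable_fun setT q by rewrite /q; mfun.
pose G (v : R) : R := ((0 < v)%R%:R * (h c (p * v ^+ 2 + - (2 * b) * v) / v))%R.
have mG : measurable_fun setT G.
  have mq' : measurable_fun setT (fun v : R => h c (p * v ^+ 2 + - (2 * b) * v)).
    by apply: mhx; mfun.
  by rewrite /G; mfun.
have G0 v : (0 <= G v)%R.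
  rewrite /G; have [v0|] := ltP 0%R v; last by rewrite mul0r.
  by rewrite mul1r divr_ge0 ?h_ge0// ltW.
have GE (v : R) : (G (v + beta) = (0 < v)%R%:R * (h c (q v) / (v + beta)))%R.
  rewrite /G; have -> : (p * (v + beta) ^+ 2 + - (2 * b) * (v + beta) = q v)%R.
    by rewrite /q /beta; field; rewrite gt_eqF.
  have [v0|v0] := ltP 0%R v; first by rewrite ltr_wpDr.
  have [vb|] := ltP 0%R (v + beta)%R; last by rewrite !mul0r.
  rewrite mul0r h_eq0 ?mul0r ?mulr0//.
  have -> : q v = (p * v * (v + beta))%R by rewrite /q /beta; field; rewrite gt_eqF.
  by rewrite pmulr_lle0// pmulr_rle0.
have E1 : parabola_gap p (- (2 * b)) c =
    \int[leb]_v ((0 < v)%R%:R * (h c (q v) / (v + beta)))%:E.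
  rewrite parabola_gap_invr// -(ge0_integral_translation (f := fun v => (G v)%:E) beta).
  - by apply: eq_integral => v _; rewrite GE.
  - exact/measurable_EFinP.
  - by move=> v; rewrite lee_fin.
rewrite E1 parabola_gap_invr//.
have mhq := mhx c q mq.
rewrite -ge0_intD; last 4 first.
- by mfun.
- by mfun.
- move=> v; rewrite lee_fin; have [v0|] := ltP 0%R v; last by rewrite mul0r.
  by rewrite mul1r divr_ge0 ?h_ge0// addr_ge0// ltW.
- move=> v; rewrite lee_fin; have [v0|] := ltP 0%R v; last by rewrite mul0r.
  by rewrite mul1r divr_ge0 ?h_ge0// ltW.
have hx0 (x : R) : (0 <= h c x / x)%R.
  have [x0|x0] := ltP 0%R x; last by rewrite h_eq0// mul0r.
  by rewrite divr_ge0 ?h_ge0// ltW.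
have mhid : measurable_fun setT (fun x : R => h c x) by apply: mhx; exact: measurable_id.
transitivity (\int[leb]_v ((0 < v)%R%:R * (h c (q v) / q v * (2 * p * v + 2 * b)))%:E).
  apply: eq_integral => v _; rewrite -EFinD; congr EFin.
  have [v0|] := ltP 0%R v; last by rewrite !mul0r addr0.
  rewrite !mul1r -mulrDr -[in RHS]mulrA; congr (_ * _)%R.
  rewrite /q /beta; field.
  have h1 : (0 < p * v ^+ 2 + 2 * b * v)%R by rewrite ltr_wpDr ?mulr_gt0 ?exprn_gt0// !mulr_ge0// ltW.
  have h2 : (0 < v * p + 2 * b)%R by rewrite ltr_wpDr ?mulr_gt0// mulr_ge0.
  by rewrite !gt_eqF.
rewrite (ge0_integral_quadraticR (f := fun x => h c x / x)%R)//; last by mfun.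
rewrite -(ge0_integral_scaling (f := fun x => ((0 < x)%R%:R * (h c x / x))%:E) c0); last 2 first.
- by mfun.
- by move=> x; rewrite lee_fin mulr_ge0.
rewrite EFinM fineK; last by rewrite ge0_fin_numE// gap1_lty.
rewrite -!ge0_intZl ?powR_ge0//.
- apply: eq_integral => x _; rewrite -!EFinM; congr EFin.
  rewrite pmulr_rgt0//; have [x0|] := ltP 0%R x; last by rewrite !mul0r !mulr0.
  rewrite !mul1r /ppow_gap -[X in (c * x - X)%R](mulr1 c) -mulrBr !ppowZ// -mulrBr.
  by field; rewrite !gt_eqF.
- have m1 : measurable_fun setT (fun x : R => h 1 x) by apply: mhx; exact: measurable_id.
  by mfun.
- by move=> x; rewrite lee_fin; have [x0|] := ltP 0%R x; rewrite ?mul0r// mul1r divr_ge0 ?h_ge0// ltW.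
- have m1 : measurable_fun setT (fun x : R => h c (c * x)) by apply: mhx; mfun.
  by mfun.
- by move=> x; rewrite lee_fin mulr_ge0.
Qed.

Definition cap_mass : \bar R := \int[leb]_w (ppow (s - 1) (1 - w ^+ 2))%:E.

Let cap_mass_le (w : R) : (ppow (s - 1) (1 - w ^+ 2) <=
  (0 < 1 + w)%R%:R * ((1 + w < 2)%R%:R * (1 + w) `^ (s - 1)) +
  (0 < 1 - w)%R%:R * ((1 - w < 2)%R%:R * (1 - w) `^ (s - 1)))%R.
Proof.
have le1 (x y : R) : (0 < x)%R -> (x <= y)%R -> (y `^ (s - 1) <= x `^ (s - 1))%R.
  move=> x0 xy; have y0 := lt_le_trans x0 xy.
  rewrite -[(s - 1)%R]opprB !powRN lef_pV2 ?posrE ?powR_gt0//.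
  by apply: ge0_ler_powR; rewrite ?nnegrE ?subr_ge0 ?(ltW s1) ?(ltW x0) ?(ltW y0).
have [w1|w1] := ltP 0%R (1 - w ^+ 2)%R; last first.
  by rewrite ppow_le0E// addr_ge0// !mulr_ge0// powR_ge0.
have w2 : (-1 < w)%R by nra.
have w3 : (w < 1)%R by nra.
have -> : (0 < 1 + w)%R by lra.
have -> : (0 < 1 - w)%R by lra.
have -> : (1 + w < 2)%R by lra.
have -> : (1 - w < 2)%R by lra.
rewrite ppow_gt0E// !mul1r; have [w0|w0] := leP 0%R w.
  apply: (@le_trans _ _ ((1 - w) `^ (s - 1))%R); last by rewrite lerDr powR_ge0.
  by apply: le1; [lra|nra].
apply: (@le_trans _ _ ((1 + w) `^ (s - 1))%R); last by rewrite lerDl powR_ge0.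
by apply: le1; [lra|nra].
Qed.

Lemma cap_mass_pos : exists2 B : R, (0 < B)%R & cap_mass = B%:E.
Proof.
have mcap : measurable_fun setT (fun w : R => ppow (s - 1) (1 - w ^+ 2)).
  by apply: measurable_ppow; mfun.
have up : cap_mass < +oo.
  pose u (x : R) := ((0 < x)%R%:R * ((x < 2)%R%:R * x `^ (s - 1)))%R.
  have mu : measurable_fun setT u by rewrite /u; mfun.
  have u0 x : (0 <= u x)%R by rewrite !mulr_ge0// powR_ge0.
  have Iu : \int[leb]_x (u x)%:E = (2 `^ s / s)%:E.
    rewrite -integral_powR_near0E// integral_posE.
    by apply: eq_integral => x _; rewrite -EFinM.
  have Iu1 : \int[leb]_x (u (1 + x))%:E = (2 `^ s / s)%:E.
    rewrite -Iu -(ge0_integral_translation (f := fun x => (u x)%:E) 1%R).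
    - by apply: eq_integral => x _; rewrite addrC.
    - exact/measurable_EFinP.
    - by move=> x; rewrite lee_fin.
  have Iu2 : \int[leb]_x (u (1 - x))%:E = (2 `^ s / s)%:E.
    have mu1 : measurable_fun setT (fun x : R => (u (1 + x))%:E).
      by apply/measurable_EFinP; apply: measurableT_comp => //; mfun.
    rewrite -Iu1; apply: (ge0_integral_opp mu1) => x; rewrite lee_fin; exact: u0.
  apply: (@le_lt_trans _ _ (\int[leb]_x ((u (1 + x))%:E + (u (1 - x))%:E))); last first.
    rewrite ge0_intD.
    - by rewrite Iu1 Iu2 -EFinD ltry.
    - by apply/measurable_EFinP; apply: measurableT_comp => //; mfun.
    - by apply/measurable_EFinP; apply: measurableT_comp => //; mfun.
    - by move=> x; rewrite lee_fin.
    - by move=> x; rewrite lee_fin.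
  apply: ge0_int_le.
  - exact/measurable_EFinP.
  - apply: emeasurable_funD.
      by apply/measurable_EFinP; apply: measurableT_comp => //; mfun.
    by apply/measurable_EFinP; apply: measurableT_comp => //; mfun.
  - by move=> x; rewrite lee_fin ppow_ge0.
  - by move=> x; rewrite -EFinD lee_fin; exact: cap_mass_le.
have lo : 1%:E <= cap_mass.
  have I1 : \int[leb]_x ((0 < x < 1)%R%:R * 1)%:E = 1%:E.
    rewrite integral_lt_lt integral_cst//= lebesgue_measure_itv/= lte_fin ltr01.
    by rewrite -EFinD subr0 mule1.
  rewrite -I1; apply: ge0_int_le.
  - by mfun.
  - exact/measurable_EFinP.
  - by move=> x; rewrite lee_fin mulr_ge0.
  - move=> x; rewrite lee_fin mulr1; case: (boolP (0 < x < 1)%R) => [/andP[x0 x1]|_].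
      rewrite ppow_gt0E; last by rewrite subr_gt0 expr_lt1// ltW.
      have x2 : (0 < 1 - x ^+ 2 <= 1)%R.
        by rewrite subr_gt0 expr_lt1 ?(ltW x0)// x1 gerBl sqr_ge0.
      rewrite -[leLHS](powRr0 (1 - x ^+ 2)%R).
      by apply: ger_powR => //; rewrite subr_le0 ltW.
    by rewrite ppow_ge0.
have f : cap_mass \is a fin_num.
  by rewrite ge0_fin_numE//; apply: le_trans lo; rewrite lee_fin.
by exists (fine cap_mass); rewrite ?fineK// -lte_fin fineK//; apply: lt_le_trans lo; rewrite lte_fin.
Qed.

(* Reflecting [v] in the vertex [e / P] of the parabola replaces the weight [v] by the constant [e / P]. *)
Lemma cap_integral (e P c : R) : (0 < e)%R -> (0 < P)%R -> (0 < c)%R ->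
  \int[leb]_t ((0 < t)%R%:R * (ppow (s - 1) (2 * e * t - P - c * t ^+ 2) *
     t `^ (- (2 * s) - 1)))%:E =
  (e * P `^ (- s - 1) * ppow (s - 2^-1) (e ^+ 2 - P * c))%:E * cap_mass.
Proof.
move=> e0 P0 c0.
rewrite -ge0_integral_invrR; last 2 first.
- by rewrite /ppow; mfun.
- by move=> t; rewrite mulr_ge0 ?powR_ge0 ?ppow_ge0.
pose f (v : R) := ppow (s - 1) (2 * e * v - P * v ^+ 2 - c).
have f0 v : (0 <= f v)%R by exact: ppow_ge0.
have mf : measurable_fun setT f by apply: measurable_ppow; mfun.
pose v0 := (e / P)%R.
have v00 : (0 < v0)%R by rewrite divr_gt0.
pose G (v : R) : R := ((0 < v)%R%:R * (v * f v))%R.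
have G0 v : (0 <= G v)%R.
  rewrite /G; have [vp|] := ltP 0%R v; last by rewrite mul0r.
  by rewrite mul1r mulr_ge0// ltW.
have mG : measurable_fun setT G by rewrite /G; mfun.
transitivity (\int[leb]_v (G v)%:E).
  apply: eq_integral => v _; congr EFin; rewrite /G.
  have [vp|] := ltP 0%R v; last by rewrite !mul0r.
  congr (_ * _)%R.
  have v'0 : (0 < v^-1 ^+ 2)%R by rewrite exprn_gt0// invr_gt0.
  have -> : (2 * e * v^-1 - P - c * v^-1 ^+ 2 = v^-1 ^+ 2 * (2 * e * v - P * v ^+ 2 - c))%R.
    by field; rewrite gt_eqF.
  rewrite ppowZ// -/(f v).
  transitivity ((v^-1 ^+ 2) `^ (s - 1) * v^-1 `^ (- (2 * s) - 1) * v ^- 2 * f v)%R; first by ring.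
  congr (_ * _)%R.
  have vi : (0 <= v^-1)%R by rewrite invr_ge0 ltW.
  rewrite -(powR_invn 2 (ltW vp)) -(powR_mulrn 2 vi) -!(powR_inv1 (ltW vp)) -!powRrM.
  rewrite -!powRD ?(gt_eqF vp) ?implybT//.
  by rewrite -[RHS]powRr1 ?(ltW vp)//; congr (_ `^ _)%R; ring.
have GG (v : R) : (G v + G (2 * v0 - v) = 2 * v0 * f v)%R.
  have fE : f (2 * v0 - v)%R = f v.
    by rewrite /f /v0; congr (ppow _ _); field; rewrite gt_eqF.
  rewrite /G fE; have [fp|fp] := ltP 0%R (2 * e * v - P * v ^+ 2 - c)%R; last first.
    by rewrite /f ppow_le0E// !mulr0 addr0.
  have vp : (0 < v)%R.
    rewrite ltNge; apply/negP => vn; have := sqr_ge0 v.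
    have : (0 <= P * v ^+ 2)%R by rewrite mulr_ge0 ?sqr_ge0// ltW.
    have : (2 * e * v <= 0)%R by rewrite mulr_ge0_le0// mulr_ge0// ltW.
    lra.
  have vp2 : (0 < 2 * v0 - v)%R.
    have : (0 < v * (P * (2 * v0 - v)))%R.
      have -> : (v * (P * (2 * v0 - v)) = 2 * e * v - P * v ^+ 2)%R.
        by rewrite /v0; field; rewrite gt_eqF.
      lra.
    by rewrite !pmulr_rgt0.
  by rewrite vp vp2 /= !mul1r; ring.
have double : \int[leb]_v (G v)%:E = v0%:E * \int[leb]_v (f v)%:E.
  have D : \int[leb]_v (G v)%:E + \int[leb]_v (G v)%:E =
      2%:E * (v0%:E * \int[leb]_v (f v)%:E).
    rewrite [X in _ + X](_ : _ = \int[leb]_v (G (2 * v0 - v))%:E); last first.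
      have mG2 : measurable_fun setT (fun v : R => (G (2 * v0 + v))%:E).
        by apply/measurable_EFinP; apply: measurableT_comp => //; mfun.
      transitivity (\int[leb]_v (G (2 * v0 + v))%:E); last first.
        by apply/esym; apply: (ge0_integral_opp mG2) => v; rewrite lee_fin; exact: G0.
      rewrite -(ge0_integral_translation (f := fun v => (G v)%:E) (2 * v0)%R).
      - by apply: eq_integral => v _; rewrite addrC.
      - exact/measurable_EFinP.
      - by move=> v; rewrite lee_fin.
    rewrite -ge0_intD.
    - rewrite muleA -EFinM -ge0_intZl.
      + apply: eq_integral => v _; rewrite -EFinD -EFinM; congr EFin.
        exact: GG.
      + by rewrite mulr_ge0// ltW.
      + exact/measurable_EFinP.
      + by move=> v; rewrite lee_fin.
    - exact/measurable_EFinP.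
    - by apply/measurable_EFinP; apply: measurableT_comp => //; mfun.
    - by move=> v; rewrite lee_fin.
    - by move=> v; rewrite lee_fin.
  have E (x : \bar R) : x = (2^-1)%:E * (2%:E * x).
    by rewrite muleA -EFinM mulVf ?mul1e.
  by rewrite [LHS]E [RHS]E -D; congr (_ * _); rewrite mule_natl mule2n.
rewrite {}double; pose d := (e ^+ 2 / P - c)%R.
have mp (r : R) : measurable_fun setT (fun w : R => ppow (s - 1) (r - P * w ^+ 2)).
  by apply: measurable_ppow; mfun.
have -> : \int[leb]_v (f v)%:E = \int[leb]_w (ppow (s - 1) (d - P * w ^+ 2))%:E.
  rewrite -(ge0_integral_translation (f := fun v => (f v)%:E) v0).
  - apply: eq_integral => w _; rewrite /f /d /v0; congr (ppow _ _)%:E.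
    by field; rewrite gt_eqF.
  - exact/measurable_EFinP.
  - by move=> v; rewrite lee_fin.
have dP : (e ^+ 2 - P * c = P * d)%R by rewrite /d; field; rewrite gt_eqF.
rewrite dP; have [d0|d0] := ltP 0%R d; last first.
  rewrite [ppow _ (P * d)]ppow_le0E; last by rewrite pmulr_rle0.
  rewrite mulr0 mul0e integral0_eq ?mule0// => w _.
  by rewrite ppow_le0E// subr_le0 (le_trans d0)// mulr_ge0 ?sqr_ge0// ltW.
have r0 : (0 < (d / P) `^ (2^-1))%R by rewrite powR_gt0// divr_gt0.
have rr : (((d / P) `^ (2^-1)) ^+ 2 = d / P)%R.
  by rewrite powR12_sqrt ?sqr_sqrtr// divr_ge0// ltW.
rewrite -(ge0_integral_scaling (f := fun w => (ppow (s - 1) (d - P * w ^+ 2))%:E) r0); last 2 first.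
- by apply/measurable_EFinP; exact: mp.
- by move=> w; rewrite lee_fin ppow_ge0.
transitivity (v0%:E * (((d / P) `^ (2^-1))%:E * ((d `^ (s - 1))%:E * cap_mass))).
  congr (_ * (_ * _)); rewrite /cap_mass -ge0_intZl ?powR_ge0//.
  - apply: eq_integral => w _; rewrite -EFinM; congr EFin; rewrite -ppowZ//; congr ppow.
    by rewrite exprMn rr; field; rewrite gt_eqF.
  - by apply/measurable_EFinP; apply: measurable_ppow; mfun.
  - by move=> w; rewrite lee_fin ppow_ge0.
rewrite !muleA -!EFinM; congr (_%:E * _).
rewrite ppow_gt0E ?mulr_gt0// /v0 -!mulrA; congr (_ * _)%R.
have Pi : (0 <= P^-1)%R by rewrite invr_ge0 ltW.
rewrite !powRM ?(ltW d0) ?(ltW P0)// -!(powR_inv1 (ltW P0)) -!powRrM.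
transitivity (P `^ (-1) * P `^ (-1 / 2) * (d `^ 2^-1 * d `^ (s - 1)))%R; first by ring.
rewrite [RHS]mulrA -!powRD ?(gt_eqF P0) ?(gt_eqF d0) ?implybT//.
by congr (_ `^ _ * _ `^ _)%R; field.
Qed.

End half_line.

Section tail_scaling.
Context {R : realType}.
Variable s : R.
Hypotheses (s0 : 0 < s) (s1 : s < 1).
Local Notation leb := (@lebesgue_measure R).
Local Open Scope ereal_scope.

Lemma ge0_integral_ge_gt (f : R -> R) c : measurable_fun setT f -> (forall x, 0 <= f x)%R ->
  \int[leb]_x ((c <= x)%R%:R * f x)%:E = \int[leb]_x ((c < x)%R%:R * f x)%:E.
Proof.
move=> mf f0.
under eq_integral do rewrite EFinM; under [RHS]eq_integral do rewrite EFinM.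
rewrite -!integral_bool.
have -> : [set x : R | (c <= x)%R] = `[c, +oo[%classic.
  by apply/seteqP; split => x /=; rewrite in_itv/= andbT.
have -> : [set x : R | (c < x)%R] = `]c, +oo[%classic.
  by apply/seteqP; split => x /=; rewrite in_itv/= andbT.
by rewrite integral_itv_obnd_cbnd//; apply/measurable_EFinP; exact: measurable_funTS.
Qed.

Lemma integral_powR_tail (tau : R) : (0 < tau)%R ->
  \int[leb]_t ((0 < t)%R%:R * ((tau <= t)%R%:R * t `^ (- (2 * s) - 1)))%:E =
  (tau `^ (- (2 * s)) / (2 * s))%:E.
Proof.
move=> t0; have s20 : (0 < 2 * s)%R by rewrite mulr_gt0.
rewrite -integral_powR_infty// integral_posE.
transitivity (\int[leb]_t ((tau <= t)%R%:R * ((0 < t)%R%:R * t `^ (- (2 * s) - 1)))%:E).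
  by apply: eq_integral => t _; rewrite mulrCA.
rewrite ge0_integral_ge_gt.
- by apply: eq_integral => t _; rewrite -EFinM mulrCA.
- by mfun.
- by move=> t; rewrite mulr_ge0// powR_ge0.
Qed.

Lemma two_sided_tailN (c tau : R) : two_sided_tail s (- c) tau = two_sided_tail s c tau.
Proof.
by apply: eq_integral => t _; rewrite mulNr opprK [(ppow s (1 + _) + _)%R]addrC.
Qed.

Lemma two_sided_tailZ (c tau : R) : (0 < c)%R ->
  two_sided_tail s c tau = (c `^ (2 * s))%:E * two_sided_tail s 1 (c * tau).
Proof.
move=> c0; rewrite /two_sided_tail.
pose F (x : R) : R := ((0 < x)%R%:R * ((c * tau <= x)%R%:R *
  ((ppow s (1 - 1 * x) + ppow s (1 + 1 * x)) * x `^ (- (2 * s) - 1))))%R.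
have F0 x : (0 <= F x)%R by rewrite !mulr_ge0 ?powR_ge0 ?addr_ge0 ?ppow_ge0.
have mF : measurable_fun setT F by rewrite /F /ppow; mfun.
rewrite -(ge0_integral_scaling (f := fun x => (F x)%:E) c0); last 2 first.
- exact/measurable_EFinP.
- by move=> x; rewrite lee_fin.
rewrite muleA -EFinM -ge0_intZl.
- apply: eq_integral => t _; rewrite -EFinM; congr EFin.
  rewrite /F pmulr_rgt0// ler_pM2l// !mul1r.
  have [t0|] := ltP 0%R t; last by rewrite !mul0r mulr0.
  rewrite powRM ?(ltW c0) ?(ltW t0)//.
  have cc : (c `^ (2 * s) * c * c `^ (- (2 * s) - 1) = 1)%R.
    rewrite -{2}[c]powRr1 ?(ltW c0)// -!powRD ?(gt_eqF c0) ?implybT//.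
    have -> : (2 * s + 1 + (- (2 * s) - 1) = 0)%R by ring.
    by rewrite powRr0.
  transitivity (c `^ (2 * s) * c * c `^ (- (2 * s) - 1) * ((tau <= t)%R%:R *
      ((ppow s (1 - c * t) + ppow s (1 + c * t)) * t `^ (- (2 * s) - 1))))%R.
    by rewrite cc /= !mul1r.
  by rewrite /=; ring.
- by rewrite mulr_ge0 ?powR_ge0// ltW.
- by apply/measurable_EFinP; apply: measurableT_comp => //; mfun.
- by move=> x; rewrite lee_fin.
Qed.

Lemma two_sided_tail_estimate (c tau : R) : (0 < tau)%R -> exists2 r : R,
  two_sided_tail s c tau = r%:E &
  (`|r - tau `^ (- (2 * s)) / s| <= 2 / s * `|c| `^ (2 * s))%R /\
  (`|r - tau `^ (- (2 * s)) / s| <= 2 / s * (`|c| ^+ 2 * tau `^ (2 - 2 * s)))%R.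
Proof.
move=> tau0.
have pos (b : R) : (0 < b)%R -> exists2 r : R,
  two_sided_tail s b tau = r%:E &
  (`|r - tau `^ (- (2 * s)) / s| <= 2 / s * b `^ (2 * s))%R /\
  (`|r - tau `^ (- (2 * s)) / s| <= 2 / s * (b ^+ 2 * tau `^ (2 - 2 * s)))%R.
  move=> b0; have bt : (0 < b * tau)%R by rewrite mulr_gt0.
  have [r rE [r1 r2]] := two_sided_tail_bound s0 s1 bt.
  exists (b `^ (2 * s) * r)%R; first by rewrite two_sided_tailZ// rE.
  have bb : (0 < b `^ (2 * s))%R by rewrite powR_gt0.
  have E : (b `^ (2 * s) * r - tau `^ (- (2 * s)) / s =
            b `^ (2 * s) * (r - (b * tau) `^ (- (2 * s)) / s))%R.
    rewrite mulrBr powRM ?(ltW b0) ?(ltW tau0)//; congr (_ - _)%R.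
    by rewrite !mulrA -powRD ?(gt_eqF b0) ?implybT// addrN powRr0 mul1r.
  rewrite E normrM (gtr0_norm bb); split; first by rewrite mulrC ler_wpM2r// ltW.
  apply: le_trans (ler_wpM2l (ltW bb) r2) _.
  rewrite powRM ?(ltW b0) ?(ltW tau0)//.
  have -> : (b ^+ 2 = b `^ (2 * s) * b `^ (2 - 2 * s))%R.
    by rewrite -powRD ?(gt_eqF b0) ?implybT// -(powR_mulrn 2 (ltW b0)); congr (_ `^ _)%R; ring.
  by rewrite le_eqVlt; apply/orP; left; apply/eqP; ring.
have [c0|c0|c0] := ltgtP c 0%R.
- have [|r rE h] := pos (- c)%R; first by rewrite oppr_gt0.
  exists r; first by rewrite -two_sided_tailN.
  rewrite (ltr0_norm c0).
  exact: h.
- by have [r rE h] := pos c c0; exists r => //; rewrite (gtr0_norm c0); exact: h.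
exists (tau `^ (- (2 * s)) / s)%R.
  rewrite c0 (_ : (tau `^ (- (2 * s)) / s = 2 * (tau `^ (- (2 * s)) / (2 * s)))%R); last first.
    by field; rewrite gt_eqF.
  rewrite EFinM -integral_powR_tail// -ge0_intZl//.
  - apply: eq_integral => t _; rewrite -EFinM mul0r subr0 addr0 ppow_gt0E// powR1.
    by congr EFin; ring.
  - by mfun.
  - by move=> t; rewrite lee_fin !mulr_ge0// powR_ge0.
by rewrite subrr normr0; split; rewrite !mulr_ge0 ?powR_ge0 ?invr_ge0 ?sqr_ge0 ?(ltW s0).
Qed.

End tail_scaling.

(** * The kernel in polar coordinates *)

Section kernel_polar.
Context {R : realType} {m : nat}.
Variable s : R.
Hypotheses (s0 : 0 < s) (s1 : s < 1).
Local Notation leb := (@lebesgue_measure R).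
Local Notation V := 'rV[R]_m.+1.
Local Notation vol := (@vol R m).
Local Notation kern := (kern s).
Local Open Scope ereal_scope.

Lemma kernZ (t : R) (z : V) : (0 < t)%R ->
  (t ^+ m * kern (t *: z) = t `^ (- (2 * s) - 1) * kern z)%R.
Proof.
move=> t0; rewrite -(exprm_kern (m := m) _ t0) -mulrA; congr (_ * _)%R.
by rewrite /kern enormZ gtr0_norm// powRM ?(ltW t0) ?enorm_ge0// invfM.
Qed.

(** The angular part of the kernel in the coordinates of [ge0_polar]; by homogeneity the radial part
    is [t^(-2s-1)] on every ray. *)
Definition polar_weight (z : V) : R := ((annulus z)%:R * enorm z * kern z)%R.

Lemma polar_weight_ge0 z : (0 <= polar_weight z)%R.
Proof. by rewrite !mulr_ge0 ?enorm_ge0 ?kern_ge0. Qed.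

Lemma measurable_polar_weight : measurable_fun setT polar_weight.
Proof. by rewrite /polar_weight /annulus /kern; mfun. Qed.

Lemma polar_weightN z : polar_weight (- z)%R = polar_weight z.
Proof. by rewrite /polar_weight /annulus kernN enormN. Qed.

Definition ray_integral (u : V -> R) (z : V) : \bar R :=
  \int[leb]_t ((0 < t)%R%:R * (u (t *: z) * t `^ (- (2 * s) - 1)))%:E.

Lemma ray_integral_ge0 (u : V -> R) z : (forall x, 0 <= u x)%R -> 0 <= ray_integral u z.
Proof. by move=> u0; apply: integral_ge0 => t _; rewrite lee_fin !mulr_ge0// powR_ge0. Qed.

Lemma measurable_ray_integral (u : V -> R) : measurable_fun setT u -> (forall x, 0 <= u x)%R ->
  measurable_fun setT (ray_integral u).
Proof.
move=> mu u0; apply: measurable_integral_leb; last first.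
  by move=> z t; rewrite lee_fin !mulr_ge0// powR_ge0.
have mu2 : measurable_fun setT (fun p : V * R => u (p.2 *: p.1)%R).
  by apply: measurableT_comp => //; mfun.
by mfun.
Qed.

Lemma polar_kern (u : V -> R) : measurable_fun setT u -> (forall x, 0 <= u x)%R ->
  \int[vol]_z (u z * kern z)%:E = \int[vol]_z ((polar_weight z)%:E * ray_integral u z).
Proof.
move=> mu u0; rewrite ge0_polar; last 2 first.
- by rewrite /kern; mfun.
- by move=> z; rewrite lee_fin mulr_ge0// kern_ge0.
apply: eq_integral => z _.
have mut : measurable_fun setT (fun t : R => u (t *: z)%R).
  by apply: measurableT_comp => //; mfun.
rewrite /polar_weight [in RHS]EFinM -muleA; congr (_ * _).
rewrite integral_posE /ray_integral -ge0_intZl ?kern_ge0//.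
- apply: eq_integral => t _; rewrite -!EFinM; congr EFin.
  have [t0|] := ltP 0%R t; last by rewrite !mul0r mulr0.
  by rewrite !mul1r mulrCA kernZ//; ring.
- by mfun.
- by move=> t; rewrite lee_fin !mulr_ge0// powR_ge0.
Qed.

(** Opposite rays are paired, because the one-dimensional formulas are explicit only for the sum
    over the two rays of a line. *)
Lemma polar_kern_sym (u : V -> R) : measurable_fun setT u -> (forall x, 0 <= u x)%R ->
  2%:E * \int[vol]_z (u z * kern z)%:E =
  \int[vol]_z ((polar_weight z)%:E * (ray_integral u z + ray_integral u (- z)%R)).
Proof.
move=> mu u0; rewrite mule_natl mule2n polar_kern//.
have mw := measurable_polar_weight.
have mI := measurable_ray_integral mu u0.
have mI' : measurable_fun setT (fun z : V => ray_integral u (- z)%R).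
  by apply: measurableT_comp => //; mfun.
have mwI : measurable_fun setT (fun z => (polar_weight z)%:E * ray_integral u z) by mfun.
have I0 z := ray_integral_ge0 z u0.
have w0 z : 0 <= (polar_weight z)%:E by rewrite lee_fin polar_weight_ge0.
have wI0 z : 0 <= (polar_weight z)%:E * ray_integral u z by rewrite mule_ge0.
have wI0' z : 0 <= (polar_weight z)%:E * ray_integral u (- z)%R by rewrite mule_ge0.
have mwI' : measurable_fun setT (fun z => (polar_weight z)%:E * ray_integral u (- z)%R) by mfun.
rewrite [X in _ + X](_ : _ = \int[vol]_z ((polar_weight z)%:E * ray_integral u (- z)%R)).
  rewrite -(ge0_intD _ mwI mwI' wI0 wI0').
  by apply: eq_integral => z _; rewrite -ge0_muleDr ?I0.
rewrite -(ge0_vol_opp mwI wI0).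
by apply: eq_integral => z _; rewrite polar_weightN.
Qed.

Lemma polar_weight_tail (e : R) : (0 < e)%R ->
  2%:E * \int[vol]_z ((e <= enorm z)%R%:R * kern z)%:E =
  \int[vol]_z (polar_weight z * ((e / enorm z) `^ (- (2 * s)) / s))%:E.
Proof.
move=> e0; rewrite (polar_kern_sym (u := fun z => (e <= enorm z)%R%:R)); last 2 first.
- by mfun.
- by move=> z; rewrite ler0n.
apply: eq_integral => z _; rewrite [in RHS]EFinM.
have [za|za] := boolP (annulus z); last by rewrite /polar_weight (negbTE za) !mul0r !mul0e.
have z0 : (0 < enorm z)%R by case/andP: za => h _; apply: lt_trans h.
congr (_ * _).
have I (x : V) : enorm x = enorm z -> ray_integral (fun z => (e <= enorm z)%R%:R) x =
    ((e / enorm z) `^ (- (2 * s)) / (2 * s))%:E.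
  move=> xz; rewrite -integral_powR_tail ?divr_gt0//.
  apply: eq_integral => t _; congr EFin.
  have [t0|] := ltP 0%R t; last by rewrite !mul0r.
  by rewrite enormZ gtr0_norm// xz ler_pdivrMr.
rewrite !I ?enormN// -EFinD; congr EFin; field; by rewrite gt_eqF.
Qed.

Lemma polar_weight_lty : exists2 W : R, (0 <= W)%R & \int[vol]_z (polar_weight z)%:E = W%:E.
Proof.
have mw := measurable_polar_weight.
have [k k0 kE] := kern_tail s0 (m := m).
have fin : \int[vol]_z (polar_weight z)%:E < +oo.
  apply: (@le_lt_trans _ _ (2%:E * \int[vol]_z ((1 <= enorm z)%R%:R * kern z)%:E)).
    rewrite -ge0_intZl//; last 2 first.
    - by rewrite /kern; mfun.
    - by move=> z; rewrite lee_fin mulr_ge0// kern_ge0.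
    apply: ge0_int_le.
    - exact/measurable_EFinP.
    - by apply: measurable_funeM; rewrite /kern; mfun.
    - by move=> z; rewrite lee_fin polar_weight_ge0.
    - move=> z; rewrite -EFinM lee_fin /polar_weight mulrA.
      have [/andP[z1 z2]|za] := boolP (annulus z); last by rewrite !mul0r !mulr_ge0// kern_ge0.
      by rewrite (ltW z1) mul1r mulr1 ler_wpM2r ?kern_ge0// ltW.
  by rewrite kE// -EFinM ltry.
exists (fine (\int[vol]_z (polar_weight z)%:E)).
  by apply/fine_ge0/integral_ge0 => z _; rewrite lee_fin polar_weight_ge0.
rewrite fineK// ge0_fin_numE//.
by apply/integral_ge0 => z _; rewrite lee_fin polar_weight_ge0.
Qed.

End kernel_polar.

(** * The barrier inside its ball *)

Section half_space_comparison.
Context {R : realType} {m : nat}.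
Variable s : R.
Hypotheses (s0 : 0 < s) (s1 : s < 1).
Local Notation leb := (@lebesgue_measure R).
Local Notation V := 'rV[R]_m.+1.
Local Notation vol := (@vol R m).
Local Notation kern := (kern s).
Local Open Scope ereal_scope.

Lemma half_space_rays (p e : R) (y z : V) : (0 < p)%R -> (0 < enorm z)%R ->
  ray_integral s (fun z => (e <= enorm z)%R%:R * ppow s (p - 2 * dot y z))%R z +
  ray_integral s (fun z => (e <= enorm z)%R%:R * ppow s (p - 2 * dot y z))%R (- z) =
  (p `^ s)%:E * two_sided_tail s (2 * dot y z / p) (e / enorm z).
Proof.
move=> p0 z0; rewrite /ray_integral /two_sided_tail -ge0_intD.
- rewrite -ge0_intZl ?powR_ge0//.
  + apply: eq_integral => t _; rewrite -EFinD -EFinM; congr EFin.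
    have [t0|] := ltP 0%R t; last by rewrite !mul0r addr0 mulr0.
    rewrite !enormZ !enormN (gtr0_norm t0) -ler_pdivrMr// !dotZr dotNr.
    have -> : (p - 2 * (t * dot y z) = p * (1 - 2 * dot y z / p * t))%R.
      by field; rewrite gt_eqF.
    have -> : (p - 2 * (t * - dot y z) = p * (1 + 2 * dot y z / p * t))%R.
      by field; rewrite gt_eqF.
    by rewrite !ppowZ//; ring.
  + by rewrite /ppow; mfun.
  + by move=> t; rewrite lee_fin !mulr_ge0 ?powR_ge0// addr_ge0 ?ppow_ge0.
- by rewrite /ppow /dot; mfun.
- by rewrite /ppow /dot; mfun.
- by move=> t; rewrite lee_fin !mulr_ge0 ?powR_ge0 ?ppow_ge0.
- by move=> t; rewrite lee_fin !mulr_ge0 ?powR_ge0 ?ppow_ge0.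
Qed.

Lemma measurable_dot d (T : measurableType d) (f g : T -> V) :
  measurable_fun setT f -> measurable_fun setT g ->
  measurable_fun setT (fun x => dot (f x) (g x)).
Proof. by move=> mf mg; rewrite /dot; mfun. Qed.

Definition half_space (p : R) (y z : V) : R := ppow s (p - 2 * dot y z).

Lemma measurable_half_space p y : measurable_fun setT (half_space p y).
Proof.
apply: measurable_ppow; apply: measurable_funD; first exact: measurable_cst.
apply: measurable_funN; apply: measurable_funM; first exact: measurable_cst.
by apply: measurable_dot; [exact: measurable_cst|exact: measurable_id].
Qed.

(** The estimate on each line, integrated over directions: the constants [2/s] times the mass [W] of
    [polar_weight], halved by the pairing of rays, give [C = W / s]. *)
Lemma half_space_tail (k : R) :
  (forall e : R, (0 < e)%R ->
    \int[vol]_z ((e <= enorm z)%R%:R * kern z)%:E = (k * e `^ (- (2 * s)))%:E) ->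
  exists2 C : R, (0 <= C)%R & forall (p e : R) (y : V), (0 < p)%R -> (0 < e)%R -> exists2 h : R,
    \int[vol]_z ((e <= enorm z)%R%:R * half_space p y z * kern z)%:E = h%:E &
    (`|h - p `^ s * (k * e `^ (- (2 * s)))| <= C * (p `^ s * (4 * enorm y / p) `^ (2 * s)))%R /\
    (`|h - p `^ s * (k * e `^ (- (2 * s)))| <=
       C * (p `^ s * ((4 * enorm y / p) ^+ 2 * e `^ (2 - 2 * s))))%R.
Proof.
move=> kE; have [W W0 WE] := polar_weight_lty s0 (m := m).
exists (W / s)%R; first by rewrite divr_ge0// ltW.
move=> p e y p0 e0.
pose u (z : V) : R := ((e <= enorm z)%R%:R * half_space p y z)%R.
have u0 z : (0 <= u z)%R by rewrite mulr_ge0// ppow_ge0.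
have mh := measurable_half_space p y.
have mu : measurable_fun setT u by rewrite /u; mfun.
have mw := @measurable_polar_weight R m s.
have w0 z := @polar_weight_ge0 R m s z.
have mI := measurable_ray_integral s mu u0.
have mI' : measurable_fun setT (fun z : V => ray_integral s u (- z)%R).
  by apply: measurableT_comp => //; mfun.
have I0 z : 0 <= ray_integral s u z by exact: ray_integral_ge0.
pose X := \int[vol]_z ((polar_weight s z)%:E * (ray_integral s u z + ray_integral s u (- z)%R)).
have mX : measurable_fun setT
   (fun z => (polar_weight s z)%:E * (ray_integral s u z + ray_integral s u (- z)%R)).
  have mS := emeasurable_funD mI mI'.
  by apply: (emeasurable_funM _ mS); exact/measurable_EFinP.
have X0 z : 0 <= (polar_weight s z)%:E * (ray_integral s u z + ray_integral s u (- z)%R).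
  by rewrite mule_ge0 ?lee_fin// adde_ge0.
have ps : (0 <= p `^ s)%R by exact: powR_ge0.
pose Y := (k * e `^ (- (2 * s)))%R.
pose v (z : V) : R := ((e / enorm z) `^ (- (2 * s)) / s)%R.
have mv : measurable_fun setT v by rewrite /v; mfun.
have v0 z : (0 <= v z)%R by rewrite divr_ge0 ?powR_ge0// ltW.
have Yint : \int[vol]_z (polar_weight s z * v z)%:E = (2 * Y)%:E.
  by rewrite -polar_weight_tail// kE// -EFinM.
have est (z : V) : annulus z -> exists2 r : R,
    ray_integral s u z + ray_integral s u (- z)%R = (p `^ s * r)%:E &
    (`|r - v z| <= 2 / s * (4 * enorm y / p) `^ (2 * s))%R /\
    (`|r - v z| <= 2 / s * ((4 * enorm y / p) ^+ 2 * e `^ (2 - 2 * s)))%R.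
  move=> /andP[z1 z2]; have z0 : (0 < enorm z)%R by apply: lt_trans z1.
  have tau0 : (0 < e / enorm z)%R by rewrite divr_gt0.
  have [r rE [r1 r2]] := two_sided_tail_estimate s0 s1 (2 * dot y z / p) tau0.
  exists r; first by rewrite half_space_rays// rE.
  (* The annulus lies in [|z| < 2], whence the 4; that it also lies in [|z| > 1] later gives
     [e / |z| <= e]. *)
  have c4 : (`|2 * dot y z / p| <= 4 * enorm y / p)%R.
    rewrite normrM normfV (gtr0_norm p0) ler_pM2r ?invr_gt0// normrM ger0_norm//.
    apply: le_trans (_ : 2 * (enorm y * enorm z) <= _)%R; first by rewrite ler_pM2l// dot_le.
    rewrite (_ : 4 * enorm y = 2 * (enorm y * 2))%R; last by ring.
    by rewrite ler_pM2l// ler_wpM2l ?enorm_ge0// ltW.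
  have y0 : (0 <= 4 * enorm y / p)%R by apply: le_trans c4.
  split; [apply: le_trans r1 _|apply: le_trans r2 _]; rewrite ler_wpM2l ?divr_ge0 ?(ltW s0)//.
    by apply: ge0_ler_powR; rewrite ?nnegrE// mulr_ge0// ltW.
  apply: ler_pM; rewrite ?sqr_ge0 ?powR_ge0//; first by rewrite lerXn2r ?nnegrE.
  apply: ge0_ler_powR; rewrite ?nnegrE ?(ltW tau0) ?(ltW e0)//.
    by rewrite subr_ge0 ler_piMr// ltW.
  by rewrite ler_pdivrMr// ler_peMr ?(ltW z1)// ltW.
(* Two additive inequalities replace an absolute value, because the finiteness of [X] is itself
   deduced from the first of them. *)
have bound (B : R) : (0 <= B)%R ->
    (forall z : V, annulus z -> exists2 r : R,
      ray_integral s u z + ray_integral s u (- z)%R = (p `^ s * r)%:E & (`|r - v z| <= B)%R) ->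
    X <= (p `^ s * (2 * Y) + p `^ s * B * W)%:E /\
    (p `^ s * (2 * Y))%:E <= X + (p `^ s * B * W)%:E.
  move=> B0 hB; have pB : (0 <= p `^ s * B)%R by rewrite mulr_ge0.
  rewrite EFinD !(EFinM (p `^ s * B)%R W) !(EFinM (p `^ s) (2 * Y)) -WE -Yint.
  have mYp : measurable_fun setT (fun z : V => (p `^ s)%:E * (polar_weight s z * v z)%:E) by mfun.
  have mWp : measurable_fun setT (fun z : V => (p `^ s * B)%:E * (polar_weight s z)%:E).
    by apply: measurable_funeM; exact/measurable_EFinP.
  have mY' : measurable_fun setT (fun z : V => (polar_weight s z * v z)%:E) by mfun.
  have mW' : measurable_fun setT (fun z : V => (polar_weight s z)%:E) by exact/measurable_EFinP.
  have Y0 z : 0 <= (polar_weight s z * v z)%:E by rewrite lee_fin mulr_ge0.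
  have W00 (z : V) : 0 <= (polar_weight s z)%:E by rewrite lee_fin.
  have Yp0 (z : V) : 0 <= (p `^ s)%:E * (polar_weight s z * v z)%:E by rewrite mule_ge0// lee_fin.
  have Wp0 (z : V) : 0 <= (p `^ s * B)%:E * (polar_weight s z)%:E by rewrite mule_ge0// lee_fin.
  rewrite -(ge0_intZl _ ps mY' Y0) -(ge0_intZl _ pB mW' W00).
  rewrite -(ge0_intD _ mYp mWp Yp0 Wp0) -(ge0_intD _ mX mWp X0 Wp0).
  split; apply: ge0_int_le => //.
  - exact: emeasurable_funD.
  - move=> z; have [za|za] := boolP (annulus z); last first.
      by rewrite /polar_weight (negbTE za) !mul0r !mul0e !mule0 adde0.
    have [r -> rB] := hB z za; rewrite -!EFinM -EFinD lee_fin.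
    have -> : (p `^ s * (polar_weight s z * v z) + p `^ s * B * polar_weight s z =
      polar_weight s z * (p `^ s * (v z + B)))%R by ring.
    rewrite !ler_wpM2l//; have := ler_norm (r - v z)%R; lra.
  - exact: emeasurable_funD.
  - move=> z; have [za|za] := boolP (annulus z); last first.
      by rewrite /polar_weight (negbTE za) !mul0r !mul0e !mule0 adde0.
    have [r -> rB] := hB z za; rewrite -!EFinM -EFinD lee_fin.
    have -> : (polar_weight s z * (p `^ s * r) + p `^ s * B * polar_weight s z =
      p `^ s * (polar_weight s z * (r + B)))%R by ring.
    rewrite !ler_wpM2l//; have := ler_norm (- (r - v z))%R; rewrite normrN; lra.
have y0 : (0 <= 4 * enorm y / p)%R by rewrite divr_ge0 ?mulr_ge0 ?enorm_ge0// ltW.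
pose B1 := (2 / s * (4 * enorm y / p) `^ (2 * s))%R.
pose B2 := (2 / s * ((4 * enorm y / p) ^+ 2 * e `^ (2 - 2 * s)))%R.
have B10 : (0 <= B1)%R by rewrite mulr_ge0 ?powR_ge0// divr_ge0// ltW.
have B20 : (0 <= B2)%R.
  by apply: mulr_ge0; [rewrite divr_ge0// ltW|rewrite mulr_ge0 ?powR_ge0 ?sqr_ge0].
have [b1 b2] : X <= (p `^ s * (2 * Y) + p `^ s * B1 * W)%:E /\
    (p `^ s * (2 * Y))%:E <= X + (p `^ s * B1 * W)%:E.
  by apply: bound => // z za; have [r rE [r1 _]] := est z za; exists r.
have [b3 b4] : X <= (p `^ s * (2 * Y) + p `^ s * B2 * W)%:E /\
    (p `^ s * (2 * Y))%:E <= X + (p `^ s * B2 * W)%:E.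
  by apply: bound => // z za; have [r rE [_ r2]] := est z za; exists r.
pose I := \int[vol]_z ((e <= enorm z)%R%:R * half_space p y z * kern z)%:E.
have Ige0 : 0 <= I.
  apply: integral_ge0 => z _; rewrite lee_fin mulr_ge0 ?kern_ge0// mulr_ge0//.
  exact: ppow_ge0.
have XI : X = 2%:E * I by rewrite /X -polar_kern_sym.
have Ifin : I \is a fin_num.
  rewrite ge0_fin_numE//; apply: (@le_lt_trans _ _ (2%:E * I)).
    by rewrite -{1}[I]mul1e lee_wpmul2r// lee_fin ler1n.
  by rewrite -XI; apply: le_lt_trans b1 _; rewrite ltry.
exists (fine I); first by rewrite fineK.
rewrite -/I -/Y; move: b1 b2 b3 b4; rewrite XI -(fineK Ifin) -!EFinM -!EFinD !lee_fin.
set J := fine I; set q := (p `^ s)%R => b1 b2 b3 b4.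
have E1 : (W / s * (q * (4 * enorm y / p) `^ (2 * s)) = q * B1 * W / 2)%R.
  by rewrite /B1; field; rewrite gt_eqF.
have E2 : (W / s * (q * ((4 * enorm y / p) ^+ 2 * e `^ (2 - 2 * s))) = q * B2 * W / 2)%R.
  by rewrite /B2; field; rewrite !gt_eqF.
by rewrite [fine _]/= E1 E2; split; rewrite ler_norml; apply/andP; split; lra.
Qed.

Definition barrier (S : R) (x : V) : R := ppow s (S - enorm x ^+ 2).

Lemma barrier_ge0 S x : (0 <= barrier S x)%R. Proof. exact: ppow_ge0. Qed.

Lemma measurable_barrier d (T : measurableType d) S (f : T -> V) :
  measurable_fun setT f -> measurable_fun setT (fun x => barrier S (f x)).
Proof. by move=> mf; apply: measurable_ppow; mfun. Qed.

Lemma barrierD S (y z : V) :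
  barrier S (y + z)%R = ppow s (S - enorm y ^+ 2 - 2 * dot y z - enorm z ^+ 2).
Proof. by rewrite /barrier enorm_sqrD; congr (ppow s _); ring. Qed.

Lemma barrier_le_half_space S (y z : V) : (barrier S (y + z)%R <= half_space (S - enorm y ^+ 2) y z)%R.
Proof. by rewrite barrierD; apply: ppow_le; [exact: ltW|rewrite gerBl sqr_ge0]. Qed.

(** In the direction [z] this is [parabola_gap] with [p = S - |y|^2], slope [- 2 dot y z] and
    [c = |z|^2]; adding the opposite ray leaves only a multiple of [|z|^(2s)], so integration over
    directions forgets both [S] and [y]. *)
Lemma half_space_gap : exists2 A : R, (0 <= A)%R & forall (S : R) (y : V), (enorm y ^+ 2 < S)%R ->
  \int[vol]_z ((half_space (S - enorm y ^+ 2) y z - barrier S (y + z)%R) * kern z)%:E = A%:E.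
Proof.
have [A0 A00 A0E] := parabola_gapD s0 s1.
have [W W0 WE] := polar_weight_lty s0 (m := m).
have mw := @measurable_polar_weight R m s.
have w0 z := @polar_weight_ge0 R m s z.
pose J := \int[vol]_z (polar_weight s z * ((enorm z ^+ 2) `^ s * A0))%:E.
have J0 : 0 <= J.
  by apply: integral_ge0 => z _; rewrite lee_fin mulr_ge0 ?w0// mulr_ge0// powR_ge0.
have Jfin : J \is a fin_num.
  rewrite ge0_fin_numE//; apply: (@le_lt_trans _ _ (\int[vol]_z ((4 `^ s * A0)%:E * (polar_weight s z)%:E))).
    apply: ge0_int_le.
    - by mfun.
    - by mfun.
    - by move=> z; rewrite lee_fin mulr_ge0 ?w0// mulr_ge0// powR_ge0.
    - move=> z; rewrite -EFinM lee_fin mulrC.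
      have [/andP[z1 z2]|za] := boolP (annulus z); last by rewrite /polar_weight (negbTE za) !mul0r !mulr0.
      rewrite ler_wpM2r// ler_wpM2r//; apply: ge0_ler_powR; rewrite ?nnegrE ?sqr_ge0// ?(ltW s0)//.
      rewrite (_ : 4 = 2 ^+ 2)%R; last by ring.
      by rewrite lerXn2r ?nnegrE ?enorm_ge0// ltW.
  rewrite ge0_intZl.
  - by rewrite WE -EFinM ltry.
  - by rewrite mulr_ge0 ?powR_ge0.
  - by mfun.
  - by move=> z; rewrite lee_fin.
exists (2^-1 * fine J)%R; first by rewrite mulr_ge0// fine_ge0.
move=> S y yS; set p := (S - enorm y ^+ 2)%R; have p0 : (0 < p)%R by rewrite subr_gt0.
pose u (z : V) : R := (half_space p y z - barrier S (y + z))%R.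
have u0 z : (0 <= u z)%R by rewrite subr_ge0 barrier_le_half_space.
have mh := measurable_half_space p y.
have mb : measurable_fun setT (fun z : V => barrier S (y + z)%R) by apply: measurable_barrier; mfun.
have mu : measurable_fun setT u by rewrite /u; mfun.
have E := polar_kern_sym s mu u0.
have half (x : \bar R) : x = (2^-1)%:E * (2%:E * x) by rewrite muleA -EFinM mulVf// mul1e.
rewrite [LHS]half {}E EFinM fineK//; congr (_ * _).
apply: eq_integral => z _; rewrite [in RHS]EFinM.
have [za|za] := boolP (annulus z); last by rewrite /polar_weight (negbTE za) !mul0r !mul0e.
congr (_ * _); have z0 : (0 < enorm z)%R by case/andP: za => h _; apply: lt_trans h.
have ray (x : V) : enorm x = enorm z ->
    ray_integral s u x = parabola_gap s p (- (2 * dot y x)) (enorm z ^+ 2).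
  move=> xz; apply: eq_integral => t _; congr EFin.
  have [t0|] := ltP 0%R t; last by rewrite !mul0r.
  rewrite /u /half_space barrierD -/p !dotZr enormZ (gtr0_norm t0) xz exprMn.
  by congr (_ * ((ppow _ _ - ppow _ _) * _))%R; ring.
transitivity (parabola_gap s p (- (2 * dot y z)) (enorm z ^+ 2) +
              parabola_gap s p (- - (2 * dot y z)) (enorm z ^+ 2)); last first.
  by apply: A0E => //; rewrite exprn_gt0.
rewrite (ray z erefl) (ray _ (enormN z)) dotNr mulrN.
reflexivity.
Qed.

Local Notation inv j := (j.+1%:R^-1 : R)%R.

Lemma cvg_truncated (f : V -> R) : measurable_fun setT f -> (forall z, 0 <= f z)%R ->
  (fun j : nat => \int[vol]_z ((inv j <= enorm z)%R%:R * (f z * kern z))%:E) @ \oo -->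
  \int[vol]_z (f z * kern z)%:E.
Proof.
move=> mf f0.
pose g (j : nat) (z : V) : \bar R := ((inv j <= enorm z)%R%:R * (f z * kern z))%:E.
have mg j : measurable_fun setT (g j) by rewrite /g /kern; mfun.
have g0 j z : setT z -> 0 <= g j z by move=> _; rewrite lee_fin !mulr_ge0 ?kern_ge0.
have ndg z : setT z -> nondecreasing_seq (g ^~ z).
  move=> _ i j ij; rewrite lee_fin ler_wpM2r ?mulr_ge0 ?kern_ge0//.
  have h : (inv j <= inv i)%R by rewrite lef_pV2 ?posrE// ler_nat ltnS.
  have [zi|] := leP (inv i) (enorm z); last by rewrite ler0n.
  by rewrite (le_trans h zi).
have lim_g (z : V) : g ^~ z @ \oo --> (f z * kern z)%:E.
  have [z0|z0] := ltP 0%R (enorm z); last first.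
    have ez : enorm z = 0%R by apply/le_anti; rewrite z0 enorm_ge0.
    (* At the origin the kernel is 0 (a positive power of 0, then the inverse of 0), so no
       truncation excludes anything there. *)
    have kz : kern z = 0%R.
      by rewrite /kern ez powR0 ?invr0// gt_eqF// exponent_gt0.
    by rewrite /g kz !mulr0; under eq_fun do rewrite mulr0; exact: cvg_cst.
  apply: cvg_near_cst; near=> j; rewrite /g.
  suff -> : (inv j <= enorm z)%R by rewrite mul1r.
  apply: ltW; near: j; exact: (near_infty_natSinv_lt (PosNum z0)).
have /(_ vol) := cvg_monotone_convergence measurableT mg g0 ndg.
rewrite (_ : \int[vol]_(x in setT) limn (g^~ x) = \int[vol]_z (f z * kern z)%:E)//.
by apply: eq_integral => z _; apply/cvg_lim.
Unshelve. all: by end_near. Qed.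

Definition trunc_pot (e S : R) (y : V) : \bar R :=
  \int[vol]_z ((e <= enorm z)%R%:R * (barrier S (y + z) * kern z))%:E.

(** Up to [C_ns], [L e] is the Laplacian of [barrier S] at [y], truncated at [e]. Writing the
    barrier as the half-space power minus the gap splits it into an error bounded by
    [half_space_tail] and a truncated gap that increases to [A]. The error bound free of [e] yields
    [AC.2], with [4^(2s)] taken out of [(4 |y| / p)^(2s)]; the bound in [e^(2 - 2s)] yields the
    limit. *)
Lemma trunc_pot_inside (k : R) :
  (forall e : R, (0 < e)%R ->
    \int[vol]_z ((e <= enorm z)%R%:R * kern z)%:E = (k * e `^ (- (2 * s)))%:E) ->
  exists2 AC : R * R, (0 <= AC.1)%R /\ (0 <= AC.2)%R &
  forall (S : R) (y : V), (enorm y ^+ 2 < S)%R ->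
    let L (e : R) := ((S - enorm y ^+ 2) `^ s * (k * e `^ (- (2 * s))) - fine (trunc_pot e S y))%R in
    (forall e : R, (0 < e)%R -> trunc_pot e S y < +oo /\
      (`|L e| <= AC.1 + AC.2 * (enorm y `^ (2 * s) * (S - enorm y ^+ 2) `^ (- s)))%R) /\
    (fun j : nat => L (inv j)) @ \oo --> AC.1.
Proof.
move=> kE; have [A A0 AE] := half_space_gap; have [C C0 CE] := half_space_tail kE.
exists (A, C * 4 `^ (2 * s))%R; first by rewrite mulr_ge0// powR_ge0.
move=> S y yS L; rewrite /=.
have p0 : (0 < S - enorm y ^+ 2)%R by rewrite subr_gt0.
pose p : R := (S - enorm y ^+ 2)%R; rewrite -/p in L p0 *.
have {}AE := AE S y yS; rewrite -/p in AE.
pose d (z : V) : R := (half_space p y z - barrier S (y + z))%R.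
have d0 z : (0 <= d z)%R by rewrite subr_ge0 barrier_le_half_space.
have mb : measurable_fun setT (fun z : V => barrier S (y + z)%R) by apply: measurable_barrier; mfun.
have mh := measurable_half_space p y.
have md : measurable_fun setT d by rewrite /d; mfun.
pose D e := \int[vol]_z ((e <= enorm z)%R%:R * (d z * kern z))%:E.
have D0 e : 0 <= D e by apply: integral_ge0 => z _; rewrite lee_fin !mulr_ge0 ?kern_ge0.
have DA e : D e <= A%:E.
  rewrite -AE; apply: ge0_int_le.
  - by rewrite /kern; mfun.
  - by rewrite /kern; mfun.
  - by move=> z; rewrite lee_fin !mulr_ge0 ?kern_ge0.
  - move=> z; rewrite lee_fin -[leRHS]mul1r ler_wpM2r ?mulr_ge0 ?kern_ge0//.
    by rewrite lern1 leq_b1.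
have Dfin e : D e \is a fin_num.
  by rewrite ge0_fin_numE//; apply: le_lt_trans (DA e) _; rewrite ltry.
have T0 e : 0 <= trunc_pot e S y.
  by apply: integral_ge0 => z _; rewrite lee_fin mulr_ge0// mulr_ge0 ?kern_ge0// barrier_ge0.
pose Y e := (k * e `^ (- (2 * s)))%R.
have split_h e : (0 < e)%R -> exists2 h : R, trunc_pot e S y + D e = h%:E &
    (`|h - p `^ s * Y e| <= C * (p `^ s * (4 * enorm y / p) `^ (2 * s)))%R /\
    (`|h - p `^ s * Y e| <= C * (p `^ s * ((4 * enorm y / p) ^+ 2 * e `^ (2 - 2 * s))))%R.
  move=> e0; have [h hE hb] := CE p e y p0 e0; exists h => //.
  rewrite -hE -ge0_intD.
  - by apply: eq_integral => z _; rewrite -EFinD; congr EFin; rewrite /d; ring.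
  - by rewrite /kern; mfun.
  - by rewrite /kern; mfun.
  - by move=> z; rewrite lee_fin mulr_ge0// mulr_ge0 ?kern_ge0// barrier_ge0.
  - by move=> z; rewrite lee_fin !mulr_ge0 ?kern_ge0.
have Tfin e : (0 < e)%R -> trunc_pot e S y \is a fin_num.
  move=> e0; have [h hE _] := split_h e e0.
  rewrite ge0_fin_numE//; apply: (@le_lt_trans _ _ (h%:E)); last by rewrite ltry.
  by rewrite -hE leeDl.
have Lh e : (0 < e)%R -> exists2 h : R, L e = (p `^ s * Y e - h + fine (D e))%R &
    (`|h - p `^ s * Y e| <= C * (p `^ s * (4 * enorm y / p) `^ (2 * s)))%R /\
    (`|h - p `^ s * Y e| <= C * (p `^ s * ((4 * enorm y / p) ^+ 2 * e `^ (2 - 2 * s))))%R.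
  move=> e0; have [h hE hb] := split_h e e0; exists h => //.
  have -> : h = (fine (trunc_pot e S y) + fine (D e))%R.
    by apply: EFin_inj; rewrite -hE EFinD !fineK// Tfin.
  by rewrite /L /Y; ring.
have y0 := enorm_ge0 y.
have pi0 : (0 <= p^-1)%R by rewrite invr_ge0 ltW.
split=> [e e0|].
  split; first by rewrite -ge0_fin_numE ?Tfin.
  have [h -> [hb _]] := Lh e e0.
  have dA : (0 <= fine (D e) <= A)%R by rewrite fine_ge0//= -lee_fin fineK.
  have E : (p `^ s * (4 * enorm y / p) `^ (2 * s) =
            4 `^ (2 * s) * (enorm y `^ (2 * s) * p `^ (- s)))%R.
    rewrite powRM ?mulr_ge0// powRM// -(powR_inv1 (ltW p0)) -powRrM.
    rewrite mulrCA -!mulrA; congr (_ * (_ * _))%R.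
    by rewrite -powRD ?(gt_eqF p0) ?implybT//; congr (_ `^ _)%R; ring.
  apply: le_trans (ler_normD _ _) _; rewrite -normrN opprB addrC lerD//.
    by rewrite ger0_norm; have /andP[] := dA.
  by apply: le_trans hb _; rewrite E mulrA.
have Dcvg : (fun j : nat => fine (D (inv j))) @ \oo --> A.
  have := cvg_truncated md d0; rewrite AE; exact: fine_cvg.
pose B : R := (C * (p `^ s * (4 * enorm y / p) ^+ 2))%R.
have Bcvg : (fun j : nat => B * inv j `^ (2 - 2 * s))%R @ \oo --> (0 : R)%R.
  rewrite -[X in _ --> X](mulr0 B); apply: cvgM; first exact: cvg_cst.
  have s22 : (0 < 2 - 2 * s)%R by rewrite subr_gt0 gtr_pMr.
  have /cvg_at_rightP := powR_cvg0 s22; apply; split=> [n|]; first by rewrite invr_gt0.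
  exact: cvg_harmonic.
have Ecvg : (fun j : nat => L (inv j) - fine (D (inv j)))%R @ \oo --> (0 : R)%R.
  apply/norm_cvg0P; apply: (squeeze_cvgr _ (cvg_cst 0%R) Bcvg).
  near=> j; rewrite normr_ge0/=.
  have e0 : (0 < inv j)%R by rewrite invr_gt0.
  have [h -> [_ hb]] := Lh _ e0.
  rewrite addrK distrC; apply: le_trans hb _.
  by rewrite /B le_eqVlt; apply/orP; left; apply/eqP; ring.
rewrite (_ : (fun j : nat => L (inv j)) =
  (fun j : nat => L (inv j) - fine (D (inv j)) + fine (D (inv j)))%R).
  by rewrite -[X in _ --> X](add0r A); exact: cvgD.
by apply/funext => j; rewrite subrK.
Unshelve. all: by end_near. Qed.

End half_space_comparison.

(** * The potential outside the ball *)

Section axis_reduction.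
Context {R : realType} {m : nat}.
Local Notation V := 'rV[R]_m.+1.
Implicit Types (x y : V).

Definition axis (c : R) : V := c *: delta_mx 0 ord_max.

Lemma dot_axis x c : dot x (axis c) = c * x 0 ord_max.
Proof.
rewrite /dot (bigD1 ord_max)//= big1 ?addr0 => [|i im]; first by rewrite !mxE !eqxx mulr1 mulrC.
by rewrite !mxE (negbTE im) andbF !mulr0.
Qed.

Lemma reflection_to_axis y : exists L : V -> V,
  [/\ forall x x', L (x + x') = L x + L x', forall x, L (L x) = x,
      forall x, enorm (L x) = enorm x, measurable_fun setT L & L y = axis (enorm y)].
Proof.
have [yE|yN] := eqVneq y (axis (enorm y)).
  by exists id; split=> //; exact: measurable_id.
have [v vdef] : exists v, v = y - axis (enorm y) by exists (y - axis (enorm y)).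
have vv0 : dot v v != 0.
  rewrite -enorm_sqr sqrf_eq0; apply: contra yN => /eqP /enorm_eq0 /eqP.
  by rewrite vdef subr_eq0.
(* The Householder reflection exchanging [y] and the point of the same norm on the last axis;
   equality of the norms gives [dot v v = 2 * dot y v]. *)
pose L (x : V) : V := x - (2 * dot x v / dot v v) *: v.
have LvE x : dot (L x) v = - dot x v.
  by rewrite dotDl dotNl dotZl; field.
have Lsqr x : enorm (L x) ^+ 2 = enorm x ^+ 2.
  rewrite !enorm_sqr /L !(dotDl, dotDr, dotNl, dotNr, dotZl, dotZr) [dot v x]dotC.
  by field.
exists L; split.
- by move=> x x'; rewrite /L dotDl; apply/rowP => i; rewrite !mxE; field.
- by move=> x; rewrite /L -/(L x) LvE; apply/rowP => i; rewrite !mxE; field.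
- by move=> x; apply/eqP; rewrite -(eqrXn2 (n := 2))// ?enorm_ge0// Lsqr.
- apply: measurable_rVD; first exact: measurable_id.
  apply: measurable_rVN; apply: measurable_rVZ; last exact: measurable_cst.
  apply: measurable_funM; last exact: measurable_cst.
  apply: measurable_funM; first exact: measurable_cst.
  by apply: measurable_dot; [exact: measurable_id|exact: measurable_cst].
- have axy : dot (axis (enorm y)) (axis (enorm y)) = enorm y ^+ 2.
    by rewrite dot_axis !mxE !eqxx mulr1 expr2.
  have vE : dot v v = 2 * dot y v.
    by rewrite vdef !(dotDl, dotDr, dotNl, dotNr) axy -enorm_sqr [dot (axis _) y]dotC; ring.
  have yv0 : dot y v != 0 by move: vv0; rewrite vE mulf_eq0 negb_or => /andP[].
  rewrite /L vE divff ?scale1r ?mulf_neq0//.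
  by rewrite vdef opprB addrC subrK.
Qed.

End axis_reduction.

Section gnomonic.
Context {R : realType}.
Variable s : R.
Hypotheses (s0 : 0 < s) (s1 : s < 1).
Local Notation leb := (@lebesgue_measure R).
Local Open Scope ereal_scope.

Definition gnomonic_const (a : R) : \bar R :=
  \int[leb]_x (ppow (s - 2^-1) x * (x + 1) `^ (- a))%:E.

Lemma gnomonic_const_pos (a : R) : (s + 1 <= a)%R ->
  exists2 K : R, (0 < K)%R & gnomonic_const a = K%:E.
Proof.
move=> sa; have a0 : (0 <= a)%R by rewrite (le_trans _ sa)// addr_ge0// ltW.
have sh : (0 < s + 2^-1)%R by rewrite addr_gt0// invr_gt0.
pose f (x : R) : R := (ppow (s - 2^-1) x * (x + 1) `^ (- a))%R.
have f0 x : (0 <= f x)%R by rewrite mulr_ge0 ?ppow_ge0 ?powR_ge0.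
have mf : measurable_fun setT f by rewrite /f /ppow; mfun.
have e1 := integral_powR_near0E sh (ltr0n R 2).
have h0 : (0 < 2^-1 :> R)%R by rewrite invr_gt0.
have e2 := integral_powR_infty h0 (@ltr01 R).
have up : gnomonic_const a < +oo.
  rewrite !integral_posE in e1 e2.
  pose g1 (x : R) := (0 < x)%R%:R%:E * ((x < 2)%R%:R * x `^ (s + 2^-1 - 1))%:E.
  pose g2 (x : R) := (0 < x)%R%:R%:E * ((1 < x)%R%:R * x `^ (- 2^-1 - 1))%:E.
  have mg1 : measurable_fun setT g1 by rewrite /g1; mfun.
  have mg2 : measurable_fun setT g2 by rewrite /g2; mfun.
  have g10 x : 0 <= g1 x by rewrite /g1 -EFinM lee_fin !mulr_ge0// powR_ge0.
  have g20 x : 0 <= g2 x by rewrite /g2 -EFinM lee_fin !mulr_ge0// powR_ge0.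
  apply: (@le_lt_trans _ _ (\int[leb]_x (g1 x + g2 x))); last first.
    by rewrite ge0_intD// e1 e2 -EFinD ltry.
  apply: ge0_int_le.
  - exact/measurable_EFinP.
  - exact: emeasurable_funD.
  - by move=> x; rewrite lee_fin; exact: f0.
  move=> x; rewrite /g1 /g2 -!EFinM -EFinD lee_fin.
  have [x0|x0] := ltP 0%R x; last by rewrite ppow_le0E// !mul0r addr0.
  have x10 : (0 < x + 1)%R by rewrite addr_gt0.
  rewrite ppow_gt0E// !mul1r; have [x2|x2] := ltP x 2%R.
    apply: (@le_trans _ _ (x `^ (s + 2^-1 - 1))%R); last first.
      by rewrite mul1r lerDl mulr_ge0// powR_ge0.
    have -> : (s + 2^-1 - 1 = s - 2^-1)%R by field.
    rewrite -[leRHS]mulr1 ler_wpM2l ?powR_ge0// powRN invf_le1 ?powR_gt0//.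
    by apply: powR_ge1 => //; rewrite lerDr ltW.
  have x1 : (1 < x)%R by apply: lt_le_trans x2; rewrite ltr1n.
  rewrite mul0r add0r x1 mul1r.
  apply: (@le_trans _ _ (x `^ (s - 2^-1) * x `^ (- (s + 1)))%R).
    rewrite ler_wpM2l ?powR_ge0// !powRN lef_pV2 ?posrE ?powR_gt0//.
    apply: (@le_trans _ _ (x `^ a)%R); first by apply: ler_powR => //; exact: ltW.
    by apply: ge0_ler_powR; rewrite ?nnegrE ?(ltW x0) ?(ltW x10)// lerDl.
  rewrite -powRD ?(gt_eqF x0) ?implybT//.
  by rewrite le_eqVlt; apply/orP; left; apply/eqP; congr (_ `^ _)%R; field.
pose c := (2^-1 * 3 `^ (- a))%R.
have c0 : (0 < c)%R by rewrite mulr_gt0 ?invr_gt0// powR_gt0.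
have lo : c%:E <= gnomonic_const a.
  have I1 : \int[leb]_x ((1 < x < 2)%R%:R * c)%:E = c%:E.
    rewrite integral_lt_lt integral_cst//= lebesgue_measure_itv/= lte_fin ltr1n.
    by rewrite -EFinD -EFinM; congr EFin; ring.
  rewrite -I1; apply: ge0_int_le.
  - by mfun.
  - exact/measurable_EFinP.
  - by move=> x; rewrite lee_fin mulr_ge0// ltW.
  - move=> x; rewrite lee_fin; case: (boolP (1 < x < 2)%R) => [/andP[x1 x2]|_]; last first.
      by rewrite mul0r; exact: f0.
    have x0 : (0 < x)%R by apply: lt_trans x1.
    have x10 : (0 < x + 1)%R by rewrite addr_gt0.
    rewrite mul1r ppow_gt0E//; apply: ler_pM; rewrite ?invr_ge0 ?powR_ge0//.
      apply: (@le_trans _ _ (x `^ (-1))%R).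
        by rewrite powR_inv1 ?(ltW x0)// lef_pV2 ?posrE// ltW.
      by apply: ler_powR; [exact: ltW|move: s0; lra].
    rewrite !powRN lef_pV2 ?posrE ?powR_gt0//.
    by apply: ge0_ler_powR; rewrite ?nnegrE ?(ltW x10)//; move: x2; lra.
have f1 : gnomonic_const a \is a fin_num.
  by rewrite ge0_fin_numE//; apply: le_trans lo; rewrite lee_fin ltW.
by exists (fine (gnomonic_const a)); rewrite ?fineK// -lte_fin fineK//; apply: lt_le_trans lo; rewrite lte_fin.
Qed.

(** In the variable [x = r^(-2)] the factor [S - P r^2] becomes affine. Translation by [P / S] and
    dilation by [(S + P) / S] then reduce both factors to multiples of [x] and [x + 1], leaving a
    Beta integral without parameters [S], [P]. *)
Lemma gnomonic_radial (m : nat) (S P : R) : (0 < S)%R -> (0 < P)%R ->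
  let a := (m%:R / 2 + 1 + s)%R in
  \int[leb]_r ((0 < r)%R%:R * (r ^+ m * (ppow (s - 2^-1) (S - P * r ^+ 2) *
    (1 + r ^+ 2) `^ (- a))))%:E =
  (2^-1 * (S + P) `^ (- (m%:R / 2) - 2^-1) * S `^ (m%:R / 2 + s))%:E * gnomonic_const a.
Proof.
move=> S0 P0 a; have Y0 : (0 < S + P)%R by rewrite addr_gt0.
(* The absolute value makes the integrand nonnegative on the whole line, as the inversion formula
   requires. *)
pose f0 (r : R) : R := (`|r| ^+ m * (ppow (s - 2^-1) (S - P * r ^+ 2) * (1 + r ^+ 2) `^ (- a)))%R.
have f0_ge0 r : (0 <= f0 r)%R by rewrite !mulr_ge0 ?exprn_ge0 ?ppow_ge0 ?powR_ge0.
have mf0 : measurable_fun setT f0 by rewrite /f0 /ppow; mfun.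
transitivity (\int[leb]_r ((0 < r)%R%:R * f0 r)%:E).
  apply: eq_integral => r _; congr EFin.
  by have [r0|] := ltP 0%R r; [rewrite /f0 gtr0_norm|rewrite !mul0r].
rewrite -ge0_integral_invrR//.
pose f2 (x : R) : R := (2^-1 * (ppow (s - 2^-1) (S * x - P) * (x + 1) `^ (- a)))%R.
have f2_ge0 x : (0 <= f2 x)%R by rewrite !mulr_ge0 ?ppow_ge0 ?powR_ge0// invr_ge0.
have mf2 : measurable_fun setT f2 by rewrite /f2 /ppow; mfun.
transitivity (\int[leb]_v ((0 < v)%R%:R * (f2 (1 * v ^+ 2 + 2 * 0 * v) * (2 * 1 * v + 2 * 0)))%:E).
  apply: eq_integral => v _; congr EFin.
  have [v0|] := ltP 0%R v; last by rewrite !mul0r.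
  congr (_ * _)%R; rewrite /f0 /f2 !(mul1r, mulr0, mul0r, addr0, mulr1).
  have vi : (0 < v^-1)%R by rewrite invr_gt0.
  have v2 : (0 < v^-1 ^+ 2)%R by rewrite exprn_gt0.
  rewrite (gtr0_norm vi).
  have -> : (S - P * v^-1 ^+ 2 = v^-1 ^+ 2 * (S * v ^+ 2 - P))%R by field; rewrite gt_eqF.
  have -> : (1 + v^-1 ^+ 2 = v^-1 ^+ 2 * (v ^+ 2 + 1))%R by field; rewrite gt_eqF.
  rewrite ppowZ// (@powRM _ (v^-1 ^+ 2) (v ^+ 2 + 1)) ?(ltW v2) ?addr_ge0 ?sqr_ge0//.
  transitivity ((v^-1 ^+ m * (v^-1 ^+ 2) `^ (s - 2^-1) * (v^-1 ^+ 2) `^ (- a) * v ^- 2) *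
    (ppow (s - 2^-1) (S * v ^+ 2 - P) * (v ^+ 2 + 1) `^ (- a)))%R; first by ring.
  have -> : (v^-1 ^+ m * (v^-1 ^+ 2) `^ (s - 2^-1) * (v^-1 ^+ 2) `^ (- a) * v ^- 2 = v)%R; last by field.
  rewrite -(powR_invn 2 (ltW v0)) -!(powR_mulrn _ (ltW vi)) -!(powR_inv1 (ltW v0)) -!powRrM.
  rewrite -!powRD ?(gt_eqF v0) ?implybT//.
  by rewrite -[RHS]powRr1 ?(ltW v0)//; congr (_ `^ _)%R; rewrite /a; field.
rewrite (ge0_integral_quadraticR (b := 0)) ?ltr01 ?lexx//.
transitivity (\int[leb]_x (f2 x)%:E).
  apply: eq_integral => x _; congr EFin; have [x0|x0] := ltP 0%R x; first by rewrite mul1r.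
  by rewrite /f2 ppow_le0E ?(mul0r, mulr0)// subr_le0 (le_trans _ (ltW P0))// pmulr_rle0.
rewrite -(ge0_integral_translation (f := fun x => (f2 x)%:E) (P / S)); last 2 first.
- exact/measurable_EFinP.
- by move=> x; rewrite lee_fin.
pose c := ((S + P) / S)%R; have c0 : (0 < c)%R by rewrite divr_gt0.
have mf3 : measurable_fun setT (fun x : R => f2 (x + P / S)%R).
  by apply: measurableT_comp => //; mfun.
rewrite -(ge0_integral_scaling (f := fun x => (f2 (x + P / S)%R)%:E) c0); last 2 first.
- exact/measurable_EFinP.
- by move=> x; rewrite lee_fin.
pose g (x : R) : R := (ppow (s - 2^-1) x * (x + 1) `^ (- a))%R.
transitivity (c%:E * ((2^-1 * (S + P) `^ (s - 2^-1) * c `^ (- a))%:E * \int[leb]_x (g x)%:E)).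
  congr (_ * _); rewrite -ge0_intZl.
  - apply: eq_integral => x _; rewrite -EFinM; congr EFin; rewrite /f2 /g.
    have -> : (S * (c * x + P / S) - P = (S + P) * x)%R by rewrite /c; field; rewrite gt_eqF.
    have -> : (c * x + P / S + 1 = c * (x + 1))%R by rewrite /c; field; rewrite gt_eqF.
    have [x0|x0] := ltP 0%R x; last by rewrite !ppow_le0E ?(mul0r, mulr0)// pmulr_rle0.
    by rewrite ppowZ// powRM ?(ltW c0) ?addr_ge0 ?(ltW x0)//; ring.
  - by rewrite !mulr_ge0 ?powR_ge0// invr_ge0.
  - by rewrite /g /ppow; mfun.
  - by move=> x; rewrite lee_fin mulr_ge0 ?ppow_ge0 ?powR_ge0.
rewrite muleA -EFinM; congr (_%:E * _).
rewrite /c powRM ?(ltW Y0) ?invr_ge0 ?(ltW S0)//.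
have Si : (0 <= S^-1)%R by rewrite invr_ge0 ltW.
rewrite -[X in (X / S)%R](powRr1 (ltW Y0)) -!(powR_inv1 (ltW S0)) -!powRrM.
transitivity (2^-1 * ((S + P) `^ 1 * (S + P) `^ (s - 2^-1) * (S + P) `^ (- a)) *
   (S `^ (-1) * S `^ (-1 * - a)))%R; first by ring.
rewrite -!powRD ?(gt_eqF S0) ?(gt_eqF Y0) ?implybT//.
by congr (_ * _ `^ _ * _ `^ _)%R; rewrite /a; field.
Qed.

End gnomonic.

(** * The potential of one layer *)

Section layer_potential.
Context {R : realType}.
Variable s : R.
Hypotheses (s0 : 0 < s) (s1 : s < 1).
Local Notation leb := (@lebesgue_measure R).
Local Open Scope ereal_scope.

(** Up to the factor [s], the derivative in [S] of the potential of [barrier S]. *)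
Definition layer m (S : R) (y : 'rV[R]_m.+1) : \bar R :=
  \int[@vol R m]_x (ppow (s - 1) (S - enorm x ^+ 2) * kern s (x - y))%:E.

(** The same potential once [y] has been reflected to the last axis at distance [e] and [z = y - x]
    taken as variable: with [P = |y|^2 - S], the quantity [S - |x|^2] becomes
    [2 e z_n - P - |z|^2]. *)
Definition axis_layer m (e P : R) : \bar R :=
  \int[@vol R m]_z (ppow (s - 1) (2 * e * z 0%R ord_max - P - enorm z ^+ 2) * kern s z)%:E.

Lemma layer_axis m (S : R) (y : 'rV[R]_m.+1) :
  layer S y = axis_layer m (enorm y) (enorm y ^+ 2 - S).
Proof.
have [L [LD LK Lnorm mL Ly]] := reflection_to_axis y.
have L0 : L 0%R = 0%R.
  have := LD 0%R 0%R; rewrite addr0 => h.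
  by apply: (@addrI _ (L 0%R)); rewrite addr0 -h.
have LN x : L (- x)%R = (- L x)%R.
  by apply: (@addrI _ (L x)); rewrite -LD !subrr.
rewrite /layer /axis_layer.
have mf (f : 'rV[R]_m.+1 -> 'rV[R]_m.+1) : measurable_fun setT f ->
    measurable_fun setT (fun x => (ppow (s - 1) (S - enorm (f x) ^+ 2) * kern s (f x - y))%:E).
  by move=> mf; rewrite /ppow /kern; mfun.
have pos x : 0 <= (ppow (s - 1) (S - enorm x ^+ 2) * kern s (x - y))%:E.
  by rewrite lee_fin mulr_ge0 ?ppow_ge0 ?kern_ge0.
rewrite -(ge0_vol_isometry LD LK Lnorm mL (mf id (@measurable_id _ _ _)) pos).
pose g (x : 'rV[R]_m.+1) : \bar R := (ppow (s - 1) (S - enorm x ^+ 2) * kern s (x - axis (enorm y)))%:E.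
have mg : measurable_fun setT g by rewrite /g /ppow /kern; mfun.
have g0 x : 0 <= g x by rewrite lee_fin mulr_ge0 ?ppow_ge0 ?kern_ge0.
transitivity (\int[@vol R m]_x g x).
  apply: eq_integral => x _; rewrite /g Lnorm /kern; congr (_ * (_ `^ _)^-1)%:E.
  by rewrite -Lnorm LD LK LN Ly.
rewrite -(ge0_vol_translation (axis (enorm y)) mg g0).
pose h (x : 'rV[R]_m.+1) : \bar R := g (x + axis (enorm y))%R.
have mh : measurable_fun setT h by apply: measurableT_comp => //; mfun.
have h0 x : 0 <= h x by exact: g0.
rewrite -(ge0_vol_opp mh h0); apply: eq_integral => z _; rewrite /h /g addrK kernN.
congr (ppow _ _ * _)%:E; rewrite enorm_sqrD dotNl dot_axis enormN /axis enormZ.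
have -> : enorm (delta_mx 0%R ord_max : 'rV[R]_m.+1) = 1%R.
  apply/eqP; rewrite -(eqrXn2 (n := 2)) ?enorm_ge0// enorm_sqr.
  rewrite (_ : delta_mx 0%R ord_max = axis 1%R); last by rewrite /axis scale1r.
  by rewrite dot_axis !mxE !eqxx !mul1r expr1n.
by rewrite ger0_norm ?enorm_ge0// mulr1; ring.
Qed.

Lemma enorm_snoc m (x : 'rV[R]_m.+1) (t : R) : (enorm (snoc x t) ^+ 2 = enorm x ^+ 2 + t ^+ 2)%R.
Proof.
rewrite !enorm_sqr /dot sum_snoc snoc_max; congr (_ + _)%R.
by apply: eq_bigr => i _; rewrite snoc_lift.
Qed.

Lemma axis_layer0 (e P : R) : (0 < e)%R -> (0 < P)%R ->
  axis_layer 0 e P = (e * P `^ (- s - 1) * ppow (s - 2^-1) (e ^+ 2 - P))%:E * cap_mass s.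
Proof.
move=> e0 P0; rewrite /axis_layer ge0_integral_vol0; last 2 first.
- by rewrite /ppow /kern; mfun.
- by move=> z; rewrite lee_fin mulr_ge0 ?ppow_ge0 ?kern_ge0.
transitivity ((e * P `^ (- s - 1) * ppow (s - 2^-1) (e ^+ 2 - P * 1))%:E * cap_mass s); last first.
  by rewrite mulr1.
rewrite -cap_integral//.
apply: eq_integral => t _; congr EFin.
have nt : enorm (\row_(i < 1) t) = `|t|%R.
  by rewrite /enorm big_ord1 mxE sqrtr_sqr.
rewrite nt real_normK ?num_real// mxE mul1r.
have [t0|t0] := ltP 0%R t; last first.
  rewrite mul0r ppow_le0E ?mul0r//.
  have h1 : (0 <= t ^+ 2)%R := sqr_ge0 t.
  have h2 : (e * t <= 0)%R by rewrite pmulr_rle0.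
  by rewrite -mulrA; lra.
rewrite mul1r /kern nt gtr0_norm// -[in RHS](exprm_kern (m := 0) _ t0) mul1r.
by congr (_ * _)%R.
Qed.

(** Gnomonic coordinates [z = t (x, 1)]: the ball is seen from [y] inside the half-space [t > 0],
    and the ray of slope [x] meets it along the parabola [2 e t - P - (1 + |x|^2) t^2] of
    [cap_integral]. The Jacobian [t^(m+1)] and the kernel combine into [t^(-2s-1)]. *)
Lemma axis_layerS m (e P : R) : (0 < e)%R -> (0 < P)%R ->
  axis_layer m.+1 e P = (e * P `^ (- s - 1))%:E * cap_mass s *
    \int[@vol R m]_x (ppow (s - 2^-1) (e ^+ 2 - P - P * enorm x ^+ 2) *
       (1 + enorm x ^+ 2) `^ (- (m%:R / 2 + 1 + s)))%:E.
Proof.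
move=> e0 P0; rewrite /axis_layer.
pose f (z : 'rV[R]_m.+2) : R :=
  (ppow (s - 1) (2 * e * z 0%R ord_max - P - enorm z ^+ 2) * kern s z)%R.
have f0 z : (0 <= f z)%R by rewrite mulr_ge0 ?ppow_ge0 ?kern_ge0.
have mf : measurable_fun setT f.
  apply: measurable_funM; last exact: measurable_kern (@measurable_id _ _ _).
  apply/measurable_ppow/measurable_funB; last exact/measurable_funX/measurable_enorm.
  apply: measurable_funB => //; apply: measurable_funM => //; exact: measurable_coord.
have mfE : measurable_fun setT (fun z => (f z)%:E) by exact/measurable_EFinP.
have fE0 z : 0 <= (f z)%:E by rewrite lee_fin.
rewrite [LHS](ge0_integral_slice mfE fE0).
pose w (x : 'rV[R]_m.+1) : R := (1 + enorm x ^+ 2)%R.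
have w0 x : (0 < w x)%R by rewrite ltr_wpDr// sqr_ge0.
pose G (x : 'rV[R]_m.+1) (t : R) : R := ((0 < t)%R%:R * (ppow (s - 1) (2 * e * t - P - w x * t ^+ 2) *
    t `^ (- (2 * s) - 1)) * w x `^ (- (m%:R / 2 + 1 + s)))%R.
have G0 x t : (0 <= G x t)%R by rewrite !mulr_ge0 ?ppow_ge0 ?powR_ge0.
have mG : measurable_fun setT (fun p : 'rV[R]_m.+1 * R => (G p.1 p.2)%:E).
  by rewrite /G /w /ppow; mfun.
transitivity (\int[leb]_t \int[@vol R m]_x (G x t)%:E).
  apply: eq_integral => t _.
  have [t0|t0] := ltP 0%R t; last first.
    rewrite !integral0_eq// => x _; first by rewrite /G ltNge t0 !mul0r.
    rewrite /f ppow_le0E ?mul0r// snoc_max.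
    have h1 : (0 <= enorm (snoc x t) ^+ 2)%R := sqr_ge0 _.
    have h2 : (e * t <= 0)%R by rewrite pmulr_rle0.
    by rewrite -mulrA; lra.
  have mft : measurable_fun setT (fun x : 'rV[R]_m.+1 => (f (snoc x t))%:E).
    by apply/measurable_EFinP; apply: measurableT_comp => //; mfun.
  have mft2 : measurable_fun setT (fun x : 'rV[R]_m.+1 => (f (snoc (t *: x) t))%:E).
    by apply/measurable_EFinP; apply: measurableT_comp => //; mfun.
  have pos2 (x : 'rV[R]_m.+1) : 0 <= (f (snoc (t *: x) t))%:E by exact: fE0.
  rewrite -(ge0_vol_scaling t0 mft (fun x => fE0 _)).
  rewrite -(ge0_intZl _ (exprn_ge0 _ (ltW t0)) mft2 pos2).
  apply: eq_integral => x _; rewrite -EFinM; congr EFin; rewrite /G t0 mul1r.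
  have -> : snoc (t *: x) t = (t *: snoc x 1)%R by rewrite snocZ mulr1.
  rewrite /f mulrCA kernZ// mulrA mxE snoc_max mulr1; congr (ppow _ _ * _ * _)%R.
    by rewrite enormZ exprMn (gtr0_norm t0) enorm_snoc /w expr1n; ring.
  have wE : w x = (enorm (snoc x 1) ^+ 2)%R by rewrite enorm_snoc expr1n addrC.
  rewrite /kern wE -(powR_mulrn 2 (enorm_ge0 _)) -powRrM -powRN; congr (_ `^ _)%R.
  by rewrite -!natr1; field.
have GE0 (x : 'rV[R]_m.+1) (t : R) : 0 <= (G x t)%:E by rewrite lee_fin.
rewrite -(vol_leb_tonelli mG GE0).
have [B B0 BE] := cap_mass_pos s0 s1.
have eP0 : (0 <= e * P `^ (- s - 1))%R by rewrite mulr_ge0 ?powR_ge0// ltW.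
rewrite BE -EFinM -ge0_intZl; last 3 first.
- by rewrite mulr_ge0// ltW.
- by rewrite /ppow; mfun.
- by move=> x; rewrite lee_fin mulr_ge0 ?ppow_ge0 ?powR_ge0.
apply: eq_integral => x _.
have mc : measurable_fun setT (fun t : R => ((0 < t)%R%:R *
   (ppow (s - 1) (2 * e * t - P - w x * t ^+ 2) * t `^ (- (2 * s) - 1)))%:E).
  by rewrite /ppow; mfun.
under eq_integral do rewrite /G EFinM.
rewrite ge0_intZr ?lee_fin ?powR_ge0//; last first.
  by move=> t; rewrite lee_fin !mulr_ge0 ?ppow_ge0 ?powR_ge0.
rewrite cap_integral// BE -!EFinM; congr EFin.
have -> : (e ^+ 2 - P - P * enorm x ^+ 2 = e ^+ 2 - P * w x)%R by rewrite /w; ring.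
by rewrite /w; ring.
Qed.

(** In dimension 1 there is no transversal variable and [cap_integral] alone gives the value.
    Otherwise [gnomonic_radial] applies with [S + P = |y|^2], which produces the power of
    [|y|^2]. *)
Lemma layerE m : exists2 C : R, (0 < C)%R & forall (S : R) (y : 'rV[R]_m.+1),
  (0 < S)%R -> (S < enorm y ^+ 2)%R ->
  layer S y = (C * ((enorm y ^+ 2) `^ (1 - m.+1%:R / 2) * S `^ (s + m.+1%:R / 2 - 1) *
    (enorm y ^+ 2 - S) `^ (- s - 1)))%:E.
Proof.
have [B B0 BE] := cap_mass_pos s0 s1.
have y0 (S : R) (y : 'rV[R]_m.+1) : (0 < S)%R -> (S < enorm y ^+ 2)%R -> (0 < enorm y)%R.
  move=> S0 Sy; rewrite lt_neqAle enorm_ge0 andbT eq_sym; apply/eqP => e0.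
  by move: Sy; rewrite e0 expr0n/= ltNge (ltW S0).
case: m y0 => [|m] y0.
  exists B => // S y S0 Sy; rewrite layer_axis axis_layer0 ?subr_gt0 ?(y0 S)// BE.
  have yy := y0 S y S0 Sy.
  have -> : (enorm y ^+ 2 - (enorm y ^+ 2 - S) = S)%R by ring.
  rewrite ppow_gt0E// -EFinM; congr EFin.
  rewrite -(powR_mulrn 2 (ltW yy)) -[X in (_ * (X * _ * _))%R]powRrM.
  have -> : (2 * (1 - 1 / 2) = 1 :> R)%R by field.
  rewrite (powRr1 (ltW yy)); have -> : (s + 1 / 2 - 1 = s - 2^-1)%R by field.
  by ring.
have [k k0 kE] := @radial R m.
have sa : (s + 1 <= m%:R / 2 + 1 + s)%R by rewrite [leRHS]addrC lerD2l lerDr divr_ge0.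
have [K K0 KE] := gnomonic_const_pos s0 sa.
exists (B * (k * (2^-1 * K)))%R; first by rewrite !mulr_gt0// invr_gt0.
move=> S y S0 Sy; have yy := y0 S y S0 Sy.
have P0 : (0 < enorm y ^+ 2 - S)%R by rewrite subr_gt0.
rewrite layer_axis axis_layerS//.
set P := (enorm y ^+ 2 - S)%R in P0 *.
have YE : (enorm y ^+ 2 = S + P)%R by rewrite /P; ring.
rewrite BE.
pose h (r : R) : \bar R := (ppow (s - 2^-1) (S - P * r ^+ 2) * (1 + r ^+ 2) `^ (- (m%:R / 2 + 1 + s)))%:E.
have mh : measurable_fun setT h by rewrite /h /ppow; mfun.
have h0 r : 0 <= h r by rewrite lee_fin mulr_ge0 ?ppow_ge0 ?powR_ge0.
have -> : \int[@vol R m]_x (ppow (s - 2^-1) (enorm y ^+ 2 - P - P * enorm x ^+ 2) *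
       (1 + enorm x ^+ 2) `^ (- (m%:R / 2 + 1 + s)))%:E = \int[@vol R m]_x h (enorm x).
  by apply: eq_integral => x _; rewrite /h YE addrK.
rewrite (kE h mh h0) integral_posE.
have -> : \int[leb]_t ((0 < t)%R%:R%:E * ((t ^+ m)%:E * h t)) =
   \int[leb]_r ((0 < r)%R%:R * (r ^+ m * (ppow (s - 2^-1) (S - P * r ^+ 2) *
    (1 + r ^+ 2) `^ (- (m%:R / 2 + 1 + s)))))%:E.
  by apply: eq_integral => t _; rewrite /h -!EFinM.
rewrite gnomonic_radial// KE -!EFinM; congr EFin; rewrite -YE.
set Y := (enorm y ^+ 2)%R; have Y0 : (0 < Y)%R by rewrite exprn_gt0.
have -> : enorm y = (Y `^ (2^-1))%R by rewrite powR12_sqrt ?sqr_ge0// sqrtr_sqr gtr0_norm.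
have <- : (Y `^ 2^-1 * Y `^ (- (m%:R / 2) - 2^-1) = Y `^ (1 - m.+2%:R / 2))%R.
  by rewrite -powRD ?(gt_eqF Y0) ?implybT//; congr (_ `^ _)%R; rewrite -!natr1; field.
have -> : (s + m.+2%:R / 2 - 1 = m%:R / 2 + s)%R by rewrite -!natr1; field.
by ring.
Qed.

End layer_potential.

Section real_valued_integrands.
Local Open Scope ereal_scope.
Context d (T : measurableType d) (R : realType) (mu : {measure set T -> \bar R}).
Implicit Types f g : T -> R.

Lemma ge0_intZR (k : R) f : (0 <= k)%R -> measurable_fun setT f -> (forall x, 0 <= f x)%R ->
  k%:E * \int[mu]_x (f x)%:E = \int[mu]_x (k * f x)%:E.
Proof.
move=> k0 mf f0; by rewrite -ge0_intZl//; exact/measurable_EFinP.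
Qed.

Lemma ge0_intDR f g : measurable_fun setT f -> measurable_fun setT g ->
  (forall x, 0 <= f x)%R -> (forall x, 0 <= g x)%R ->
  \int[mu]_x (f x)%:E + \int[mu]_x (g x)%:E = \int[mu]_x (f x + g x)%:E.
Proof.
by move=> mf mg f0 g0; rewrite -ge0_intD//; exact/measurable_EFinP.
Qed.

Lemma ge0_int_leR f g : measurable_fun setT f -> measurable_fun setT g ->
  (forall x, 0 <= f x <= g x)%R -> \int[mu]_x (f x)%:E <= \int[mu]_x (g x)%:E.
Proof.
move=> mf mg fg; apply: ge0_int_le; [exact/measurable_EFinP|exact/measurable_EFinP| |].
  by move=> x; rewrite lee_fin; have /andP[] := fg x.
by move=> x; rewrite lee_fin; have /andP[] := fg x.
Qed.

Lemma ge0_int_ltyR f : (forall x, 0 <= f x)%R -> \int[mu]_x (f x)%:E < +oo ->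
  exists2 v : R, (0 <= v)%R & \int[mu]_x (f x)%:E = v%:E.
Proof.
move=> f0 fin; have I0 : 0 <= \int[mu]_x (f x)%:E.
  by apply: integral_ge0 => x _; rewrite lee_fin.
exists (fine (\int[mu]_x (f x)%:E)); first exact: fine_ge0.
by rewrite fineK// ge0_fin_numE.
Qed.

End real_valued_integrands.

Lemma ge0_lebZ {R : realType} (k : R) (f : R -> R) :
  0 <= k -> measurable_fun setT f -> (forall x, 0 <= f x) ->
  (k%:E * \int[@lebesgue_measure R]_x (f x)%:E = \int[@lebesgue_measure R]_x (k * f x)%:E)%E.
Proof. by move=> k0 mf f0; exact: (@ge0_intZR _ _ R (@lebesgue_measure R) k f k0 mf f0). Qed.

(** * The potential of the barrier as an incomplete Beta integral *)

Section exterior_potential.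
Context {R : realType} {m : nat}.
Variable s : R.
Hypotheses (s0 : 0 < s) (s1 : s < 1).
Local Notation leb := (@lebesgue_measure R).
Local Notation V := 'rV[R]_m.+1.
Local Notation vol := (@vol R m).
Local Notation kern := (kern s).
Local Notation barrier := (barrier s).
Local Notation nu := (m.+1%:R / 2 : R)%R.
Local Open Scope ereal_scope.

Definition pot (S : R) (y : V) : \bar R := \int[vol]_z (barrier S (y + z)%R * kern z)%:E.

Lemma barrier_layers (S : R) (x : V) : (0 < S)%R ->
  (barrier S x)%:E = s%:E * \int[leb]_t ((0 < t < S)%R%:R * ppow (s - 1) (t - enorm x ^+ 2))%:E.
Proof.
move=> S0; set X := (enorm x ^+ 2)%R; have X0 : (0 <= X)%R by exact: sqr_ge0.
have -> : \int[leb]_t ((0 < t < S)%R%:R * ppow (s - 1) (t - X))%:E =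
          \int[leb]_t ((0 < t)%R%:R * ((t < S - X)%R%:R * t `^ (s - 1)))%:E.
  rewrite -(ge0_integral_translation
    (f := fun t => ((0 < t < S)%R%:R * ppow (s - 1) (t - X))%:E) X); last 2 first.
  - by rewrite /ppow; mfun.
  - by move=> t; rewrite lee_fin mulr_ge0 ?ppow_ge0.
  apply: eq_integral => t _; rewrite addrK -ltrBrDr; congr EFin.
  have [t0|t0] := ltP 0%R t; last by rewrite ppow_le0E// mulr0 mul0r.
  have -> : (0 < t + X)%R by rewrite ltr_pwDl.
  by rewrite ppow_gt0E//= mul1r.
have [SX|SX] := ltP 0%R (S - X)%R.
  have e := integral_powR_near0E s0 SX; rewrite integral_posE in e.
  rewrite (_ : \int[leb]_t _ = ((S - X) `^ s / s)%:E).
    by rewrite /barrier ppow_gt0E// -EFinM mulrC divfK// gt_eqF.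
  by rewrite -e; apply: eq_integral => t _; rewrite -EFinM.
rewrite /barrier ppow_le0E// integral0_eq ?mule0// => t _.
have [t0|] := ltP 0%R t; last by rewrite mul0r.
by rewrite ltNge (le_trans SX (ltW t0)) mul0r mulr0.
Qed.

Lemma pot_layers (S : R) (y : V) : (0 < S)%R ->
  pot S y = s%:E * \int[leb]_t ((0 < t < S)%R%:R%:E * layer s t y).
Proof.
move=> S0.
have mb : measurable_fun setT (fun z : V => (barrier S (y + z)%R * kern z)%:E).
  apply/measurable_EFinP; apply: measurable_funM; last exact: measurable_kern (@measurable_id _ _ _).
  by apply: measurable_barrier; mfun.
have b0 (z : V) : 0 <= (barrier S (y + z)%R * kern z)%:E by rewrite lee_fin mulr_ge0 ?barrier_ge0 ?kern_ge0.
rewrite /pot -(ge0_vol_translation (- y)%R mb b0).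
pose F (x : V) (t : R) : R := ((0 < t < S)%R%:R * (ppow (s - 1) (t - enorm x ^+ 2) * kern (x - y)))%R.
have F0 (x : V) (t : R) : 0 <= (F x t)%:E.
  by rewrite lee_fin mulr_ge0// mulr_ge0 ?ppow_ge0 ?kern_ge0.
have mF : measurable_fun setT (fun p : V * R => (F p.1 p.2)%:E).
  apply/measurable_EFinP; apply: measurable_funM; first by mfun.
  apply: measurable_funM; first by apply: measurable_ppow; mfun.
  by apply: measurable_kern; mfun.
transitivity (\int[vol]_x (s%:E * \int[leb]_t (F x t)%:E)).
  apply: eq_integral => x _; rewrite addrC subrK EFinM barrier_layers// -muleA; congr (_ * _).
  have mFx : measurable_fun setT (fun t : R => (0 < t < S)%R%:R * ppow (s - 1) (t - enorm x ^+ 2))%R.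
    by apply: measurable_funM; [mfun|apply: measurable_ppow; mfun].
  rewrite muleC ge0_intZR ?kern_ge0//; last by move=> t; rewrite mulr_ge0 ?ppow_ge0.
  by apply: eq_integral => t _; rewrite /F; congr EFin; ring.
have mI : measurable_fun setT (fun x : V => \int[leb]_t (F x t)%:E).
  exact: measurable_integral_leb.
rewrite ge0_intZl ?ltW//; last by move=> x; apply: integral_ge0 => t _; exact: F0.
congr (_ * _); rewrite vol_leb_tonelli//.
apply: eq_integral => t _; rewrite /layer -ge0_intZl.
- by apply: eq_integral => x _; rewrite -EFinM.
- by rewrite ler0n.
- apply/measurable_EFinP; apply: measurable_funM; first by apply: measurable_ppow; mfun.
  by apply: measurable_kern; mfun.
- by move=> x; rewrite lee_fin mulr_ge0 ?ppow_ge0 ?kern_ge0.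
Qed.

Definition beta_integral (S Y : R) : \bar R :=
  \int[leb]_t ((0 < t < S)%R%:R * (t `^ (s + nu - 1) * (Y - t) `^ (- s)))%:E.

Lemma nu_gt0 : (0 < nu)%R. Proof. by rewrite divr_gt0// ltr0n. Qed.

(** Differentiating [t^(nu+s) (Y - t)^(-s)] leaves the factor [(nu + s) (Y - t) + s t = s Y + nu (Y
    - t)]. The exponent [- s - 1] of the layers, not integrable at [t = Y], is thus traded for
    [- s], which is. *)
Lemma beta_primitive (S Y : R) : (0 < S)%R -> (S < Y)%R ->
  (s * Y)%:E * \int[leb]_t ((0 < t < S)%R%:R * (t `^ (s + nu - 1) * (Y - t) `^ (- s - 1)))%:E +
  nu%:E * beta_integral S Y = (S `^ (nu + s) * (Y - S) `^ (- s))%:E.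
Proof.
move=> S0 SY; have n0 := nu_gt0.
have a0 : (0 < nu + s)%R by rewrite addr_gt0.
have sY0 : (0 <= s * Y)%R by rewrite mulr_ge0 ?(ltW s0)// ltW// (lt_trans S0).
pose f (t : R) : R := (s * Y * (t `^ (s + nu - 1) * (Y - t) `^ (- s - 1)) +
  nu * (t `^ (s + nu - 1) * (Y - t) `^ (- s)))%R.
pose F (t : R) : R := (t `^ (nu + s) * (Y - t) `^ (- s))%R.
transitivity (\int[leb]_t ((0 < t < S)%R%:R * f t)%:E).
  rewrite -!ge0_intZl ?(ltW n0)//.
  - rewrite -ge0_intD.
    + by apply: eq_integral => t _; rewrite -EFinD; congr EFin; rewrite /f; ring.
    + by mfun.
    + by mfun.
    + by move=> t; rewrite -EFinM lee_fin mulr_ge0// !mulr_ge0 ?powR_ge0.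
    + by move=> t; rewrite -EFinM lee_fin mulr_ge0 ?(ltW n0)// !mulr_ge0 ?powR_ge0.
  - by mfun.
  - by move=> t; rewrite lee_fin !mulr_ge0 ?powR_ge0.
  - by mfun.
  - by move=> t; rewrite lee_fin !mulr_ge0 ?powR_ge0.
have dF (t : R) : (0 < t)%R -> (t < Y)%R -> is_derive t 1%R F (f t).
  move=> t0 tY; have Yt : (0 < Y - t)%R by rewrite subr_gt0.
  have d1 := is_derive1_powR (nu + s) t0.
  have dm : is_derive t 1%R (fun t : R => Y - t)%R (-1)%R by apply: (is_derive_eq (is_deriveB (is_derive_cst Y t 1%R) (is_derive_id t 1%R))); rewrite sub0r.
  have d2 := is_derive1_powR (- s) Yt.
  have d3 := @is_derive1_comp R (fun w => w `^ (- s))%R (fun t : R => Y - t)%R _ _ _ d2 dm.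
  have d4 : is_derive t 1%R (fun t : R => (Y - t) `^ (- s))%R (- s * (Y - t) `^ (- s - 1) * -1)%R by exact: d3.
  apply: (is_derive_eq (is_deriveM d1 d4)); rewrite /GRing.scale/= /f.
  have tE : (t `^ (nu + s) = t `^ (nu + s - 1) * t)%R by rewrite powRB1// divfK// gt_eqF.
  have YE : ((Y - t) `^ (- s) = (Y - t) `^ (- s - 1) * (Y - t))%R by rewrite powRB1// divfK// gt_eqF.
  by rewrite tE YE [(s + nu)%R]addrC; ring.
have cF (t : R) : (0 < t)%R -> (t < Y)%R -> F x @[x --> t] --> F t.
  by move=> t0 tY; exact: is_derive_cvg (dF t t0 tY).
have cp (a t : R) : (0 < t)%R -> (fun t : R => t `^ a)%R @ t --> (t `^ a)%R.
  by move=> t0; exact: is_derive_cvg (is_derive1_powR _ t0).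
have cq (a t : R) : (t < Y)%R -> (fun t : R => (Y - t) `^ a)%R @ t --> ((Y - t) `^ a)%R.
  move=> tY; have Yt : (0 < Y - t)%R by rewrite subr_gt0.
  have dm : is_derive t 1%R (fun t : R => Y - t)%R (-1)%R by apply: (is_derive_eq (is_deriveB (is_derive_cst Y t 1%R) (is_derive_id t 1%R))); rewrite sub0r.
  have d2 := is_derive1_powR a Yt.
  exact: is_derive_cvg (@is_derive1_comp R (fun w => w `^ a)%R (fun t : R => Y - t)%R _ _ _ d2 dm).
rewrite integral_lt_lt.
have -> : (S `^ (nu + s) * (Y - S) `^ (- s) = F S - F 0)%R.
  by rewrite /F powR0 ?gt_eqF// mul0r subr0.
apply: (@ge0_FTC2_oo R f F) => //.
- by move=> t /andP[t0 tS]; apply: dF => //; apply: lt_trans SY.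
- move=> t; rewrite in_itv/= => /andP[t0 tS].
  have tY : (t < Y)%R by apply: lt_trans SY.
  by apply: cvgD; (apply: cvgM; first exact: cvg_cst); (apply: cvgM; [exact: cp|exact: cq]).
- by move=> t _; rewrite addr_ge0// mulr_ge0 ?(ltW n0)// mulr_ge0// powR_ge0.
- rewrite /F powR0 ?gt_eqF//; apply: cvgM; first exact: powR_cvg0.
  by apply: cvg_at_right_filter; apply: cq; apply: lt_trans SY.
- by apply: cvg_at_left_filter; exact: cF.
Qed.

(** The layer formula integrated in [S], with the bad exponent removed by [beta_primitive].
    Integrated against [g], the right side will be a multiple of [S^nu M S] and the Beta term a part
    of the primitive of [t^(nu-1) M t]. *)
Lemma potE : exists2 C : R, (0 < C)%R & forall (S : R) (y : V),
  (0 < S)%R -> (S < enorm y ^+ 2)%R ->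
  pot S y + (C * nu * (enorm y ^+ 2) `^ (- nu))%:E * beta_integral S (enorm y ^+ 2) =
  (C * (enorm y ^+ 2) `^ (- nu) * (S `^ (nu + s) * (enorm y ^+ 2 - S) `^ (- s)))%:E.
Proof.
have [C C0 CE] := layerE s0 s1 m; exists C => // S y S0 SY.
set Y := (enorm y ^+ 2)%R in SY *; have Y0 : (0 < Y)%R by apply: lt_trans SY.
have n0 := nu_gt0.
have CY0 : (0 <= C * Y `^ (- nu))%R by rewrite mulr_ge0 ?powR_ge0// ltW.
have h1 : 0 <= (s * Y)%:E * \int[leb]_t ((0 < t < S)%R%:R * (t `^ (s + nu - 1) * (Y - t) `^ (- s - 1)))%:E.
  apply: mule_ge0; first by rewrite lee_fin; exact: (mulr_ge0 (ltW s0) (ltW Y0)).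
  by apply: integral_ge0 => t _; rewrite lee_fin !mulr_ge0 ?powR_ge0.
have h2 : 0 <= nu%:E * beta_integral S Y.
  apply: mule_ge0; first by rewrite lee_fin ltW.
  by apply: integral_ge0 => t _; rewrite lee_fin !mulr_ge0 ?powR_ge0.
rewrite [RHS]EFinM -(beta_primitive S0 SY) [X in _ = X]ge0_muleDr//.
congr (_ + _); last by rewrite muleA -EFinM mulrAC.
rewrite pot_layers// muleA -EFinM.
have -> : (C * Y `^ (- nu) * (s * Y) = s * (C * Y `^ (1 - nu)))%R.
  by rewrite powRD ?(gt_eqF Y0) ?implybT// powRr1 ?(ltW Y0)//; ring.
have CY1 : (0 <= C * Y `^ (1 - nu))%R by rewrite mulr_ge0 ?powR_ge0// ltW.
rewrite EFinM -muleA; congr (_ * _); rewrite ge0_intZR//.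
- apply: eq_integral => t _; have [/andP[t0 tS]|_] := boolP (0 < t < S)%R; last first.
    by rewrite mul0e mul0r mulr0.
  rewrite CE//; last by apply: lt_trans SY.
  by rewrite -!EFinM !mul1r; congr EFin; rewrite /Y; ring.
- by mfun.
- by move=> t; rewrite !mulr_ge0 ?powR_ge0.
Qed.

Lemma beta_integral_diag (Y : R) : (0 < Y)%R -> beta_integral Y Y = (Y `^ nu)%:E * beta_integral 1 1.
Proof.
move=> Y0; rewrite /beta_integral.
pose f (t : R) : R := ((0 < t < Y)%R%:R * (t `^ (s + nu - 1) * (Y - t) `^ (- s)))%R.
have mf : measurable_fun setT f by rewrite /f; mfun.
have f0 t : (0 <= f t)%R by rewrite !mulr_ge0 ?powR_ge0.
rewrite -(ge0_integral_scaling (f := fun t => (f t)%:E) Y0); last 2 first.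
- exact/measurable_EFinP.
- by move=> t; rewrite lee_fin.
have mfY : measurable_fun setT (fun t : R => f (Y * t)%R).
  by apply: measurableT_comp => //; mfun.
pose h (t : R) : R := ((0 < t < 1)%R%:R * (t `^ (s + nu - 1) * (1 - t) `^ (- s)))%R.
have mh : measurable_fun setT h by rewrite /h; mfun.
have h0 (t : R) : (0 <= h t)%R by rewrite !mulr_ge0 ?powR_ge0.
have fY0 (t : R) : (0 <= f (Y * t))%R by [].
rewrite (ge0_lebZ (ltW Y0) mfY fY0) (ge0_lebZ (powR_ge0 Y nu) mh h0).
apply: eq_integral => t _; congr EFin; rewrite /f /h pmulr_rgt0//.
have -> : (Y * t < Y)%R = (t < 1)%R by rewrite -[ltRHS]mulr1 ltr_pM2l.
have [/andP[t0 t1]|_] := boolP (0 < t < 1)%R; last by rewrite !(mul0r, mulr0).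
rewrite !mul1r powRM ?(ltW Y0) ?(ltW t0)//.
have -> : (Y - Y * t = Y * (1 - t))%R by ring.
rewrite (powRM (- s)) ?(ltW Y0) ?subr_ge0 ?(ltW t1)//.
have <- : (Y * Y `^ (s + nu - 1) * Y `^ (- s) = Y `^ nu)%R.
  rewrite -{1}(powRr1 (ltW Y0)) -!powRD ?(gt_eqF Y0) ?implybT//.
  by congr (_ `^ _)%R; ring.
by ring.
Qed.

Lemma integral_powR_abs (a r : R) : (0 < r)%R -> \int[leb]_t ((`|t - a| < r)%R%:R * `|t - a| `^ (- s))%:E < +oo.
Proof.
move=> r0; have m1 : (0 < 1 - s)%R by rewrite subr_gt0.
pose f (t : R) : R := ((`|t| < r)%R%:R * `|t| `^ (- s))%R.
have mf : measurable_fun setT f by rewrite /f; mfun.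
have f0 t : (0 <= f t)%R by rewrite mulr_ge0 ?powR_ge0.
have mfE : measurable_fun setT (fun t => (f t)%:E) by exact/measurable_EFinP.
have fE0 t : 0 <= (f t)%:E by rewrite lee_fin.
have -> : \int[leb]_t ((`|t - a| < r)%R%:R * `|t - a| `^ (- s))%:E = \int[leb]_t (f t)%:E.
  by rewrite -(ge0_integral_translation (- a)%R mfE fE0).
pose g (t : R) : R := ((0 < t)%R%:R * ((t < r)%R%:R * t `^ (1 - s - 1)))%R.
have mg : measurable_fun setT g by rewrite /g; mfun.
have g0 t : (0 <= g t)%R by rewrite !mulr_ge0 ?powR_ge0.
have Ig : \int[leb]_t (g t)%:E = (r `^ (1 - s) / (1 - s))%:E.
  rewrite -integral_powR_near0E// integral_posE.
  by apply: eq_integral => t _; rewrite -EFinM.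
have mgN : measurable_fun setT (fun t : R => g (- t)%R).
  by apply: measurableT_comp => //; mfun.
apply: (@le_lt_trans _ _ (\int[leb]_t (g t + g (- t)%R)%:E)); last first.
  rewrite -ge0_intDR// (ge0_integral_opp (f := fun t => (g t)%:E)); last 2 first.
  - exact/measurable_EFinP.
  - by move=> t; rewrite lee_fin.
  by rewrite Ig -EFinD ltry.
apply: ge0_int_leR => //; first exact: measurable_funD.
move=> t; rewrite f0 /f /g /=; have -> : (1 - s - 1 = - s)%R by ring.
have [t0|t0|->] := ltgtP t 0%R.
- by rewrite ltr0_norm// oppr_gt0 t0 mul0r add0r mul1r.
- by rewrite gtr0_norm// mul1r lerDl !mulr_ge0 ?powR_ge0.
- by rewrite normr0 powR0 ?mulr0 ?addr_ge0 ?mulr_ge0 ?powR_ge0// oppr_eq0 gt_eqF.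
Qed.

Lemma beta_integral_lty : beta_integral 1 1 < +oo.
Proof.
have sh : (0 < s + 2^-1)%R by rewrite addr_gt0// invr_gt0.
have nu2 : (2^-1 <= nu)%R by rewrite -[leLHS]mul1r ler_wpM2r// ?invr_ge0// ler1n.
pose g1 (t : R) : R := ((0 < t)%R%:R * ((t < 1)%R%:R * t `^ (s + 2^-1 - 1)))%R.
pose g2 (t : R) : R := ((`|t - 1| < 1)%R%:R * `|t - 1| `^ (- s))%R.
have mg1 : measurable_fun setT g1 by rewrite /g1; mfun.
have mg2 : measurable_fun setT g2 by rewrite /g2; mfun.
have g10 t : (0 <= g1 t)%R by rewrite !mulr_ge0 ?powR_ge0.
have g20 t : (0 <= g2 t)%R by rewrite !mulr_ge0 ?powR_ge0.
have I2 : \int[leb]_t (g2 t)%:E < +oo by exact: integral_powR_abs.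
have I1 : \int[leb]_t (g1 t)%:E < +oo.
  rewrite (_ : \int[leb]_t _ = (1 `^ (s + 2^-1) / (s + 2^-1))%:E) ?ltry//.
  rewrite -(integral_powR_near0E sh (@ltr01 R)) integral_posE.
  by apply: eq_integral => t _; rewrite -EFinM.
(* On each half of []0, 1[] only one factor is singular and the other is at most 2; [nu >= 1/2] lets
   the first factor be compared with [t^(s - 1/2)]. *)
apply: (@le_lt_trans _ _ (\int[leb]_t (2 * (g1 t + g2 t))%:E)).
  apply: ge0_int_leR.
  - by mfun.
  - by apply: measurable_funM; [mfun|exact: measurable_funD].
  move=> t; apply/andP; split; first by rewrite !mulr_ge0 ?powR_ge0.
  have [/andP[t0 t1]|_] := boolP (0 < t < 1)%R; last by rewrite mul0r mulr_ge0// addr_ge0.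
  have t10 : (0 < 1 - t)%R by rewrite subr_gt0.
  rewrite /g1 /g2 t0 t1 ltr0_norm ?subr_lt0// opprB ltrBlDr ltrDl t0 !mul1r.
  have two (x : R) : (0 < x)%R -> (2^-1 <= x)%R -> (x^-1 <= 2)%R.
    by move=> x0 x2; rewrite -[leRHS]invrK lef_pV2 ?posrE ?invr_gt0.
  have [th|th] := leP t (2^-1)%R.
    apply: (@le_trans _ _ (2 * t `^ (s + 2^-1 - 1))%R); last first.
      by rewrite ler_pM2l// lerDl powR_ge0.
    rewrite mulrC; apply: ler_pM; rewrite ?powR_ge0//.
      apply: le_trans (two _ t10 _); last by lra.
      by rewrite powRN lef_pV2 ?posrE ?powR_gt0//; apply: ger1_powR; [lra|exact: ltW].
    by apply: ger_powR; [rewrite t0 ltW|rewrite lerD2r lerD2l].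
  apply: (@le_trans _ _ (2 * (1 - t) `^ (- s))%R); last first.
    by rewrite ler_pM2l// lerDr powR_ge0.
  rewrite ler_wpM2r ?powR_ge0//; apply: le_trans (two _ t0 (ltW th)).
  rewrite -(powR_inv1 (ltW t0)); apply: ger_powR; first by rewrite t0 ltW.
  by rewrite lerBrDr addNr addr_ge0// ltW// nu_gt0.
have mg : measurable_fun setT (fun t => g1 t + g2 t)%R by exact: measurable_funD.
have g0 t : (0 <= g1 t + g2 t)%R by rewrite addr_ge0.
rewrite -(ge0_lebZ (ler0n R 2) mg g0).
apply: lte_mul_pinfty; [by rewrite lee_fin|by []|].
rewrite (_ : \int[leb]_t (g1 t + g2 t)%:E = \int[leb]_t (g1 t)%:E + \int[leb]_t (g2 t)%:E).
  exact: lte_add_pinfty.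
by apply/esym; apply: ge0_intDR.
Qed.

(** Radially the singularity is [|t - a|^(-s)], integrable since [s < 1]. The same bound serves the
    Poisson kernel outside the sphere and the error of [trunc_pot_inside] inside it. *)
Lemma near_sphere_lty (a r : R) : (0 <= a)%R -> (0 < r)%R ->
  \int[vol]_y ((enorm y < r)%R%:R * `|enorm y - a| `^ (- s))%:E < +oo.
Proof.
move=> a0 r0; have [k k0 kE] := @radial R m.
pose h (t : R) : \bar R := ((t < r)%R%:R * `|t - a| `^ (- s))%:E.
have mh : measurable_fun setT h by rewrite /h; mfun.
have h0 t : 0 <= h t by rewrite lee_fin mulr_ge0 ?powR_ge0.
rewrite (kE h mh h0) integral_posE.
have ra : (0 < r + a)%R by rewrite ltr_pwDl.
pose g (t : R) : R := ((`|t - a| < r + a)%R%:R * `|t - a| `^ (- s))%R.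
have mg : measurable_fun setT g by rewrite /g; mfun.
have g0 t : (0 <= g t)%R by rewrite mulr_ge0 ?powR_ge0.
have rm : (0 <= r ^+ m)%R by rewrite exprn_ge0// ltW.
apply: (@le_lt_trans _ _ (k%:E * ((r ^+ m)%:E * \int[leb]_t (g t)%:E))).
  apply: lee_wpmul2l; first by rewrite lee_fin ltW.
  rewrite (ge0_lebZ rm mg g0); apply: ge0_int_le.
  - by rewrite /h; mfun.
  - by apply/measurable_EFinP; apply: measurable_funM.
  - by move=> t; rewrite /h -!EFinM lee_fin; have [t0|] := ltP 0%R t; rewrite ?mul0r// !mulr_ge0 ?powR_ge0 ?exprn_ge0// ltW.
  - move=> t; rewrite /h /g -!EFinM lee_fin; have [t0|] := ltP 0%R t; last first.
      by rewrite mul0r !mulr_ge0 ?powR_ge0.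
    have [tr|] := ltP t r; last by rewrite mul0r !mulr0 !mulr_ge0 ?powR_ge0.
    have -> : (`|t - a| < r + a)%R by rewrite ltr_norml; apply/andP; split; lra.
    by rewrite !mul1r ler_wpM2r ?powR_ge0// lerXn2r ?nnegrE ?ltW.
have := integral_powR_abs a ra; rewrite -/(g _) => I.
have Ifin : \int[leb]_t (g t)%:E \is a fin_num by rewrite ge0_fin_numE// integral_ge0// => t _; rewrite lee_fin.
by rewrite -(fineK Ifin) -!EFinM ltry.
Qed.

Lemma sphere_null (a : R) : vol [set y : V | enorm y == a] = 0.
Proof.
have [k k0 kE] := @radial R m.
pose h (t : R) : \bar R := (t == a)%R%:R%:E.
have h0 t : 0 <= h t by rewrite lee_fin ler0n.
have mA : measurable [set t : R | t == a].
  by rewrite (_ : [set t | _] = [set a])//; apply/seteqP; split => t /= /eqP.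
have mh : measurable_fun setT h.
  rewrite (_ : h = EFin \o \1_[set t : R | t == a]); first exact/measurable_EFinP.
  by apply/funext => t; rewrite /h /= indicE mem_setE.
have mS : measurable [set y : V | enorm y == a].
  rewrite -[X in measurable X]setTI.
  exact: (measurable_enorm (@measurable_id _ V setT) measurableT mA).
transitivity (\int[vol]_y h (enorm y)).
  rewrite -[LHS]mul1e -integral_cst// integral_bool.
  by apply: eq_integral => y _; rewrite mule1.
rewrite (kE h mh h0) integral_posE.
rewrite (_ : \int[leb]_t _ = 0) ?mule0//.
rewrite -(integral_set1 (fun t => (0 < t)%R%:R%:E * (t ^+ m)%:E) a).
rewrite (_ : [set a] = [set t : R | t == a]); last by apply/seteqP; split => t /= /eqP.
by rewrite integral_bool; apply: eq_integral => t _; rewrite /h muleA muleC.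
Qed.

End exterior_potential.

(** * Spherical means *)

Section weighted_integrals.
Context {R : realType} {m : nat}.
Variable s : R.
Hypotheses (s0 : 0 < s) (s1 : s < 1).
Local Notation leb := (@lebesgue_measure R).
Local Notation V := 'rV[R]_m.+1.
Local Notation vol := (@vol R m).
Local Notation kern := (kern s).
Local Notation barrier := (barrier s).
Local Notation pot := (pot s).
Local Notation trunc_pot := (trunc_pot s).
Local Notation nu := (m.+1%:R / 2 : R)%R.
Local Notation inv j := (j.+1%:R^-1 : R)%R.
Local Open Scope ereal_scope.

Lemma integral_off_spheres (f f' : V -> \bar R) (a b : R) :
  measurable_fun setT f -> measurable_fun setT f' ->
  (forall y, 0 <= f y) -> (forall y, 0 <= f' y) ->
  (forall y, enorm y != a -> enorm y != b -> f y = f' y) ->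
  \int[vol]_y f y = \int[vol]_y f' y.
Proof.
move=> mf mf' f0 f'0 ff'; apply: ge0_ae_eq_integral => //.
have mS (c : R) : measurable [set y : V | enorm y == c].
  rewrite -[X in measurable X]setTI.
  have mc : measurable [set t : R | t == c].
    by rewrite (_ : [set t | _] = [set c])//; apply/seteqP; split => t /= /eqP.
  exact: (measurable_enorm (@measurable_id _ V setT) measurableT mc).
exists ([set y | enorm y == a] `|` [set y | enorm y == b]); split.
- exact: measurableU.
- by rewrite null_set_setU//; apply: sphere_null.
- move=> y /= h; apply: contrapT => /not_orP[/negP h1 /negP h2]; apply: h => _.
  exact: ff'.
Qed.

Variable g : V -> R.

(** The size conditions on the weight, isolated so that they cover both [|nabla^s u|^2] and the
    constant 1. *)
Definition tame := [/\ measurable_fun setT g, forall x, (0 <= g x)%R,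
  forall r : R, (0 < r)%R -> exists2 B : R, (0 <= B)%R & forall x, (enorm x < r)%R -> (g x <= B)%R &
  \int[vol]_x (g x / (1 + enorm x `^ (m.+1%:R + 2 * s)))%:E < +oo].

Hypothesis tg : tame.
Let mg : measurable_fun setT g. Proof. by case: tg. Qed.
Let g0 x : (0 <= g x)%R. Proof. by case: tg. Qed.

Lemma tame_ball (r : R) (f : V -> R) : (0 < r)%R -> measurable_fun setT f -> (forall x, 0 <= f x)%R ->
  \int[vol]_y ((enorm y < r)%R%:R * f y)%:E < +oo ->
  \int[vol]_y ((enorm y < r)%R%:R * f y * g y)%:E < +oo.
Proof.
move=> r0 mf f0 fin; have [_ _ /(_ r r0) [B B0 gB] _] := tg.
have h0 (y : V) : (0 <= (enorm y < r)%R%:R * f y)%R by rewrite mulr_ge0.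
have mh : measurable_fun setT (fun y : V => (enorm y < r)%R%:R * f y)%R by mfun.
have [v v0 vE] := ge0_int_ltyR h0 fin.
apply: (@le_lt_trans _ _ (\int[vol]_y (B * ((enorm y < r)%R%:R * f y))%:E)); last first.
  by rewrite -ge0_intZR// vE -EFinM ltry.
apply: ge0_int_leR; [by mfun|by mfun|] => y.
rewrite mulr_ge0//=; have [yr|] := ltP (enorm y) r; last by rewrite !mul0r mulr0.
by rewrite mul1r mulrC ler_wpM2r// gB.
Qed.

Lemma tame_far (a : R) : (0 < a)%R ->
  \int[vol]_y ((a <= enorm y)%R%:R * kern y * g y)%:E < +oo.
Proof.
move=> a0; have [_ _ _ fin] := tg.
pose q : R := (m.+1%:R + 2 * s)%R; have q0 : (0 < q)%R by exact: exponent_gt0.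
pose w (y : V) : R := (g y / (1 + enorm y `^ q))%R.
have w0 y : (0 <= w y)%R by rewrite divr_ge0// addr_ge0// powR_ge0.
have mw : measurable_fun setT w by rewrite /w; mfun.
have [v v0 vE] := ge0_int_ltyR w0 fin.
pose C := (1 + a `^ (- q))%R.
have C0 : (0 <= C)%R by rewrite addr_ge0// powR_ge0.
apply: (@le_lt_trans _ _ (\int[vol]_y (C * w y)%:E)); last first.
  by rewrite -ge0_intZR// vE -EFinM ltry.
apply: ge0_int_leR; [by rewrite /kern; mfun|by mfun|] => y.
rewrite !mulr_ge0 ?kern_ge0//=; have [ya|] := leP a (enorm y); last first.
  by rewrite !mul0r mulr_ge0.
have y0 : (0 < enorm y)%R by apply: lt_le_trans ya.
have yq : (0 < enorm y `^ q)%R by rewrite powR_gt0.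
rewrite mul1r mulrC /w mulrCA ler_wpM2l// /kern -/q ler_pdivlMr; last by rewrite addr_gt0.
rewrite mulrDr mulr1 mulVf ?gt_eqF// /C addrC lerD2l powRN lef_pV2 ?posrE ?powR_gt0//.
by apply: ge0_ler_powR; rewrite ?nnegrE ?(ltW q0) ?(ltW a0) ?(ltW y0).
Qed.

(** The Poisson kernel of radius [sqrt S] without its factor [a_ns]. Using the squared radius as
    parameter keeps the powers of [S] and [|y|^2] homogeneous. *)
Definition shell (S : R) (y : V) : R :=
  ((S < enorm y ^+ 2)%R%:R * ((S / (enorm y ^+ 2 - S)) `^ s / enorm y ^+ m.+1))%R.

Lemma shell_ge0 S y : (0 <= shell S y)%R.
Proof. by rewrite mulr_ge0// divr_ge0 ?powR_ge0// exprn_ge0 ?enorm_ge0. Qed.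

Lemma measurable_shell d (T : measurableType d) (f : T -> R) (h : T -> V) :
  measurable_fun setT f -> measurable_fun setT h -> measurable_fun setT (fun x => shell (f x) (h x)).
Proof. by move=> mf mh; rewrite /shell; mfun. Qed.

Definition mean (S : R) : \bar R := \int[vol]_y (shell S y * g y)%:E.

Lemma mean_ge0 S : 0 <= mean S.
Proof. by apply: integral_ge0 => y _; rewrite lee_fin mulr_ge0 ?shell_ge0. Qed.

Lemma mean_lty (S : R) : (0 < S)%R -> mean S < +oo.
Proof.
move=> S0; pose a := Num.sqrt S; have a0 : (0 < a)%R by rewrite sqrtr_gt0.
have aa : (a ^+ 2 = S)%R by rewrite sqr_sqrtr// ltW.
have a20 : (0 < 2 * a)%R by rewrite mulr_gt0.
pose f1 (y : V) : R := ((enorm y < 2 * a)%R%:R * `|enorm y - a| `^ (- s) * g y)%R.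
pose f2 (y : V) : R := ((a <= enorm y)%R%:R * kern y * g y)%R.
have mf1 : measurable_fun setT f1 by rewrite /f1; mfun.
have mf2 : measurable_fun setT f2 by rewrite /f2 /kern; mfun.
have f10 y : (0 <= f1 y)%R by rewrite !mulr_ge0 ?powR_ge0.
have f20 y : (0 <= f2 y)%R by rewrite !mulr_ge0 ?kern_ge0.
have I1 : \int[vol]_y (f1 y)%:E < +oo.
  apply: tame_ball => //; first by mfun.
  exact: near_sphere_lty (ltW a0) a20.
have I2 : \int[vol]_y (f2 y)%:E < +oo by exact: tame_far.
have [v1 _ e1] := ge0_int_ltyR f10 I1; have [v2 _ e2] := ge0_int_ltyR f20 I2.
(* [c1] comes from [|y|^2 - S = (|y| + a) (|y| - a)] with [|y| + a >= a] and [|y| >= a]. Beyond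
   [2 a] one has [|y|^2 >= 2 S], hence [S / (|y|^2 - S) <= 2 S / |y|^2], which is [c2]. *)
pose c1 := (S `^ s * a `^ (- s) / a ^+ m.+1)%R.
pose c2 := ((2 * S) `^ s)%R.
have c10 : (0 <= c1)%R by rewrite !mulr_ge0 ?powR_ge0// invr_ge0 exprn_ge0// ltW.
have c20 : (0 <= c2)%R by exact: powR_ge0.
apply: (@le_lt_trans _ _ (\int[vol]_y (c1 * f1 y + c2 * f2 y)%:E)); last first.
  rewrite -ge0_intDR; [|by mfun|by mfun|by move=> y; rewrite mulr_ge0|by move=> y; rewrite mulr_ge0].
  by rewrite -!ge0_intZR// e1 e2 -!EFinM -EFinD ltry.
have msh : measurable_fun setT (fun y : V => shell S y).
  by apply: measurable_shell; [exact: measurable_cst|exact: measurable_id].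
apply: ge0_int_leR; [by mfun|by mfun|] => y.
rewrite mulr_ge0 ?shell_ge0//= /f1 /f2 !mulrA -mulrDl ler_wpM2r// /shell.
have [yS|_] := ltP S (enorm y ^+ 2)%R; last first.
  by rewrite mul0r addr_ge0// mulr_ge0 ?powR_ge0 ?kern_ge0// mulr_ge0.
have ya : (a < enorm y)%R.
  by rewrite -(@ltr_pXn2r _ 2) ?nnegrE ?enorm_ge0 ?(ltW a0)// aa.
have y0 : (0 < enorm y)%R by apply: lt_trans ya.
have YS : (0 < enorm y ^+ 2 - S)%R by rewrite subr_gt0.
rewrite mul1r (ltW ya) mulr1 -mulrA; have [y2|y2] := ltP (enorm y) (2 * a)%R.
  rewrite /= mul1r.
  apply: (@le_trans _ _ (c1 * `|enorm y - a| `^ (- s))%R); last first.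
    by rewrite lerDl mulr_ge0 ?kern_ge0.
  rewrite gtr0_norm ?subr_gt0// /c1 mulrAC; apply: ler_pM.
  - exact: powR_ge0.
  - by rewrite invr_ge0 exprn_ge0// ltW.
  - rewrite powRM ?(ltW S0) ?invr_ge0 ?(ltW YS)// -mulrA ler_wpM2l ?powR_ge0//.
    rewrite -(powR_inv1 (ltW YS)) -powRrM mulN1r.
    have -> : (enorm y ^+ 2 - S = (enorm y + a) * (enorm y - a))%R by rewrite -aa; ring.
    rewrite powRM ?subr_ge0 ?addr_ge0 ?(ltW y0) ?(ltW a0) ?(ltW ya)//.
    rewrite ler_wpM2r ?powR_ge0// !powRN lef_pV2 ?posrE ?powR_gt0 ?addr_gt0//.
    by apply: ge0_ler_powR; rewrite ?nnegrE ?addr_ge0 ?(ltW y0) ?(ltW a0) ?(ltW s0)// lerDr ltW.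
  - rewrite lef_pV2 ?posrE ?exprn_gt0// lerXn2r ?nnegrE ?(ltW a0) ?(ltW y0)//.
    exact: ltW.
rewrite /= mul0r mulr0 add0r.
have Y2 : (2 * S <= enorm y ^+ 2)%R.
  apply: (@le_trans _ _ ((2 * a) ^+ 2)%R); first by rewrite exprMn aa; nra.
  by rewrite lerXn2r ?nnegrE ?(ltW a20) ?(ltW y0).
have -> : (c2 * kern y = (2 * S) `^ s * (enorm y ^+ 2) `^ (- s) / enorm y ^+ m.+1)%R.
  rewrite /kern -mulrA; congr (_ * _)%R.
  rewrite -(powR_mulrn 2 (ltW y0)) -powRrM -(powR_mulrn m.+1 (ltW y0)) -powRN -powRN.
  by rewrite -powRD ?(gt_eqF y0) ?implybT//; congr (_ `^ _)%R; ring.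
rewrite ler_wpM2r ?invr_ge0 ?exprn_ge0 ?(ltW y0)//.
have Y0 : (0 < enorm y ^+ 2)%R by rewrite exprn_gt0.
rewrite -(mulN1r s) (powRrM (enorm y ^+ 2)) (powR_inv1 (ltW Y0)).
rewrite -powRM ?mulr_ge0 ?invr_ge0 ?(ltW S0) ?(ltW Y0)//.
apply: ge0_ler_powR; rewrite ?nnegrE ?(ltW s0) ?divr_ge0 ?mulr_ge0 ?(ltW S0) ?(ltW YS) ?(ltW Y0) ?(ltW y0)//.
by rewrite ler_pdivrMr// mulrAC ler_pdivlMr//; nra.
Qed.

Lemma tame_barrier (S : R) : (0 < S)%R -> \int[vol]_y (barrier S y * g y)%:E < +oo.
Proof.
move=> S0; pose a := Num.sqrt S; have a0 : (0 < a)%R by rewrite sqrtr_gt0.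
have aa : (a ^+ 2 = S)%R by rewrite sqr_sqrtr// ltW.
have one : \int[vol]_y ((enorm y < a)%R%:R * S `^ s * g y)%:E < +oo.
  apply: tame_ball => //; first by move=> _; exact: powR_ge0.
  under eq_integral do rewrite mulrC.
  rewrite -ge0_intZR ?powR_ge0//; last by mfun.
  have -> : \int[vol]_y ((enorm y < a)%R%:R : R)%:E = vol [set y : V | (enorm y < a)%R].
    rewrite -[RHS]mul1e -integral_cst ?integral_bool; last exact: measurable_enorm_lt.
    by apply: eq_integral => y _; rewrite mule1.
  have v := @enorm_lt_vol_lty R m a.
  by rewrite -(fineK (_ : vol [set y : V | (enorm y < a)%R] \is a fin_num)) ?ge0_fin_numE// -EFinM ltry.
apply: le_lt_trans one; have mb := measurable_barrier s S (@measurable_id _ V setT).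
apply: ge0_int_leR; [by mfun|by mfun|] => y.
rewrite mulr_ge0 ?barrier_ge0//= ler_wpM2r// /barrier.
have [yS|yS] := ltP 0%R (S - enorm y ^+ 2)%R; last first.
  by rewrite ppow_le0E// mulr_ge0// powR_ge0.
have -> : (enorm y < a)%R.
  by rewrite -(@ltr_pXn2r _ 2) ?nnegrE ?enorm_ge0 ?(ltW a0)// aa; move: yS; rewrite subr_gt0.
rewrite mul1r ppow_gt0E//; apply: ge0_ler_powR; rewrite ?nnegrE ?(ltW s0) ?(ltW yS) ?(ltW S0)//.
by rewrite gerBl sqr_ge0.
Qed.

(** Integrability of the function that dominates the truncated Laplacians of the barrier in
    [trunc_pot_inside]. *)
Lemma tame_inside (S A C : R) : (0 < S)%R -> (0 <= A)%R -> (0 <= C)%R ->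
  \int[vol]_y ((enorm y ^+ 2 < S)%R%:R *
    (A + C * (enorm y `^ (2 * s) * (S - enorm y ^+ 2) `^ (- s))) * g y)%:E < +oo.
Proof.
move=> S0 A0 C0; pose a := Num.sqrt S; have a0 : (0 < a)%R by rewrite sqrtr_gt0.
have aa : (a ^+ 2 = S)%R by rewrite sqr_sqrtr// ltW.
pose f1 (y : V) : R := ((enorm y < a)%R%:R * 1 * g y)%R.
pose f2 (y : V) : R := ((enorm y < a)%R%:R * `|enorm y - a| `^ (- s) * g y)%R.
have mf1 : measurable_fun setT f1 by rewrite /f1; mfun.
have mf2 : measurable_fun setT f2 by rewrite /f2; mfun.
have f10 y : (0 <= f1 y)%R by rewrite !mulr_ge0.
have f20 y : (0 <= f2 y)%R by rewrite !mulr_ge0 ?powR_ge0.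
have I1 : \int[vol]_y (f1 y)%:E < +oo.
  apply: tame_ball => //.
  rewrite (_ : \int[vol]_y _ = vol [set y : V | (enorm y < a)%R]); first exact: enorm_lt_vol_lty.
  rewrite -[RHS]mul1e -integral_cst ?integral_bool; last exact: measurable_enorm_lt.
  by apply: eq_integral => y _; rewrite mule1 mulr1.
have I2 : \int[vol]_y (f2 y)%:E < +oo.
  apply: tame_ball => //; first by mfun.
  exact: near_sphere_lty (ltW a0) a0.
have [v1 _ e1] := ge0_int_ltyR f10 I1; have [v2 _ e2] := ge0_int_ltyR f20 I2.
pose c2 := (C * (a `^ (2 * s) * a `^ (- s)))%R.
have c20 : (0 <= c2)%R by rewrite !mulr_ge0 ?powR_ge0.
apply: (@le_lt_trans _ _ (\int[vol]_y (A * f1 y + c2 * f2 y)%:E)); last first.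
  rewrite -ge0_intDR; [|by mfun|by mfun|by move=> y; rewrite mulr_ge0|by move=> y; rewrite mulr_ge0].
  by rewrite -!ge0_intZR// e1 e2 -!EFinM -EFinD ltry.
apply: ge0_int_leR; [by mfun|by mfun|] => y; apply/andP; split.
  by rewrite !mulr_ge0// addr_ge0// !mulr_ge0 ?powR_ge0.
rewrite /f1 /f2 !mulrA -mulrDl ler_wpM2r//.
have [yS|_] := ltP (enorm y ^+ 2)%R S; last first.
  by rewrite mul0r addr_ge0// mulr_ge0 ?powR_ge0// mulr_ge0.
have ya : (enorm y < a)%R.
  by rewrite -(@ltr_pXn2r _ 2) ?nnegrE ?enorm_ge0 ?(ltW a0)// aa.
rewrite ya !mulr1 mul1r lerD2l -!mulrA ler_wpM2l//; apply: ler_pM; rewrite ?powR_ge0//.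
  by apply: ge0_ler_powR; rewrite ?nnegrE ?enorm_ge0 ?(ltW a0) ?(ltW ya)// mulr_ge0// ltW.
rewrite ltr0_norm ?subr_lt0// opprB.
have -> : (S - enorm y ^+ 2 = (a + enorm y) * (a - enorm y))%R by rewrite -aa; ring.
rewrite powRM ?subr_ge0 ?addr_ge0 ?enorm_ge0 ?(ltW a0) ?(ltW ya)//.
rewrite ler_wpM2r ?powR_ge0// !powRN lef_pV2 ?posrE ?powR_gt0// ?ltr_pwDl ?enorm_ge0//.
by apply: ge0_ler_powR; rewrite ?nnegrE ?addr_ge0 ?enorm_ge0 ?(ltW a0) ?(ltW s0)// lerDl enorm_ge0.
Qed.

End weighted_integrals.

Ltac mker := repeat first
  [ progress mfun
  | match goal with
    | |- measurable_fun _ (fun p => barrier _ _ _) => apply: measurable_barrier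
    | |- measurable_fun _ (fun p => kern _ _) => apply: measurable_kern
    | |- measurable_fun _ (fun p => shell _ _ _) => apply: measurable_shell
    | |- measurable_fun _ (kern _) => apply: measurable_kern
    | |- measurable_fun _ (barrier _ _) => apply: measurable_barrier
    | |- measurable_fun _ (shell _ _) => apply: measurable_shell
    | |- measurable_fun _ (fun p => ?g (_ + _)%R) => apply: (measurableT_comp (f := g))
    | |- measurable_fun _ (fun p => ?g (_ p)) => apply: (measurableT_comp (f := g))
    end ].

(** * Testing the inequality against the barriers *)

Section comparison.
Context {R : realType} {m : nat}.
Variable s : R.
Hypotheses (s0 : 0 < s) (s1 : s < 1).
Local Notation leb := (@lebesgue_measure R).
Local Notation V := 'rV[R]_m.+1.
Local Notation vol := (@vol R m).
Local Notation kern := (kern s).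
Local Notation barrier := (barrier s).
Local Notation pot := (pot s).
Local Notation trunc_pot := (trunc_pot s).
Local Notation nu := (m.+1%:R / 2 : R)%R.
Local Notation inv j := (j.+1%:R^-1 : R)%R.
Local Open Scope ereal_scope.

Lemma barrier_le (S1 S2 : R) (x : V) : (S1 <= S2)%R -> (barrier S1 x <= barrier S2 x)%R.
Proof. by move=> S12; apply: ppow_le => //; [exact: ltW|rewrite lerD2r]. Qed.

Section weight.
Variable g : V -> R.
Hypothesis tg : tame s g.
Let mg : measurable_fun setT g. Proof. by case: tg. Qed.
Let g0 x : (0 <= g x)%R. Proof. by case: tg. Qed.

Definition trunc_int (e : R) (x : V) : \bar R :=
  \int[vol]_z ((e <= enorm z)%R%:R * (kern z * g (x + z)%R))%:E.

Lemma trunc_int_ge0 (e : R) (x : V) : 0 <= trunc_int e x.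
Proof. by apply: integral_ge0 => z _; rewrite lee_fin mulr_ge0// mulr_ge0 ?kern_ge0. Qed.

Lemma measurable_trunc_int (e : R) : measurable_fun setT (trunc_int e).
Proof.
apply: (measurable_integral_vol
  (f := fun x z : V => ((e <= enorm z)%R%:R * (kern z * g (x + z)%R))%:E)); first by mker.
by move=> x z; rewrite lee_fin mulr_ge0// mulr_ge0 ?kern_ge0.
Qed.

Lemma trunc_pot_ge0 (e S : R) (y : V) : 0 <= trunc_pot e S y.
Proof. by apply: integral_ge0 => z _; rewrite lee_fin mulr_ge0// mulr_ge0 ?kern_ge0 ?barrier_ge0. Qed.

Lemma measurable_trunc_pot (e S : R) : measurable_fun setT (trunc_pot e S : V -> \bar R).
Proof.
apply: (measurable_integral_vol
  (f := fun y z : V => ((e <= enorm z)%R%:R * (barrier S (y + z)%R * kern z))%:E)); first by mker.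
by move=> x z; rewrite lee_fin mulr_ge0// mulr_ge0 ?kern_ge0 ?barrier_ge0.
Qed.

Definition trunc_energy (e S : R) : \bar R := \int[vol]_y ((g y)%:E * trunc_pot e S y).

(** Symmetry of the truncated kernel: Tonelli and the substitution [y = x + z], then [z] replaced by
    [- z]. All terms being nonnegative, no integrability is involved. *)
Lemma trunc_swap (e S : R) :
  \int[vol]_x ((barrier S x)%:E * trunc_int e x) = trunc_energy e S.
Proof.
rewrite /trunc_energy.
pose F (x y z : V) : R := ((g y) * ((e <= enorm z)%R%:R * (barrier S x * kern z)))%R.
have F0 x y z : 0 <= (F x y z)%:E.
  by rewrite lee_fin /F mulr_ge0// mulr_ge0// mulr_ge0 ?kern_ge0 ?barrier_ge0.
transitivity (\int[vol]_x \int[vol]_z (F x (x + z)%R z)%:E).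
  apply: eq_integral => x _; rewrite -ge0_intZl ?barrier_ge0//; last first.
  - by move=> z; rewrite lee_fin mulr_ge0// mulr_ge0 ?kern_ge0.
  - by mker.
  by apply: eq_integral => z _; rewrite -EFinM /F; congr _%:E; ring.
rewrite vol_tonelli; [|by rewrite /F; mker|by move=> *; exact: F0].
transitivity (\int[vol]_z \int[vol]_y (F (y - z)%R y z)%:E).
  apply: eq_integral => z _.
  transitivity (\int[vol]_x (F (x + z - z)%R (x + z)%R z)%:E).
    by apply: eq_integral => x _; rewrite addrK.
  apply: (ge0_vol_translation (f := fun y : V => (F (y - z)%R y z)%:E) z).
  - by rewrite /F; mker.
  - by move=> *; exact: F0.
rewrite -vol_tonelli; [|by rewrite /F; mker|by move=> *; exact: F0].
apply: eq_integral => y _.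
transitivity (\int[vol]_z (F (y - - z)%R y (- z)%R)%:E).
  apply: esym; apply: (ge0_vol_opp (f := fun z : V => (F (y - z)%R y z)%:E)).
  - by rewrite /F; mker.
  - by move=> *; exact: F0.
transitivity (\int[vol]_z ((g y)%:E * ((e <= enorm z)%R%:R * (barrier S (y + z)%R * kern z))%:E)).
  by apply: eq_integral => z _; rewrite -EFinM /F opprK kernN enormN.
apply: ge0_intZl => //; first by mker.
by move=> z; rewrite lee_fin mulr_ge0// mulr_ge0 ?kern_ge0 ?barrier_ge0.
Qed.

(** The hypothesis multiplied by the nonnegative difference of the barriers and integrated, with the
    negative terms moved across. The error is charged to the whole of [barrier S2]. *)
Lemma barrier_comparison (S1 S2 k e eta : R) : (S1 <= S2)%R -> (0 <= k)%R -> (0 <= eta)%R ->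
  (forall x : V, (enorm x ^+ 2 < S2)%R -> (g x * k)%:E <= trunc_int e x + eta%:E) ->
  k%:E * (\int[vol]_x (barrier S2 x * g x)%:E) + trunc_energy e S1 <=
  trunc_energy e S2 + k%:E * (\int[vol]_x (barrier S1 x * g x)%:E) +
  eta%:E * \int[vol]_x (barrier S2 x)%:E.
Proof.
move=> S12 k0 eta0 sub; rewrite -(trunc_swap e S1) -(trunc_swap e S2).
have mb S := measurable_barrier s S (@measurable_id _ V setT).
have mT S : measurable_fun setT (fun x : V => (barrier S x)%:E * trunc_int e x).
  by apply: emeasurable_funM; [mker|exact: measurable_trunc_int].
have T0 S x : 0 <= (barrier S x)%:E * trunc_int e x.
  by rewrite mule_ge0 ?lee_fin ?barrier_ge0 ?trunc_int_ge0.
have b0 S x : 0 <= (barrier S x * g x)%:E by rewrite lee_fin mulr_ge0 ?barrier_ge0.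
have kE S : k%:E * (\int[vol]_x (barrier S x * g x)%:E) = \int[vol]_x (k%:E * (barrier S x * g x)%:E).
  by apply: esym; apply: ge0_intZl => //; mker.
have eE : eta%:E * (\int[vol]_x (barrier S2 (x : V))%:E) = \int[vol]_x (eta%:E * (barrier S2 x)%:E).
  by apply: esym; apply: ge0_intZl => //; [mker|move=> x; rewrite lee_fin barrier_ge0].
rewrite [X in _ <= _ + X + _](kE S1) [X in X + _ <= _](kE S2) [X in _ <= _ + X]eE {kE eE}.
have kb0 S x : 0 <= k%:E * (barrier S x * g x)%:E by rewrite mule_ge0.
have eb0 S (x : V) : 0 <= eta%:E * (barrier S x)%:E by rewrite mule_ge0// lee_fin ?barrier_ge0.
have mkb S : measurable_fun setT (fun x : V => k%:E * (barrier S x * g x)%:E) by mker.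
have meb S : measurable_fun setT (fun x : V => eta%:E * (barrier S x)%:E) by mker.
rewrite -!ge0_intD//; first last.
- by move=> x; rewrite adde_ge0.
- exact: emeasurable_funD.
apply: ge0_int_le.
- exact: emeasurable_funD.
- by apply: emeasurable_funD => //; exact: emeasurable_funD.
- by move=> x; rewrite adde_ge0.
move=> x; have [xS|xS] := ltP (enorm x ^+ 2)%R S2; last first.
  have z S : (S <= S2)%R -> barrier S x = 0%R.
    by move=> SS2; rewrite /barrier ppow_le0E// subr_le0 (le_trans SS2).
  by rewrite !z// !(mul0r, mule0, mul0e, adde0).
have := barrier_le x S12; have b1 := barrier_ge0 s S1 x; have b2 := barrier_ge0 s S2 x.
have := sub x xS; have := trunc_int_ge0 e x; case: (trunc_int e x) => [t| |]//.
  rewrite -!EFinM -!EFinD !lee_fin => t0 h b12.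
  have : (0 <= (barrier S2 x - barrier S1 x) * (t + eta - g x * k) + eta * barrier S1 x)%R.
    by apply: addr_ge0; [apply: mulr_ge0; rewrite subr_ge0|exact: mulr_ge0].
  by move: h b12 => _ _; lra.
(* Where [trunc_int] is infinite, the positivity of [barrier S2] makes the right side infinite. *)
move=> _ _ _; have bp : (0 < barrier S2 x)%R.
  by rewrite /barrier ppow_gt0E ?subr_gt0// powR_gt0// subr_gt0.
rewrite (gt0_muley (x := (barrier S2 x)%:E)) ?lte_fin//.
by rewrite -addeA addye ?leey// gt_eqF// (lt_le_trans (ltNy0 R))// adde_ge0.
Qed.

Lemma pot_ge0 (S : R) (y : V) : 0 <= pot S y.
Proof. by apply: integral_ge0 => z _; rewrite lee_fin mulr_ge0 ?kern_ge0 ?barrier_ge0. Qed.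

Lemma measurable_pot (S : R) : measurable_fun setT (pot S : V -> \bar R).
Proof.
apply: (measurable_integral_vol (f := fun y z : V => (barrier S (y + z)%R * kern z)%:E)); first by mker.
by move=> x z; rewrite lee_fin mulr_ge0 ?kern_ge0 ?barrier_ge0.
Qed.

Lemma le_trunc_pot (e e' S : R) (y : V) : (e' <= e)%R -> trunc_pot e S y <= trunc_pot e' S y.
Proof.
move=> ee'; apply: ge0_int_leR; [by mker|by mker|] => z.
have bk0 : (0 <= barrier S (y + z)%R * kern z)%R by rewrite mulr_ge0 ?kern_ge0 ?barrier_ge0.
apply/andP; split; [exact: mulr_ge0|apply: ler_wpM2r => //].
by rewrite ler_nat; case: (leP e (enorm z)) => // /(le_trans ee') ->.
Qed.

Definition exterior (S : R) : \bar R :=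
  \int[vol]_y ((S < enorm y ^+ 2)%R%:R%:E * ((g y)%:E * pot S y)).

Definition ball_mass (S : R) : \bar R := \int[vol]_y ((enorm y ^+ 2 < S)%R%:R * g y)%:E.

Lemma ball_mass_lty (S : R) : (0 < S)%R -> ball_mass S < +oo.
Proof.
move=> S0; have := tame_inside s0 s1 tg S0 (@ler01 R) (lexx 0%R).
by apply: le_lt_trans; rewrite le_eqVlt; apply/orP; left; apply/eqP; apply: eq_integral => y _;
  rewrite mul0r addr0 mulr1.
Qed.

(** Outside the ball the truncated potentials increase as [e] decreases, so monotone convergence
    applies without any bound. The sphere itself is negligible, which turns [<=] into [<]. *)
Lemma outer_cvg (S : R) : (0 < S)%R ->
  (fun j => \int[vol]_y ((S <= enorm y ^+ 2)%R%:R%:E * ((g y)%:E * trunc_pot (inv j) S y)))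
    @ \oo --> exterior S.
Proof.
move=> S0.
pose h (j : nat) (y : V) : \bar R := (S <= enorm y ^+ 2)%R%:R%:E * ((g y)%:E * trunc_pot (inv j) S y).
have mh j : measurable_fun setT (h j).
  apply: emeasurable_funM; first by mfun.
  by apply: emeasurable_funM; [mfun|exact: measurable_trunc_pot].
have h0 j y : setT y -> 0 <= h j y by move=> _; rewrite !mule_ge0 ?lee_fin ?trunc_pot_ge0.
have nd y : setT y -> {homo h^~ y : i j / (i <= j)%N >-> i <= j}.
  move=> _ i j ij; rewrite /h; apply: lee_wpmul2l; first by rewrite lee_fin.
  apply: lee_wpmul2l; first by rewrite lee_fin.
  by apply: le_trunc_pot; rewrite lef_pV2 ?posrE// ler_nat.
have /(_ vol) := cvg_monotone_convergence measurableT mh h0 nd.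
suff -> : \int[vol]_(y in setT) (limn (h^~ y)) = exterior S by [].
have lim_h (y : V) : limn (h^~ y) = (S <= enorm y ^+ 2)%R%:R%:E * ((g y)%:E * pot S y).
  apply/cvg_lim => //; apply: cvgeZl => //; apply: cvgeZl => //.
  apply: cvg_truncated => //; first by mker.
  by move=> z; rewrite barrier_ge0.
rewrite (eq_integral (fun y => (S <= enorm y ^+ 2)%R%:R%:E * ((g y)%:E * pot S y))); last first.
  by move=> y _; exact: lim_h.
have aa : (Num.sqrt S ^+ 2 = S)%R by rewrite sqr_sqrtr// ltW.
apply: (integral_off_spheres (a := Num.sqrt S) (b := Num.sqrt S)).
- by apply: emeasurable_funM; [mfun|apply: emeasurable_funM; [mfun|exact: measurable_pot]].
- by apply: emeasurable_funM; [mfun|apply: emeasurable_funM; [mfun|exact: measurable_pot]].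
- by move=> y; rewrite !mule_ge0 ?lee_fin ?pot_ge0.
- by move=> y; rewrite !mule_ge0 ?lee_fin ?pot_ge0.
move=> y yS _; rewrite le_eqVlt (_ : (S == _) = false)//.
apply/negbTE; apply: contraNN yS => /eqP yS.
by rewrite yS sqrtr_sqr ger0_norm ?enorm_ge0.
Qed.

(** Inside, the potential diverges like [k e^(-2s)] times the barrier. [I] is the integral of the
    difference, an integrable function of varying sign, and converges by domination with
    [tame_inside]. *)
Lemma inner_cvg (S k A C : R) : (0 < S)%R -> (0 <= k)%R -> (0 <= A)%R -> (0 <= C)%R ->
  (forall y : V, (enorm y ^+ 2 < S)%R ->
    let L (e : R) := ((S - enorm y ^+ 2) `^ s * (k * e `^ (- (2 * s))) - fine (trunc_pot e S y))%R in
    (forall e, (0 < e)%R -> trunc_pot e S y < +oo /\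
      (`|L e| <= A + C * (enorm y `^ (2 * s) * (S - enorm y ^+ 2) `^ (- s)))%R) /\
    (fun j : nat => L (inv j)) @ \oo --> A) ->
  exists I : nat -> R,
    (forall j, \int[vol]_y ((enorm y ^+ 2 < S)%R%:R%:E * ((g y)%:E * trunc_pot (inv j) S y)) =
       ((k * inv j `^ (- (2 * s)))%:E * \int[vol]_x (barrier S x * g x)%:E) - (I j)%:E) /\
    (fun j => (I j)%:E) @ \oo --> A%:E * ball_mass S.
Proof.
move=> S0 k0 A0 C0 inside.
pose ke (j : nat) : R := (k * inv j `^ (- (2 * s)))%R.
have ke0 j : (0 <= ke j)%R by rewrite mulr_ge0 ?powR_ge0.
pose l (j : nat) (y : V) : R := ((enorm y ^+ 2 < S)%R%:R *
  (g y * (barrier S y * ke j - fine (trunc_pot (inv j) S y))))%R.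
pose B (y : V) : R := ((enorm y ^+ 2 < S)%R%:R *
  (A + C * (enorm y `^ (2 * s) * (S - enorm y ^+ 2) `^ (- s))) * g y)%R.
have mb := measurable_barrier s S (@measurable_id _ V setT).
have ml j : measurable_fun setT (l j).
  rewrite /l; apply: measurable_funM; first by mfun.
  apply: measurable_funM => //; apply: measurable_funB; first by mfun.
  by apply: measurableT_comp => //; exact: measurable_trunc_pot.
have B0 y : (0 <= B y)%R.
  by rewrite mulr_ge0// mulr_ge0// addr_ge0// mulr_ge0// mulr_ge0 ?powR_ge0.
have mB : measurable_fun setT B by rewrite /B; mfun.
have iB : vol.-integrable setT (EFin \o B).
  apply/integrableP; split; first exact/measurable_EFinP.
  under eq_integral do rewrite /= ger0_norm//.
  exact: tame_inside.
have bS (y : V) : (enorm y ^+ 2 < S)%R -> barrier S y = ((S - enorm y ^+ 2) `^ s)%R.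
  by move=> yS; rewrite /barrier ppow_gt0E// subr_gt0.
have invp j : (0 < inv j)%R by rewrite invr_gt0.
have lB j y : (`|l j y| <= B y)%R.
  rewrite /l /B; have [yS|_] := ltP (enorm y ^+ 2)%R S; last by rewrite !mul0r normr0.
  rewrite !mul1r normrM (ger0_norm (g0 y)) mulrC ler_wpM2r// bS//.
  by have [/(_ _ (invp j))[]] := inside y yS.
have il j : vol.-integrable setT (EFin \o l j).
  apply: (le_integrable measurableT _ _ iB); first exact/measurable_EFinP.
  by move=> y _ /=; rewrite lee_fin (ger0_norm (B0 y)).
have ib j : vol.-integrable setT (EFin \o (fun y : V => ke j * (barrier S y * g y))%R).
  apply/integrableP; split; first by apply/measurable_EFinP; mfun.
  have b0 y : (0 <= barrier S y * g y)%R by rewrite mulr_ge0 ?barrier_ge0.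
  rewrite (eq_integral (fun y : V => (ke j * (barrier S y * g y))%:E)); last first.
    by move=> y _ /=; rewrite ger0_norm// mulr_ge0.
  rewrite -ge0_intZR//; last by mfun.
  have [v _ ->] := ge0_int_ltyR b0 (tame_barrier s0 tg S0).
  by rewrite -EFinM ltry.
exists (fun j => fine (\int[vol]_y (l j y)%:E)); split=> [j|].
  rewrite fineK; last exact: integrable_fin_num (il j).
  have b0 y : (0 <= barrier S y * g y)%R by rewrite mulr_ge0 ?barrier_ge0.
  rewrite -[(k * _)%R]/(ke j) ge0_intZR//; last by mfun.
  rewrite -integralB_EFin//; apply: eq_integral => y _; rewrite /l.
  have [yS|yS] := ltP (enorm y ^+ 2)%R S.
    have [/(_ _ (invp j))[Tfin _] _] := inside y yS.
    rewrite -[in LHS](fineK (_ : trunc_pot (inv j) S y \is a fin_num)); last first.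
      by rewrite ge0_fin_numE ?trunc_pot_ge0.
    by rewrite mul1e mul1r -EFinM -EFinD; congr _%:E; ring.
  have -> : barrier S y = 0%R by rewrite /barrier ppow_le0E// subr_le0.
  by rewrite !(mul0e, mul0r, mulr0) sube0.
have -> : (fun j => (fine (\int[vol]_y (l j y)%:E))%:E) = (fun j => \int[vol]_y (l j y)%:E).
  by apply/funext => j; rewrite fineK//; exact: integrable_fin_num (il j).
have -> : A%:E * ball_mass S = \int[vol]_y ((enorm y ^+ 2 < S)%R%:R * (g y * A))%:E.
  rewrite /ball_mass ge0_intZR//; [|by mfun|by move=> y; rewrite mulr_ge0].
  by apply: eq_integral => y _; congr _%:E; ring.
apply: (dominated_cvg measurableT (g := EFin \o B)) => //.
- by move=> j; exact/measurable_EFinP.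
- move=> y _; apply: cvg_EFin; first by apply: nearW.
  rewrite (_ : fine \o _ = l^~ y)//.
  rewrite /l; have [yS|_] := ltP (enorm y ^+ 2)%R S; last by under eq_fun do rewrite mul0r; rewrite mul0r; exact: cvg_cst.
  apply: cvgMr; apply: cvgMr.
  have [_] := inside y yS; rewrite /ke bS//.
- by move=> j y _; rewrite lee_fin.
Qed.

End weight.
End comparison.

(** * The exterior term expressed by spherical means *)

Section spherical_means.
Context {R : realType} {m : nat}.
Variable s : R.
Hypotheses (s0 : 0 < s) (s1 : s < 1).
Local Notation leb := (@lebesgue_measure R).
Local Notation V := 'rV[R]_m.+1.
Local Notation vol := (@vol R m).
Local Notation kern := (kern s).
Local Notation barrier := (barrier s).
Local Notation pot := (pot s).
Local Notation trunc_pot := (trunc_pot s).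
Local Notation beta := (@beta_integral R m s).
Local Notation nu := (m.+1%:R / 2 : R)%R.
Local Notation inv j := (j.+1%:R^-1 : R)%R.
Local Open Scope ereal_scope.

Lemma enorm_powR (y : V) : (enorm y ^+ m.+1 = (enorm y ^+ 2) `^ nu)%R.
Proof.
rewrite -(powR_mulrn 2 (enorm_ge0 y)) -powRrM -(powR_mulrn m.+1 (enorm_ge0 y)).
by congr (_ `^ _)%R; field.
Qed.

(** The constant 1 is the weight that determines [kappa]; it also gives the finiteness of the
    integral of the barrier in [gap_le]. *)
Lemma tame_one : tame s (fun _ : V => 1%R).
Proof.
split=> //; first by move=> r _; exists 1%R.
have [k k0 kE] := kern_tail (m := m) s0.
pose q : R := (m.+1%:R + 2 * s)%R.
pose f1 (y : V) : R := (enorm y < 1)%R%:R.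
pose f2 (y : V) : R := ((1 <= enorm y)%R%:R * kern y)%R.
have mf1 : measurable_fun setT f1 by rewrite /f1; mfun.
have mf2 : measurable_fun setT f2 by rewrite /f2 /kern; mfun.
have f20 y : (0 <= f2 y)%R by rewrite mulr_ge0 ?kern_ge0.
apply: (@le_lt_trans _ _ (\int[vol]_y (f1 y + f2 y)%:E)).
  apply: ge0_int_leR; [by mfun|by mfun|] => y.
  have p0 : (0 <= enorm y `^ q)%R by exact: powR_ge0.
  rewrite divr_ge0 ?addr_ge0//= mul1r /f1 /f2; have [_|y1] := ltP (enorm y) 1%R.
    by rewrite /= mul0r addr0 invf_le1 ?lerDl// ltr_pwDl.
  rewrite (_ : (false : nat)%:R = 0 :> R)%R// add0r mul1r /kern lef_pV2 ?posrE ?ltr_pwDl//.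
    by rewrite lerDr.
  by rewrite powR_gt0// (lt_le_trans _ y1).
rewrite -ge0_intDR// (kE 1%R)//.
have -> : \int[vol]_y (f1 y)%:E = vol [set y : V | (enorm y < 1)%R].
  rewrite -[RHS]mul1e -integral_cst ?integral_bool; last exact: measurable_enorm_lt.
  by apply: eq_integral => y _; rewrite mule1.
have v := @enorm_lt_vol_lty R m 1%R.
by rewrite lte_add_pinfty// ltry.
Qed.

(** Seen from [y], the shells of parameter [t] are present only for [t < |y|^2], whence the
    minimum. *)
Lemma layer_integral (S : R) (y : V) : (0 < enorm y)%R -> (enorm y ^+ 2 != S)%R ->
  \int[leb]_t ((0 < t < S)%R%:R * t `^ (nu - 1) * shell s t y)%:E =
  ((enorm y ^+ 2) `^ (- nu))%:E * beta (Num.min S (enorm y ^+ 2)%R) (enorm y ^+ 2).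
Proof.
move=> y0 yS; set Y := (enorm y ^+ 2)%R; have Y0 : (0 < Y)%R by rewrite exprn_gt0.
rewrite /beta_integral ge0_lebZ ?powR_ge0//; [|by mfun|by move=> t; rewrite !mulr_ge0 ?powR_ge0].
apply: eq_integral => t _; congr _%:E; rewrite /shell enorm_powR -/Y lt_min.
have [t0|] := ltP 0%R t; last by rewrite /= !mul0r mulr0.
have [tS|] := ltP t S; last by rewrite /= !mul0r mulr0.
have [tY|] := ltP t Y; last by rewrite /= !(mul0r, mulr0).
have tY0 : (0 < Y - t)%R by rewrite subr_gt0.
rewrite /= !mul1r powRM ?invr_ge0 ?(ltW t0) ?(ltW tY0)//.
rewrite -(powR_inv1 (ltW tY0)) -powRrM mulN1r -powRN.
rewrite (_ : s + nu - 1 = (nu - 1) + s)%R; last by ring.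
by rewrite (powRD (x := t) (r := nu - 1)) ?(gt_eqF t0) ?implybT//; ring.
Qed.

Section weight.
Variable g : V -> R.
Hypothesis tg : tame s g.
Let mg : measurable_fun setT g. Proof. by case: tg. Qed.
Let g0 x : (0 <= g x)%R. Proof. by case: tg. Qed.
Local Notation mean := (mean s g).

Definition primitive (S : R) : \bar R :=
  \int[leb]_t (((0 < t < S)%R%:R * t `^ (nu - 1))%:E * mean t).

Definition tail_mass (S : R) : \bar R := \int[vol]_y ((S < enorm y ^+ 2)%R%:R%:E *
  ((g y)%:E * (((enorm y ^+ 2) `^ (- nu))%:E * beta S (enorm y ^+ 2)))).

Lemma beta_ge0 (S Y : R) : 0 <= beta S Y.
Proof. by apply: integral_ge0 => t _; rewrite lee_fin !mulr_ge0 ?powR_ge0. Qed.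

Lemma measurable_beta (S : R) : measurable_fun setT (fun y : V => beta S (enorm y ^+ 2)).
Proof.
apply: (measurable_integral_leb (f := fun (y : V) t =>
  ((0 < t < S)%R%:R * (t `^ (s + nu - 1) * (enorm y ^+ 2 - t) `^ (- s)))%:E)); first by mfun.
by move=> y t; rewrite lee_fin !mulr_ge0 ?powR_ge0.
Qed.

Lemma measurable_mean : measurable_fun setT (mean : R -> \bar R).
Proof.
apply: (measurable_integral_vol (f := fun (t : R) (y : V) => (shell s t y * g y)%:E)); first by mker.
by move=> t y; rewrite lee_fin mulr_ge0 ?shell_ge0.
Qed.

Lemma tail_integrand_ge0 (S : R) (y : V) : 0 <= (S < enorm y ^+ 2)%R%:R%:E *
  ((g y)%:E * (((enorm y ^+ 2) `^ (- nu))%:E * beta S (enorm y ^+ 2))).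
Proof. by rewrite !mule_ge0 ?lee_fin ?powR_ge0 ?beta_ge0. Qed.

Lemma measurable_tail_integrand (S : R) : measurable_fun setT (fun y : V => (S < enorm y ^+ 2)%R%:R%:E *
  ((g y)%:E * (((enorm y ^+ 2) `^ (- nu))%:E * beta S (enorm y ^+ 2)))).
Proof.
apply: emeasurable_funM; first by mfun.
apply: emeasurable_funM; first by mfun.
by apply: emeasurable_funM; [mfun|exact: measurable_beta].
Qed.

(** After exchanging the integrals, points outside the ball contribute [tail_mass]. At a point
    inside, the integral in [t] stops at [|y|^2] and is [B] by homogeneity, whatever the point. *)
Lemma primitiveE (S B : R) : (0 < S)%R -> beta 1 1 = B%:E ->
  primitive S = tail_mass S + B%:E * ball_mass g S.
Proof.
move=> S0 BE; have B0 : (0 <= B)%R by rewrite -lee_fin -BE beta_ge0.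
pose F (y : V) (t : R) : R := ((0 < t < S)%R%:R * t `^ (nu - 1) * (shell s t y * g y))%R.
have F0 y t : 0 <= (F y t)%:E.
  rewrite lee_fin; apply: mulr_ge0; first by rewrite mulr_ge0 ?powR_ge0.
  by rewrite mulr_ge0 ?shell_ge0.
have mF : measurable_fun setT (fun p : V * R => (F p.1 p.2)%:E) by rewrite /F; mker.
transitivity (\int[leb]_t \int[vol]_y (F y t)%:E).
  apply: eq_integral => t _.
  transitivity (\int[vol]_y (((0 < t < S)%R%:R * t `^ (nu - 1))%:E * (shell s t y * g y)%:E)).
    apply: esym; apply: ge0_intZl; first by rewrite mulr_ge0 ?powR_ge0.
    - by mker.
    - by move=> y; rewrite lee_fin mulr_ge0 ?shell_ge0.
  by apply: eq_integral => y _; rewrite -EFinM.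
rewrite -(vol_leb_tonelli mF F0).
pose tl (y : V) : \bar R := (S < enorm y ^+ 2)%R%:R%:E *
  ((g y)%:E * (((enorm y ^+ 2) `^ (- nu))%:E * beta S (enorm y ^+ 2))).
pose bl (y : V) : \bar R := B%:E * ((enorm y ^+ 2 < S)%R%:R * g y)%:E.
have bl0 y : 0 <= bl y by rewrite mule_ge0// lee_fin mulr_ge0.
have tl0 y : 0 <= tl y by exact: tail_integrand_ge0.
have mbl : measurable_fun setT bl by rewrite /bl; mfun.
have mtl : measurable_fun setT tl by exact: measurable_tail_integrand.
transitivity (\int[vol]_y (tl y + bl y)); last first.
  rewrite ge0_intD//; congr (_ + _); apply: ge0_intZl => //; first by mfun.
  by move=> y; rewrite lee_fin mulr_ge0.
have aa : (Num.sqrt S ^+ 2 = S)%R by rewrite sqr_sqrtr// ltW.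
apply: (integral_off_spheres (a := 0%R) (b := Num.sqrt S)).
- exact: (measurable_integral_leb (f := fun y t => (F y t)%:E)).
- exact: emeasurable_funD.
- by move=> y; apply: integral_ge0 => t _; exact: F0.
- by move=> y; rewrite adde_ge0.
move=> y y0 yS; have {}y0 : (0 < enorm y)%R by rewrite lt_def y0 enorm_ge0.
have YS : (enorm y ^+ 2 != S)%R.
  by apply: contraNN yS => /eqP <-; rewrite sqrtr_sqr ger0_norm ?enorm_ge0.
have Y0 : (0 < enorm y ^+ 2)%R by rewrite exprn_gt0.
transitivity ((g y)%:E * \int[leb]_t ((0 < t < S)%R%:R * t `^ (nu - 1) * shell s t y)%:E).
  rewrite ge0_lebZ//; last first.
  - move=> t; apply: mulr_ge0; last exact: shell_ge0.
    by rewrite mulr_ge0 ?powR_ge0.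
  - by mker.
  by apply: eq_integral => t _; congr _%:E; rewrite /F; ring.
rewrite layer_integral// /tl /bl; have [yS'|yS'] := ltP S (enorm y ^+ 2)%R.
  by rewrite (lt_gtF yS') mul0r mule0 adde0 mul1e.
have {}yS' : (enorm y ^+ 2 < S)%R by rewrite lt_neqAle YS.
rewrite yS' mul0e add0e mul1r beta_integral_diag// BE -!EFinM; congr _%:E.
by rewrite [X in (_ * X)%R]mulrA -powRD ?(gt_eqF Y0) ?implybT// addNr powRr0 mul1r mulrC.
Qed.

Variable K : R.
Hypothesis K0 : (0 < K)%R.
Hypothesis potK : forall (S : R) (y : V), (0 < S)%R -> (S < enorm y ^+ 2)%R ->
  pot S y + (K * nu * (enorm y ^+ 2) `^ (- nu))%:E * beta S (enorm y ^+ 2) =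
  (K * (enorm y ^+ 2) `^ (- nu) * (S `^ (nu + s) * (enorm y ^+ 2 - S) `^ (- s)))%:E.

(** [potK] integrated against [g] outside the ball; its right side is [K S^nu] times [shell S y].
    Finiteness of [exterior] and [tail_mass] then follows from that of [mean]. *)
Lemma exterior_tail (S : R) : (0 < S)%R ->
  exterior s g S + (K * nu)%:E * tail_mass S = (K * S `^ nu)%:E * mean S.
Proof.
move=> S0.
pose tl (y : V) : \bar R := (S < enorm y ^+ 2)%R%:R%:E *
  ((g y)%:E * (((enorm y ^+ 2) `^ (- nu))%:E * beta S (enorm y ^+ 2))).
have tl0 y : 0 <= tl y by exact: tail_integrand_ge0.
have mtl : measurable_fun setT tl by exact: measurable_tail_integrand.
have Kn0 : (0 <= K * nu)%R by rewrite mulr_ge0 ?(ltW K0)// divr_ge0.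
have KS0 : (0 <= K * S `^ nu)%R by rewrite mulr_ge0 ?(ltW K0)// powR_ge0.
transitivity (exterior s g S + \int[vol]_y ((K * nu)%:E * tl y)).
  by congr (_ + _); apply: esym; exact: ge0_intZl.
transitivity (\int[vol]_y ((S < enorm y ^+ 2)%R%:R%:E * ((g y)%:E * pot S y) + (K * nu)%:E * tl y)).
  apply: esym; apply: ge0_intD.
  - by apply: emeasurable_funM; [mfun|apply: emeasurable_funM; [mfun|exact: measurable_pot]].
  - by apply: emeasurable_funM; [mfun|].
  - by move=> y; rewrite !mule_ge0 ?lee_fin ?pot_ge0.
  - by move=> y; rewrite mule_ge0.
transitivity (\int[vol]_y ((K * S `^ nu)%:E * (shell s S y * g y)%:E)); last first.
  apply: ge0_intZl => //; first by mker.
  by move=> y; rewrite lee_fin mulr_ge0 ?shell_ge0.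
apply: eq_integral => y _; rewrite /tl /shell.
have [yS|_] := ltP S (enorm y ^+ 2)%R; last by rewrite !(mul0r, mul0e, mule0) adde0.
have Y0 : (0 < enorm y ^+ 2)%R by exact: lt_trans yS.
have YS0 : (0 < enorm y ^+ 2 - S)%R by rewrite subr_gt0.
rewrite !mul1e muleCA (muleA (K * nu)%:E) -EFinM -ge0_muleDr ?mule_ge0 ?lee_fin ?mulr_ge0 ?powR_ge0 ?pot_ge0 ?beta_ge0 ?(ltW K0)//.
rewrite potK// -!EFinM; congr _%:E; rewrite mul1r enorm_powR.
rewrite powRM ?invr_ge0 ?(ltW S0) ?(ltW YS0)//.
rewrite -(powR_inv1 (ltW YS0)) -powRrM mulN1r -powRN powRD ?(gt_eqF S0) ?implybT//.
by ring.
Qed.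

Lemma exterior_lty (S : R) : (0 < S)%R -> exterior s g S < +oo.
Proof.
move=> S0; have E := exterior_tail S0.
apply: (@le_lt_trans _ _ ((K * S `^ nu)%:E * mean S)); last first.
  apply: lte_mul_pinfty; [by rewrite lee_fin mulr_ge0 ?(ltW K0) ?powR_ge0|by []|].
  exact: mean_lty.
rewrite -{}E leeDl// mule_ge0 ?lee_fin ?mulr_ge0 ?(ltW K0)//.
by apply: integral_ge0 => y _; exact: tail_integrand_ge0.
Qed.

Lemma tail_mass_lty (S : R) : (0 < S)%R -> tail_mass S < +oo.
Proof.
move=> S0; have E := exterior_tail S0.
have Kn0 : (0 < K * nu)%R by rewrite mulr_gt0// divr_gt0.
rewrite -(@lte_pmul2l _ (K * nu)%:E)// ?lte_fin//.
rewrite gt0_muley ?lte_fin//.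
apply: (@le_lt_trans _ _ ((K * S `^ nu)%:E * mean S)); last first.
  apply: lte_mul_pinfty; [by rewrite lee_fin mulr_ge0 ?(ltW K0) ?powR_ge0|by []|].
  exact: mean_lty.
rewrite -{}E leeDr//; apply: integral_ge0 => y _.
by rewrite !mule_ge0 ?lee_fin ?pot_ge0.
Qed.

End weight.
End spherical_means.

(** * The tested inequality in the limit of vanishing truncation *)

Section monotonicity.
Context {R : realType} {m : nat}.
Variable s : R.
Hypotheses (s0 : 0 < s) (s1 : s < 1).
Local Notation leb := (@lebesgue_measure R).
Local Notation V := 'rV[R]_m.+1.
Local Notation vol := (@vol R m).
Local Notation kern := (kern s).
Local Notation barrier := (barrier s).
Local Notation pot := (pot s).
Local Notation trunc_pot := (trunc_pot s).
Local Notation beta := (@beta_integral R m s).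
Local Notation nu := (m.+1%:R / 2 : R)%R.
Local Notation inv j := (j.+1%:R^-1 : R)%R.
Local Open Scope ereal_scope.

(** These constants and their properties are produced by [kern_tail], [trunc_pot_inside] and [potE].
    They are fixed here, before the weight, because the argument for [kappa] uses the same constants
    with the weight 1 as with [g]. *)
Variables k A D : R.
Hypotheses (k0 : (0 < k)%R) (A0 : (0 <= A)%R) (D0 : (0 <= D)%R).
Hypothesis kE : forall e : R, (0 < e)%R ->
  \int[vol]_z ((e <= enorm z)%R%:R * kern z)%:E = (k * e `^ (- (2 * s)))%:E.
Hypothesis inside : forall (S : R) (y : V), (enorm y ^+ 2 < S)%R ->
  let L (e : R) := ((S - enorm y ^+ 2) `^ s * (k * e `^ (- (2 * s))) - fine (trunc_pot e S y))%R in
  (forall e : R, (0 < e)%R -> trunc_pot e S y < +oo /\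
    (`|L e| <= A + D * (enorm y `^ (2 * s) * (S - enorm y ^+ 2) `^ (- s)))%R) /\
  (fun j : nat => L (inv j)) @ \oo --> A.
Variable K : R.
Hypothesis K0 : (0 < K)%R.
Hypothesis potK : forall (S : R) (y : V), (0 < S)%R -> (S < enorm y ^+ 2)%R ->
  pot S y + (K * nu * (enorm y ^+ 2) `^ (- nu))%:E * beta S (enorm y ^+ 2) =
  (K * (enorm y ^+ 2) `^ (- nu) * (S `^ (nu + s) * (enorm y ^+ 2 - S) `^ (- s)))%:E.

Section weight.
Variable g : V -> R.
Hypothesis tg : tame s g.
Let mg : measurable_fun setT g. Proof. by case: tg. Qed.
Let g0 x : (0 <= g x)%R. Proof. by case: tg. Qed.
Local Notation M t := (fine (mean s g t)).
Local Notation P t := (fine (primitive s g t)).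

(* The fractional Laplacian of [barrier S] tested against [g]. *)
Definition gap (S : R) : R := (A * fine (ball_mass g S) - fine (exterior s g S))%R.

Lemma ball_fin_num (S : R) : (0 < S)%R -> ball_mass g S \is a fin_num.
Proof.
move=> S0; rewrite ge0_fin_numE; first exact: (ball_mass_lty s0 s1 tg).
by apply: integral_ge0 => y _; rewrite lee_fin mulr_ge0.
Qed.

Lemma ext_fin_num (S : R) : (0 < S)%R -> exterior s g S \is a fin_num.
Proof.
move=> S0; rewrite ge0_fin_numE; first exact: (exterior_lty s0 s1 tg K0 potK S0).
by apply: integral_ge0 => y _; rewrite !mule_ge0 ?lee_fin ?pot_ge0.
Qed.

(** Isolates the divergent part [k e^(-2s) b] of the energy. The remainder is the inner integral of
    [inner_cvg] minus the truncated exterior term, and each of them converges. *)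
Lemma energy_cvg (S b : R) : (0 < S)%R -> \int[vol]_x (barrier S x * g x)%:E = b%:E ->
  exists v : nat -> R,
    (\forall j \near \oo, trunc_energy s g (inv j) S = (k * inv j `^ (- (2 * s)) * b - v j)%:E) /\
    v @ \oo --> gap S.
Proof.
move=> S0 bE.
have [I [IE Icvg]] := inner_cvg s0 s1 tg S0 (ltW k0) A0 D0 (inside (S := S)).
pose Out (j : nat) := \int[vol]_y ((S <= enorm y ^+ 2)%R%:R%:E * ((g y)%:E * trunc_pot (inv j) S y)).
have [ball_fin ext_fin] := (ball_fin_num S0, ext_fin_num S0).
have Ocvg0 : Out @ \oo --> (fine (exterior s g S))%:E by rewrite fineK//; exact: outer_cvg.
have /fine_cvgP[Ofin Ocvg] := Ocvg0.
have Icvg0 : (fun j => (I j)%:E) @ \oo --> (A * fine (ball_mass g S))%:E by rewrite EFinM fineK.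
have /fine_cvgP[_ Icvg1] := Icvg0.
exists (fun j => I j - fine (Out j))%R; split; last exact: cvgB.
apply: filterS Ofin => j Ofin.
pose In := \int[vol]_y ((enorm y ^+ 2 < S)%R%:R%:E * ((g y)%:E * trunc_pot (inv j) S y)).
have -> : trunc_energy s g (inv j) S = In + Out j.
  have mT := @measurable_trunc_pot R m s (inv j) S.
  transitivity (\int[vol]_y ((enorm y ^+ 2 < S)%R%:R%:E * ((g y)%:E * trunc_pot (inv j) S y) +
     (S <= enorm y ^+ 2)%R%:R%:E * ((g y)%:E * trunc_pot (inv j) S y))).
    apply: eq_integral => y _; case: ltP => _; by rewrite mul1e mul0e ?adde0 ?add0e.
  apply: ge0_intD.
  - by apply: emeasurable_funM; [mfun|apply: emeasurable_funM => //; mfun].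
  - by apply: emeasurable_funM; [mfun|apply: emeasurable_funM => //; mfun].
  - by move=> y; rewrite !mule_ge0 ?lee_fin ?trunc_pot_ge0.
  - by move=> y; rewrite !mule_ge0 ?lee_fin ?trunc_pot_ge0.
rewrite /In IE bE -(fineK Ofin) -EFinM -EFinB -EFinD; congr _%:E; ring.
Qed.

(** Eliminates [tail_mass] between [exterior_tail] and [primitiveE]. The coefficient of [ball_mass]
    is the constant [kappa]. *)
Lemma gap_mean (S B : R) : (0 < S)%R -> beta 1 1 = B%:E ->
  gap S = ((A - K * nu * B) * fine (ball_mass g S) + K * (nu * P S - S `^ nu * M S))%R.
Proof.
move=> S0 BE; have [ball_fin ext_fin] := (ball_fin_num S0, ext_fin_num S0).
have tail_fin : tail_mass s g S \is a fin_num.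
  rewrite ge0_fin_numE; first exact: (tail_mass_lty s0 s1 tg K0 potK S0).
  by apply: integral_ge0 => y _; exact: (tail_integrand_ge0 tg).
have mean_fin : mean s g S \is a fin_num.
  by rewrite ge0_fin_numE ?mean_ge0//; exact: mean_lty.
have := exterior_tail tg K0 potK S0; rewrite -(fineK ext_fin) -(fineK tail_fin) -(fineK mean_fin).
rewrite -!EFinM -EFinD => -[extE].
have := primitiveE tg S0 BE; rewrite -(fineK ball_fin) -(fineK tail_fin) -EFinM -EFinD => ->.
have extE' : fine (exterior s g S) = (K * S `^ nu * M S - K * nu * fine (tail_mass s g S))%R.
  by rewrite -extE addrK.
by rewrite /gap extE' /=; ring.
Qed.

Lemma primitive_lty (S : R) : (0 < S)%R -> primitive s g S < +oo.
Proof.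
move=> S0; have B1 : beta 1 1 \is a fin_num.
  by rewrite ge0_fin_numE ?beta_ge0//; exact: beta_integral_lty.
rewrite (primitiveE tg S0 (esym (fineK B1))) lte_add_pinfty//.
  exact: (tail_mass_lty s0 s1 tg K0 potK S0).
by rewrite lte_mul_pinfty ?lee_fin ?fine_ge0 ?beta_ge0//; exact: (ball_mass_lty s0 s1 tg).
Qed.

(** In [barrier_comparison] the divergent terms [k e^(-2s) b1] and [k e^(-2s) b2] appear on both
    sides and cancel, leaving [v2 j <= v1 j] up to an arbitrarily small error. *)
Lemma gap_le (S1 S2 : R) : (0 < S1)%R -> (S1 <= S2)%R ->
  (forall eta : R, (0 < eta)%R -> exists2 e0 : R, (0 < e0)%R & forall (e : R) (x : V), (0 < e < e0)%R ->
    (enorm x ^+ 2 < S2)%R -> (g x * (k * e `^ (- (2 * s))))%:E <= trunc_int s g e x + eta%:E) ->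
  (gap S2 <= gap S1)%R.
Proof.
move=> S10 S12 sub; have S20 := lt_le_trans S10 S12.
have bg0 S x : (0 <= barrier S x * g x)%R by rewrite mulr_ge0 ?barrier_ge0.
have [b1 _ b1E] := ge0_int_ltyR (bg0 S1) (tame_barrier s0 tg S10).
have [b2 _ b2E] := ge0_int_ltyR (bg0 S2) (tame_barrier s0 tg S20).
have bb0 (x : V) : (0 <= barrier S2 x * 1)%R by rewrite mulr1 barrier_ge0.
have [Phi Phi0] := ge0_int_ltyR bb0 (tame_barrier s0 (tame_one s0) S20).
under eq_integral do rewrite mulr1.
move=> PhiE.
have [v1 [v1E v1cvg]] := energy_cvg S10 b1E; have [v2 [v2E v2cvg]] := energy_cvg S20 b2E.
apply/ler_addgt0Pr => d d0.
(* Chosen so that [eta * Phi <= d]; the added 1 keeps the denominator positive. *)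
pose eta := (d / (Phi + 1))%R.
have P1 : (0 < Phi + 1)%R by rewrite ltr_wpDl.
have eta0 : (0 < eta)%R by rewrite divr_gt0.
have [e0 e00 sube] := sub eta eta0.
have v1cvg' : (fun j => v1 j + d)%R @ \oo --> (gap S1 + d)%R.
  exact: (cvgD v1cvg (cvg_cst _)).
apply: (ler_cvg_to v2cvg v1cvg').
near=> j.
have inv0 : (0 < inv j)%R by rewrite invr_gt0.
have kj0 : (0 <= k * inv j `^ (- (2 * s)))%R by rewrite mulr_ge0 ?powR_ge0 ?(ltW k0).
have je : (0 < inv j < e0)%R.
  by rewrite inv0/=; near: j; exact: (near_infty_natSinv_lt (PosNum e00)).
have := barrier_comparison s0 tg S12 kj0 (ltW eta0) (fun x => sube _ x je).
have -> : trunc_energy s g (inv j) S1 = (k * inv j `^ (- (2 * s)) * b1 - v1 j)%:E by near: j.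
have -> : trunc_energy s g (inv j) S2 = (k * inv j `^ (- (2 * s)) * b2 - v2 j)%:E by near: j.
rewrite b1E b2E PhiE -!EFinM -!EFinD lee_fin => h.
have : (eta * Phi <= d)%R by rewrite /eta mulrAC ler_pdivrMr// ler_wpM2l ?(ltW d0)// lerDl.
by move: h => + h2; move: h2; lra.
Unshelve. all: by end_near. Qed.

End weight.
End monotonicity.

(** * Monotonicity of the spherical means *)

Section mean_monotone.
Context {R : realType} {m : nat}.
Variable s : R.
Hypotheses (s0 : 0 < s) (s1 : s < 1).
Local Notation leb := (@lebesgue_measure R).
Local Notation V := 'rV[R]_m.+1.
Local Notation vol := (@vol R m).
Local Notation kern := (kern s).
Local Notation nu := (m.+1%:R / 2 : R)%R.
Local Notation inv j := (j.+1%:R^-1 : R)%R.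
Local Open Scope ereal_scope.

Lemma primitive_weight (S : R) : (0 < S)%R ->
  \int[leb]_t ((0 < t < S)%R%:R * t `^ (nu - 1))%:E = (S `^ nu / nu)%:E.
Proof.
move=> S0; have nu0 : (0 < nu)%R by exact: nu_gt0.
rewrite -(integral_powR_near0E nu0 S0) integral_posE; apply: eq_integral => t _.
by rewrite -EFinM; congr _%:E; case: (ltP 0%R t); rewrite ?(mul0r, mul1r).
Qed.

Lemma mean_one (S : R) : (0 < S)%R ->
  mean s (fun _ : V => 1%R) S = mean s (fun _ : V => 1%R) 1.
Proof.
move=> S0; pose a := Num.sqrt S; have a0 : (0 < a)%R by rewrite sqrtr_gt0.
have aa : (a ^+ 2 = S)%R by rewrite sqr_sqrtr// ltW.
rewrite /mean -(ge0_vol_scaling (f := fun y : V => (shell s S y * 1)%:E) a0); last 2 first.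
- by mker.
- by move=> y; rewrite mulr1 lee_fin shell_ge0.
transitivity (\int[vol]_y ((a ^+ m.+1)%:E * (shell s S (a *: y) * 1)%:E)).
  apply: esym; apply: ge0_intZl; first by rewrite exprn_ge0// ltW.
  - by mker.
  - by move=> y; rewrite mulr1 lee_fin shell_ge0.
apply: eq_integral => y _; rewrite -EFinM; congr _%:E; rewrite !mulr1 /shell.
rewrite enormZ (gtr0_norm a0) !exprMn aa -[X in (X < _)%R](mulr1 S) ltr_pM2l//.
have [y1|_] := ltP 1%R (enorm y ^+ 2)%R; last by rewrite !mul0r mulr0.
have -> : (S / (S * enorm y ^+ 2 - S) = 1 / (enorm y ^+ 2 - 1))%R.
  by field; rewrite !gt_eqF//; nra.
rewrite !mul1r.
rewrite invfM mulrCA; congr (_ * _)%R; rewrite mulrA divff ?mul1r//.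
by rewrite gt_eqF// exprn_gt0.
Qed.

Section weight.
Variable g : V -> R.
Hypothesis tg : tame s g.
Local Notation M t := (fine (mean s g t)).
Local Notation P t := (fine (primitive s g t)).

Lemma meanK (t : R) : (0 < t)%R -> mean s g t = (M t)%:E.
Proof. by move=> t0; rewrite fineK// ge0_fin_numE ?mean_ge0//; exact: mean_lty. Qed.

Lemma primitive_le (S1 S2 c : R) : (0 < S1)%R -> (S1 <= S2)%R -> (0 <= c)%R ->
  primitive s g S1 < +oo -> primitive s g S2 < +oo ->
  (forall t, (S1 <= t < S2)%R -> (c <= M t)%R) ->
  (P S1 + c * (S2 `^ nu / nu) <= P S2 + c * (S1 `^ nu / nu))%R.
Proof.
move=> S10 S12 c0 P1 P2 cM; have S20 := lt_le_trans S10 S12.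
pose w (S t : R) : R := ((0 < t < S)%R%:R * t `^ (nu - 1))%R.
have w0 S t : (0 <= w S t)%R by rewrite mulr_ge0 ?powR_ge0.
have mw S : measurable_fun setT (w S) by rewrite /w; mfun.
have wM0 S t : 0 <= (w S t)%:E * mean s g t by rewrite mule_ge0 ?lee_fin ?mean_ge0.
have mwM S : measurable_fun setT (fun t => (w S t)%:E * mean s g t).
  by apply: emeasurable_funM; [mfun|exact: measurable_mean].
have cw0 S t : 0 <= (c * w S t)%:E by rewrite lee_fin mulr_ge0.
have mcw S : measurable_fun setT (fun t => (c * w S t)%:E) by mfun.
have PE S : primitive s g S < +oo -> primitive s g S = (P S)%:E.
  by move=> ?; rewrite fineK// ge0_fin_numE//; apply: integral_ge0 => t _; exact: wM0.
have cE S : (0 < S)%R -> \int[leb]_t (c * w S t)%:E = (c * (S `^ nu / nu))%:E.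
  by move=> S0; rewrite -ge0_lebZ// primitive_weight.
rewrite -lee_fin !EFinD -(PE _ P1) -(PE _ P2) -(cE _ S10) -(cE _ S20) {PE cE}.
have DE S S' : primitive s g S + \int[leb]_t (c * w S' t)%:E =
    \int[leb]_t ((w S t)%:E * mean s g t + (c * w S' t)%:E).
  exact: esym (ge0_integralD leb measurableT
    (fun t _ => wM0 S t) (mwM S) (fun t _ => cw0 S' t) (mcw S')).
rewrite (DE S1 S2) (DE S2 S1) {DE}.
suff le12 t : setT t -> (w S1 t)%:E * mean s g t + (c * w S2 t)%:E <=
    (w S2 t)%:E * mean s g t + (c * w S1 t)%:E.
  exact: (@ge0_le_integral _ _ R leb setT measurableT _ _
    (fun t _ => adde_ge0 (wM0 S1 t) (cw0 S2 t)) (emeasurable_funD (mwM S1) (mcw S2))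
    (emeasurable_funD (mwM S2) (mcw S1)) le12).
move=> _; rewrite /w; have [t0|_] := ltP 0%R t; last by rewrite /= !mul0r !mul0e !mulr0.
rewrite (meanK t0) -!EFinM -!EFinD lee_fin /=.
have [tS1|S1t] := ltP t S1; first by rewrite (lt_le_trans tS1 S12).
have [tS2|S2t] := ltP t S2; last by rewrite !mul0r !mulr0.
rewrite !mul0r mulr0 mul1r add0r addr0 mulrC ler_wpM2l ?powR_ge0//.
by apply: cM; rewrite S1t tS2.
Qed.

(** Let [c] be the infimum of [M] on [[S1, S2]]. The hypothesis and [primitive_le] give [t^nu M t -
    S1^nu M S1 >= nu (P t - P S1) >= c (t^nu - S1^nu)], that is
    [t^nu (M t - c) >= S1^nu (M S1 - c)]. If [M S1 > c], then [M] stays above [c] by a fixed amount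
    on the interval, against the choice of [c]. *)
Lemma mean_nondecreasing (r : R) :
  (forall S, (0 < S)%R -> primitive s g S < +oo) ->
  (forall S1 S2, (0 < S1)%R -> (S1 <= S2)%R -> (S2 < r)%R ->
    (nu * P S2 - S2 `^ nu * M S2 <= nu * P S1 - S1 `^ nu * M S1)%R) ->
  forall S1 S2, (0 < S1)%R -> (S1 <= S2)%R -> (S2 < r)%R -> (M S1 <= M S2)%R.
Proof.
move=> Pfin H S1 S2 S10 S12 S2r; have S20 := lt_le_trans S10 S12.
have nu0 : (0 < nu)%R by exact: nu_gt0.
pose E := [set M t | t in [set t : R | (S1 <= t <= S2)%R]].
have E0 : E !=set0 by exists (M S1), S1 => //=; rewrite lexx S12.
have lbE : lbound E 0%R by move=> _ [t _ <-]; rewrite fine_ge0// mean_ge0.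
have hE : has_inf E by split => //; exists 0%R.
have Ec t : (S1 <= t <= S2)%R -> (inf E <= M t)%R.
  by move=> tS; apply: ge_inf; [exists 0%R|exists t].
have c0 : (0 <= inf E)%R by exact: lb_le_inf.
apply: (@le_trans _ _ (inf E)); last by apply: Ec; rewrite lexx S12.
have pS1 : (0 < S1 `^ nu)%R by exact: powR_gt0.
have pS2 : (0 < S2 `^ nu)%R by exact: powR_gt0.
pose th := (S1 `^ nu / S2 `^ nu)%R; have th0 : (0 < th)%R by rewrite divr_gt0.
(* On [S1, S2], [M >= inf E + th * (M S1 - inf E)]. *)
rewrite leNgt; apply/negP => lt1.
suff : (inf E + th * (M S1 - inf E) <= inf E)%R.
  by apply/negP; rewrite -ltNge ltrDl mulr_gt0// subr_gt0.
apply: lb_le_inf => // _ [t /= /andP[S1t tS2] <-].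
have t0 : (0 < t)%R by exact: lt_le_trans S1t.
have pt : (0 < t `^ nu)%R by exact: powR_gt0.
have h1 := H _ _ S10 S1t (le_lt_trans tS2 S2r).
have /= h2 : (P S1 + inf E * (t `^ nu / nu) <= P t + inf E * (S1 `^ nu / nu))%R.
  apply: (primitive_le S10 S1t c0 (Pfin _ S10) (Pfin _ t0)).
  by move=> t' /andP[h h']; apply: Ec; rewrite h (le_trans (ltW h')).
have h3 : (nu * P S1 + inf E * t `^ nu <= nu * P t + inf E * S1 `^ nu)%R.
  have nuE p c x : (nu * p + c * x = nu * (p + c * (x / nu)))%R.
    by rewrite mulrDr mulrCA (mulrC nu (x / nu)%R) divfK ?gt_eqF.
  by rewrite !nuE ler_wpM2l// ltW.
have combine (n a b c d e f q : R) : (n * b - f * d <= n * a - e * c -> n * a + q * f <= n * b + q * e ->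
    e * (c - q) <= f * (d - q))%R.
  by clear => h h'; lra.
have h4 := combine _ _ _ _ _ _ _ _ h1 h3.
rewrite -lerBrDl; apply: (@le_trans _ _ (S1 `^ nu / t `^ nu * (M S1 - inf E)))%R.
  rewrite ler_wpM2r ?subr_ge0 ?(ltW lt1)// ler_wpM2l ?(ltW pS1)//.
  rewrite lef_pV2 ?posrE//; apply: ge0_ler_powR => //; rewrite ?nnegrE ?ltW//.
by rewrite mulrAC ler_pdivrMr// [leRHS]mulrC.
Qed.

End weight.

Theorem mean_subharmonic (k : R) (g : V -> R) (r : R) : tame s g -> (0 < k)%R ->
  (forall e : R, (0 < e)%R ->
     \int[vol]_z ((e <= enorm z)%R%:R * kern z)%:E = (k * e `^ (- (2 * s)))%:E) ->
  (forall eta : R, (0 < eta)%R -> exists2 e0 : R, (0 < e0)%R & forall (e : R) (x : V), (0 < e < e0)%R ->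
    (enorm x ^+ 2 < r)%R -> (g x * (k * e `^ (- (2 * s))))%:E <= trunc_int s g e x + eta%:E) ->
  forall S1 S2, (0 < S1)%R -> (S1 <= S2)%R -> (S2 < r)%R -> mean s g S1 <= mean s g S2.
Proof.
move=> tg k0 kE sub S1 S2 S10 S12 S2r; have S20 := lt_le_trans S10 S12.
have [[A D] /= [A0 D0] inside] := trunc_pot_inside s0 s1 kE.
have [K K0 potK] := potE (m := m) s0 s1.
have B1 : @beta_integral R m s 1 1 \is a fin_num.
  by rewrite ge0_fin_numE ?beta_ge0//; exact: beta_integral_lty.
pose B := fine (@beta_integral R m s 1 1); have BE : @beta_integral R m s 1 1 = B%:E by rewrite fineK.
have nu0 : (0 < nu)%R by exact: nu_gt0.
have kappa0 : (A - K * nu * B = 0)%R.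
  have t1 := tame_one (m := m) s0.
  have b0 (x : V) : (0 <= barrier s 1 x * 1)%R by rewrite mulr1 barrier_ge0.
  have [b _ bE] := ge0_int_ltyR b0 (tame_barrier s0 t1 ltr01).
  have [v [vE vcvg]] := energy_cvg s0 s1 k0 A0 D0 inside K0 potK t1 ltr01 bE.
  (* For the weight 1 the truncated integral is exactly [k e^(-2s)] at every point, so after
     [trunc_swap] the energy equals its divergent part and [v] is eventually 0. *)
  have gap0 : gap s A (fun _ : V => 1%R) 1 = 0%R.
    suff : v @ \oo --> 0%R by move=> v0; exact: (cvg_unique _ vcvg v0).
    apply: cvg_near_cst; apply: filterS vE => j.
    rewrite -trunc_swap// => E.
    have inv0 : (0 < inv j)%R by rewrite invr_gt0.
    have : \int[vol]_x ((barrier s 1 x)%:E * trunc_int s (fun _ : V => 1%R) (inv j) x) =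
        (k * inv j `^ (- (2 * s)) * b)%:E.
      rewrite EFinM -bE; have kj : (0 <= k * inv j `^ (- (2 * s)))%R by rewrite mulr_ge0 ?powR_ge0 ?(ltW k0).
      rewrite -ge0_intZl//; last by mker.
      apply: eq_integral => x _; rewrite mulr1 muleC; congr (_ * _).
      by rewrite -kE// /trunc_int; apply: eq_integral => z _; rewrite mulr1.
    by rewrite {}E => -[h]; lra.
  have := gap_mean s0 s1 A K0 potK t1 ltr01 BE; rewrite gap0 => E.
  have ball0 : (0 < fine (ball_mass (fun _ : V => 1%R) 1))%R.
    have fb := ball_fin_num s0 s1 t1 ltr01.
    rewrite -lte_fin fineK// /ball_mass.
    have -> : \int[vol]_y ((enorm y ^+ 2 < 1)%R%:R * 1)%:E = vol [set y : V | (enorm y < 1)%R].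
      rewrite -[RHS]mul1e -integral_cst ?integral_bool; last exact: measurable_enorm_lt.
      apply: eq_integral => y _; rewrite mule1 mulr1.
      by rewrite -[X in (_ < X)%R](expr1n _ 2) (@ltr_pXn2r _ 2) ?nnegrE ?enorm_ge0.
    exact: enorm_lt_vol_gt0.
  (* As [mean] is constant for this weight, the term [nu P - S^nu M] vanishes at [S = 1]; only
     [kappa] times a positive mass remains. *)
  have P1 : fine (primitive s (fun _ : V => 1%R) 1) = (fine (mean s (fun _ : V => 1%R) 1) / nu)%R.
    set M1 := fine (mean _ _ _); rewrite /primitive.
    have -> : \int[leb]_t (((0 < t < 1)%R%:R * t `^ (nu - 1))%:E * mean s (fun _ : V => 1%R) t) =
        (M1 * (1 `^ nu / nu))%:E.
      rewrite EFinM -primitive_weight// ge0_lebZ//; [|by rewrite fine_ge0// mean_ge0|by mfun|]; last first.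
        by move=> t; rewrite mulr_ge0 ?powR_ge0.
      apply: eq_integral => t _; have [t0|_] := ltP 0%R t; last by rewrite /= !mul0r mul0e mulr0.
      by rewrite mean_one// (meanK t1)// -EFinM mulrC.
    by rewrite powR1 mul1r.
  have nuK x : (nu * (x / nu) = x)%R by rewrite mulrC divfK ?gt_eqF.
  move: E; rewrite P1 nuK powR1 mul1r subrr mulr0 addr0.
  by move/esym/eqP; rewrite mulf_eq0 (gt_eqF ball0) orbF => /eqP.
rewrite (meanK tg S10) (meanK tg S20) lee_fin.
apply: (mean_nondecreasing tg _ _ S10 S12 S2r).
  by move=> S S0; exact: (primitive_lty s0 s1 K0 potK tg S0).
have drop kap b1 b2 X Y : kap = 0%R -> (kap * b1 + K * X <= kap * b2 + K * Y)%R -> (X <= Y)%R.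
  by move=> ->; rewrite !mul0r !add0r (ler_pM2l K0).
move=> T1 T2 T10 T12 T2r.
have : (gap s A g T2 <= gap s A g T1)%R.
  apply: (gap_le s0 s1 k0 A0 D0 inside K0 potK tg T10 T12) => eta /sub[e0 e00 h].
  by exists e0 => // e x he xT; apply: h => //; exact: lt_trans T2r.
have T20 := lt_le_trans T10 T12.
rewrite (gap_mean s0 s1 A K0 potK tg T10 BE) (gap_mean s0 s1 A K0 potK tg T20 BE).
exact: drop kappa0.
Qed.

End mean_monotone.

(** * The fractional Laplacian *)

Lemma Rn_intE (R : realType) m (A : set 'rV[R]_m.+1) (f : 'rV[R]_m.+1 -> \bar R) :
  measurable A -> measurable_fun setT f -> Rn_int A f = (\int[@vol R m]_(x in A) f x)%E.
Proof.
move=> mA mf; rewrite [RHS]integralE -!integral_vol//.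
- rewrite /Rn_int integralE; congr (_ - _)%E.
    by apply: eq_integral => p _; rewrite !funeposE.
  by apply: eq_integral => p _; rewrite !funenegE.
- exact: measurable_funeneg.
- exact: measurable_funepos.
Qed.

Section fractional_laplacian.
Context {R : realType} {m : nat}.
Variable s : R.
Hypotheses (s0 : 0 < s) (s1 : s < 1).
Local Notation V := 'rV[R]_m.+1.
Local Notation vol := (@vol R m).
Local Notation kern := (kern s).
Local Open Scope ereal_scope.
Variable f : V -> R.
Hypothesis tf : tame s f.
Let mf : measurable_fun setT f. Proof. by case: tf. Qed.
Let f0 x : (0 <= f x)%R. Proof. by case: tf. Qed.

Lemma trunc_int_lty (e : R) (x : V) : (0 < e)%R -> trunc_int s f e x < +oo.
Proof.
move=> e0; have [_ _ _ fin] := tf.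
pose q : R := (m.+1%:R + 2 * s)%R; have q0 : (0 < q)%R by exact: exponent_gt0.
pose w (y : V) : R := (f y / (1 + enorm y `^ q))%R.
have w0 y : (0 <= w y)%R by rewrite divr_ge0// addr_ge0// powR_ge0.
have mw : measurable_fun setT w by rewrite /w; mfun.
have mwE : measurable_fun setT (EFin \o w) by exact: measurableT_comp.
have [v v0 vE] := ge0_int_ltyR w0 fin.
(* For [|z| >= e] one has [|x + z| <= (1 + |x| / e) |z|], and [1 <= |z|^q / e^q]; the two terms of
   [C] absorb the two terms of [1 + |x + z|^q]. *)
pose C := ((e `^ q)^-1 + (1 + enorm x / e) `^ q)%R.
have C0 : (0 <= C)%R by rewrite addr_ge0 ?invr_ge0 ?powR_ge0.
have mwx : measurable_fun setT (fun z : V => w (z + x)%R).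
  by apply: (measurableT_comp mw); mfun.
apply: (@le_lt_trans _ _ (\int[vol]_z (C * w (z + x)%R)%:E)); last first.
  have -> : \int[vol]_z (C * w (z + x)%R)%:E = C%:E * v%:E.
    rewrite -vE -(ge0_vol_translation (f := EFin \o w) x); last 2 first.
    - exact: mwE.
    - by move=> y; rewrite lee_fin.
    by apply: esym; exact: ge0_intZR.
  by rewrite -EFinM ltry.
apply: ge0_int_leR; [by mker|exact: measurable_funM|] => z.
apply/andP; split; first by rewrite mulr_ge0// mulr_ge0 ?kern_ge0.
rewrite (addrC z x) /w; have [ez|_] := leP e (enorm z); last first.
  by rewrite mul0r mulr_ge0// divr_ge0// addr_ge0// powR_ge0.
have z0 : (0 < enorm z)%R by exact: lt_le_trans ez.
have zq : (0 < enorm z `^ q)%R by rewrite powR_gt0.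
rewrite mul1r /kern -/q mulrC mulrA [leRHS]mulrAC mulrC; apply: ler_wpM2r => //.
have p1 : (0 < 1 + enorm (x + z)%R `^ q)%R by rewrite ltr_pwDl// powR_ge0.
rewrite ler_pdivlMr// mulrC ler_pdivrMr// /C mulrDl; apply: lerD.
  rewrite mulrC ler_pdivlMr ?powR_gt0// mul1r.
  by apply: ge0_ler_powR; rewrite ?nnegrE ?(ltW q0) ?(ltW e0) ?(ltW z0).
rewrite -powRM ?addr_ge0 ?divr_ge0 ?enorm_ge0 ?(ltW e0)//.
apply: ge0_ler_powR; rewrite ?nnegrE ?(ltW q0) ?enorm_ge0 ?mulr_ge0 ?addr_ge0 ?divr_ge0 ?enorm_ge0 ?(ltW e0)//.
apply: (le_trans (enorm_triangle _ _)); rewrite mulrDl mul1r addrC lerD2l.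
by rewrite mulrAC ler_pdivlMr// ler_wpM2l// enorm_ge0.
Qed.

Variable k : R.
Hypothesis k0 : (0 < k)%R.
Hypothesis kE : forall e : R, (0 < e)%R ->
  \int[vol]_z ((e <= enorm z)%R%:R * kern z)%:E = (k * e `^ (- (2 * s)))%:E.

Lemma frac_lap_truncE (e : R) (x : V) : (0 < e)%R ->
  frac_lap_trunc s f x e = (f x * (k * e `^ (- (2 * s))) - fine (trunc_int s f e x))%R.
Proof.
move=> e0; pose h1 (y : V) : R := (f x * ((e <= enorm (y - x)%R)%R%:R * kern (y - x)%R))%R.
pose h2 (y : V) : R := ((e <= enorm (y - x)%R)%R%:R * (kern (y - x)%R * f y))%R.
have h10 y : (0 <= h1 y)%R by rewrite mulr_ge0// mulr_ge0 ?kern_ge0.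
have h20 y : (0 <= h2 y)%R by rewrite mulr_ge0// mulr_ge0 ?kern_ge0.
have mh1 : measurable_fun setT h1 by rewrite /h1; mker.
have mh2 : measurable_fun setT h2 by rewrite /h2; mker.
have I1 : \int[vol]_y (h1 y)%:E = (f x * (k * e `^ (- (2 * s))))%:E.
  rewrite -(ge0_vol_translation (f := fun y : V => (h1 y)%:E) x); last 2 first.
  - exact/measurable_EFinP.
  - by move=> y; rewrite lee_fin.
  transitivity (\int[vol]_z (f x * ((e <= enorm z)%R%:R * kern z))%:E).
    by apply: eq_integral => z _; rewrite /h1 addrK.
  rewrite EFinM -(kE e0); apply: esym; apply: ge0_intZR => //; first by mker.
  by move=> z; rewrite mulr_ge0 ?kern_ge0.
have I2 : \int[vol]_y (h2 y)%:E = trunc_int s f e x.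
  rewrite -(ge0_vol_translation (f := fun y : V => (h2 y)%:E) x); last 2 first.
  - exact/measurable_EFinP.
  - by move=> y; rewrite lee_fin.
  by apply: eq_integral => z _; rewrite /h2 addrK (addrC z x).
have i1 : vol.-integrable setT (EFin \o h1).
  apply/integrableP; split; first exact/measurable_EFinP.
  rewrite (eq_integral (fun y : V => (h1 y)%:E)); first by rewrite I1 ltry.
  by move=> y _ /=; rewrite ger0_norm.
have i2 : vol.-integrable setT (EFin \o h2).
  apply/integrableP; split; first exact/measurable_EFinP.
  rewrite (eq_integral (fun y : V => (h2 y)%:E)); first by rewrite I2; exact: trunc_int_lty.
  by move=> y _ /=; rewrite ger0_norm.
have mA : measurable [set y : V | (e <= enorm (y - x))%R].
  rewrite -[X in measurable X]setTI.
  have mm : measurable_fun setT (fun y : V => e <= enorm (y - x))%R by mfun.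
  by have := mm measurableT [set true]; rewrite /preimage/=; apply.
rewrite /frac_lap_trunc /Rn_Rint Rn_intE//; last by mfun.
rewrite integral_mkcond -I2.
rewrite (eq_integral (fun y : V => (h1 y)%:E - (h2 y)%:E)); last first.
  move=> y _; rewrite patchE /h1 /h2 -EFinD.
  case: ifPn => [/set_mem/= ->|/negP yA].
    by congr _%:E; rewrite /kern (enormBC x y) !mul1r; ring.
  rewrite (_ : (e <= enorm (y - x))%R = false); first by rewrite !(mul0r, mulr0) subr0.
  by apply/negP => h; apply: yA; exact: mem_set.
have Tfin : trunc_int s f e x \is a fin_num.
  by rewrite ge0_fin_numE ?trunc_int_ge0//; exact: trunc_int_lty.
by rewrite integralB_EFin// I1 I2 fineB.
Qed.

(** Two truncations differ by an integral over [e' <= |z| < e]. There the kernel is even and of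
    finite mass, so the difference can be symmetrised in [z] and only second differences of [f]
    remain. *)
Lemma frac_lap_trunc_osc (C q k2 rho e e' : R) (x : V) : (0 < e')%R -> (e' <= e)%R -> (e <= 1)%R ->
  (0 <= C)%R -> (0 <= k2)%R -> (enorm x < rho)%R ->
  (forall x z : V, (enorm x < rho)%R -> (enorm z < 1)%R ->
    (`|2 * f x - f (x + z)%R - f (x - z)%R| <= C * enorm z `^ q)%R) ->
  \int[vol]_z ((enorm z < e)%R%:R * (enorm z `^ q * kern z))%:E = (k2 * e `^ (q - 2 * s))%:E ->
  (`|frac_lap_trunc s f x e' - frac_lap_trunc s f x e| <= C * (k2 * e `^ (q - 2 * s)))%R.
Proof.
move=> e'0 e'e e1 C0 k20 xrho sd k2E; have e0 := lt_le_trans e'0 e'e.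
pose w (z : V) : R := ((e' <= enorm z < e)%R%:R * kern z)%R.
have w0 z : (0 <= w z)%R by rewrite mulr_ge0 ?kern_ge0.
have mw : measurable_fun setT w by rewrite /w; mker.
pose t (z : V) : R := ((enorm z < e)%R%:R * (enorm z `^ q * kern z))%R.
have t0 z : (0 <= t z)%R by rewrite mulr_ge0// mulr_ge0 ?powR_ge0 ?kern_ge0.
have mt : measurable_fun setT t by rewrite /t; mker.
have wf0 z : (0 <= w z * f (x + z)%R)%R by rewrite mulr_ge0.
have wfN0 z : (0 <= w z * f (x - z)%R)%R by rewrite mulr_ge0.
have mwf : measurable_fun setT (fun z : V => w z * f (x + z)%R)%R by mker.
have mwfN : measurable_fun setT (fun z : V => w z * f (x - z)%R)%R by mker.
have split_ind (z : V) : ((e' <= enorm z)%R%:R = (e <= enorm z)%R%:R + (e' <= enorm z < e)%R%:R :> R)%R.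
  case: (leP e (enorm z)) => ez; first by rewrite (le_trans e'e ez) addr0.
  by rewrite andbT add0r.
have kap : (k * e' `^ (- (2 * s)))%:E = (k * e `^ (- (2 * s)))%:E + \int[vol]_z (w z)%:E.
  rewrite -!kE// ge0_intDR//; [|by mker|by move=> z; rewrite mulr_ge0 ?kern_ge0].
  by apply: eq_integral => z _; rewrite split_ind mulrDl.
have tr : trunc_int s f e' x = trunc_int s f e x + \int[vol]_z (w z * f (x + z)%R)%:E.
  rewrite /trunc_int ge0_intDR//; [|by mker|by move=> z; rewrite mulr_ge0// mulr_ge0 ?kern_ge0].
  by apply: eq_integral => z _; rewrite split_ind mulrDl /w -mulrA.
have wfin : \int[vol]_z (w z)%:E < +oo.
  by apply: (@le_lt_trans _ _ (k * e' `^ (- (2 * s)))%:E); [rewrite kap leeDr// lee_fin mulr_ge0 ?powR_ge0 ?(ltW k0)|exact: ltry].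
have wffin : \int[vol]_z (w z * f (x + z)%R)%:E < +oo.
  by apply: (@le_lt_trans _ _ (trunc_int s f e' x)); [rewrite tr leeDr// trunc_int_ge0|exact: trunc_int_lty].
have [kap1 _ kap1E] := ge0_int_ltyR w0 wfin; have [d _ dE] := ge0_int_ltyR wf0 wffin.
have dNE : \int[vol]_z (w z * f (x - z)%R)%:E = d%:E.
  rewrite -dE -(ge0_vol_opp (f := fun z : V => (w z * f (x + z)%R)%:E)).
  - by apply: eq_integral => z _; rewrite /w enormN kernN.
  - by mfun.
  - by move=> z; rewrite lee_fin.
have sd' z : (w z * `|2 * f x - f (x + z)%R - f (x - z)%R| <= C * t z)%R.
  rewrite /w /t; have [ez|_] := ltP (enorm z) e; last by rewrite andbF !mul0r mulr0.
  rewrite andbT mul1r; have [_|_] := leP e' (enorm z); last first.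
    by rewrite !mul0r mulr_ge0// mulr_ge0 ?powR_ge0 ?kern_ge0.
  rewrite mul1r mulrC mulrA; apply: ler_wpM2r; first exact: kern_ge0.
  exact: sd xrho (lt_le_trans ez e1).
pose T := (C * (k2 * e `^ (q - 2 * s)))%R.
have T0 : (0 <= T)%R by rewrite /T mulr_ge0// mulr_ge0 ?powR_ge0.
have Ct0 z : (0 <= C * t z)%R by rewrite mulr_ge0.
have mCt : measurable_fun setT (fun z : V => C * t z)%R by mfun.
have CtE : \int[vol]_z (C * t z)%:E = T%:E by rewrite -ge0_intZR// k2E -EFinM.
have fx0 : (0 <= 2 * f x)%R by rewrite mulr_ge0.
have mfw : measurable_fun setT (fun z : V => 2 * f x * w z)%R by mfun.
have fw0 z : (0 <= 2 * f x * w z)%R by rewrite mulr_ge0.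
have fwE : \int[vol]_z (2 * f x * w z)%:E = (2 * f x * kap1)%:E by rewrite -ge0_intZR// kap1E -EFinM.
have ff0 z : (0 <= w z * f (x + z)%R + w z * f (x - z)%R)%R by rewrite addr_ge0.
have mff : measurable_fun setT (fun z : V => w z * f (x + z)%R + w z * f (x - z)%R)%R.
  exact: measurable_funD.
have ffE : \int[vol]_z (w z * f (x + z)%R + w z * f (x - z)%R)%:E = (d + d)%:E.
  by rewrite -ge0_intDR// dE dNE.
have up : (2 * f x * kap1 <= d + d + T)%R.
  rewrite -lee_fin EFinD -fwE -ffE -CtE ge0_intDR//.
  apply: ge0_int_leR => //; first exact: measurable_funD.
  move=> z; rewrite fw0/=; have := sd' z; rewrite -[X in (X * _ <= _)%R](ger0_norm (w0 z)) -normrM => h.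
  have := le_trans (ler_norm _) h; lra.
have lo : (d + d <= 2 * f x * kap1 + T)%R.
  rewrite -lee_fin [leRHS]EFinD -fwE -ffE -CtE ge0_intDR//.
  apply: ge0_int_leR => //; first exact: measurable_funD.
  move=> z; rewrite ff0/=; have := sd' z; rewrite -[X in (X * _ <= _)%R](ger0_norm (w0 z)) -normrM -normrN => h.
  have := le_trans (ler_norm _) h; lra.
rewrite !frac_lap_truncE// -/T.
have kapE : (k * e' `^ (- (2 * s)) = k * e `^ (- (2 * s)) + kap1)%R.
  by move: kap; rewrite kap1E -EFinD => -[].
have trE : fine (trunc_int s f e' x) = (fine (trunc_int s f e x) + d)%R.
  by rewrite tr dE fineD// ge0_fin_numE ?trunc_int_ge0//; exact: trunc_int_lty.
rewrite kapE trE ler_norml; move: up lo T0; clear; move: (fine _) (k * _)%R => t a up lo T0.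
by apply/andP; split; lra.
Qed.

(** The hypothesis concerns a limit, whereas [barrier_comparison] needs truncated integrals with an
    error uniform in [x]. The oscillation bound provides both the existence of the limit and the
    uniform rate. *)
Lemma frac_lap_subharmonic (q rho : R) : (2 * s < q)%R -> (0 < rho)%R -> second_difference_bound f q ->
  (forall x, (enorm x < rho)%R -> (frac_lap s f x <= 0)%R) ->
  forall eta : R, (0 < eta)%R -> exists2 e0 : R, (0 < e0)%R & forall (e : R) (x : V), (0 < e < e0)%R ->
    (enorm x ^+ 2 < rho ^+ 2)%R -> (f x * (k * e `^ (- (2 * s))))%:E <= trunc_int s f e x + eta%:E.
Proof.
move=> sq rho0 sdb sub eta eta0.
have [C C0 sd] := sdb rho rho0; have [k2 k20 k2E] := kern_near0 (m := m) sq.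
have b0 : (0 < q - 2 * s)%R by rewrite subr_gt0.
(* [del t] is the radius at which [c e^(q - 2s)] reaches [t], capped at 1 because second differences
   are controlled for [|z| < 1] only; the 1 in [c] permits the division. *)
pose c := (C * k2 + 1)%R; have c0 : (0 < c)%R by rewrite ltr_wpDl// mulr_ge0.
pose del (t : R) := Num.min 1%R ((t / c) `^ (q - 2 * s)^-1)%R.
have del0 t : (0 < t)%R -> (0 < del t)%R by move=> t0; rewrite lt_min ltr01/= powR_gt0// divr_gt0.
have osc t e e' (x : V) : (0 < t)%R -> (enorm x < rho)%R -> (0 < e')%R -> (e' <= e)%R -> (e < del t)%R ->
    (`|frac_lap_trunc s f x e' - frac_lap_trunc s f x e| <= t)%R.
  move=> t0 xr e'0 e'e; rewrite lt_min => /andP[e1 et]; have e0 := lt_le_trans e'0 e'e.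
  apply: (le_trans (frac_lap_trunc_osc e'0 e'e (ltW e1) C0 k20 xr (sd) (k2E _ e0))).
  have h : (e `^ (q - 2 * s) <= t / c)%R.
    have := ge0_ler_powR (ltW b0) _ _ (ltW et); rewrite -powRrM mulVf ?gt_eqF// powRr1 ?divr_ge0 ?(ltW t0) ?(ltW c0)//.
    by apply; rewrite nnegrE ?(ltW e0) ?powR_ge0.
  apply: (@le_trans _ _ (c * e `^ (q - 2 * s)))%R.
    by rewrite mulrA ler_wpM2r ?powR_ge0// lerDl.
  by rewrite mulrC -ler_pdivlMr.
exists (del eta); first exact: del0.
move=> e x /andP[e0 edel] xr; have {}xr : (enorm x < rho)%R.
  by move: xr; rewrite (@ltr_pXn2r _ 2) ?nnegrE ?enorm_ge0 ?(ltW rho0).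
(* [lim] is a default value unless convergence is known, so the Cauchy property comes before any use
   of the sign of [frac_lap]. *)
have cv : cvg (frac_lap_trunc s f x e @[e --> 0^'+]).
  apply/cauchy_cvgP/cauchy_exP => t t0.
  have t20 : (0 < t / 2)%R by rewrite divr_gt0.
  pose e1 := (del (t / 2) / 2)%R; have d0 := del0 _ t20.
  have e10 : (0 < e1)%R by rewrite divr_gt0.
  exists (frac_lap_trunc s f x e1).
  suff : \forall e' \near 0^'+, ball (frac_lap_trunc s f x e1) t (frac_lap_trunc s f x e') by [].
  near=> e'; have e'0 : (0 < e')%R by near: e'; exact: nbhs_right_gt.
  have e'1 : (e' <= e1)%R by near: e'; exact: nbhs_right_le.
  rewrite /ball/= distrC; apply: (@le_lt_trans _ _ (t / 2)%R); last by rewrite ltr_pdivrMr// ltr_pMr// ltr1n.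
  by apply: osc => //; rewrite /e1 ltr_pdivrMr// ltr_pMr// ltr1n.
set L := lim (frac_lap_trunc s f x e @[e --> 0^'+]) in cv *.
have L0 : (L <= 0)%R.
  by have := sub x xr; rewrite /frac_lap -/L pmulr_rle0// C_ns_gt0.
have T_le : (frac_lap_trunc s f x e <= eta)%R.
  have : (frac_lap_trunc s f x e <= L + eta)%R.
    rewrite -lerBlDr; apply: limr_ge => //; near=> e'.
    have e'0 : (0 < e')%R by near: e'; exact: nbhs_right_gt.
    have e'e : (e' <= e)%R by near: e'; exact: nbhs_right_le.
    rewrite lerBlDr -lerBlDl; apply: le_trans (ler_norm _) _; rewrite distrC.
    by apply: osc.
  by move/le_trans; apply; rewrite gerDr.
move: T_le; rewrite frac_lap_truncE// => T_le.
rewrite -(fineK (_ : trunc_int s f e x \is a fin_num)).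
  by rewrite -EFinD lee_fin -lerBlDl.
by rewrite ge0_fin_numE ?trunc_int_ge0//; exact: trunc_int_lty.
Unshelve. all: by end_near. Qed.

End fractional_laplacian.

(** * From the spherical means to the functional *)

Section conclusion.
Context {R : realType} {m : nat}.
Variable s : R.
Hypotheses (s0 : 0 < s) (s1 : s < 1).
Local Notation leb := (@lebesgue_measure R).
Local Notation V := 'rV[R]_m.+1.
Local Notation vol := (@vol R m).
Local Open Scope ereal_scope.

(** Integrability on a ball includes measurability there, and the balls of positive integer radius
    cover the space. *)
Lemma Lpt_measurable (g : V -> R) : Lpt 1 s g -> measurable_fun setT g.
Proof.
move=> [ball_int _].
suff mgv : measurable_fun setT (g \o @rs_vec _ _ (rspace R m)).
  rewrite (_ : g = (g \o @rs_vec _ _ (rspace R m)) \o @rs_of_vec R m).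
    exact: measurableT_comp mgv (@measurable_rs_of_vec R m).
  by apply/funext => x /=; rewrite rs_of_vecK.
pose E (i : nat) := @rs_vec _ _ (rspace R m) @^-1` eball i.+1%:R.
have mE i : measurable (E i) by have := @measurable_enorm_lt R m i.+1%:R.
rewrite (_ : setT = \bigcup_i E i); last first.
  apply/esym/seteqP; split => // p _; exists (Num.truncn (enorm (@rs_vec _ _ (rspace R m) p))) => //=.
  by rewrite /E /eball/=; exact: truncnS_gt.
apply/measurable_fun_bigcup => // i.
have /integrableP[/measurable_EFinP] := ball_int i.+1%:R (ltr0Sn _ i).
by [].
Qed.

Lemma tame_Lpt (g : V -> R) : (forall x, 0 <= g x)%R -> Lpt 1 s g ->
  (forall r : R, (0 < r)%R -> exists2 B : R, (0 <= B)%R & forall x, (enorm x < r)%R -> (`|g x| <= B)%R) ->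
  tame s g.
Proof.
move=> g0 gL gB; have mg := Lpt_measurable gL; split => //.
  move=> r r0; have [B B0 h] := gB r r0; exists B => // x xr.
  by have := h x xr; rewrite ger0_norm.
have [_] := gL; rewrite integral_vol//; last 2 first.
- by apply/measurable_EFinP; apply: measurable_funM; mfun.
- by move=> x; rewrite lee_fin divr_ge0 ?powR_ge0// addr_ge0 ?powR_ge0.
apply: le_lt_trans; rewrite le_eqVlt; apply/orP; left; apply/eqP.
by apply: eq_integral => x _; rewrite powRr1 ger0_norm.
Qed.

Lemma a_ns_ge0 : (0 <= a_ns m.+1 s)%R.
Proof.
rewrite /a_ns mulr_ge0 ?powR_ge0//; last first.
  rewrite sin_ge0_pi// mulr_ge0 ?pi_ge0 ?(ltW s0)//= -[leRHS]mulr1.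
  by rewrite ler_wpM2l ?pi_ge0// ltW.
rewrite mulr_ge0 ?powR_ge0// fine_ge0//; apply: integral_ge0 => t _.
by rewrite lee_fin mulr_ge0 ?powR_ge0 ?expR_ge0.
Qed.

Section weight.
Variable g : V -> R.
Hypothesis tg : tame s g.
Let mg : measurable_fun setT g. Proof. by case: tg. Qed.
Let g0 x : (0 <= g x)%R. Proof. by case: tg. Qed.

(* On the sphere [|y| = r] the junk value [r ^+ 2 / 0 = 0] makes the Poisson kernel vanish. *)
Lemma poisson_mean (r : R) : (0 < r)%R ->
  Rn_int [set y : V | (r <= enorm y)%R] (fun y => (poisson_K s r y * g y)%:E) =
  (a_ns m.+1 s)%:E * mean s g (r ^+ 2).
Proof.
move=> r0; have a0 := a_ns_ge0.
have mA : measurable [set y : V | (r <= enorm y)%R].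
  have -> : [set y : V | (r <= enorm y)%R] = ~` [set y : V | (enorm y < r)%R].
    by apply/seteqP; split => y /=; rewrite leNgt => /negP.
  by apply: measurableC; exact: measurable_enorm_lt.
have mf : measurable_fun setT (fun y : V => (poisson_K s r y * g y)%:E).
  by rewrite /poisson_K; mfun.
rewrite Rn_intE// integral_mkcond.
transitivity (\int[vol]_y ((a_ns m.+1 s)%:E * (shell s (r ^+ 2) y * g y)%:E)); last first.
  apply: ge0_intZl => //; first by mker.
  by move=> y; rewrite lee_fin mulr_ge0 ?shell_ge0.
have sq (y : V) : (r ^+ 2 < enorm y ^+ 2)%R = (r < enorm y)%R.
  by rewrite (@ltr_pXn2r _ 2) ?nnegrE ?enorm_ge0 ?(ltW r0).
apply: eq_integral => y _; rewrite patchE -EFinM /shell sq.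
case: ifPn => [/set_mem/= ry|/negP ry]; last first.
  rewrite (_ : (r < enorm y)%R = false) ?(mul0r, mulr0)//.
  by apply/negP => h; apply: ry; apply/mem_set; exact: ltW.
congr _%:E; rewrite /poisson_K; move: ry; rewrite le_eqVlt => /predU1P[<-|ry].
  by rewrite subrr invr0 mulr0 powR0 ?gt_eqF// ltxx !(mul0r, mulr0).
by rewrite ry mul1r !mulrA.
Qed.

Lemma ACF_mean (u : V -> R) (r : R) : frac_grad_norm2 s u = g -> (0 < r)%R ->
  J_ACF s u r = \int[leb]_t (((0 < t < 1)%R%:R * t `^ s * a_ns m.+1 s)%:E * mean s g ((r * t) ^+ 2)).
Proof.
move=> ug r0; have a0 := a_ns_ge0; rewrite /J_ACF ug.
pose F (t : R) : \bar R := ((0 < t < r)%R%:R * t `^ s * a_ns m.+1 s)%:E * mean s g (t ^+ 2).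
have F0 t : 0 <= F t by rewrite mule_ge0 ?mean_ge0// lee_fin mulr_ge0// mulr_ge0 ?powR_ge0.
have mm : measurable_fun setT (fun t : R => mean s g (t ^+ 2)).
  by apply: (measurableT_comp (measurable_mean tg)); mfun.
have mF : measurable_fun setT F by apply: emeasurable_funM => //; mfun.
have -> : \int[leb]_(t in `]0%R, r[%classic) ((t `^ s)%:E *
     Rn_int [set y : V | (t <= enorm y)%R] (fun y => (poisson_K s t y * g y)%:E)) = \int[leb]_t F t.
  rewrite integral_mkcond; apply: eq_integral => t _; rewrite patchE /F.
  case: ifPn => [/set_mem tr|/negP tr].
    have /andP[t0 t1] : (0 < t < r)%R by move: tr; rewrite /= in_itv.
    by rewrite (poisson_mean t0) t0 t1 mul1r muleA -EFinM.
  rewrite (_ : (0 < t < r)%R = false) ?(mul0r, mul0e)//.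
  by apply/negP => h; apply: tr; apply/mem_set; rewrite /= in_itv.
transitivity (((r `^ (1 + s))^-1)%:E * (r%:E * \int[leb]_t F (r * t)%R)).
  by congr (_ * _); apply: esym; exact: ge0_integral_scaling r0 mF F0.
rewrite muleA -EFinM.
pose G (t : R) : \bar R := ((0 < t < 1)%R%:R * t `^ s * a_ns m.+1 s)%:E * mean s g ((r * t) ^+ 2).
have G0 t : 0 <= G t by rewrite mule_ge0 ?mean_ge0// lee_fin mulr_ge0// mulr_ge0 ?powR_ge0.
have mG : measurable_fun setT G.
  apply: emeasurable_funM; first by mfun.
  by apply: (measurableT_comp (measurable_mean tg)); mfun.
have FG t : F (r * t)%R = (r `^ s)%:E * G t.
  rewrite /F /G pmulr_rgt0// gtr_pMr// muleA -EFinM.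
  case: (ltP 0%R t) => t0; last by rewrite /= !(mul0r, mulr0, mul0e).
  by rewrite powRM ?(ltW r0) ?(ltW t0)//; congr (_%:E * _); ring.
have -> : \int[leb]_t F (r * t)%R = (r `^ s)%:E * \int[leb]_t G t.
  under eq_integral do rewrite FG.
  exact: (ge0_integralZl_EFin leb measurableT (fun t _ => G0 t) mG (powR_ge0 r s)).
rewrite muleA -EFinM.
have -> : ((r `^ (1 + s))^-1 * r * r `^ s = 1)%R.
  rewrite -mulrA powRD ?(gt_eqF r0) ?implybT// powRr1 ?(ltW r0)// mulVf//.
  by rewrite mulf_neq0 ?gt_eqF ?powR_gt0.
by rewrite mul1e.
Qed.

End weight.

Lemma ACF_nondecreasing (u : V -> R) (rho R1 R2 : R) :
  tame s (frac_grad_norm2 s u) -> (0 < R1)%R -> (R1 <= R2)%R -> (R2 < rho)%R ->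
  (forall S1 S2, (0 < S1)%R -> (S1 <= S2)%R -> (S2 < rho ^+ 2)%R ->
    mean s (frac_grad_norm2 s u) S1 <= mean s (frac_grad_norm2 s u) S2) ->
  J_ACF s u R1 <= J_ACF s u R2.
Proof.
move=> tg R10 R12 R2r mono; have R20 := lt_le_trans R10 R12; have a0 := a_ns_ge0.
rewrite (ACF_mean tg erefl R10) (ACF_mean tg erefl R20).
have w0 t : 0 <= ((0 < t < 1)%R%:R * t `^ s * a_ns m.+1 s)%:E.
  by rewrite lee_fin mulr_ge0// mulr_ge0 ?powR_ge0.
have mG r : measurable_fun setT (fun t : R => ((0 < t < 1)%R%:R * t `^ s * a_ns m.+1 s)%:E *
    mean s (frac_grad_norm2 s u) ((r * t) ^+ 2)).
  apply: emeasurable_funM; first by mfun.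
  by apply: (measurableT_comp (measurable_mean tg)); mfun.
have G0 r t : setT t -> 0 <= ((0 < t < 1)%R%:R * t `^ s * a_ns m.+1 s)%:E *
    mean s (frac_grad_norm2 s u) ((r * t) ^+ 2).
  by move=> _; apply: mule_ge0; [exact: w0|exact: mean_ge0].
apply: (@ge0_le_integral _ _ R leb setT measurableT _ _ (G0 R1) (mG R1) (mG R2)) => t _.
have [/andP[t0 t1]|/negbTE t01] := boolP (0 < t < 1)%R; last first.
  have -> : (false%:R * t `^ s * a_ns m.+1 s)%:E = 0 by rewrite !mul0r.
  by move: (mean _ _ _) (mean _ _ _) => a b; rewrite !mul0e.
apply: lee_wpmul2l; first by rewrite lee_fin mulr_ge0// mulr_ge0 ?powR_ge0.
apply: mono; first by rewrite exprn_gt0// mulr_gt0.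
  by rewrite lerXn2r ?nnegrE ?mulr_ge0 ?(ltW R10) ?(ltW R20) ?(ltW t0)// ler_wpM2r// ltW.
rewrite (@ltr_pXn2r _ 2) ?nnegrE ?mulr_ge0 ?(ltW R20) ?(ltW t0)//.
  by apply: lt_trans R2r; rewrite gtr_pMr.
exact: (ltW (lt_trans R20 R2r)).
Qed.

End conclusion.

Theorem theorem1p4 (R : realType) (n : nat) (hn : (1 <= n)%N)
  (s eps delta : R) (hs0 : 0 < s) (hs1 : s < 1)
  (heps : 0 < eps) (hdelta : 0 < delta)
  (u : 'rV[R]_n -> R)
  (hu_reg : C_loc (s + eps) u)
  (hu_int : Lpt 1 (s / 2) u)
  (hg_reg : C_loc (2 * s + delta) (frac_grad_norm2 s u))
  (hg_int : Lpt 1 s (frac_grad_norm2 s u))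
  (hsub : exists rho : R, 0 < rho /\
     forall x : 'rV[R]_n, enorm x < rho -> frac_lap s (frac_grad_norm2 s u) x <= 0) :
  exists R0 : R, 0 < R0 /\
    forall R1 R2 : R, 0 < R1 -> R1 <= R2 -> R2 < R0 ->
      (J_ACF s u R1 <= J_ACF s u R2)%E.
Proof.
case: n hn u hu_reg hu_int hg_reg hg_int hsub => // m _ u _ _ g_reg g_int [rho [rho0 sub]].
have sd : 2 * s < 2 * s + delta by rewrite ltrDl.
have [[q sq sdb] bnd] := C_loc_regularity hs0 hs1 sd g_reg.
have g0 x : 0 <= frac_grad_norm2 s u x by apply: sumr_ge0 => i _; exact: sqr_ge0.
have tg : tame s (frac_grad_norm2 s u) by exact: tame_Lpt g_int bnd.
have [k k0 kE] := kern_tail (m := m) hs0.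
(* The radius of the given neighbourhood works as [R0]: only means at parameters [(R t)^2 < rho^2]
   with [t < 1] occur. *)
exists rho; split=> // R1 R2 R10 R12 R2r.
apply: (ACF_nondecreasing hs0 hs1 tg R10 R12 R2r).
apply: (mean_subharmonic hs0 hs1 tg k0 kE).
exact: (frac_lap_subharmonic hs0 hs1 tg k0 kE sq rho0 sdb sub).
Qed.
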